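(* Let $\boldsymbol{k}\in\mathbb{Z}_+^m$ be a partition of $n$ with $m\geq 2$. For every $j=1,\dots,m$, let $a_j\in L^\infty(\mathbb{B}^n)$ be a $(\boldsymbol{k},j)$-quasi-radial quasi-homogeneous symbol, i.e. a $\mathrm{U}(\boldsymbol{k},j,\mathbb{T})$-invariant essentially bounded symbol. Consider the set of symbols \[ \mathcal{S} = L^\infty(\mathbb{B}^n)^{\mathrm{U}(\boldsymbol{k})}\cup\{a_j : j=1,\dots,m\}. \] Then, for every $\lambda>-1$, the Banach algebra $\mathcal{T}^{(\lambda)}(\mathcal{S})$ generated by the Toeplitz operators $T^{(\lambda)}_a$ with symbols $a\in\mathcal{S}$ is commutative.
   Context: Here $\mathbb{Z}_+$ is the set of positive integers. $\mathbb{B}^n$ is the open unit ball of $\mathbb{C}^n$ with Lebesgue measure $v$. For $\lambda>-1$, $dv_\lambda(z) = c_\lambda (1-|z|^2)^\lambda dv(z)$ with $c_\lambda = \frac{\Gamma(n+\lambda+1)}{\pi^n\Gamma(\lambda+1)}$, and $\mathcal{A}^2_\lambda(\mathbb{B}^n)$ is the closed subspace of holomorphic functions in $L^2(\mathbb{B}^n,v_\lambda)$, with orthogonal projection $B_\lambda$. For $a\in L^\infty(\mathbb{B}^n)$ the Toeplitz operator is $T_a^{(\lambda)}(f)=B_\lambda(af)$ on $\mathcal{A}^2_\lambda(\mathbb{B}^n)$. For a subgroup $H\subset\mathrm{U}(n)$, a symbol $a\in L^\infty(\mathbb{B}^n)$ is $H$-invariant if $a\circ A=a$ for all $A\in H$,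 and $L^\infty(\mathbb{B}^n)^H$ is the space of all $H$-invariant symbols. A partition of $n$ is $\boldsymbol{k}=(k_1,\dots,k_m)\in\mathbb{Z}_+^m$ with $k_1+\dots+k_m=n$. $\mathrm{U}(\boldsymbol{k})=\mathrm{U}(k_1)\times\dots\times\mathrm{U}(k_m)$, embedded block diagonally in $\mathrm{U}(n)$, and for $j\in\{1,\dots,m\}$, $\mathrm{U}(\boldsymbol{k},j,\mathbb{T}) = \mathrm{U}(k_1)\times\dots\times\mathrm{U}(k_{j-1})\times\mathbb{T}I_{(j)}\times\mathrm{U}(k_{j+1})\times\dots\times\mathrm{U}(k_m)\subset\mathrm{U}(\boldsymbol{k})$, where $I_{(j)}$ is the identity of $\mathbb{C}^{k_j}$ and $\mathbb{T}$ is the group of unit complex numbers. The Banach algebra generated by a set of operators is the smallest norm-closed subalgebra of the bounded operators on $\mathcal{A}^2_\lambda(\mathbb{B}^n)$ containing it. *)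

(* Defs.v *)
From HB Require Import structures.
From mathcomp Require Import all_boot all_order all_algebra spectral.
From mathcomp Require Import all_classical all_reals all_analysis.
From mathcomp Require Import measurable_realfun complex ring lra.

Set Implicit Arguments.
Unset Strict Implicit.
Unset Printing Implicit Defensive.

Import Order.TTheory GRing.Theory Num.Theory Normc.
Import numFieldNormedType.Exports.

Local Open Scope classical_set_scope.
Local Open Scope ring_scope.
Local Open Scope complex_scope.

(* R[i] is a normed module over itself; the library only says so for R[i]^o. *)
HB.instance Definition _ (R : realType) := NormedModule.copy R[i] R[i]^o.
HB.instance Definition _ (R : realType) := Pointed.copy R[i] R[i]^o.

Section measurable_complex.
Context (R : realType).

Let rei := g_sigma_preimageU (@complex.Re R) (@complex.Im R).

Let rei0 : rei set0. Proof. exact: sigma_algebra0. Qed.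

Let reiC A : rei A -> rei (~` A). Proof. exact: sigma_algebraC. Qed.

Let rei_bigcup (F : (set R[i])^nat) :
  (forall i, rei (F i)) -> rei (\bigcup_i F i).
Proof. exact: sigma_algebra_bigcup. Qed.

(* The Borel sigma-algebra of C, generated by the real and imaginary parts. *)
HB.instance Definition _ :=
  @isMeasurable.Build default_measure_display R[i] rei rei0 reiC rei_bigcup.

Lemma measurable_Re : measurable_fun setT (@complex.Re R).
Proof. by move=> _ A mA; apply: sub_sigma_algebra; left; exists A. Qed.

Lemma measurable_Im : measurable_fun setT (@complex.Im R).
Proof. by move=> _ A mA; apply: sub_sigma_algebra; right; exists A. Qed.

Lemma measurable_complexP d (T : measurableType d) (D : set T) (f : T -> R[i]) :
  measurable_fun D f <->
  measurable_fun D (fun x => complex.Re (f x)) /\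
  measurable_fun D (fun x => complex.Im (f x)).
Proof.
split=> [mf|[mre mim]].
  by split; [apply: (measurableT_comp measurable_Re mf)|
             apply: (measurableT_comp measurable_Im mf)].
move=> mD; suff : measurable_fun D f by exact.
apply: (@measurability _ _ _ _ _ _
  (preimage_set_system setT (@complex.Re R) measurable `|`
   preimage_set_system setT (@complex.Im R) measurable)) => //.
by move=> _ [B [[A mA <-]|[A mA <-]] <-]; rewrite setTI;
  [exact: mre|exact: mim].
Qed.

End measurable_complex.

Lemma sigma_finite_pushforward d1 d2 (T1 : measurableType d1)
    (T2 : measurableType d2) (R : realType) (mu : set T1 -> \bar R)
    (f : T1 -> T2) (g : T2 -> T1) :
  cancel f g -> measurable_fun setT g ->
  sigma_finite setT mu -> sigma_finite setT (pushforward mu f).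
Proof.
move=> fK mg [F FT Ffin]; exists (fun k => g @^-1` F k) => [|k].
  by rewrite -preimage_bigcup -FT.
have [mF Foo] := Ffin k; split.
  by rewrite -[X in measurable X]setTI; exact: mg.
rewrite /pushforward (_ : f @^-1` _ = F k)//.
by apply/seteqP; split=> x; rewrite /= fK.
Qed.

Lemma sigma_finite_product d1 d2 (T1 : measurableType d1)
    (T2 : measurableType d2) (R : realType)
    (m1 : {sigma_finite_measure set T1 -> \bar R})
    (m2 : {sigma_finite_measure set T2 -> \bar R}) :
  sigma_finite setT (m1 \x m2)%E.
Proof.
have /sigma_finiteP[F [TF ndF Foo]] := sigma_finiteT m1.
have /sigma_finiteP[G [TG ndG Goo]] := sigma_finiteT m2.
exists (fun n => F n `*` G n) => [|k].
  rewrite -setXTT TF TG; apply/seteqP; split=> -[x y].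
    move=> [/= [n _ Fnx] [k _ Gky]]; exists (maxn n k) => //; split.
    - by move: x Fnx; exact/subsetPset/ndF/leq_maxl.
    - by move: y Gky; exact/subsetPset/ndG/leq_maxr.
  by move=> [n _ []/= ? ?]; split; exists n.
have [? ?] := Foo k; have [? ?] := Goo k; split; first exact: measurableX.
by rewrite product_measure1E// lte_mul_pinfty// ge0_fin_numE.
Qed.

Section lebesgue_complex.
Context (R : realType).

Let toC (x : measurableTypeR R * measurableTypeR R) : R[i] := x.1 +i* x.2.

Let measurable_toC : measurable_fun setT toC.
Proof.
apply/measurable_complexP; split; first exact: measurable_fst.
exact: measurable_snd.
Qed.

(* The area measure of C, identified with R * R. *)
Definition lebesgueC : set R[i] -> \bar R :=
  pushforward (lebesgue_measure \x lebesgue_measure)%E toC.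

Let lebesgueC0 : lebesgueC set0 = 0%E. Proof. exact: measure0. Qed.

Let lebesgueC_ge0 A : (0 <= lebesgueC A)%E. Proof. exact: measure_ge0. Qed.

Let lebesgueC_sigma_additive : semi_sigma_additive lebesgueC.
Proof.
exact: (@measure_semi_sigma_additive _ _ _
  (pushforward (lebesgue_measure \x lebesgue_measure)%E toC)).
Qed.

HB.instance Definition _ := isMeasure.Build _ _ _ lebesgueC
  lebesgueC0 lebesgueC_ge0 lebesgueC_sigma_additive.

Let ofC (z : R[i]) : measurableTypeR R * measurableTypeR R :=
  (complex.Re z, complex.Im z).

Let lebesgueC_sigma_finite : sigma_finite setT lebesgueC.
Proof.
apply: (sigma_finite_pushforward (g := ofC)) => [[]//||].
  by apply: measurable_fun_pair; [exact: measurable_Re|exact: measurable_Im].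
by apply: sigma_finite_product; exact: sigma_finiteT.
Qed.

HB.instance Definition _ := Measure_isSigmaFinite.Build _ _ _ lebesgueC
  lebesgueC_sigma_finite.

End lebesgue_complex.

Section measurable_vector.
Context (R : realType) (n : nat).

Let coord (i : 'I_n) (z : 'cV[R[i]]_n) : R[i] := z i 0.

Let prod0 : g_sigma_preimage coord set0. Proof. exact: sigma_algebra0. Qed.

Let prodC A : g_sigma_preimage coord A -> g_sigma_preimage coord (~` A).
Proof. exact: sigma_algebraC. Qed.

Let prod_bigcup (F : (set 'cV[R[i]]_n)^nat) :
  (forall i, g_sigma_preimage coord (F i)) ->
  g_sigma_preimage coord (\bigcup_i F i).
Proof. exact: sigma_algebra_bigcup. Qed.

(* The Borel sigma-algebra of C^n, generated by the coordinates. *)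
HB.instance Definition _ := @isMeasurable.Build default_measure_display
  'cV[R[i]]_n (g_sigma_preimage coord) prod0 prodC prod_bigcup.

Lemma measurable_coord (i : 'I_n) :
  measurable_fun setT (fun z : 'cV[R[i]]_n => z i 0).
Proof.
move=> _ A mA; rewrite setTI; apply: sub_sigma_algebra => /=.
rewrite -bigcup_seq/=; exists i => /=; first by rewrite mem_index_enum.
by exists A => //; rewrite setTI.
Qed.

Lemma measurable_vectorP d (T : measurableType d) (f : T -> 'cV[R[i]]_n) :
  measurable_fun setT f <->
  forall i, measurable_fun setT (fun x => f x i 0).
Proof.
split=> [mf i|mf]; first exact: (measurableT_comp (measurable_coord i) mf).
apply: (@measurability _ _ _ _ _ _ (\big[setU/set0]_(i < n)
  preimage_set_system setT (coord i) measurable)) => //.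
move=> _ [B + <-]; rewrite -bigcup_seq/= => -[i _ [A mA <-]].
by rewrite !setTI -[X in measurable X]setTI; exact: mf.
Qed.

End measurable_vector.

Section lebesgue_vector.
Context (R : realType).

Section cons.
Context (n : nat) (mu : {sigma_finite_measure set 'cV[R[i]]_n -> \bar R}).

Let cons (x : R[i] * 'cV[R[i]]_n) : 'cV[R[i]]_n.+1 :=
  \col_i if unlift ord0 i is Some j then x.2 j 0 else x.1.

Let measurable_cons : measurable_fun setT cons.
Proof.
apply/measurable_vectorP => i.
rewrite (_ : (fun x => _) = fun x : R[i] * 'cV[R[i]]_n =>
    if unlift ord0 i is Some j then x.2 j 0 else x.1).
  case: unliftP => [j _|_] /=; last exact: measurable_fst.
  exact: (measurableT_comp (measurable_coord j) measurable_snd).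
by apply/funext => x; rewrite mxE.
Qed.

Definition lebesgue_cons : set 'cV[R[i]]_n.+1 -> \bar R :=
  pushforward (@lebesgueC R \x mu)%E cons.

Let lebesgue_cons0 : lebesgue_cons set0 = 0%E. Proof. exact: measure0. Qed.

Let lebesgue_cons_ge0 A : (0 <= lebesgue_cons A)%E.
Proof. exact: measure_ge0. Qed.

Let lebesgue_cons_sigma_additive : semi_sigma_additive lebesgue_cons.
Proof.
exact: (@measure_semi_sigma_additive _ _ _
  (pushforward (@lebesgueC R \x mu)%E cons)).
Qed.

HB.instance Definition _ := isMeasure.Build _ _ _ lebesgue_cons
  lebesgue_cons0 lebesgue_cons_ge0 lebesgue_cons_sigma_additive.

Let uncons (z : 'cV[R[i]]_n.+1) : R[i] * 'cV[R[i]]_n :=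
  (z 0 0, \col_i z (lift ord0 i) 0).

Let lebesgue_cons_sigma_finite : sigma_finite setT lebesgue_cons.
Proof.
apply: (sigma_finite_pushforward (g := uncons)) => [[x z]||].
- rewrite /uncons /cons !mxE unlift_none/=; congr pair.
  by apply/colP => i; rewrite !mxE liftK.
- apply: measurable_fun_pair; first exact: measurable_coord.
  apply/measurable_vectorP => i.
  rewrite (_ : (fun x => _) = fun z : 'cV[R[i]]_n.+1 => z (lift ord0 i) 0).
    exact: measurable_coord.
  by apply/funext => z; rewrite mxE.
- by apply: sigma_finite_product; exact: sigma_finiteT.
Qed.

HB.instance Definition _ := Measure_isSigmaFinite.Build _ _ _ lebesgue_cons
  lebesgue_cons_sigma_finite.

End cons.

(* The Lebesgue measure v of C^n = C * C^(n-1), with C^0 a point of mass 1. *)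
Fixpoint lebesgueCn (n : nat) : {sigma_finite_measure set 'cV[R[i]]_n -> \bar R} :=
  if n is n'.+1 then lebesgue_cons (lebesgueCn n') else dirac (0 : 'cV[R[i]]_0).

End lebesgue_vector.

Section unit_ball.
Context (R : realType) (n : nat).
Implicit Types z : 'cV[R[i]]_n.

(* The norm of 'cV[R[i]]_n in the library is the sup norm, hence this one. *)
Definition sqnorm z : R := \sum_(i < n) normc (z i 0) ^+ 2.

Definition unit_ball : set 'cV[R[i]]_n := [set z | sqnorm z < 1].

Lemma measurable_sqr_normc d (T : measurableType d) (D : set T) (f : T -> R[i]) :
  measurable_fun D f -> measurable_fun D (fun x => normc (f x) ^+ 2).
Proof.
move=> /measurable_complexP[mre mim].
rewrite (_ : (fun x => _) =
    fun x => complex.Re (f x) ^+ 2 + complex.Im (f x) ^+ 2).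
  by apply: measurable_funD; exact: measurable_funX.
by apply/funext => x; case: (f x) => a b /=; rewrite sqr_sqrtr ?addr_ge0 ?sqr_ge0.
Qed.

Lemma measurable_sqnorm : measurable_fun setT sqnorm.
Proof.
by apply: measurable_sum => i; apply: measurable_sqr_normc; exact: measurable_coord.
Qed.

Lemma measurable_unit_ball : measurable unit_ball.
Proof.
rewrite (_ : unit_ball = setT `&` sqnorm @^-1` `]-oo, 1[).
  exact: measurable_sqnorm.
by rewrite setTI; apply/seteqP; split=> z; rewrite /unit_ball/= in_itv/=.
Qed.

End unit_ball.
Arguments unit_ball {R n}.

Definition Gamma (R : realType) (s : R) : R :=
  \int[lebesgue_measure]_(t in `]0, +oo[) (t `^ (s - 1) * expR (- t)).

Section bergman_measure.
Context (R : realType) (n : nat) (lam : R).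

Definition bergman_weight (z : 'cV[R[i]]_n) : R :=
  Gamma (n%:R + lam + 1) / (pi ^+ n * Gamma (lam + 1)) *
  (1 - sqnorm z) `^ lam.

(* The measure v_lam, carried by the unit ball. *)
Definition bergman_measure : set 'cV[R[i]]_n -> \bar R :=
  fun A => (\int[lebesgueCn R n]_(z in A `&` unit_ball) (bergman_weight z)%:E)%E.

Let Gamma_ge0 (s : R) : 0 <= Gamma s.
Proof. by apply: Rintegral_ge0 => t _; rewrite mulr_ge0 ?powR_ge0 ?expR_ge0. Qed.

Lemma bergman_weight_ge0 z : 0 <= bergman_weight z.
Proof.
by rewrite mulr_ge0 ?powR_ge0// divr_ge0 ?mulr_ge0 ?exprn_ge0 ?pi_ge0.
Qed.

Lemma measurable_bergman_weight : measurable_fun setT bergman_weight.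
Proof.
apply: measurable_funM => //; apply: (measurableT_comp (measurable_powR lam)).
by apply: measurable_funB => //; exact: measurable_sqnorm.
Qed.

Let bergman_measure0 : bergman_measure set0 = 0%E.
Proof. by rewrite /bergman_measure set0I integral_set0. Qed.

Let bergman_measure_ge0 A : (0 <= bergman_measure A)%E.
Proof. by apply: integral_ge0 => z _; rewrite lee_fin bergman_weight_ge0. Qed.

Let bergman_measure_sigma_additive : semi_sigma_additive bergman_measure.
Proof.
move=> F mF tF mUF; rewrite /bergman_measure setI_bigcupl.
have mball := @measurable_unit_ball R n.
apply: (@semi_sigma_additive_nng_induced _ _ _ (lebesgueCn R n)
  (fun z => (bergman_weight z)%:E) _ _ (fun k => F k `&` unit_ball)).
- by apply/measurable_EFinP; exact: measurable_bergman_weight.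
- by move=> z; rewrite lee_fin bergman_weight_ge0.
- by move=> k; exact: measurableI.
- exact: trivIset_setIr.
- by apply: bigcup_measurable => k _; exact: measurableI.
Qed.

HB.instance Definition _ := isMeasure.Build _ _ _ bergman_measure
  bergman_measure0 bergman_measure_ge0 bergman_measure_sigma_additive.

End bergman_measure.

Section bergman_space.
Context (R : realType) (n : nat) (lam : R).
Local Notation C := R[i].
Local Notation Cn := 'cV[R[i]]_n.
Local Notation v_lam := (@bergman_measure R n lam).

Definition holomorphic_on (D : set Cn) (f : Cn -> C) :=
  forall z, D z -> differentiable f z.

Definition square_integrable (f : Cn -> C) :=
  measurable_fun unit_ball f /\
  (\int[v_lam]_(z in unit_ball) (normc (f z) ^+ 2)%:E < +oo)%E.

(* A function on the unit ball is represented by its extension by 0. *)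
Definition bergman_pred : {pred Cn -> C} :=
  mem [set f : Cn -> C | [/\ holomorphic_on unit_ball f, square_integrable f &
                             forall z, ~ unit_ball z -> f z = 0]].

Record bergman := Bergman {
  bergman_fun :> Cn -> C;
  _ : bergman_fun \in bergman_pred
}.

HB.instance Definition _ := [isSub for bergman_fun].
HB.instance Definition _ := [Choice of bergman by <:].

Let sqr_normcD (a x y : C) :
  normc (a * x + y) ^+ 2 <= 2 * normc a ^+ 2 * normc x ^+ 2 + 2 * normc y ^+ 2.
Proof.
have normc_ge0 (w : C) : 0 <= normc w by case: w => ? ?; exact: sqrtr_ge0.
have tri : normc (a * x + y) <= normc a * normc x + normc y.
  by rewrite -normcM; exact: (@le_normcD R).
have := normc_ge0 (a * x + y); have := sqr_ge0 (normc a * normc x - normc y).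
nra.
Qed.

Lemma square_integrableD (a : C) (f g : Cn -> C) :
  square_integrable f -> square_integrable g -> square_integrable (a *: f + g).
Proof.
move=> [mf intf] [mg intg].
have mfg : measurable_fun unit_ball (a *: f + g).
  have /measurable_complexP[mref mimf] := mf.
  have /measurable_complexP[mreg mimg] := mg.
  apply/measurable_complexP; split.
    rewrite (_ : (fun z => _) = fun z => complex.Re a * complex.Re (f z) -
        complex.Im a * complex.Im (f z) + complex.Re (g z)).
      apply: measurable_funD => //.
      by apply: measurable_funB; apply: measurable_funM.
    apply/funext => z; rewrite !fctE/=.
    by case: (a) (f z) (g z) => [? ?] [? ?] [? ?].
  rewrite (_ : (fun z => _) = fun z => complex.Re a * complex.Im (f z) +
      complex.Im a * complex.Re (f z) + complex.Im (g z)).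
    apply: measurable_funD => //.
    by apply: measurable_funD; apply: measurable_funM.
  apply/funext => z; rewrite !fctE/=.
  by case: (a) (f z) (g z) => [? ?] [? ?] [? ?].
split=> //; have mball := @measurable_unit_ball R n.
have mf2 := measurable_sqr_normc mf; have mg2 := measurable_sqr_normc mg.
apply: (@le_lt_trans _ _ (\int[v_lam]_(z in unit_ball)
    ((2 * normc a ^+ 2)%:E * (normc (f z) ^+ 2)%:E +
     2%:E * (normc (g z) ^+ 2)%:E))%E).
  apply: ge0_le_integral => //.
  - by move=> z _; rewrite lee_fin sqr_ge0.
  - by apply/measurable_EFinP; exact: measurable_sqr_normc.
  - by apply: emeasurable_funD; apply: emeasurable_funM => //; apply/measurable_EFinP.
  - by move=> z _; rewrite -!EFinM -EFinD lee_fin; exact: sqr_normcD.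
rewrite ge0_integralD//; first last.
- by apply: emeasurable_funM => //; apply/measurable_EFinP.
- by move=> z _; rewrite -EFinM lee_fin; do ![exact: sqr_ge0|exact: ler0n|apply: mulr_ge0].
- by apply: emeasurable_funM => //; apply/measurable_EFinP.
- by move=> z _; rewrite -EFinM lee_fin; do ![exact: sqr_ge0|exact: ler0n|apply: mulr_ge0].
rewrite !ge0_integralZl//=;
  try by [exact/measurable_EFinP | move=> z _; rewrite lee_fin sqr_ge0].
  by rewrite lte_add_pinfty// lte_mul_pinfty// lee_fin; do ![exact: sqr_ge0|exact: ler0n|apply: mulr_ge0].
by rewrite lee_fin; do ![exact: sqr_ge0|exact: ler0n|apply: mulr_ge0].
Qed.

Lemma bergman_submod_closed : submod_closed bergman_pred.
Proof.
split=> [|a f g].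
  rewrite inE/=; split=> //; split; first exact: measurable_cst.
  by rewrite integral0_eq ?ltry// => z _; rewrite normc0 expr0n.
rewrite !inE/= => -[df sf f0] [dg sg g0]; split.
- move=> z Bz; apply: differentiableD; last exact: dg.
  by apply: differentiableZ; exact: df.
- exact: square_integrableD.
- by move=> z Bz; rewrite !fctE f0// g0// scaler0 addr0.
Qed.

HB.instance Definition _ :=
  GRing.isSubmodClosed.Build C (Cn -> C) bergman_pred bergman_submod_closed.
HB.instance Definition _ := [SubChoice_isSubLmodule of bergman by <:].

End bergman_space.

Section toeplitz.
Context (R : realType) (n : nat) (lam : R).
Local Notation C := R[i].
Local Notation Cn := 'cV[R[i]]_n.
Local Notation v_lam := (@bergman_measure R n lam).
Local Notation bergman := (bergman n lam).

Definition inner (f g : Cn -> C) : C :=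
  (\int[v_lam]_(z in unit_ball) complex.Re (f z * conjc (g z))) +i*
  (\int[v_lam]_(z in unit_ball) complex.Im (f z * conjc (g z))).

Definition norm2 (f : Cn -> C) : R :=
  Num.sqrt (\int[v_lam]_(z in unit_ball) (normc (f z) ^+ 2)).

(* The orthogonal projection B_lam of f : the g in the Bergman space such that
   f - g is orthogonal to the Bergman space. The default value 0 is irrelevant
   for a square integrable f, for which there is exactly one such g. *)
Definition bergman_proj (f : Cn -> C) : bergman :=
  xget 0 [set g : bergman | forall h : bergman, inner (f - (g : Cn -> C)) h = 0].

Definition toeplitz (a : Cn -> C) (f : bergman) : bergman :=
  bergman_proj (a * (f : Cn -> C)).

Definition bounded_operator : set (bergman -> bergman) :=
  [set T : bergman -> bergman | linear T /\
    exists M : R, forall f : bergman, norm2 (T f) <= M * norm2 f].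

(* The last clause is closedness for the operator norm: the inequality says
   that the operator norm of T - S is at most e. *)
Definition closed_subalgebra (A : set (bergman -> bergman)) :=
  [/\ A `<=` bounded_operator,
      A (fun=> 0),
      forall (c : C) (S T : bergman -> bergman),
        A S -> A T -> A (fun f => c *: S f + T f),
      forall S T, A S -> A T -> A (S \o T) &
      forall T, bounded_operator T ->
        (forall e : R, 0 < e ->
          exists2 S, A S & forall f : bergman, norm2 (T f - S f) <= e * norm2 f) ->
        A T].

Definition toeplitz_algebra (symbols : set (Cn -> C)) : set (bergman -> bergman) :=
  smallest closed_subalgebra (toeplitz @` symbols).

End toeplitz.

Section symbols.
Context (R : realType).
Local Notation C := R[i].

Definition Linfty n : set ('cV[C]_n -> C) :=
  [set a | measurable_fun unit_ball a /\
    exists M : R, {ae lebesgueCn R n, forall z, unit_ball z -> normc (a z) <= M}].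

(* Symbols are classes of functions modulo null sets, so that the equality
   a \o A = a holds almost everywhere, for every A separately. *)
Definition Linfty_inv n (H : set 'M[C]_n) : set ('cV[C]_n -> C) :=
  [set a | Linfty a /\ forall A, H A ->
    {ae lebesgueCn R n, forall z, unit_ball z -> a (A *m z) = a z}].

Context (m : nat) (k : 'I_m -> nat).

Definition Uk : set 'M[C]_(\sum_(i < m) k i) :=
  [set A | exists2 B : forall i, 'M[C]_(k i),
    forall i, B i \is unitarymx & A = \mxdiag_(i < m) B i].

Definition UkT (j : 'I_m) : set 'M[C]_(\sum_(i < m) k i) :=
  [set A | exists B : forall i, 'M[C]_(k i),
    [/\ forall i, B i \is unitarymx,
        exists2 t : C, `|t| = 1 & B j = t%:M &
        A = \mxdiag_(i < m) B i]].

End symbols.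
Arguments Uk {R m} k.
Arguments UkT {R m} k j.

(* Main.v *)
Require Import Defs.
From HB Require Import structures.
From mathcomp Require Import all_boot all_order all_algebra spectral.
From mathcomp Require Import all_classical all_reals all_analysis.
From mathcomp Require Import measurable_realfun complex ring lra.

(** Let [a] be invariant under U(k, j, T) and put I(al, be) = <a z^al, z^be>.
Invariance under phases kills I(al, be) unless al = be outside the block j and
|al| = |be| on the block j. If u and w lie in the same block l <> j, invariance
under the rotation by pi/4 in the coordinates u and w gives
C(al_u + al_w, al_u) I(al, be) = I(al', be'), where al' and be' are obtained by
moving the exponent of w to u; hence, al being fixed outside the block l,
I(al, be) is proportional to the product of the factorials of al on the block l
when |al| is fixed there. For b invariant under U(k, l, T) with l <> j, the
coefficient <T_a T_b z^al, z^be> is a sum over intermediate monomials with a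
single nonzero term, the one which changes the block l first, and
<T_b T_a z^al, z^be> has the single term which changes the block j first; the
proportionality identifies the two. As T_a* = T_(conj a) and monomials are total
in the Bergman space, T_a and T_b commute. Since m >= 2, any two symbols of S are
equal or invariant for distinct indices, and the commutant of a set of bounded
operators is a closed algebra.

The orthogonal projection exists because the truncated expansions of a square
integrable f in monomials form a Cauchy sequence, while point evaluations are
bounded on polynomials, uniformly on smaller balls; the limit is holomorphic. *)

Set Implicit Arguments.
Unset Strict Implicit.
Unset Printing Implicit Defensive.

Import Order.TTheory GRing.Theory Num.Theory Normc.
Import numFieldNormedType.Exports.

Local Open Scope classical_set_scope.
Local Open Scope ring_scope.
Local Open Scope complex_scope.

(** * Measure preserving maps of C^n *)

Section measure_preserving.
Context (R : realType).

(** A symbol is invariant only almost everywhere and for each matrix separately, so the proof uses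
    single elements of the group and never integrates over it. One rotation by pi/4 is enough: it
    turns powers of z_u - z_w and z_u + z_w into powers of z_u and z_w, and its entries only involve
    the square root of 1/2.

    Holomorphic means complex differentiable at each point, with no continuity of the derivative, so
    Goursat's theorem comes first. It is used through means over circles: pairing f with a function
    of given weight under phases extracts a homogeneous part of f. Power series are thereby avoided;
    what replaces them is that a function orthogonal to all monomials vanishes. Orthogonality is
    extended to the products of monomials and conjugate monomials, hence to the powers of a kernel
    peaked at a point.

    Linear maps preserve Lebesgue measure because they are composed of shears, which translate the
    fibres of a product. The weighted measure enters through few properties, collected in
    [ball_measure]. *)

Definition mpres d (T : measurableType d) (mu : set T -> \bar R) (phi : T -> T) :=
  measurable_fun setT phi /\
  forall A, measurable A -> mu (phi @^-1` A) = mu A.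

Lemma mpres_comp d (T : measurableType d) (mu : set T -> \bar R) (f g : T -> T) :
  mpres mu f -> mpres mu g -> mpres mu (f \o g).
Proof.
move=> [mf fE] [mg gE]; split; first exact: measurableT_comp.
move=> A mA; rewrite comp_preimage gE ?fE//.
by rewrite -[X in measurable X]setTI; exact: mf.
Qed.

Lemma mpres_pushforward d1 d2 (T1 : measurableType d1) (T2 : measurableType d2)
    (mu : set T1 -> \bar R) (c : T1 -> T2) (f : T1 -> T1) (g : T2 -> T2) :
  measurable_fun setT c -> measurable_fun setT g ->
  g \o c = c \o f -> mpres mu f -> mpres (pushforward mu c) g.
Proof.
move=> mc mg gc [mf fE]; split=> // A mA; rewrite /pushforward.
rewrite -comp_preimage gc comp_preimage fE//.
by rewrite -[X in measurable X]setTI; exact: mc.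
Qed.

(** * Maps acting on the fibres of a product *)

Section fiberwise.
Context d1 d2 (T1 : measurableType d1) (T2 : measurableType d2).
Variables (m1 : {sigma_finite_measure set T1 -> \bar R})
  (m2 : {sigma_finite_measure set T2 -> \bar R}).

(** Cavalieri's principle. Since psi may depend on the base point, a shear is a translation in each
    fibre. *)
Lemma mpres_fiberr (psi : T1 -> T2 -> T2) :
  measurable_fun setT (fun x : T1 * T2 => psi x.1 x.2) ->
  (forall x, mpres m2 (psi x)) ->
  mpres (m1 \x m2)%E (fun x => (x.1, psi x.1 x.2)).
Proof.
move=> mpsi pE; split; first exact: measurable_fun_pair measurable_fst mpsi.
move=> A mA; apply: eq_integral => x _ /=.
rewrite -[RHS](pE x).2; last exact: measurable_xsection.
by congr (m2 _); apply/seteqP; split=> y; rewrite /= /xsection/= !inE.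
Qed.

(** Allows sections along either factor to be measured; [mpres_fiberl] needs those at fixed second
    coordinate. *)
Lemma product_measure12 A : measurable A -> (m1 \x m2)%E A = (m1 \x^ m2)%E A.
Proof.
move=> mA; apply: product_measure_unique => // B C mB mC.
exact: product_measure2E.
Qed.

Lemma mpres_fiberl (psi : T2 -> T1 -> T1) :
  measurable_fun setT (fun x : T1 * T2 => psi x.2 x.1) ->
  (forall y, mpres m1 (psi y)) ->
  mpres (m1 \x m2)%E (fun x => (psi x.2 x.1, x.2)).
Proof.
move=> mpsi pE.
have mphi : measurable_fun setT (fun x : T1 * T2 => (psi x.2 x.1, x.2)).
  exact: measurable_fun_pair mpsi measurable_snd.
split=> // A mA; rewrite !product_measure12//; last first.
  by rewrite -[X in measurable X]setTI; exact: mphi.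
apply: eq_integral => y _ /=; rewrite -[RHS](pE y).2; last exact: measurable_ysection.
by congr (m1 _); apply/seteqP; split=> x; rewrite /= /ysection/= !inE.
Qed.

End fiberwise.

Lemma mpres_shiftR (c : R) :
  mpres (@lebesgue_measure R) ((fun x => x + c) : measurableTypeR R -> measurableTypeR R).
Proof.
have mf : measurable_fun setT ((fun x => x + c) : measurableTypeR R -> measurableTypeR R).
  exact: measurable_funD.
split=> // A mA.
pose phi : {mfun measurableTypeR R >-> measurableTypeR R} := HB.pack (fun x : measurableTypeR R => (x + c : measurableTypeR R)) (isMeasurableFun.Build _ _ _ _ _ mf).
rewrite -[LHS]/(pushforward lebesgue_measure phi A).
apply/esym/lebesgue_measure_unique => //= _ [[a b]] _ <-.
rewrite /pushforward (_ : _ @^-1` _ = `]a - c, b - c]%classic); last first.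
  by apply/seteqP; split=> x; rewrite /= !in_itv/= ltrBlDr lerBrDr.
by rewrite !lebesgue_measure_itv/= !lte_fin ltrD2r -!EFinB opprB addrA subrK.
Qed.

Definition pairC (x : measurableTypeR R * measurableTypeR R) : R[i] := x.1 +i* x.2.

Lemma measurable_pairC : measurable_fun setT pairC.
Proof.
by apply/measurable_complexP; split; [exact: measurable_fst|exact: measurable_snd].
Qed.

Lemma mpres_C (f : _ -> _) (g : R[i] -> R[i]) :
  measurable_fun setT g -> g \o pairC = pairC \o f ->
  mpres (lebesgue_measure \x lebesgue_measure)%E f -> mpres (@lebesgueC R) g.
Proof. by apply: mpres_pushforward; exact: measurable_pairC. Qed.

Lemma mpres_shiftC (c : R[i]) : mpres (@lebesgueC R) (fun z => z + c).
Proof.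
case: c => a b.
apply: (@mpres_C ((fun x => (x.1, x.2 + b)) \o (fun x => (x.1 + a, x.2)))).
- apply/measurable_complexP; split.
    rewrite (_ : (fun z => _) = fun z => complex.Re z + a); last by apply/funext => -[].
    by apply: measurable_funD => //; exact: measurable_Re.
  rewrite (_ : (fun z => _) = fun z => complex.Im z + b); last by apply/funext => -[].
  by apply: measurable_funD => //; exact: measurable_Im.
- by apply/funext => -[x y].
- apply: mpres_comp.
  + apply: (@mpres_fiberr _ _ (measurableTypeR R) (measurableTypeR R) lebesgue_measure lebesgue_measure (fun _ y => y + b)) => [|x]; last exact: mpres_shiftR.
    by apply: measurable_funD => //; exact: measurable_snd.
  + apply: (@mpres_fiberl _ _ (measurableTypeR R) (measurableTypeR R) lebesgue_measure lebesgue_measure (fun _ y => y + a)) => [|x]; last exact: mpres_shiftR.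
    by apply: measurable_funD => //; exact: measurable_fst.
Qed.

(* A rotation of the plane which is not a half turn is a product of three shears. *)
Lemma mpres_rotC (t : R[i]) : normc t = 1 -> mpres (@lebesgueC R) (fun z => t * z).
Proof.
have rot (u v : R) : v != 0 -> u ^+ 2 + v ^+ 2 = 1 ->
    mpres (@lebesgueC R) (fun z => (u +i* v) * z).
  (* For u + iv = exp(i theta), s is - tan(theta / 2): the shears of slopes s, v, s compose to the
     rotation. This needs v to be nonzero. *)
  move=> v0 uv1; pose s := (u - 1) / v.
  pose shx (x : measurableTypeR R * measurableTypeR R) : measurableTypeR R * measurableTypeR R := (x.1 + s * x.2, x.2).
  pose shy (x : measurableTypeR R * measurableTypeR R) : measurableTypeR R * measurableTypeR R := (x.1, x.2 + v * x.1).
  have mshx : mpres (lebesgue_measure \x lebesgue_measure)%E shx.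
    apply: (@mpres_fiberl _ _ (measurableTypeR R) (measurableTypeR R) lebesgue_measure lebesgue_measure (fun y x => x + s * y)) => [|x]; last exact: mpres_shiftR.
    apply: measurable_funD => //.
    by apply: measurable_funM => //; exact: measurable_snd.
  have mshy : mpres (lebesgue_measure \x lebesgue_measure)%E shy.
    apply: (@mpres_fiberr _ _ (measurableTypeR R) (measurableTypeR R) lebesgue_measure lebesgue_measure (fun x y => y + v * x)) => [|x]; last exact: mpres_shiftR.
    apply: measurable_funD => //.
    by apply: measurable_funM => //; exact: measurable_fst.
  apply: (@mpres_C (shx \o (shy \o shx))).
  - apply/measurable_complexP; split.
      rewrite (_ : (fun z => _) = fun z => u * complex.Re z - v * complex.Im z); last by apply/funext => -[].
      by apply: measurable_funB => //; apply: measurable_funM => //; [exact: measurable_Re|exact: measurable_Im].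
    rewrite (_ : (fun z => _) = fun z => u * complex.Im z + v * complex.Re z); last by apply/funext => -[].
    by apply: measurable_funD => //; apply: measurable_funM => //; [exact: measurable_Im|exact: measurable_Re].
  - apply/funext => -[x y]; rewrite /pairC /shx /shy/=.
    have sv : s * v = u - 1 by rewrite /s divfK.
    have svu : s * (u + 1) = - v.
      apply: (mulIf v0); rewrite mulrAC sv; nra.
    have sx : s * v * x = (u - 1) * x by rewrite sv.
    have sy : s * v * (s * y) = (u - 1) * (s * y) by rewrite sv.
    have vy : s * (u + 1) * y = - v * y by rewrite svu.
    have vy' : s * v * y = (u - 1) * y by rewrite sv.
    apply/eqP; rewrite eq_complex/=; apply/andP; split; apply/eqP; lra.
  - by apply: mpres_comp; [exact: mshx|apply: mpres_comp; [exact: mshy|exact: mshx]].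
case: t => u v /(congr1 (fun x => x ^+ 2)) /=.
rewrite sqr_sqrtr ?addr_ge0 ?sqr_ge0// expr1n => uv1.
have [v0|] := eqVneq v 0; last by move=> ?; exact: rot.
move: uv1; rewrite v0 expr0n/= addr0 => /eqP; rewrite sqrf_eq1 => /orP[/eqP ->|/eqP ->].
  split; last by move=> A mA; congr (lebesgueC _); apply/seteqP; split=> z /=; rewrite ?mul1r.
  by rewrite (_ : (fun z => _) = id) //; apply/funext => z; rewrite mul1r.
(* The half turn is the square of the quarter turn, for which v = 1. *)
rewrite (_ : (fun z => _) = (fun z => (0 +i* 1) * z) \o (fun z => (0 +i* 1) * z)).
  by apply: mpres_comp; apply: rot; rewrite ?oner_neq0// expr0n expr1n add0r.
by apply/funext => -[x y]/=; apply/eqP; rewrite eq_complex/=; apply/andP; split; apply/eqP; ring.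
Qed.


Section complex_measurable.
Context d (T : measurableType d) (D : set T).
Implicit Types f g : T -> R[i].

Lemma measurableC_add f g : measurable_fun D f -> measurable_fun D g ->
  measurable_fun D (fun x => f x + g x).
Proof.
move=> /measurable_complexP[rf mf] /measurable_complexP[rg mg].
apply/measurable_complexP; split.
  rewrite (_ : (fun x => _) = fun x => complex.Re (f x) + complex.Re (g x)); last by apply/funext => x; case: (f x) (g x) => ? ? [].
  exact: measurable_funD.
rewrite (_ : (fun x => _) = fun x => complex.Im (f x) + complex.Im (g x)); last by apply/funext => x; case: (f x) (g x) => ? ? [].
exact: measurable_funD.
Qed.

Lemma measurableC_mul f g : measurable_fun D f -> measurable_fun D g ->
  measurable_fun D (fun x => f x * g x).
Proof.
move=> /measurable_complexP[rf mf] /measurable_complexP[rg mg].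
apply/measurable_complexP; split.
  rewrite (_ : (fun x => _) = fun x => complex.Re (f x) * complex.Re (g x) - complex.Im (f x) * complex.Im (g x)); last by apply/funext => x; case: (f x) (g x) => ? ? [].
  by apply: measurable_funB; exact: measurable_funM.
rewrite (_ : (fun x => _) = fun x => complex.Re (f x) * complex.Im (g x) + complex.Im (f x) * complex.Re (g x)); last by apply/funext => x; case: (f x) (g x) => ? ? [].
by apply: measurable_funD; exact: measurable_funM.
Qed.

Lemma measurableC_conj f : measurable_fun D f -> measurable_fun D (fun x => conjc (f x)).
Proof.
move=> /measurable_complexP[rf mf]; apply/measurable_complexP; split.
  by rewrite (_ : (fun x => _) = fun x => complex.Re (f x)) //; apply/funext => x; case: (f x).
rewrite (_ : (fun x => _) = fun x => - complex.Im (f x)); last by apply/funext => x; case: (f x).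
exact: measurableT_comp.
Qed.

Lemma measurableC_exp f n : measurable_fun D f -> measurable_fun D (fun x => f x ^+ n).
Proof.
move=> mf; elim: n => [|n IH].
  by rewrite (_ : (fun x => _) = cst 1) //; apply/funext => x; rewrite expr0.
rewrite (_ : (fun x => _) = fun x => f x * f x ^+ n); last by apply/funext => x; rewrite exprS.
exact: measurableC_mul.
Qed.

Lemma measurableC_prod (I : Type) (r : seq I) (F : I -> T -> R[i]) :
  (forall i, measurable_fun D (F i)) ->
  measurable_fun D (fun x => \prod_(i <- r) F i x).
Proof.
move=> mF; elim: r => [|i r IH].
  by rewrite (_ : (fun x => _) = cst 1) //; apply/funext => x; rewrite big_nil.
rewrite (_ : (fun x => _) = fun x => F i x * \prod_(i <- r) F i x); last by apply/funext => x; rewrite big_cons.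
exact: measurableC_mul.
Qed.

End complex_measurable.

Local Notation C := R[i].

(** The map in the definition of [lebesgue_cons], where it is local; by conversion, Lebesgue measure
    in dimension n + 1 is the pushforward of the product measure along it. *)
Definition vcons n (x : C * 'cV[C]_n) : 'cV[C]_n.+1 :=
  \col_i if unlift ord0 i is Some j then x.2 j 0 else x.1.

Lemma vcons0 n x : @vcons n x 0 0 = x.1.
Proof. by rewrite mxE unlift_none. Qed.

Lemma vconsS n x j : @vcons n x (lift ord0 j) 0 = x.2 j 0.
Proof. by rewrite mxE liftK. Qed.

Lemma measurable_vcons n : measurable_fun setT (@vcons n).
Proof.
apply/measurable_vectorP => i.
rewrite (_ : (fun x => _) = fun x : C * 'cV[C]_n =>
    if unlift ord0 i is Some j then x.2 j 0 else x.1).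
  case: unliftP => [j _|_] /=; last exact: measurable_fst.
  exact: (measurableT_comp (measurable_coord j) measurable_snd).
by apply/funext => x; rewrite mxE.
Qed.

Lemma mpres_vcons n (f : C * 'cV[C]_n -> C * 'cV[C]_n) (g : 'cV[C]_n.+1 -> 'cV[C]_n.+1) :
  measurable_fun setT g ->
  (forall x, g (vcons x) 0 0 = (f x).1) ->
  (forall x j, g (vcons x) (lift ord0 j) 0 = (f x).2 j 0) ->
  mpres (@lebesgueC R \x lebesgueCn R n)%E f -> mpres (lebesgueCn R n.+1) g.
Proof.
move=> mg g0 gS; apply: mpres_pushforward => //; first exact: measurable_vcons.
apply/funext => x /=; apply/colP => i; case: (unliftP ord0 i) => [j ->|->].
  by rewrite vconsS gS.
by rewrite vcons0 g0.
Qed.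

Lemma measurable_shift n (c : 'cV[C]_n) : measurable_fun setT (fun z : 'cV[C]_n => z + c).
Proof.
apply/measurable_vectorP => i.
rewrite (_ : (fun z => _) = fun z : 'cV[C]_n => z i 0 + c i 0); last by apply/funext => z; rewrite mxE.
by apply: measurableC_add => //; exact: measurable_coord.
Qed.

Lemma mpres_shift n (c : 'cV[C]_n) : mpres (lebesgueCn R n) (fun z : 'cV[C]_n => z + c).
Proof.
elim: n c => [c|n IH c].
  split; first exact: measurable_shift.
  move=> A mA; congr (lebesgueCn R 0 _); apply/seteqP; split=> z /=;
    by rewrite (_ : z + c = z) //; apply/colP => -[].
apply: (@mpres_vcons n ((fun x => (x.1, x.2 + \col_j c (lift ord0 j) 0)) \o (fun x => (x.1 + c 0 0, x.2)))).
- exact: measurable_shift.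
- by move=> x; rewrite mxE vcons0.
- by move=> x j; rewrite mxE vconsS !mxE.
- apply: mpres_comp.
    apply: (@mpres_fiberr _ _ _ _ (@lebesgueC R) (lebesgueCn R n) (fun _ y => y + \col_j c (lift ord0 j) 0)) => [|x].
      exact: (measurableT_comp (measurable_shift _) measurable_snd).
    exact: IH.
  apply: (@mpres_fiberl _ _ _ _ (@lebesgueC R) (lebesgueCn R n) (fun _ y => y + c 0 0)) => [|x].
    by apply: measurableC_add => //; exact: measurable_fst.
  exact: mpres_shiftC.
Qed.

(** With P a single coordinate, a block or everything, these are the torus action, the block phases
    and the dilations; w need not have modulus 1. *)
Definition scl n (P : pred 'I_n) (w : C) (z : 'cV[C]_n) : 'cV[C]_n :=
  \col_i if P i then w * z i 0 else z i 0.

Lemma measurable_scl n (P : pred 'I_n) w : measurable_fun setT (scl P w).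
Proof.
apply/measurable_vectorP => i.
rewrite (_ : (fun z => _) = fun z : 'cV[C]_n => (if P i then w else 1) * z i 0); last first.
  by apply/funext => z; rewrite mxE; case: ifP; rewrite ?mul1r.
by apply: measurableC_mul => //; exact: measurable_coord.
Qed.

Lemma mpres_scl1 n (p : 'I_n) t : normc t = 1 -> mpres (lebesgueCn R n) (scl (pred1 p) t).
Proof.
move=> t1; elim: n p => [[]//|n IH] p; case: (unliftP ord0 p) => [q ->|->].
  apply: (@mpres_vcons n (fun x => (x.1, scl (pred1 q) t x.2))).
  - exact: measurable_scl.
  - by move=> x; rewrite mxE vcons0/=.
  - by move=> x j; rewrite !mxE liftK /= (inj_eq lift_inj).
  - apply: (@mpres_fiberr _ _ _ _ (@lebesgueC R) (lebesgueCn R n) (fun _ y => scl (pred1 q) t y)) => [|x].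
      exact: (measurableT_comp (measurable_scl _ _) measurable_snd).
    exact: IH.
apply: (@mpres_vcons n (fun x => (t * x.1, x.2))).
- exact: measurable_scl.
- by move=> x; rewrite mxE vcons0.
- by move=> x j; rewrite mxE vconsS.
- apply: (@mpres_fiberl _ _ _ _ (@lebesgueC R) (lebesgueCn R n) (fun _ y => t * y)) => [|x].
    by apply: measurableC_mul => //; exact: measurable_fst.
  exact: mpres_rotC.
Qed.

Lemma mpres_scl n (P : pred 'I_n) t : normc t = 1 -> mpres (lebesgueCn R n) (scl P t).
Proof.
move=> t1; suff H (s : seq 'I_n) : uniq s -> mpres (lebesgueCn R n) (scl (mem s) t).
  rewrite (_ : scl P t = scl (mem (enum P)) t); first exact/H/enum_uniq.
  by apply/funext => z; apply/colP => i; rewrite !mxE /= mem_enum.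
elim: s => [_|p s IH /= /andP[ps us]].
  rewrite (_ : scl _ _ = id); first by split.
  by apply/funext => z; apply/colP => i; rewrite !mxE.
rewrite (_ : scl _ _ = scl (pred1 p) t \o scl (mem s) t).
  by apply: mpres_comp; [exact: mpres_scl1|exact: IH].
apply/funext => z; apply/colP => i; rewrite !mxE/= inE.
by have [->|] := eqVneq i p; rewrite ?(negbTE ps).
Qed.

Definition shear n (p q : 'I_n) (s : C) (z : 'cV[C]_n) : 'cV[C]_n :=
  \col_i if i == p then z i 0 + s * z q 0 else z i 0.

Lemma measurable_shear n (p q : 'I_n) s : measurable_fun setT (shear p q s).
Proof.
apply/measurable_vectorP => i.
rewrite (_ : (fun z => _) = fun z : 'cV[C]_n => z i 0 + (if i == p then s else 0) * z q 0); last first.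
  by apply/funext => z; rewrite mxE; case: ifP; rewrite ?mul0r ?addr0.
apply: measurableC_add; first exact: measurable_coord.
by apply: measurableC_mul => //; exact: measurable_coord.
Qed.

(** If p or q is the first coordinate, the shear translates one factor by an amount depending on the
    other; otherwise it acts on the remaining coordinates and induction applies. *)
Lemma mpres_shear n (p q : 'I_n) s : p != q -> mpres (lebesgueCn R n) (shear p q s).
Proof.
elim: n p q => [[]//|n IH] p q; case: (unliftP ord0 p) => [p' ->|->]; case: (unliftP ord0 q) => [q' ->|->].
- rewrite (inj_eq lift_inj) => pq.
  apply: (@mpres_vcons n (fun x => (x.1, shear p' q' s x.2))).
  - exact: measurable_shear.
  - by move=> x; rewrite mxE vcons0/=.
  - by move=> x j; rewrite mxE !vconsS !mxE /= (inj_eq lift_inj).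
  - apply: (@mpres_fiberr _ _ _ _ (@lebesgueC R) (lebesgueCn R n) (fun _ y => shear p' q' s y)) => [|x].
      exact: (measurableT_comp (measurable_shear _ _ _) measurable_snd).
    exact: IH.
- move=> _; apply: (@mpres_vcons n (fun x => (x.1, x.2 + \col_j (if j == p' then s * x.1 else 0)))).
  - exact: measurable_shear.
  - by move=> x; rewrite mxE vcons0/=.
  - move=> x j; rewrite mxE vcons0 !vconsS !mxE /= (inj_eq lift_inj).
    by case: ifP; rewrite ?addr0.
  - apply: (@mpres_fiberr _ _ _ _ (@lebesgueC R) (lebesgueCn R n) (fun x y => y + \col_j (if j == p' then s * x else 0))) => [|x].
      apply/measurable_vectorP => i.
      rewrite (_ : (fun z => _) = fun z : C * 'cV[C]_n => z.2 i 0 + (if i == p' then s else 0) * z.1); last first.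
        by apply/funext => z; rewrite !mxE; case: ifP; rewrite ?mul0r ?addr0.
      apply: measurableC_add; first exact: (measurableT_comp (measurable_coord i) measurable_snd).
      by apply: measurableC_mul => //; exact: measurable_fst.
    exact: mpres_shift.
- move=> _; apply: (@mpres_vcons n (fun x => (x.1 + s * x.2 q' 0, x.2))).
  - exact: measurable_shear.
  - by move=> x; rewrite mxE vcons0 vconsS.
  - by move=> x j; rewrite mxE !vconsS.
  - apply: (@mpres_fiberl _ _ _ _ (@lebesgueC R) (lebesgueCn R n) (fun y x => x + s * y q' 0)) => [|x].
      apply: measurableC_add; first exact: measurable_fst.
      by apply: measurableC_mul => //; exact: (measurableT_comp (measurable_coord q') measurable_snd).
    exact: mpres_shiftC.
- by rewrite eqxx.
Qed.

(* Rotation by pi/4 in the plane of the coordinates p and q. *)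
Definition rot4 n (p q : 'I_n) (z : 'cV[C]_n) : 'cV[C]_n :=
  let c := (Num.sqrt 2^-1)%:C in
  \col_i if i == p then c * (z p 0 + z q 0)
         else if i == q then c * (z q 0 - z p 0) else z i 0.

Lemma sqrt_half : (Num.sqrt 2^-1 : R)%:C ^+ 2 = 2^-1 :> C.
Proof. by rewrite -rmorphXn/= sqr_sqrtr ?invr_ge0// fmorphV rmorph_nat. Qed.

Lemma mpres_rot4 n (p q : 'I_n) : p != q -> mpres (lebesgueCn R n) (rot4 p q).
Proof.
move=> pq; pose c : C := (Num.sqrt 2^-1)%:C.
have c2 : c * c = 2^-1 by rewrite -expr2 sqrt_half.
have c0 : c != 0.
  by apply/eqP => c0; move: c2; rewrite c0 mul0r => /eqP; rewrite eq_sym invr_eq0 pnatr_eq0.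
(* The factorisation into three shears again, for cosine c and sine - c. *)
rewrite (_ : rot4 p q = shear p q ((1 - c) / c) \o (shear q p (- c) \o shear p q ((1 - c) / c))).
  by apply: mpres_comp; [|apply: mpres_comp]; apply: mpres_shear => //; rewrite eq_sym.
have s1 : (1 - c) / c = 2 * c - 1.
  by apply: (mulIf c0); rewrite divfK// mulrBl mul1r -mulrA c2 mulfV ?pnatr_eq0.
have qp : q != p by rewrite eq_sym.
(* The two sides differ by a multiple of e, which vanishes because 2 c^2 = 1; the remaining
   identities hold by [ring]. *)
pose e := c * (2 * c - 1) - (1 - c).
have e0 : e = 0.
  transitivity (2 * (c * c) - 1); first by rewrite /e; ring.
  by rewrite c2 mulfV ?subrr// pnatr_eq0.
apply/funext => z; apply/colP => i; rewrite s1 -/c.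
rewrite !(mxE, eqxx, negbTE pq, negbTE qp).
have [->|ip] := eqVneq i p; last have [->|iq //] := eqVneq i q; rewrite ?(eqxx, negbTE pq, negbTE qp)//.
  transitivity (c * (z p 0 + z q 0) + e * (z q 0 - z p 0 - (2 * c - 1) * z q 0)); last by rewrite /e; ring.
  by rewrite e0 mul0r addr0.
transitivity (c * (z q 0 - z p 0) - e * z q 0); last by rewrite /e; ring.
by rewrite e0 mul0r subr0.
Qed.

End measure_preserving.

(** * Finiteness of the weighted measure *)

Section weight_integrals.
Context (R : realType).
Local Notation leb := (@lebesgue_measure R).

Lemma le0_ler_powR (a u v : R) : a <= 0 -> 0 < u -> u <= v -> v `^ a <= u `^ a.
Proof.
move=> a0 u0 uv; have v0 := lt_le_trans u0 uv.
rewrite -[a]opprK [v `^ _]powRN [u `^ _]powRN lef_pV2 ?posrE ?powR_gt0//.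
by apply: ge0_ler_powR; rewrite ?nnegrE ?oppr_ge0 ?(ltW u0) ?(ltW v0).
Qed.

Lemma powR_le1 (t b : R) : 0 <= t <= 1 -> 0 <= b -> t `^ b <= 1.
Proof.
move=> /andP[t0 t1] b0; have := @ge0_ler_powR R b b0 t 1.
by rewrite !nnegrE powR1; exact.
Qed.

(** The integrand may be unbounded at 0, so the fundamental theorem of calculus is applied on
    intervals away from 0, and the bound passes to the limit by monotone convergence. *)
Lemma integral_powR_le (a t : R) : -1 < a -> 0 < t ->
  (\int[leb]_(x in `]0%R, t]) (x `^ a)%:E <= (t `^ (a + 1) / (a + 1))%:E)%E.
Proof.
move=> a1 t0; pose e i : R := t / i.+2%:R.
have a10 : 0 < a + 1 by rewrite -ltrBlDr sub0r.
(* The intervals [t / (i + 2), t] increase to ]0, t]; starting with i + 2 keeps each of them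
   nondegenerate. *)
have e0 i : 0 < e i by rewrite divr_gt0.
have et i : e i < t by rewrite /e ltr_pdivrMr// ltr_pMr// ltr1n.
pose F i : set R := `[e i, t]%classic.
have bF : \bigcup_i F i = `]0, t]%classic.
  apply/seteqP; split=> x.
    by move=> [i _]; rewrite /F/= !in_itv/= => /andP[ex ->]; rewrite (lt_le_trans (e0 i)).
  rewrite /= in_itv/= => /andP[x0 xt]; exists (Num.truncn (t / x)) => //.
  rewrite /F/= in_itv/= xt andbT /e ler_pdivrMr// mulrC -ler_pdivrMr//.
  have := truncnS_gt (t / x) => /ltW /le_trans; apply.
  by rewrite ler_nat.
rewrite -bF.
have mf i : measurable_fun (F i) (fun x => (x `^ a)%:E).
  by apply/measurable_EFinP; apply: measurable_funTS; exact: measurable_powR.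
have ndF : nondecreasing_seq (F : nat -> set (measurableTypeR R)).
  apply/nondecreasing_seqP => i; apply/subsetPset => x; rewrite /F/= !in_itv/= => /andP[ex ->].
  by rewrite andbT (le_trans _ ex)// /e ler_pM2l// lef_pV2 ?posrE// ler_nat.
have mF i : measurable (F i : set (measurableTypeR R)) by exact: measurable_itv.
have F0 i x : (F i : set (measurableTypeR R)) x -> (0 <= (x `^ a)%:E)%E by rewrite lee_fin powR_ge0.
have mf' i : measurable_fun (F i : set (measurableTypeR R)) (fun x => (x `^ a)%:E) := mf i.
have cv := ge0_nondecreasing_set_cvg_integral (mu := leb) ndF mF mf' F0.
rewrite -(cvg_lim _ cv)//; apply: lime_le; first by apply/cvg_ex; eexists; exact: cv.
apply: nearW => i /=; pose G (x : R) := x `^ (a + 1) / (a + 1).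
have dG (x : R) : 0 < x -> is_derive x 1 G (x `^ a).
  move=> x0.
  have := @is_derive1_powR R (a + 1) x x0.
  rewrite addrK => h.
  have -> : x `^ a = (a + 1)^-1 *: ((a + 1) * x `^ a) by rewrite /GRing.scale/= mulKf// gt_eqF.
  rewrite (_ : G = (a + 1)^-1 \*: (@powR R ^~ (a + 1))); last by apply/funext => y; rewrite /G mulrC.
  exact: is_deriveZ.
rewrite (@continuous_FTC2 R (fun x => x `^ a) G)//.
- by rewrite -EFinB lee_fin lerBlDr lerDl /G divr_ge0 ?powR_ge0// ltW.
- apply: continuous_in_subspaceT => x; rewrite inE/= in_itv/= => /andP[ex _].
  have x0 := lt_le_trans (e0 i) ex.
  by apply: differentiable_continuous; apply/derivable1_diffP; apply: derivable_powR; rewrite in_itv/= andbT.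
- split => [x|  |].
  + by rewrite in_itv/= => /andP[/ltW ex _]; have [] := dG x (lt_le_trans (e0 i) ex).
  + apply: cvg_at_right_filter; apply: differentiable_continuous; apply/derivable1_diffP.
    by have [] := dG _ (e0 i).
  + apply: cvg_at_left_filter; apply: differentiable_continuous; apply/derivable1_diffP.
    by have [] := dG _ t0.
- move=> x; rewrite in_itv/= => /andP[/ltW ex _].
  by rewrite derive1E; exact: (@derive_val _ _ _ _ _ _ _ (dG x (lt_le_trans (e0 i) ex))).
Qed.

(** [Gamma] is the finite part of an integral and would be 0 if the integral were infinite; hence an
    upper bound is proved as well as a lower one. *)
Lemma Gamma_gt0 (s : R) : 0 < s -> 0 < Gamma s.
Proof.
move=> s0; pose f (t : R) := t `^ (s - 1) * expR (- t).
have f0 t : 0 <= f t by rewrite mulr_ge0 ?powR_ge0 ?expR_ge0.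
have mf D : measurable_fun D f.
  apply: measurable_funTS; apply: measurable_funM; first exact: measurable_powR.
  by apply: measurableT_comp => //; exact: measurable_expR.
have mEf D : measurable_fun D (EFin \o f) by exact/measurable_EFinP.
have le1 : (\int[leb]_(t in `]0%R, 1%R]) (f t)%:E < +oo)%E.
  apply: (@le_lt_trans _ _ (\int[leb]_(t in `]0%R, 1%R]) (t `^ (s - 1))%:E)%E).
    apply: ge0_le_integral => //.
    - by move=> t _; rewrite lee_fin.
    - exact: mEf.
    - by apply/measurable_EFinP; apply: measurable_funTS; exact: measurable_powR.
    - move=> t /=; rewrite in_itv/= => /andP[t0 _]; rewrite lee_fin /f ler_piMr ?powR_ge0//.
      by rewrite -expR0 ler_expR oppr_le0 ltW.
  by apply: le_lt_trans (integral_powR_le _ _) _; rewrite ?ltry// ltrBrDr addNr.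
have le2 : (\int[leb]_(t in `]1%R, +oo[) (f t)%:E < +oo)%E.
  (* By the exponential series t^(m + 1) <= K exp(t / 2), and m + 1 > |s|. The remaining factor
     exp(- t / 2) is twice the exponential density of rate 1/2. *)
  pose m := Num.truncn `|s|; pose K : R := 2 ^+ m.+1 * m.+1`!%:R.
  have K0 : 0 <= K by rewrite mulr_ge0// exprn_ge0.
  have intp : leb.-integrable setT (EFin \o exponential_pdf (2^-1 : R)).
    by apply: integrable_exponential_pdf; rewrite ?invr_ge0 ?invr_gt0.
  apply: (@le_lt_trans _ _ (\int[leb]_(t in `]1%R, +oo[) ((2 * K)%:E * (exponential_pdf 2^-1 t)%:E))%E).
    apply: ge0_le_integral => //.
    - by move=> t _; rewrite lee_fin.
    - exact: mEf.
    - apply: emeasurable_funM => //; apply/measurable_EFinP; apply: measurable_funTS; exact: measurable_exponential_pdf.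
    - move=> t /=; rewrite in_itv/= andbT => t1; rewrite -EFinM lee_fin /f.
      have t0 : 0 < t by apply: lt_trans t1.
      rewrite /exponential_pdf patchE mem_set; last by rewrite /= in_itv/= andbT ltW.
      have -> : 2 * K * (2^-1 * expR (- 2^-1 * t)) = K * expR (- 2^-1 * t) by field.
      have -> : expR (- t) = expR (- 2^-1 * t) * expR (- 2^-1 * t) by rewrite -expRD; congr expR; field.
      rewrite mulrA ler_wpM2r ?expR_ge0//.
      rewrite (_ : - 2^-1 * t = - (t / 2)); last by ring.
      rewrite expRN ler_pdivrMr ?expR_gt0//.
      apply: (@le_trans _ _ (t ^+ m.+1)).
        rewrite -powR_mulrn ?(ltW t0)// ler_powR ?(ltW t1)//.
        rewrite (le_trans _ (ltW (truncnS_gt `|s|)))//.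
        by rewrite (le_trans _ (ler_norm s))// gerBl.
      have := @expR_ge1Dxn R (t / 2) m; rewrite divr_ge0 ?(ltW t0)// => /(_ isT) h.
      have {}h : (t / 2) ^+ m.+1 / m.+1`!%:R <= expR (t / 2) by apply: le_trans h; rewrite lerDr.
      rewrite (_ : t ^+ m.+1 = K * ((t / 2) ^+ m.+1 / m.+1`!%:R)); last first.
        rewrite /K expr_div_n; field.
        by rewrite expf_neq0//= pnatr_eq0 -lt0n fact_gt0.
      by rewrite ler_wpM2l.
  rewrite ge0_integralZl//; last 3 first.
  - by apply/measurable_EFinP; apply: measurable_funTS; exact: measurable_exponential_pdf.
  - by move=> t _; rewrite lee_fin exponential_pdf_ge0.
  - by rewrite lee_fin mulr_ge0.
  rewrite lte_mul_pinfty// ?lee_fin ?mulr_ge0//.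
  have /integrableP[_] : leb.-integrable `]1%R, +oo[ (EFin \o exponential_pdf (2^-1 : R)).
    by apply: integrableS intp.
  apply: le_lt_trans.
  apply: ge0_le_integral => //.
  - by move=> t _; rewrite lee_fin exponential_pdf_ge0.
  - by apply/measurable_EFinP; apply: measurable_funTS; exact: measurable_exponential_pdf.
  - by apply: measurableT_comp => //; apply/measurable_EFinP; apply: measurable_funTS; exact: measurable_exponential_pdf.
  - by move=> t _; rewrite /= lee_fin ler_norm.
have lt : (\int[leb]_(t in `]0%R, +oo[) (f t)%:E < +oo)%E.
  rewrite (@itv_bndbnd_setU _ _ _ (BRight 1)) ?bnd_simp//.
  rewrite ge0_integral_setU//=.
  - by rewrite lte_add_pinfty.
  - exact: mEf.
  - by move=> t _; rewrite lee_fin.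
  - apply/disj_setPS => t /=; rewrite !in_itv/= => -[/andP[_ t1]]; rewrite andbT => t1'.
    by move: (le_lt_trans t1 t1'); rewrite ltxx.
rewrite /Gamma /Rintegral fine_gt0// lt andbT.
(* A lower bound of the integrand on [1, 2], where ln t lies in [0, 1] and t <= 2. *)
pose c := expR (- `|s - 1| - 2).
apply: (@lt_le_trans _ _ (\int[leb]_(t in `[1%R, 2%R]) c%:E)%E).
  rewrite integral_cst//= lebesgue_measure_itv/= lte_fin ltr1n -EFinB -EFinM lte_fin mulr_gt0 ?expR_gt0//.
apply: (@le_trans _ _ (\int[leb]_(t in `[1%R, 2%R]) (f t)%:E)%E).
  apply: ge0_le_integral => //.
  - by move=> t _; rewrite lee_fin expR_ge0.
  - exact: mEf.
  - move=> t /=; rewrite in_itv/= => /andP[t1 t2]; rewrite lee_fin /f /c /powR.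
    rewrite gt_eqF ?(lt_le_trans ltr01)// -expRD ler_expR.
    have l0 : 0 <= ln t by rewrite ln_ge0.
    have l1 : ln t <= 1.
      have := @le_ln1Dx R (t - 1); rewrite (addrC 1) subrK => /(_ _)/le_trans; apply; lra.
    have : - `|s - 1| <= (s - 1) * ln t.
      have := ler_norm (- (s - 1)); rewrite normrN.
      have := normr_ge0 (s - 1).
      have := ler_norm (s - 1).
      nra.
    lra.
apply: ge0_subset_integral => //.
- exact: mEf.
- by move=> t _; rewrite lee_fin.
- by move=> t /=; rewrite !in_itv/= andbT => /andP[t1 _]; rewrite (lt_le_trans ltr01).
Qed.


Lemma ge0_integral_mpres d (T : measurableType d) (mu : {measure set T -> \bar R})
    (phi : T -> T) (D : set T) (f : T -> \bar R) :
  mpres mu phi -> measurable D -> measurable_fun D f ->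
  (forall x, D x -> (0 <= f x)%E) ->
  (\int[mu]_(x in phi @^-1` D) f (phi x) = \int[mu]_(x in D) f x)%E.
Proof.
move=> [mphi pE] mD mf f0.
rewrite -(@ge0_integral_pushforward _ _ _ _ _ phi mphi mu D f)//; last first.
  by move=> x; rewrite inE; exact: f0.
by apply: eq_measure_integral => A mA _; exact: pE.
Qed.

(** [powR] does not vanish at negative bases; with this extension by 0, integrals over balls are
    integrals over the whole space. *)
Definition pospow (a t : R) : R := if 0 < t then t `^ a else 0.

Lemma pospow_ge0 a t : 0 <= pospow a t.
Proof. by rewrite /pospow; case: ifP; rewrite ?powR_ge0. Qed.

Lemma measurable_pospow a : measurable_fun setT (pospow a).
Proof.
apply: measurable_fun_ifT; [|exact: measurable_powR|by []].
exact: measurable_fun_ltr.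
Qed.

Let mpospow d (T : measurableType d) (D : set T) a (f : T -> R) :
  measurable_fun D f -> measurable_fun D (fun x => (pospow a (f x))%:E).
Proof.
by move=> mf; apply/measurable_EFinP; apply: (measurableT_comp (measurable_pospow a)).
Qed.

(** With t = r^2, factor t - x^2 as (r - x)(r + x). One factor is at least r, so its power is at
    most r^a, as a < 0; the other one is integrated as a translate of u^a on ]0, 2 r], possibly
    reflected. *)
Lemma integral_pospow_sqr (a : R) : -1 < a < 0 -> exists2 C : R, 0 <= C &
  forall t, (\int[leb]_x (pospow a (t - x ^+ 2))%:E <= (C * pospow (a + 2^-1) t)%:E)%E.
Proof.
move=> /andP[a1 a0]; pose C : R := 2 * (2 `^ (a + 1) / (a + 1)).
have a10 : 0 < a + 1 by rewrite -ltrBlDr sub0r.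
have C0 : 0 <= C by rewrite mulr_ge0// divr_ge0 ?powR_ge0// ltW.
exists C => // t; have [t0|t0] := ltP 0 t; last first.
  rewrite integral0_eq ?lee_fin; first by rewrite mulr_ge0// pospow_ge0.
  move=> x _.
  by rewrite /pospow ifF//; apply/negbTE; rewrite -leNgt subr_le0 (le_trans t0)// sqr_ge0.
pose r := Num.sqrt t; have r0 : 0 < r by rewrite sqrtr_gt0.
have rt : t = r ^+ 2 by rewrite sqr_sqrtr// ltW.
have ar0 : 0 <= r `^ a by exact: powR_ge0.
(* [h] is u^a on ]0, 2 r], extended by 0 so that translation invariance can be used on the whole
   line. *)
have [h [mh h0 hI hE]] : exists h : R -> \bar R, [/\ measurable_fun setT h,
    forall u, (0 <= h u)%E, (\int[leb]_x h x <= ((2 * r) `^ (a + 1) / (a + 1))%:E)%E &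
    forall u, u \in `]0, 2 * r] -> h u = (u `^ a)%:E].
  exists (fun u : R => (if u \in `]0, 2 * r] then u `^ a else 0)%:E); split.
  - apply/measurable_EFinP; apply: measurable_fun_ifT; [|exact: measurable_powR|by []].
    under eq_fun do rewrite in_itv/=.
    by apply: measurable_and; [exact: measurable_fun_ltr|exact: measurable_fun_ler].
  - by move=> u; rewrite lee_fin; case: ifP; rewrite ?powR_ge0.
  - apply: le_trans (integral_powR_le a1 _); last by rewrite mulr_gt0.
    rewrite [leRHS]integral_mkcond le_eqVlt; apply/orP; left; apply/eqP.
    by apply: eq_integral => x _; rewrite patchE mem_setE; case: ifP.
  - by move=> u ->.
pose N : measurableTypeR R -> measurableTypeR R := -%R.
have mpN : mpres leb N.
  split; first exact: oppr_measurable.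
  by move=> A mA; exact: (lebesgue_measureN mA).
have mp1 := mpres_shiftR r; have mp2 := mpres_comp mp1 mpN.
have e1 := ge0_integral_mpres mp1 measurableT mh (fun x _ => h0 x).
have e2 := ge0_integral_mpres mp2 measurableT mh (fun x _ => h0 x).
apply: (@le_trans _ _ (\int[leb]_x ((r `^ a)%:E * (h (x + r)%R + h (- x + r)%R)))%E).
  apply: ge0_le_integral => //.
  - by move=> x _; rewrite lee_fin pospow_ge0.
  - by apply: mpospow; apply: measurable_funB => //; exact: measurable_funX.
  - apply: emeasurable_funM => //; apply: emeasurable_funD.
      by apply: (measurableT_comp mh); exact: mp1.1.
    by apply: (measurableT_comp mh); exact: mp2.1.
  - move=> x _; rewrite /pospow; case: ifP => [|_]; last by rewrite mule_ge0 ?adde_ge0// lee_fin.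
    rewrite rt => xr; have : `|x| < r by rewrite -ltr_sqr ?nnegrE ?(ltW r0)// real_normK ?num_real// -subr_gt0.
    rewrite ltr_norml => /andP[x1 x2].
    have i1 : x + r \in `]0, 2 * r] by rewrite in_itv/=; apply/andP; split; lra.
    have i2 : - x + r \in `]0, 2 * r] by rewrite in_itv/=; apply/andP; split; lra.
    rewrite !hE// -EFinD -EFinM lee_fin subr_sqr.
    have anti u v : 0 < u -> u <= v -> v `^ a <= u `^ a by apply: le0_ler_powR; exact: ltW.
    rewrite powRM; [|lra|lra]; rewrite mulrDr.
    have [x0|x0] := leP 0 x.
      have := anti r (r + x) r0; rewrite lerDl => /(_ x0) h1.
      rewrite (addrC _ r) -[leLHS]add0r lerD ?mulr_ge0 ?powR_ge0//.
      by rewrite (addrC (- x)) mulrC ler_wpM2r ?powR_ge0.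
    have := anti r (r - x) r0; rewrite lerDl oppr_ge0 => /(_ (ltW x0)) h1.
    rewrite -[leLHS]addr0 lerD ?mulr_ge0 ?powR_ge0//.
    by rewrite (addrC x) ler_wpM2r ?powR_ge0.
rewrite ge0_integralZl//; last 2 first.
- apply: emeasurable_funD.
    by apply: (measurableT_comp mh); exact: mp1.1.
  by apply: (measurableT_comp mh); exact: mp2.1.
- by move=> x _; rewrite adde_ge0.
rewrite ge0_integralD//; last 2 first.
- by apply: (measurableT_comp mh); exact: mp1.1.
- by apply: (measurableT_comp mh); exact: mp2.1.
rewrite preimage_setT in e1 e2; rewrite e1 e2.
apply: (@le_trans _ _ ((r `^ a)%:E * (((2 * r) `^ (a + 1) / (a + 1))%:E + ((2 * r) `^ (a + 1) / (a + 1))%:E))%E).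
  by rewrite lee_wpmul2l ?lee_fin// leeD.
rewrite -EFinD -EFinM lee_fin /pospow t0 rt powRM ?(ltW r0)//.
rewrite -(powR_mulrn 2 (ltW r0)) -powRrM (_ : 2%:R * (a + 2^-1) = a + (a + 1)); last by field.
rewrite (@powRD _ r a (a + 1)) ?(gt_eqF r0) ?implybT// le_eqVlt; apply/orP; left; apply/eqP.
by rewrite /C; field; rewrite gt_eqF.
Qed.

(** Each real integration raises the exponent by 1/2, from a to a + 1/2 and to a + 1 > 0. If a + 1/2
    is already nonnegative, the second integral is at most the length of [-1, 1]. *)
Lemma integral_pospow_C (a : R) : -1 < a < 0 -> exists2 K : R, 0 <= K &
  forall t, t <= 1 ->
    (\int[@lebesgueC R]_z (pospow a (t - normc z ^+ 2))%:E <= (if 0 < t then K else 0)%:E)%E.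
Proof.
move=> a10; have [C C0 CE] := integral_pospow_sqr a10; have /andP[a1 a0] := a10.
have mC t : measurable_fun setT (fun z : R[i] => (pospow a (t - normc z ^+ 2))%:E).
  by apply: mpospow; apply: measurable_funB => //; exact: measurable_sqr_normc.
have mS (t : R) : measurable_fun setT (fun y : R => t - y ^+ 2).
  by apply: measurable_funB => //; exact: measurable_funX.
suff [K K0 KE] : exists2 K : R, 0 <= K & forall t : R, t <= 1 ->
    (\int[leb]_y (pospow (a + 2^-1) (t - y ^+ 2))%:E <= K%:E)%E.
  exists (C * K) => [|t t1]; first exact: mulr_ge0.
  case: ifPn => [t0|]; last first.
    rewrite -leNgt => t0; rewrite integral0_eq// => z _; rewrite /pospow ifF//.
    by apply/negbTE; rewrite -leNgt subr_le0 (le_trans t0)// sqr_ge0.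
  have mpC := @measurable_pairC R.
  have := @ge0_integral_pushforward _ _ _ _ _ (@pairC R) mpC (leb \x leb)%E setT _ measurableT (mC t).
  rewrite /lebesgueC => ->; last by move=> z _; rewrite lee_fin pospow_ge0.
  rewrite preimage_setT fubini_tonelli2; last 2 first.
  - by apply: (measurableT_comp (mC t)); exact: measurable_pairC.
  - by move=> x; rewrite lee_fin pospow_ge0.
  rewrite /fubini_G; apply: (@le_trans _ _ (\int[leb]_y (C%:E * (pospow (a + 2^-1) (t - y ^+ 2))%:E))%E).
    apply: ge0_le_integral => //.
    - by move=> y _; apply: integral_ge0 => x _; rewrite lee_fin pospow_ge0.
    - have := @measurable_fun_fubini_tonelli_G _ _ _ _ R leb ((fun z : R[i] => (pospow a (t - normc z ^+ 2))%:E) \o @pairC R).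
      apply; last by move=> x; rewrite lee_fin pospow_ge0.
      by apply: (measurableT_comp (mC t)); exact: measurable_pairC.
    - apply: emeasurable_funM; first exact: measurable_cst.
      exact: (@mpospow _ (measurableTypeR R) setT (a + 2^-1) _ (mS t)).
    - move=> y _; rewrite -EFinM; apply: le_trans (CE _).
      rewrite le_eqVlt; apply/orP; left; apply/eqP; apply: eq_integral => x _ /=.
      by rewrite sqr_sqrtr ?addr_ge0 ?sqr_ge0// opprD addrA addrAC.
  rewrite ge0_integralZl//; last 2 first.
  - exact: (@mpospow _ (measurableTypeR R) setT (a + 2^-1) _ (mS t)).
  - by move=> y _; rewrite lee_fin pospow_ge0.
  by rewrite EFinM lee_wpmul2l ?lee_fin// KE.
have [ha|ha] := leP 0 (a + 2^-1); last first.
  have [|C' C'0 C'E] := @integral_pospow_sqr (a + 2^-1); first by rewrite ha andbT; lra.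
  exists C' => // t t1; apply: le_trans (C'E _) _; rewrite lee_fin.
  rewrite ler_piMr// /pospow; case: ifP => // t0.
  by apply: powR_le1; [rewrite (ltW t0)|lra].
exists 2 => // t t1; apply: (@le_trans _ _ (\int[leb]_(y in `[(-1)%R, 1%R]) (cst 1%E y))%E).
  rewrite [leRHS]integral_mkcond; apply: ge0_le_integral => //.
  - by move=> y _; rewrite lee_fin pospow_ge0.
  - exact: (@mpospow _ (measurableTypeR R) setT (a + 2^-1) _ (mS t)).
  - by apply/(measurable_restrictT _ _).1.
  - move=> y _; rewrite patchE; case: ifPn => [_|/negP ny].
      rewrite lee_fin /pospow; case: ifP => // y0.
      by apply: powR_le1 => //; rewrite (ltW y0)/=; have := sqr_ge0 y; lra.
    rewrite /pospow ifF//; apply/negP => y0; apply: ny; rewrite inE/= in_itv/=.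
    have : `|y| < 1 by rewrite -(@ltr_sqr _ _ 1) ?nnegrE// real_normK ?num_real// expr1n; lra.
    by rewrite ltr_norml => /andP[/ltW -> /ltW ->].
rewrite integral_cst//= lebesgue_measure_itv/= lte_fin mul1e; case: ifP => _; rewrite lee_fin; lra.
Qed.


Definition polybox (S : set R[i]) n : set 'cV[R[i]]_n := [set z | forall i, S (z i 0)].
Arguments polybox : clear implicits.

Section boxes.
Variables (S : set R[i]) (mS : measurable S).
Local Notation polybox := (polybox S).

Lemma measurable_polybox n : measurable (polybox n).
Proof.
rewrite (_ : polybox n = \bigcap_(i in [set: 'I_n]) (fun z : 'cV[R[i]]_n => z i 0) @^-1` S).
  apply: fin_bigcap_measurable => // i _; rewrite -[X in measurable X]setTI.
  exact: measurable_coord.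
by apply/seteqP; split=> z /= h i; [move=> _|]; exact: h.
Qed.

Let lebesgueCn_polyboxS n :
  lebesgueCn R n.+1 (polybox n.+1) = (lebesgueC S * lebesgueCn R n (polybox n))%E.
Proof.
rewrite -product_measure1E//; last exact: measurable_polybox.
rewrite -[LHS]/((lebesgueC (R:=R) \x lebesgueCn R n)%E (@vcons R n @^-1` polybox n.+1)).
congr ((lebesgueC (R:=R) \x lebesgueCn R n)%E _); apply/seteqP; split=> -[x z]/=.
  move=> h; split; first by have := h ord0; rewrite vcons0.
  by move=> j; have := h (lift ord0 j); rewrite vconsS.
move=> [Sx Sz] i; case: (unliftP ord0 i) => [j ->|->]; first by rewrite vconsS; exact: Sz.
by rewrite vcons0.
Qed.

Let lebesgueCn_polybox0 : lebesgueCn R 0 (polybox 0) = 1%E.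
Proof. by rewrite /= /dirac indicE mem_set// => -[]. Qed.

Lemma lebesgueCn_polybox_gt0 n : (0 < lebesgueC S)%E -> (0 < lebesgueCn R n (polybox n))%E.
Proof.
move=> S0; elim: n => [|n IH]; first by rewrite lebesgueCn_polybox0.
by rewrite lebesgueCn_polyboxS mule_gt0.
Qed.

Lemma lebesgueCn_polybox_lty n : (lebesgueC S < +oo)%E -> (lebesgueCn R n (polybox n) < +oo)%E.
Proof.
move=> S0; elim: n => [|n IH]; first by rewrite lebesgueCn_polybox0 ltry.
rewrite lebesgueCn_polyboxS lte_mul_pinfty//.
by rewrite ge0_fin_numE.
Qed.

End boxes.

Definition square (r : R) : set R[i] := [set z | `|complex.Re z| < r /\ `|complex.Im z| < r].

Lemma measurable_square r : measurable (square r).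
Proof.
have mI (f : R[i] -> R) : measurable_fun setT f -> measurable [set z | `|f z| < r].
  move=> mf; rewrite (_ : [set z | _] = setT `&` f @^-1` (`](- r), r[)%classic).
    exact: mf.
  by rewrite setTI; apply/seteqP; split=> z; rewrite /= in_itv/= ltr_norml.
rewrite (_ : square r = [set z | `|complex.Re z| < r] `&` [set z | `|complex.Im z| < r])//.
by apply: measurableI; apply: mI; [exact: measurable_Re|exact: measurable_Im].
Qed.

Lemma lebesgueC_square r : 0 < r -> lebesgueC (square r) = ((2 * r) ^+ 2)%:E.
Proof.
move=> r0; rewrite -[LHS]/((leb \x leb)%E (@pairC R @^-1` square r)).
rewrite (_ : _ @^-1` _ = `](- r), r[%classic `*` `](- r), r[%classic); last first.
  by apply/seteqP; split=> -[x y]; rewrite /square/= !in_itv/= !ltr_norml.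
rewrite product_measure1E//= !lebesgue_measure_itv/= !lte_fin.
by rewrite gtrN// -EFinB -EFinM; congr EFin; ring.
Qed.

Lemma normc_ge0 (z : R[i]) : 0 <= normc z.
Proof. by case: z => ? ?; exact: sqrtr_ge0. Qed.

Lemma normc_sqrE (z : R[i]) : normc z ^+ 2 = complex.Re z ^+ 2 + complex.Im z ^+ 2.
Proof. by case: z => a b /=; rewrite sqr_sqrtr ?addr_ge0 ?sqr_ge0. Qed.

Lemma sqnorm_ge0 n (z : 'cV[R[i]]_n) : 0 <= sqnorm z.
Proof. by apply: sumr_ge0 => i _; exact: sqr_ge0. Qed.

Lemma lebesgueCn_ball_lty n : (lebesgueCn R n unit_ball < +oo)%E.
Proof.
apply: (@le_lt_trans _ _ (lebesgueCn R n (polybox (square 1) n))).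
  apply: le_measure; rewrite ?inE.
  - exact: measurable_unit_ball.
  - by apply: measurable_polybox; exact: measurable_square.
  - move=> z; rewrite /unit_ball/= => z1 i.
    have : normc (z i 0) ^+ 2 < 1.
      apply: le_lt_trans z1; rewrite /sqnorm (bigD1 i)//= lerDl.
      by apply: sumr_ge0 => j _; exact: sqr_ge0.
    rewrite normc_sqrE => h; split; rewrite -(@ltr_sqr _ _ 1) ?nnegrE// real_normK ?num_real// expr1n;
      apply: le_lt_trans h; [rewrite lerDl|rewrite lerDr]; exact: sqr_ge0.
apply: lebesgueCn_polybox_lty; first exact: measurable_square.
by rewrite lebesgueC_square ?ltry.
Qed.

Lemma sqnorm_vcons n (x : R[i] * 'cV[R[i]]_n) : sqnorm (vcons x) = normc x.1 ^+ 2 + sqnorm x.2.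
Proof.
rewrite /sqnorm big_ord_recl vcons0; congr (_ + _).
by apply: eq_bigr => i _; rewrite vconsS.
Qed.

(** For a < 0, integrating the first coordinate alone removes the singularity: the fibre integrals
    are bounded uniformly over the ball of the other coordinates. For a >= 0 the integrand is at
    most 1. *)
Lemma integral_ball_powR n (a : R) : -1 < a ->
  (\int[lebesgueCn R n]_(z in unit_ball) ((1 - sqnorm z) `^ a)%:E < +oo)%E.
Proof.
move=> a1; have mball := @measurable_unit_ball R n.
have mw : measurable_fun setT (fun z : 'cV[R[i]]_n => 1 - sqnorm z).
  by apply: measurable_funB => //; exact: measurable_sqnorm.
have [a0|a0] := leP 0 a.
  apply: (@le_lt_trans _ _ (\int[lebesgueCn R n]_(z in unit_ball) (cst 1%E z))%E).
    apply: ge0_le_integral => //.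
    - by move=> z _; rewrite lee_fin powR_ge0.
    - apply/measurable_EFinP; apply: measurable_funTS.
      by apply: (measurableT_comp (measurable_powR a)).
    - move=> z; rewrite /unit_ball/= => z1; rewrite lee_fin powR_le1// subr_ge0 (ltW z1)/=.
      by rewrite gerBl sqnorm_ge0.
  by rewrite integral_cst// mul1e lebesgueCn_ball_lty.
case: n mball mw => [|n] mball mw.
  rewrite integral_dirac//; last first.
    by apply/measurable_EFinP; apply: measurable_funTS; apply: (measurableT_comp (measurable_powR a)).
  by rewrite /dirac indicE mem_set ?mul1e ?ltry// /unit_ball/= /sqnorm big_ord0.
have [K K0 KE] : exists2 K : R, 0 <= K & forall t, t <= 1 ->
    (\int[@lebesgueC R]_z (pospow a (t - normc z ^+ 2))%:E <= (if 0 < t then K else 0)%:E)%E.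
  by apply: integral_pospow_C; rewrite a1.
pose F (z : 'cV[R[i]]_n.+1) := (pospow a (1 - sqnorm z))%:E.
have mF : measurable_fun setT F by exact: mpospow.
have F0 z : (0 <= F z)%E by rewrite lee_fin pospow_ge0.
have mv := @measurable_vcons R n.
have mFv : measurable_fun setT (F \o @vcons R n) by apply: (measurableT_comp mF).
rewrite (_ : integral _ _ _ = (\int[lebesgueCn R n.+1]_z F z)%E); last first.
  rewrite [LHS]integral_mkcond; apply: eq_integral => z _.
  rewrite patchE /F /pospow subr_gt0; have [zb|zb] := boolP (sqnorm z < 1).
    by rewrite mem_set.
  by rewrite memNset//; exact/negP.
have := @ge0_integral_pushforward _ _ _ _ _ (@vcons R n) mv (lebesgueC (R:=R) \x lebesgueCn R n)%E setT F measurableT mF.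
move=> /(_ (fun z _ => F0 z)); rewrite preimage_setT => E.
rewrite [X in (X < _)%E](_ : _ = (\int[lebesgueC (R:=R) \x lebesgueCn R n]_x (F \o @vcons R n) x)%E)//.
(* The first coordinate is integrated innermost, the others being fixed. *)
rewrite fubini_tonelli2//; last by move=> x; exact: F0.
apply: (@le_lt_trans _ _ (\int[lebesgueCn R n]_(z in unit_ball) cst K%:E z)%E); last first.
  rewrite integral_cst; last exact: measurable_unit_ball.
  by rewrite lte_mul_pinfty// lebesgueCn_ball_lty.
rewrite [leRHS]integral_mkcond; apply: ge0_le_integral => //.
- by move=> z _; apply: integral_ge0 => x _; exact: F0.
- by apply: measurable_fun_fubini_tonelli_G => // x; exact: F0.
- by apply/(measurable_restrictT _ _).1 => //; exact: measurable_unit_ball.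
- move=> z _; have := KE (1 - sqnorm z); rewrite gerBl sqnorm_ge0 => /(_ isT) /(le_trans _) h.
  apply: (@le_trans _ _ (if 0 < 1 - sqnorm z then K else 0)%:E).
    apply: h; rewrite le_eqVlt; apply/orP; left; apply/eqP.
    apply: eq_integral => x _; rewrite /F /= sqnorm_vcons/=; congr (pospow _ _)%:E; ring.
  rewrite patchE subr_gt0; have [zb|zb] := boolP (sqnorm z < 1).
    by rewrite mem_set.
  by rewrite memNset//; exact/negP.
Qed.

End weight_integrals.

(** * Complex valued integrals *)

Section complex_norm.
Context (R : realType).
Local Notation C := R[i].
Implicit Types z w : C.

Lemma ReD z w : complex.Re (z + w) = complex.Re z + complex.Re w.
Proof. by case: z w => ? ? []. Qed.
Lemma ImD z w : complex.Im (z + w) = complex.Im z + complex.Im w.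
Proof. by case: z w => ? ? []. Qed.
Lemma ReM z w : complex.Re (z * w) = complex.Re z * complex.Re w - complex.Im z * complex.Im w.
Proof. by case: z w => ? ? []. Qed.
Lemma ImM z w : complex.Im (z * w) = complex.Re z * complex.Im w + complex.Im z * complex.Re w.
Proof. by case: z w => ? ? []. Qed.
Lemma Re_conjc z : complex.Re (conjc z) = complex.Re z.
Proof. by case: z. Qed.
Lemma Im_conjc z : complex.Im (conjc z) = - complex.Im z.
Proof. by case: z. Qed.

Lemma complexP z w : complex.Re z = complex.Re w -> complex.Im z = complex.Im w -> z = w.
Proof. by case: z w => a b [c d] /= -> ->. Qed.

Lemma Re_le_normc z : `|complex.Re z| <= normc z.
Proof.
rewrite -ler_sqr ?nnegrE ?normc_ge0 ?normr_ge0// normc_sqrE real_normK ?num_real//.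
by rewrite lerDl sqr_ge0.
Qed.

Lemma Im_le_normc z : `|complex.Im z| <= normc z.
Proof.
rewrite -ler_sqr ?nnegrE ?normc_ge0 ?normr_ge0// normc_sqrE real_normK ?num_real//.
by rewrite lerDr sqr_ge0.
Qed.

Lemma normc_le_ReIm z : normc z <= `|complex.Re z| + `|complex.Im z|.
Proof.
rewrite -ler_sqr ?nnegrE ?normc_ge0 ?addr_ge0// normc_sqrE.
rewrite -(real_normK (num_real (complex.Re z))) -(real_normK (num_real (complex.Im z))).
by have := mulr_ge0 (normr_ge0 (complex.Re z)) (normr_ge0 (complex.Im z)); nra.
Qed.

Lemma normcD z w : normc (z + w) <= normc z + normc w.
Proof. exact: (@le_normcD R). Qed.

Lemma normc_conj z : normc (conjc z) = normc z.
Proof. by case: z => a b /=; rewrite sqrrN. Qed.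

Lemma normcN z : normc (- z) = normc z.
Proof. by case: z => a b /=; rewrite !sqrrN. Qed.

Lemma normc_real (r : R) : normc r%:C = `|r|.
Proof. by rewrite /= expr0n addr0 sqrtr_sqr. Qed.

Lemma mulc_conj z : z * conjc z = (normc z ^+ 2)%:C.
Proof. apply: complexP; rewrite ?ReM ?ImM Re_conjc Im_conjc; last by rewrite [RHS]/=; ring.
by rewrite [RHS]/= normc_sqrE; ring. Qed.

Lemma normc_eq0 z : normc z = 0 -> z = 0.
Proof. exact: (@eq0_normc R). Qed.

Lemma normcX z n : normc (z ^+ n) = normc z ^+ n.
Proof.
elim: n => [|n IH]; first by rewrite !expr0 (normc_real 1) normr1.
by rewrite !exprS normcM IH.
Qed.

End complex_norm.

Section complex_integral.
Context (R : realType) d (T : measurableType d) (mu : {measure set T -> \bar R}).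
Variables (D : set T) (mD : measurable D).
Local Notation C := R[i].
Implicit Types f g : T -> C.

Definition cintegrable f :=
  mu.-integrable D (fun x => (complex.Re (f x))%:E) /\
  mu.-integrable D (fun x => (complex.Im (f x))%:E).

(** Defined by components in order to be convertible with [inner]. *)
Definition cint f : C :=
  (\int[mu]_(x in D) complex.Re (f x)) +i* (\int[mu]_(x in D) complex.Im (f x)).

Lemma cintegrable_measurable f : cintegrable f -> measurable_fun D f.
Proof.
move=> [/(measurable_int mu)/measurable_EFinP mr /(measurable_int mu)/measurable_EFinP mi].
by apply/measurable_complexP.
Qed.

Lemma measurable_normc f : measurable_fun D f -> measurable_fun D (fun x => normc (f x)).
Proof.
move=> mf; rewrite (_ : (fun x => _) = fun x => Num.sqrt (normc (f x) ^+ 2)).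
  apply: (measurableT_comp (continuous_measurable_fun (@sqrt_continuous R))) => //.
  exact: measurable_sqr_normc.
by apply/funext => x; rewrite sqrtr_sqr ger0_norm ?normc_ge0.
Qed.

Lemma cintegrableP f : cintegrable f <->
  measurable_fun D f /\ mu.-integrable D (fun x => (normc (f x))%:E).
Proof.
split=> [cf|[mf nf]].
  have mf := cintegrable_measurable cf; split=> //; case: cf => rf imf.
  apply: (@le_integrable _ _ _ _ _ mD _ (fun x => `|(complex.Re (f x))%:E| + `|(complex.Im (f x))%:E|)%E); last first.
  - by apply: integrableD => //; exact: integrable_abse.
  - move=> x _; have -> : (`|(complex.Re (f x))%:E| + `|(complex.Im (f x))%:E|)%E =
        (`|complex.Re (f x)| + `|complex.Im (f x)|)%:E by [].
    rewrite !abse_EFin lee_fin (ger0_norm (normc_ge0 _)) [leRHS]ger0_norm ?addr_ge0//.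
    exact: normc_le_ReIm.
  - by apply/measurable_EFinP; exact: measurable_normc.
have /measurable_complexP[mr mi] := mf.
split; apply: (le_integrable mD _ _ nf); try exact/measurable_EFinP.
- by move=> x _; rewrite /= lee_fin (ger0_norm (normc_ge0 _)) Re_le_normc.
- by move=> x _; rewrite /= lee_fin (ger0_norm (normc_ge0 _)) Im_le_normc.
Qed.

Lemma cintegrable_le f (g : T -> R) : measurable_fun D f ->
  mu.-integrable D (fun x => (g x)%:E) -> (forall x, D x -> normc (f x) <= g x) ->
  cintegrable f.
Proof.
move=> mf ig fg; apply/cintegrableP; split=> //; apply: le_integrable ig => //.
  by apply/measurable_EFinP; exact: measurable_normc.
move=> x Dx; rewrite /= lee_fin (ger0_norm (normc_ge0 _)).
by apply: le_trans (fg _ Dx) _; exact: ler_norm.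
Qed.

Lemma cintegrable_bounded f (M : R) : (mu D < +oo)%E -> measurable_fun D f ->
  (forall x, D x -> normc (f x) <= M) -> cintegrable f.
Proof.
move=> Dfin mf fM; apply: (cintegrable_le mf _ fM).
by apply: measurable_bounded_integrable => //; exact: bounded_cst.
Qed.

Lemma eq_cintegrable f g : (forall x, D x -> f x = g x) -> cintegrable f -> cintegrable g.
Proof.
move=> fg [rf imf]; split.
  by apply: eq_integrable rf => // x; rewrite inE => Dx; rewrite fg.
by apply: eq_integrable imf => // x; rewrite inE => Dx; rewrite fg.
Qed.

Lemma eq_cint f g : (forall x, D x -> f x = g x) -> cint f = cint g.
Proof.
by move=> fg; congr (_ +i* _); apply: eq_Rintegral => x; rewrite inE => Dx; rewrite fg.
Qed.

Lemma cintegrableD f g : cintegrable f -> cintegrable g -> cintegrable (fun x => f x + g x).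
Proof.
move=> [rf imf] [rg img]; split.
  by under eq_fun do rewrite ReD EFinD; exact: integrableD.
by under eq_fun do rewrite ImD EFinD; exact: integrableD.
Qed.

Lemma cintegrableZ (c : C) f : cintegrable f -> cintegrable (fun x => c * f x).
Proof.
move=> /cintegrableP[mf nf]; apply/cintegrableP; split.
  by apply: measurableC_mul.
under eq_fun do rewrite normcM EFinM.
exact: integrableZl.
Qed.

Lemma cintD f g : cintegrable f -> cintegrable g ->
  cint (fun x => f x + g x) = cint f + cint g.
Proof.
move=> [rf imf] [rg img]; rewrite /cint; apply: complexP => /=.
  by under eq_Rintegral do rewrite ReD; rewrite RintegralD.
by under eq_Rintegral do rewrite ImD; rewrite RintegralD.
Qed.

Let integrableZE (c : R) (h : T -> R) : mu.-integrable D (fun x => (h x)%:E) ->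
  mu.-integrable D (EFin \o (fun x => c * h x)).
Proof. by move=> /(integrableZl mD c); under eq_fun do rewrite -EFinM. Qed.

Lemma cintZ (c : C) f : cintegrable f -> cint (fun x => c * f x) = c * cint f.
Proof.
move=> [rf imf]; apply: complexP; rewrite ?ReM ?ImM /=.
  under eq_Rintegral do rewrite ReM.
  by rewrite RintegralB ?RintegralZl//; exact: integrableZE.
under eq_Rintegral do rewrite ImM.
by rewrite RintegralD ?RintegralZl//; exact: integrableZE.
Qed.

Lemma cintegrableN f : cintegrable f -> cintegrable (fun x => - f x).
Proof. by move=> /(cintegrableZ (-1)); under eq_fun do rewrite mulN1r. Qed.

Lemma cintB f g : cintegrable f -> cintegrable g ->
  cint (fun x => f x - g x) = cint f - cint g.
Proof.
move=> cf cg; rewrite cintD//; last exact: cintegrableN.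
by rewrite -[in RHS]mulN1r -cintZ//; congr (_ + _); apply: eq_cint => x _; rewrite mulN1r.
Qed.

Lemma cint0 : cint (fun=> 0) = 0.
Proof. by apply: complexP; rewrite /= /Rintegral integral0_eq. Qed.

Lemma cintegrable0 : cintegrable (fun=> 0).
Proof. by split; exact: integrable0. Qed.

Lemma cintegrable_sum (I : Type) (s : seq I) (F : I -> T -> C) :
  (forall i, cintegrable (F i)) -> cintegrable (fun x => \sum_(i <- s) F i x).
Proof.
move=> cF; elim: s => [|i s IH].
  by under eq_fun do rewrite big_nil; exact: cintegrable0.
by under eq_fun do rewrite big_cons; exact: cintegrableD.
Qed.

Lemma cint_sum (I : Type) (s : seq I) (F : I -> T -> C) :
  (forall i, cintegrable (F i)) ->
  cint (fun x => \sum_(i <- s) F i x) = \sum_(i <- s) cint (F i).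
Proof.
move=> cF; elim: s => [|i s IH].
  by rewrite big_nil; under eq_fun do rewrite big_nil; exact: cint0.
rewrite big_cons -IH -cintD//; last exact: cintegrable_sum.
by apply: eq_cint => x _; rewrite big_cons.
Qed.

Lemma cintegrable_conj f : cintegrable f -> cintegrable (fun x => conjc (f x)).
Proof.
move=> [rf imf]; split; first by under eq_fun do rewrite Re_conjc.
by under eq_fun do rewrite Im_conjc EFinN; exact: integrableN.
Qed.

Lemma cint_conj f : cintegrable f -> cint (fun x => conjc (f x)) = conjc (cint f).
Proof.
move=> [rf imf]; apply: complexP; rewrite ?Re_conjc ?Im_conjc /=.
  by apply: eq_Rintegral => x _; rewrite Re_conjc.
rewrite -mulN1r -RintegralZl//; apply: eq_Rintegral => x _.
by rewrite Im_conjc mulN1r.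
Qed.

Lemma cint_real (f : T -> R) : cint (fun x => (f x)%:C) = (\int[mu]_(x in D) f x)%:C.
Proof. by apply: complexP; rewrite //= /Rintegral integral0_eq. Qed.

(** Multiplying f by the conjugate of its integral makes the integral a nonnegative real, thus the
    integral of a real part, which is bounded by the norm. *)
Lemma normc_cint_le f : cintegrable f -> normc (cint f) <= \int[mu]_(x in D) normc (f x).
Proof.
move=> cf; have /cintegrableP[mf nf] := cf.
have [->|I0] := eqVneq (cint f) 0.
  by rewrite normc_real normr0; apply: Rintegral_ge0 => x _; exact: normc_ge0.
have N0 : 0 < normc (cint f).
  rewrite lt_def normc_ge0 andbT; apply: contra_neq I0; exact: normc_eq0.
rewrite -(ler_pM2l N0); set c := conjc (cint f).
have -> : normc (cint f) * normc (cint f) = complex.Re (cint (fun x => c * f x)).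
  by rewrite cintZ// [c * _]mulrC /c mulc_conj /= expr2.
rewrite -RintegralZl//; apply: le_Rintegral => //.
- by case: (cintegrableZ c cf).
- exact: integrableZE.
- move=> x _; apply: le_trans (ler_norm _) _; apply: le_trans (Re_le_normc _) _.
  by rewrite normcM normc_conj.
Qed.

Lemma ae_eq_cint f g : measurable_fun D f -> measurable_fun D g ->
  {ae mu, forall x, D x -> f x = g x} -> cint f = cint g.
Proof.
move=> /measurable_complexP[rf imf] /measurable_complexP[rg img] fg.
congr (_ +i* _); congr fine; apply: ae_eq_integral => //; try exact/measurable_EFinP.
  by apply: filterS fg => x h Dx; rewrite h.
by apply: filterS fg => x h Dx; rewrite h.
Qed.

Lemma Rintegral_mpres (phi : T -> T) (f : T -> R) : mpres mu phi -> phi @^-1` D = D ->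
  mu.-integrable D (EFin \o f) ->
  mu.-integrable D (EFin \o (f \o phi)) /\
  \int[mu]_(x in D) f (phi x) = \int[mu]_(x in D) f x.
Proof.
move=> mphi phiD intf; have mpD x : D x -> D (phi x) by rewrite -[in X in X -> _]phiD.
have /integrableP[mf foo] := intf.
have mfp : measurable_fun D (EFin \o (f \o phi)).
  move/measurable_EFinP: mf => mf; apply/measurable_EFinP.
  apply: (measurable_comp mD _ mf); last by apply: measurable_funTS; exact: mphi.1.
  by move=> _ [x Dx <-]; exact: mpD.
have E (g : T -> \bar R) : measurable_fun D g -> (forall x, D x -> (0 <= g x)%E) ->
    (\int[mu]_(x in D) g (phi x) = \int[mu]_(x in D) g x)%E.
  by move=> mg g0; rewrite -[in LHS]phiD ge0_integral_mpres.
have mabs : measurable_fun D (fun x => `|(f x)%:E|)%E by exact: measurableT_comp.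
split.
  by apply/integrableP; split=> //; rewrite (E (fun x => `|(f x)%:E|)%E).
rewrite /Rintegral; congr fine; rewrite integralE [RHS]integralE.
rewrite -(E _ (measurable_funepos mf)) -?(E _ (measurable_funeneg mf))//.
by congr (_ - _)%E; apply: eq_integral => x _; rewrite ?funeposE ?funenegE.
Qed.

Lemma cint_mpres (phi : T -> T) f : mpres mu phi -> phi @^-1` D = D ->
  cintegrable f -> cintegrable (fun x => f (phi x)) /\ cint (fun x => f (phi x)) = cint f.
Proof.
move=> mphi phiD [rf imf].
have [ir er] := Rintegral_mpres mphi phiD rf.
have [ii ei] := Rintegral_mpres mphi phiD imf.
by split=> //; rewrite /cint er ei.
Qed.

End complex_integral.

(** * Fubini's theorem on a product of subsets *)

Section fubini.
Context (R : realType) d1 d2 (T1 : measurableType d1) (T2 : measurableType d2).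
Variables (m1 : {sigma_finite_measure set T1 -> \bar R})
  (m2 : {sigma_finite_measure set T2 -> \bar R}).
Variables (D1 : set T1) (D2 : set T2).
Hypotheses (mD1 : measurable D1) (mD2 : measurable D2) (D1fin : (m1 D1 < +oo)%E).

(** Extend f by 0 off D1 x D2; the uniform bound M on the fibre integrals and the finite measure of
    D1 give integrability on the product. *)
Lemma Rintegral_fubini (f : T1 -> T2 -> R) (M : R) :
  measurable_fun (D1 `*` D2) (fun p => f p.1 p.2) ->
  (forall x, D1 x -> m2.-integrable D2 (EFin \o f x) /\
     (\int[m2]_(y in D2) `|(f x y)%:E| <= M%:E)%E) ->
  (forall y, D2 y -> m1.-integrable D1 (EFin \o f^~ y)) ->
  \int[m1]_(x in D1) (\int[m2]_(y in D2) f x y) =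
  \int[m2]_(y in D2) (\int[m1]_(x in D1) f x y).
Proof.
move=> mf fx fy; pose F := (fun p : T1 * T2 => (f p.1 p.2)%:E) \_ (D1 `*` D2).
have mD : measurable (D1 `*` D2) by exact: measurableX.
have mF : measurable_fun setT F.
  have mEf : measurable_fun (D1 `*` D2) (fun p : T1 * T2 => (f p.1 p.2)%:E) by exact/measurable_EFinP.
  exact: (measurable_restrictT _ mD).1 mEf.
have FE x y : F (x, y) = if (x \in D1) && (y \in D2) then (f x y)%:E else 0%E.
  by rewrite /F patchE in_setX.
have F1 x : (\int[m2]_y F (x, y) = ((fun x => (\int[m2]_(y in D2) f x y)%:E) \_ D1) x)%E.
  rewrite patchE; case: ifPn => [xD|xD]; last first.
    by apply: integral0_eq => y _; rewrite FE (negbTE xD).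
  rewrite /Rintegral fineK; last by have [] := fx x (set_mem xD) => /(integrable_fin_num mD2).
  rewrite [RHS]integral_mkcond; apply: eq_integral => y _.
  by rewrite FE xD patchE.
have F2 y : (\int[m1]_x F (x, y) = ((fun y => (\int[m1]_(x in D1) f x y)%:E) \_ D2) y)%E.
  rewrite patchE; case: ifPn => [yD|yD]; last first.
    by apply: integral0_eq => x _; rewrite FE (negbTE yD) andbF.
  rewrite /Rintegral fineK; last by have := fy y (set_mem yD) => /(integrable_fin_num mD1).
  rewrite [RHS]integral_mkcond; apply: eq_integral => x _.
  by rewrite FE yD patchE andbT.
have iF : (m1 \x m2)%E.-integrable setT F.
  apply/integrable12ltyP => //.
  apply: (@le_lt_trans _ _ (\int[m1]_(x in D1) cst `|M|%:E x)%E); last first.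
    by rewrite integral_cst// lte_mul_pinfty.
  rewrite [leRHS]integral_mkcond; apply: ge0_le_integral => //.
  - by move=> x _; exact: integral_ge0.
  - apply: (@measurable_fun_fubini_tonelli_F _ _ _ _ _ _ (abse \o F)).
      exact: measurableT_comp.
    by move=> p; exact: abse_ge0.
  - by apply/(measurable_restrictT _ mD1).1.
  - move=> x _; rewrite patchE; case: ifPn => [xD|xD]; last first.
      by rewrite integral0_eq// => y _; rewrite FE (negbTE xD) abse0.
    have [_ h] := fx x (set_mem xD).
    apply: (@le_trans _ _ M%:E); last by rewrite lee_fin ler_norm.
    apply: le_trans h; rewrite le_eqVlt; apply/orP; left; apply/eqP.
    rewrite [RHS]integral_mkcond; apply: eq_integral => y _.
    by rewrite FE xD patchE /=; case: (y \in D2); rewrite ?abse0.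
have := Fubini iF; rewrite -/(fubini_F m2 F _).
under eq_integral do rewrite F1.
under [in RHS]eq_integral do rewrite F2.
by rewrite -!integral_mkcond => h; rewrite [LHS]/Rintegral h.
Qed.

Lemma cint_fubini (f : T1 -> T2 -> R[i]) (M : R) :
  measurable_fun (D1 `*` D2) (fun p => f p.1 p.2) ->
  (forall x, D1 x -> cintegrable m2 D2 (f x) /\
     \int[m2]_(y in D2) normc (f x y) <= M) ->
  (forall y, D2 y -> cintegrable m1 D1 (f^~ y)) ->
  cint m1 D1 (fun x => cint m2 D2 (f x)) = cint m2 D2 (fun y => cint m1 D1 (f^~ y)).
Proof.
move=> /measurable_complexP[mr mi] fx fy.
have H (p : R[i] -> R) : (forall z, `|p z| <= normc z) ->
   measurable_fun (D1 `*` D2) (fun q => p (f q.1 q.2)) ->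
   (forall x, D1 x -> m2.-integrable D2 (fun y => (p (f x y))%:E)) ->
   (forall x, D1 x -> m2.-integrable D2 (EFin \o (fun y => p (f x y))) /\
     (\int[m2]_(y in D2) `|(p (f x y))%:E| <= M%:E)%E).
  move=> pn mp ip x Dx; split; first exact: ip.
  have [cf fM] := fx x Dx; have /(cintegrableP _ mD2)[mfx nf] := cf.
  rewrite -lee_fin in fM; apply: le_trans fM; rewrite /Rintegral fineK; last exact: (integrable_fin_num mD2 nf).
  apply: ge0_le_integral => //.
  - by apply: measurableT_comp => //; exact: (measurable_int m2 (ip x Dx)).
  - by apply/measurable_EFinP; exact: measurable_normc.
  - by move=> y _; rewrite abse_EFin lee_fin.
have Hr := H _ (@Re_le_normc R) mr (fun x Dx => (fx x Dx).1.1).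
have Hi := H _ (@Im_le_normc R) mi (fun x Dx => (fx x Dx).1.2).
have er := Rintegral_fubini mr Hr (fun y Dy => (fy y Dy).1).
have ei := Rintegral_fubini mi Hi (fun y Dy => (fy y Dy).2).
by rewrite /cint /=; congr (_ +i* _).
Qed.

End fubini.

(* What is used of the measure [v_lam]. *)
Record ball_measure (R : realType) n (mu : {measure set 'cV[R[i]]_n -> \bar R}) := BallMeasure {
  ball_measure_lty : (mu setT < +oo)%E;
  ball_measure_supp : mu (~` unit_ball) = 0%E;
  ball_measure_mpres : forall phi, mpres (lebesgueCn R n) phi ->
    (forall z, sqnorm (phi z) = sqnorm z) -> mpres mu phi;
  ball_measure_dom : forall A, measurable A -> lebesgueCn R n A = 0%E -> mu A = 0%E;
  ball_measure_ge : forall rho : R, rho < 1 -> exists2 K : R, 0 < K &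
    forall A, measurable A -> A `<=` [set z | sqnorm z <= rho] ->
    (lebesgueCn R n A <= K%:E * mu A)%E
}.

Section bergman_measure.
Context (R : realType) (n : nat) (lam : R) (lam_gtN1 : -1 < lam).
Local Notation v := (@bergman_measure R n lam).
Let c : R := Gamma (n%:R + lam + 1) / (pi ^+ n * Gamma (lam + 1)).

Let c0 : 0 < c.
Proof.
have l1 : 0 < lam + 1 by rewrite -ltrBlDr sub0r.
rewrite divr_gt0 ?mulr_gt0 ?exprn_gt0 ?pi_gt0 ?Gamma_gt0//.
by rewrite -addrA ltr_wpDl.
Qed.

Let mball := @measurable_unit_ball R n.
Let mweight D : measurable_fun D (fun z : 'cV[R[i]]_n => (bergman_weight lam z)%:E).
Proof. by apply/measurable_EFinP; apply: measurable_funTS; exact: measurable_bergman_weight. Qed.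
Let weight0 (z : 'cV[R[i]]_n) : (0 <= (bergman_weight lam z)%:E)%E.
Proof. by rewrite lee_fin bergman_weight_ge0. Qed.

Let vE A : (v : {measure set _ -> \bar R}) A = (\int[lebesgueCn R n]_(z in A `&` unit_ball) (bergman_weight lam z)%:E)%E.
Proof. by []. Qed.

Lemma bergman_measure_ball_measure : ball_measure v.
Proof.
split.
- rewrite vE setTI /bergman_weight; under eq_integral do rewrite EFinM.
  rewrite ge0_integralZl//; last 3 first.
  + apply/measurable_EFinP; apply: measurable_funTS; apply: (measurableT_comp (measurable_powR lam)).
    by apply: measurable_funB => //; exact: measurable_sqnorm.
  + by move=> z _; rewrite lee_fin powR_ge0.
  + by rewrite lee_fin ltW.
  by rewrite lte_mul_pinfty ?lee_fin ?(ltW c0)// integral_ball_powR.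
- by rewrite vE setICl integral_set0.
- move=> phi mphi phiN; split; first exact: mphi.1.
  move=> A mA; rewrite !vE.
  have pb : phi @^-1` unit_ball = unit_ball.
    by apply/seteqP; split=> z; rewrite /unit_ball/= phiN.
  rewrite -[in LHS]pb -preimage_setI.
  have := @ge0_integral_mpres R _ _ (lebesgueCn R n) phi (A `&` unit_ball) (fun z => (bergman_weight lam z)%:E) mphi.
  move=> <-; [|exact: measurableI|exact: mweight|by move=> z _; exact: weight0].
  by apply: eq_integral => z _; rewrite /bergman_weight phiN.
- move=> A mA A0; rewrite vE null_set_integral//; first exact: measurableI.
  apply/eqP; rewrite eq_le measure_ge0 andbT -A0 le_measure// ?inE//.
  exact: measurableI.
(* A lower bound of the weight where |z|^2 <= rho: the power is at least 1 for lam < 0, and at least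
   (1 - rho)^lam for lam >= 0. *)
- move=> rho rho1; pose K := c * Num.min 1 ((1 - rho) `^ lam).
  have r0 : 0 < 1 - rho by rewrite subr_gt0.
  have K0 : 0 < K by rewrite mulr_gt0// lt_min ltr01 powR_gt0.
  exists K^-1 => [|A mA Arho]; first by rewrite invr_gt0.
  have Ab : A `<=` unit_ball by move=> z /Arho /= /le_lt_trans; exact.
  rewrite vE (_ : A `&` unit_ball = A); last by apply/setIidPl.
  have -> : lebesgueCn R n A = ((K^-1)%:E * (K%:E * lebesgueCn R n A))%E.
    by rewrite muleA -EFinM mulVf ?gt_eqF// mul1e.
  rewrite lee_wpmul2l ?lee_fin ?invr_ge0 ?(ltW K0)//.
  rewrite -integral_cst//; apply: ge0_le_integral => //.
  + by move=> z _; rewrite lee_fin ltW.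
  + move=> z Az; rewrite lee_fin /bergman_weight /K ler_pM2l//.
    have z0 := sqnorm_ge0 z; have zr : sqnorm z <= rho by exact: Arho.
    have [l0|l0] := leP 0 lam.
      rewrite ge_min; apply/orP; right; apply: ge0_ler_powR; rewrite ?nnegrE ?(ltW r0)//; lra.
    rewrite ge_min; apply/orP; left.
    have := @le0_ler_powR R lam (1 - sqnorm z) 1 (ltW l0); rewrite powR1; apply; lra.
Qed.

End bergman_measure.

(** * Cauchy theorem for circles *)

Section goursat.
Context (R : realType).
Local Notation leb := (@lebesgue_measure R).
Local Notation I f a b := (\int[leb]_(x in `[a, b]) f x).

Lemma nested_point (x u : nat -> R) : nondecreasing_seq x -> nonincreasing_seq u ->
  (forall j, x j <= u j) -> exists s, forall j, x j <= s <= u j.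
Proof.
move=> ndx niu xu; exists (sup (range x)) => j.
have xui i : x i <= u j.
  have h1 := ndx i (maxn i j) (leq_maxl _ _); have h2 := niu j (maxn i j) (leq_maxr _ _).
  by apply: le_trans h1 _; apply: le_trans (xu _) h2.
have ub : ubound (range x) (u j) by move=> _ [i _ <-].
apply/andP; split; last by apply: ge_sup => //; exists (x 0%N); exists 0%N.
by apply: sup_ubound; [exists (u j)|exists j].
Qed.

Definition cont_on (f : R -> R) (a b : R) := {within `[a, b], continuous f}.

Lemma cont_onS f a b a' b' : a <= a' -> b' <= b -> cont_on f a b -> cont_on f a' b'.
Proof.
move=> aa bb; apply: continuous_subspaceW => x /=; rewrite !in_itv/= => /andP[h1 h2].
by rewrite (le_trans aa h1) (le_trans h2 bb).
Qed.

Lemma cont_on_integrable f a b : cont_on f a b -> leb.-integrable `[a, b] (EFin \o f).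
Proof. by move=> cf; apply: continuous_compact_integrable => //; exact: segment_compact. Qed.

Lemma integral_itv_split f (a m b : R) : a <= m -> m <= b -> cont_on f a b ->
  I f a b = I f a m + I f m b.
Proof.
move=> am mb cf; have fi := cont_on_integrable cf.
have := @Rintegral_itvB R f (BLeft a) (BRight b) m fi.
rewrite !bnd_simp => /(_ am mb) => h.
have fi' : leb.-integrable `]m, b] (EFin \o f).
  apply: integrableS fi => //.
  by move=> x /=; rewrite !in_itv/= => /andP[/ltW h1 ->]; rewrite (le_trans am h1).
by rewrite -(Rintegral_itv_obnd_cbnd fi') -h addrC subrK.
Qed.

Lemma integral_itv_near f (a b k M : R) : a <= b -> cont_on f a b ->
  (forall x, a <= x <= b -> `|f x - k| <= M) -> `|I f a b - k * (b - a)| <= M * (b - a).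
Proof.
move=> ab cf fk; have fi := cont_on_integrable cf.
have lab : fine (leb `[a, b]%classic) = b - a.
  rewrite lebesgue_measure_itv/= lte_fin; case: ltP => //= ba.
  by apply/esym/eqP; rewrite subr_eq0 eq_le ab ba.
have ik c : leb.-integrable `[a, b] (EFin \o cst c).
  by apply: cont_on_integrable; apply: continuous_subspaceT => x; exact: cst_continuous.
have -> : I f a b - k * (b - a) = \int[leb]_(x in `[a, b]) (f x - k).
  rewrite RintegralB//; last exact: ik.
  by rewrite Rintegral_cst// lab.
have ifk : leb.-integrable `[a, b] (EFin \o (fun x => f x - k)).
  have -> : EFin \o (fun x => f x - k) = ((EFin \o f) \- (EFin \o cst k))%E by [].
  exact: integrableB.
apply: le_trans (le_normr_Rintegral _ _) _ => //.
rewrite -lab -Rintegral_cst//; apply: le_Rintegral => //.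
- exact: integrable_norm ifk.
- exact: ik.
Qed.

Variables (P Q : R -> R -> R).

(** The circulation of the form P ds + Q dt, counterclockwise along the boundary of [a, b] x
    [c, d]. *)
Definition loop_integral (a b c d : R) : R :=
  I (Q b) c d - I (Q a) c d - I (fun s => P s d) a b + I (fun s => P s c) a b.

(* [P] and [Q] are differentiable at the point, with crossed partial derivatives
   equal there; nothing is assumed on the continuity of the derivatives. *)
Definition closed_form_at (s t : R) := exists p1 p2 q2 : R, forall e : R, 0 < e ->
  exists2 de : R, 0 < de & forall s' t', `|s' - s| < de -> `|t' - t| < de ->
   `|P s' t' - P s t - p1 * (s' - s) - p2 * (t' - t)| <= e * (`|s' - s| + `|t' - t|) /\
   `|Q s' t' - Q s t - p2 * (s' - s) - q2 * (t' - t)| <= e * (`|s' - s| + `|t' - t|).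

Variables (a0 b0 c0 d0 : R).
Hypothesis closedPQ : forall s t, a0 <= s <= b0 -> c0 <= t <= d0 -> closed_form_at s t.

Let near_cont (f : R -> R) x (p : R) :
  (forall e : R, 0 < e -> exists2 de : R, 0 < de & forall y, `|y - x| < de ->
    `|f y - f x - p * (y - x)| <= e * `|y - x|) -> {for x, continuous f}.
Proof.
move=> h; apply/cvgrPdist_le => e e0; have [de de0 fde] := h 1 ltr01.
near=> y; have yx : `|y - x| < de by rewrite distrC; near: y; exact: (@cvgr_dist_lt _ _ _ _ _ id).
have K0 : 0 < `|p| + 1 by rewrite ltr_wpDl.
have yx2 : `|y - x| <= e / (`|p| + 1).
  rewrite distrC; near: y; apply: (@cvgr_dist_le _ _ _ _ _ id) => //.
  by rewrite divr_gt0.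
rewrite distrC (_ : f y - f x = (f y - f x - p * (y - x)) + p * (y - x)); last by ring.
apply: le_trans (ler_normD _ _) _; apply: (@le_trans _ _ (1 * `|y - x| + `|p| * `|y - x|)).
  by rewrite lerD ?normrM//; exact: fde.
by rewrite -mulrDl addrC mulrC -ler_pdivlMr.
Unshelve. all: by end_near. Qed.

Let contP t : c0 <= t <= d0 -> cont_on (fun s => P s t) a0 b0.
Proof.
move=> tcd; apply: continuous_in_subspaceT => s; rewrite inE/= in_itv/= => sab.
have [p1 [p2 [q2 h]]] := closedPQ sab tcd; apply: (near_cont (p := p1)) => e e0.
have [de de0 hde] := h e e0; exists de => // y yx.
by have [] := hde y t yx; rewrite subrr normr0// mulr0 subr0 addr0.
Qed.

Let contQ s : a0 <= s <= b0 -> cont_on (Q s) c0 d0.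
Proof.
move=> sab; apply: continuous_in_subspaceT => t; rewrite inE/= in_itv/= => tcd.
have [p1 [p2 [q2 h]]] := closedPQ sab tcd; apply: (near_cont (p := q2)) => e e0.
have [de de0 hde] := h e e0; exists de => // y yx.
have ss : `|s - s| < de by rewrite subrr normr0.
by have [_] := hde s y ss yx; rewrite subrr normr0 mulr0 subr0 add0r.
Qed.

Let loopDs a m b c d : a0 <= a -> a <= m -> m <= b -> b <= b0 -> c0 <= c -> c <= d -> d <= d0 ->
  loop_integral a b c d = loop_integral a m c d + loop_integral m b c d.
Proof.
move=> aa am mb bb cc cd dd; rewrite /loop_integral.
rewrite (@integral_itv_split (fun s => P s d) a m b)//; last first.
  by apply: (cont_onS _ _ (contP _)) => //; rewrite dd andbT (le_trans cc).
rewrite (@integral_itv_split (fun s => P s c) a m b)//; last first.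
  by apply: (cont_onS _ _ (contP _)) => //; rewrite cc (le_trans cd).
by ring.
Qed.

Let loopDt a b c m d : a0 <= a -> a <= b -> b <= b0 -> c0 <= c -> c <= m -> m <= d -> d <= d0 ->
  loop_integral a b c d = loop_integral a b c m + loop_integral a b m d.
Proof.
move=> aa ab bb cc cm md dd; rewrite /loop_integral.
rewrite (@integral_itv_split (Q b) c m d)//; last first.
  by apply: (cont_onS _ _ (contQ _)) => //; rewrite bb andbT (le_trans aa).
rewrite (@integral_itv_split (Q a) c m d)//; last first.
  by apply: (cont_onS _ _ (contQ _)) => //; rewrite aa (le_trans ab).
by ring.
Qed.

(** The affine part of the form has circulation p2 (b - a)(d - c) - p2 (d - c)(b - a) = 0; only the
    error term remains, of order e times the size of the rectangle, integrated along the sides. *)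
Let loop_small (s t e : R) : 0 < e -> closed_form_at s t ->
  exists2 de : R, 0 < de & forall a b c d, a0 <= a -> a <= s <= b -> b <= b0 ->
    c0 <= c -> c <= t <= d -> d <= d0 -> b - a < de -> d - c < de ->
    `|loop_integral a b c d| <= 2 * e * ((b - a) + (d - c)) ^+ 2.
Proof.
move=> e0 [p1 [p2 [q2 h]]]; have [d1 d10 hd] := h e e0; exists d1 => //.
move=> a b c d aa /andP[as' sb] bb cc /andP[ct td] dd bad cdd.
have ab := le_trans as' sb; have cd := le_trans ct td.
pose M := 2 * e * ((b - a) + (d - c)).
have ds x : a <= x <= b -> `|x - s| <= b - a by move=> /andP[? ?]; rewrite ler_norml; apply/andP; split; lra.
have dt x : c <= x <= d -> `|x - t| <= d - c by move=> /andP[? ?]; rewrite ler_norml; apply/andP; split; lra.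
have bnd x y : a <= x <= b -> c <= y <= d -> e * (`|x - s| + `|y - t|) <= e * ((b - a) + (d - c)).
  by move=> xab ycd; rewrite ler_pM2l// lerD ?ds ?dt.
have inh x y (xab : a <= x <= b) (ycd : c <= y <= d) := hd x y (le_lt_trans (ds _ xab) bad) (le_lt_trans (dt _ ycd) cdd).
have aab : a <= a <= b by rewrite lexx. have bab : a <= b <= b by rewrite lexx andbT.
have ccd : c <= c <= d by rewrite lexx. have dcd : c <= d <= d by rewrite lexx andbT.
have cQ x : a <= x <= b -> cont_on (Q x) c d.
  move=> /andP[ax xb]; apply: (cont_onS _ _ (contQ _)) => //.
  by rewrite (le_trans aa ax) (le_trans xb bb).
have cP y : c <= y <= d -> cont_on (fun s => P s y) a b.
  move=> /andP[cy yd]; apply: (cont_onS _ _ (contP _)) => //.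
  by rewrite (le_trans cc cy) (le_trans yd dd).
have contB (f g : R -> R) u v : cont_on f u v -> cont_on g u v -> cont_on (fun x => f x - g x) u v.
  by move=> cf cg x; apply: cvgB; [exact: cf|exact: cg].
have e1 : I (Q b) c d - I (Q a) c d = I (fun y => Q b y - Q a y) c d.
  by rewrite RintegralB//; apply: cont_on_integrable; exact: cQ.
have e2 : I (fun s => P s d) a b - I (fun s => P s c) a b = I (fun x => P x d - P x c) a b.
  by rewrite RintegralB//; apply: cont_on_integrable; exact: cP.
have n1 : `|I (fun y => Q b y - Q a y) c d - p2 * (b - a) * (d - c)| <= M * (d - c).
  apply: integral_itv_near => //; first by apply: contB; exact: cQ.
  move=> y ycd; have [_ h1] := inh b y bab ycd; have [_ h2] := inh a y aab ycd.
  have b1 := bnd b y bab ycd; have b2 := bnd a y aab ycd.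
  rewrite (_ : _ - _ = (Q b y - Q s t - p2 * (b - s) - q2 * (y - t)) -
    (Q a y - Q s t - p2 * (a - s) - q2 * (y - t))); last by ring.
  apply: le_trans (ler_normB _ _) _; apply: le_trans (lerD (le_trans h1 b1) (le_trans h2 b2)) _.
  by rewrite /M -mulrA [leRHS]mulr_natl mulr2n.
have n2 : `|I (fun x => P x d - P x c) a b - p2 * (d - c) * (b - a)| <= M * (b - a).
  apply: integral_itv_near => //; first by apply: contB; exact: cP.
  move=> x xab; have [h1 _] := inh x d xab dcd; have [h2 _] := inh x c xab ccd.
  have b1 := bnd x d xab dcd; have b2 := bnd x c xab ccd.
  rewrite (_ : _ - _ = (P x d - P s t - p1 * (x - s) - p2 * (d - t)) -
    (P x c - P s t - p1 * (x - s) - p2 * (c - t))); last by ring.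
  apply: le_trans (ler_normB _ _) _; apply: le_trans (lerD (le_trans h1 b1) (le_trans h2 b2)) _.
  by rewrite /M -mulrA [leRHS]mulr_natl mulr2n.
rewrite (_ : loop_integral a b c d = (I (fun y => Q b y - Q a y) c d - p2 * (b - a) * (d - c)) -
   (I (fun x => P x d - P x c) a b - p2 * (d - c) * (b - a))); last first.
  by rewrite -e1 -e2 /loop_integral; ring.
apply: le_trans (ler_normB _ _) _; apply: le_trans (lerD n1 n2) _.
by rewrite /M le_eqVlt; apply/orP; left; apply/eqP; ring.
Qed.

Let subdivide (h k : R) (x : R * R) : 0 <= h -> 0 <= k ->
  a0 <= x.1 -> x.1 + 2 * h <= b0 -> c0 <= x.2 -> x.2 + 2 * k <= d0 ->
  exists y : R * R, [/\ x.1 <= y.1, y.1 + h <= x.1 + 2 * h, x.2 <= y.2, y.2 + k <= x.2 + 2 * k &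
    `|loop_integral x.1 (x.1 + 2 * h) x.2 (x.2 + 2 * k)| <=
    4 * `|loop_integral y.1 (y.1 + h) y.2 (y.2 + k)|].
Proof.
case: x => a c /= h0 k0 aa bb cc dd.
pose L a c := loop_integral a (a + h) c (c + k).
have hh x : x + 2 * h = x + h + h by ring.
have kk x : x + 2 * k = x + k + k by ring.
have E : loop_integral a (a + 2 * h) c (c + 2 * k) =
    L a c + L a (c + k) + (L (a + h) c + L (a + h) (c + k)).
  rewrite hh in bb *; rewrite kk in dd *; rewrite /L.
  rewrite (@loopDs a (a + h) (a + h + h))//; [|lra..].
  rewrite (@loopDt a (a + h) c (c + k) (c + k + k))//; [|lra..].
  by rewrite (@loopDt (a + h) (a + h + h) c (c + k) (c + k + k))//; lra.
have tri : `|loop_integral a (a + 2 * h) c (c + 2 * k)| <=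
    `|L a c| + `|L a (c + k)| + (`|L (a + h) c| + `|L (a + h) (c + k)|).
  rewrite E; apply: le_trans (ler_normD _ _) _.
  by apply: lerD; exact: ler_normD.
pose t := `|loop_integral a (a + 2 * h) c (c + 2 * k)| / 4.
have tE : `|loop_integral a (a + 2 * h) c (c + 2 * k)| = 4 * t by rewrite /t; field.
have [y [/orP ya /orP yc yL]] : exists y : R * R,
    [/\ (y.1 == a) || (y.1 == a + h), (y.2 == c) || (y.2 == c + k) & t <= `|L y.1 y.2|].
  have [h1|h1] := leP t `|L a c|; first by exists (a, c); rewrite !eqxx.
  have [h2|h2] := leP t `|L a (c + k)|; first by exists (a, c + k); rewrite !eqxx orbT.
  have [h3|h3] := leP t `|L (a + h) c|; first by exists (a + h, c); rewrite !eqxx orbT.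
  exists (a + h, c + k); rewrite /= !eqxx !orbT; split=> //.
  by rewrite leNgt; apply/negP => h4; move: tri; rewrite tE; lra.
exists y; rewrite tE ler_pM2l//; split=> //.
- by case: ya => /eqP ->; lra.
- by case: ya => /eqP ->; lra.
- by case: yc => /eqP ->; lra.
- by case: yc => /eqP ->; lra.
Qed.

(** Quadrisection gives nested rectangles that keep at least the fraction 4^-j of the circulation,
    whereas [loop_small] at their common point bounds it by 2 e 4^-j W^2, with e arbitrary. *)
Lemma goursat : a0 <= b0 -> c0 <= d0 -> loop_integral a0 b0 c0 d0 = 0.
Proof.
move=> ab0 cd0; pose H (j : nat) : R := (b0 - a0) / 2 ^+ j; pose K (j : nat) : R := (d0 - c0) / 2 ^+ j.
have p2 j : (0 : R) < 2 ^+ j by rewrite exprn_gt0.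
have H0 j : 0 <= H j by rewrite divr_ge0 ?subr_ge0// ltW.
have K0 j : 0 <= K j by rewrite divr_ge0 ?subr_ge0// ltW.
have HS j : H j = 2 * H j.+1 by rewrite /H exprS; field; rewrite gt_eqF.
have KS j : K j = 2 * K j.+1 by rewrite /K exprS; field; rewrite gt_eqF.
pose inv j (x : R * R) := [/\ a0 <= x.1, x.1 + H j <= b0, c0 <= x.2 & x.2 + K j <= d0].
pose L j (x : R * R) := loop_integral x.1 (x.1 + H j) x.2 (x.2 + K j).
have /choice[f fE] : forall p : nat * (R * R), exists y : R * R, inv p.1 p.2 ->
    [/\ p.2.1 <= y.1, y.1 + H p.1.+1 <= p.2.1 + H p.1, p.2.2 <= y.2,
        y.2 + K p.1.+1 <= p.2.2 + K p.1 & `|L p.1 p.2| <= 4 * `|L p.1.+1 y|].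
  move=> [j x]; have [[i1 i2 i3 i4]|ni] := pselect (inv j x); last by exists x => /ni.
  rewrite /= HS in i2; rewrite /= KS in i4.
  have [y [y1 y2 y3 y4 y5]] := subdivide (H0 j.+1) (K0 j.+1) i1 i2 i3 i4.
  by exists y => _; rewrite /L /= (HS j) (KS j).
pose x := fix x j := if j is i.+1 then f (i, x i) else (a0, c0).
have xinv j : inv j (x j).
  elim: j => [|j IH]; first by rewrite /inv /H /K /= expr0 !divr1; split => //; lra.
  have [y1 y2 y3 y4 _] := fE (j, x j) IH; have [i1 i2 i3 i4] := IH.
  rewrite /= in y1 y2 y3 y4; split=> /=; lra.
have xS j := fE (j, x j) (xinv j).
have Lj j : `|L 0 (x 0)| <= 4 ^+ j * `|L j (x j)|.
  elim: j => [|j IH]; first by rewrite expr0 mul1r.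
  have [_ _ _ _ h] := xS j; apply: le_trans IH _.
  by rewrite exprSr -mulrA ler_pM2l ?exprn_gt0.
have [s sE] : exists s, forall j, (x j).1 <= s <= (x j).1 + H j.
  apply: nested_point => [||j]; last by rewrite lerDl.
    by apply/nondecreasing_seqP => j; have [] := xS j.
  by apply/nonincreasing_seqP => j; have [] := xS j.
have [t tE] : exists t, forall j, (x j).2 <= t <= (x j).2 + K j.
  apply: nested_point => [||j]; last by rewrite lerDl.
    by apply/nondecreasing_seqP => j; have [] := xS j.
  by apply/nonincreasing_seqP => j; have [] := xS j.
have st : closed_form_at s t.
  apply: closedPQ; [have := sE 0%N|have := tE 0%N]; rewrite /H /K /= expr0 divr1 => /andP[-> h] /=; lra.
have L0 : L 0%N (x 0%N) = loop_integral a0 b0 c0 d0.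
  by rewrite /L /H /K /= expr0 !divr1 !(addrC _ (_ - _)) !subrK.
pose W : R := (b0 - a0) + (d0 - c0).
suff small e : 0 < e -> `|loop_integral a0 b0 c0 d0| <= 2 * e * W ^+ 2.
  apply/eqP; rewrite -normr_eq0 eq_le normr_ge0 andbT leNgt; apply/negP => pos.
  have W0 : 0 < 2 * W ^+ 2 + 1 by have := sqr_ge0 W; lra.
  have := small (`|loop_integral a0 b0 c0 d0| / (2 * W ^+ 2 + 1)); rewrite divr_gt0// => /(_ isT).
  rewrite mulrAC mulrA ler_pdivlMr// mulrC ler_pM2r//.
  by rewrite gerDl ler10.
move=> e0; have [de de0 hde] := loop_small e0 st.
have [j Wj] : exists j, W / 2 ^+ j < de.
  exists (Num.truncn (W / de)); rewrite ltr_pdivrMr// mulrC -ltr_pdivrMr//.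
  apply: lt_le_trans (truncnS_gt _) _.
  by rewrite -natrX ler_nat ltn_expl.
have HKW : H j + K j = W / 2 ^+ j by rewrite /H /K -mulrDl.
have [i1 i2 i3 i4] := xinv j.
have aK (u w : R) : u + w - u = w by rewrite addrAC subrr add0r.
have h := hde (x j).1 ((x j).1 + H j) (x j).2 ((x j).2 + K j) i1 (sE j) i2 i3 (tE j) i4.
rewrite !aK in h.
have hH : H j < de by apply: le_lt_trans Wj; rewrite -HKW lerDl.
have hK : K j < de by apply: le_lt_trans Wj; rewrite -HKW lerDr.
have {}h : `|L j (x j)| <= 2 * e * (H j + K j) ^+ 2 := h hH hK.
rewrite -L0; apply: le_trans (Lj j) _.
apply: (@le_trans _ _ (4 ^+ j * (2 * e * (H j + K j) ^+ 2))); first by rewrite ler_pM2l ?exprn_gt0.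
rewrite HKW le_eqVlt; apply/orP; left; apply/eqP.
have -> : (4 : R) = 2 * 2 by rewrite -natrM.
by rewrite exprMn; field; rewrite gt_eqF.
Qed.

End goursat.

(** * The complex exponential and means over circles *)

Section complex_topology.
Context (R : realType).
Local Notation C := R[i].

Lemma lec_real (x y : R) : (x%:C <= y%:C :> C) = (x <= y).
Proof. by rewrite lecR. Qed.

Lemma ltc_real (x y : R) : (x%:C < y%:C :> C) = (x < y).
Proof. by rewrite ltcR. Qed.

(** Radii of balls in a normed module over C are elements of C; this lets them be taken in R. *)
Lemma complex_gt0 (e : C) : 0 < e -> exists2 r : R, 0 < r & e = r%:C.
Proof.
by case: e => a b; rewrite ltcE/= => /andP[/eqP -> a0]; exists a.
Qed.

Lemma normrE_c (z : C) : `|z| = (normc z)%:C.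
Proof. by []. Qed.

Lemma nbhs_complex_norm (V : normedModType C) (x : V) (P : V -> Prop) :
  (\forall y \near x, P y) -> exists2 de : R, 0 < de & forall h, `|h| < de%:C -> P (x + h).
Proof.
move=> /nbhs_ballP[_ /complex_gt0[de de0 ->] h]; exists de => // k kde; apply: h.
by rewrite -ball_normE/= opprD addrA subrr add0r normrN.
Qed.

Lemma nbhs_complex_normP (V : normedModType C) (x : V) (P : V -> Prop) (de : R) : 0 < de ->
  (forall h, `|h| < de%:C -> P (x + h)) -> \forall y \near x, P y.
Proof.
move=> de0 h; apply/nbhs_ballP; exists de%:C => /=; first by rewrite ltcR.
move=> y; rewrite -ball_normE/= => yx; rewrite -(subrKC x y) ; apply: h.
by rewrite distrC.
Qed.

Lemma continuous_Re : continuous (@complex.Re R).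
Proof.
move=> z A /nbhs_ballP[e /= e0 hA]; apply: (nbhs_complex_normP e0) => h he; apply: hA.
rewrite -ball_normE/= ReD opprD addrA subrr add0r normrN.
by apply: le_lt_trans (Re_le_normc _) _; rewrite -ltc_real.
Qed.

Lemma continuous_Im : continuous (@complex.Im R).
Proof.
move=> z A /nbhs_ballP[e /= e0 hA]; apply: (nbhs_complex_normP e0) => h he; apply: hA.
rewrite -ball_normE/= ImD opprD addrA subrr add0r normrN.
by apply: le_lt_trans (Im_le_normc _) _; rewrite -ltc_real.
Qed.

Lemma continuous_realC : continuous (fun x : R => x%:C : C).
Proof.
move=> x; apply/cvgrPdist_le => _ /complex_gt0[e e0 ->]; near=> y.
rewrite (_ : x%:C - y%:C = (x - y)%:C); last by rewrite rmorphB.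
rewrite normrE_c normc_real lec_real.
by near: y; exact: (@cvgr_dist_le _ _ _ _ _ id).
Unshelve. all: by end_near. Qed.

Lemma differentiable_eps (V W : normedModType C) (f : V -> W) (x : V) : differentiable f x ->
  forall e : R, 0 < e -> exists2 de : R, 0 < de & forall h, `|h| < de%:C ->
  `|f (x + h) - f x - 'd f x h| <= e%:C * `|h|.
Proof.
move=> /diff_locallyP[_ /eqaddoP h] e e0.
have := h e%:C; rewrite ltcR => /(_ e0) /nbhs_complex_norm[de de0 hde]; exists de => // k kde.
have := hde k kde; rewrite add0r /=.
by rewrite [X in `|X|]/GRing.add/= opprD addrA [k + x]addrC.
Qed.

Lemma eps_differentiable (V W : normedModType C) (f : V -> W) (x : V) (D : {linear V -> W}) :
  continuous D ->
  (forall e : R, 0 < e -> exists2 de : R, 0 < de & forall h, `|h| < de%:C ->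
    `|f (x + h) - f x - D h| <= e%:C * `|h|) -> differentiable f x.
Proof.
move=> cD h.
have o : f \o shift x = cst (f x) + D +o_ 0 id.
  apply/eqaddoP => _ /complex_gt0[e e0 ->]; have [de de0 hde] := h e e0.
  apply: (nbhs_complex_normP de0) => k kde; have := hde k kde; rewrite add0r /=.
  by rewrite [X in _ -> `|X| <= _]/GRing.add/= opprD addrA [k + x]addrC.
have dE := diff_unique cD o.
by apply/diff_locallyP; rewrite dE.
Qed.

Lemma is_derive_eps (g : R -> R) (x a : R) : is_derive x 1 g a ->
  forall e : R, 0 < e -> exists2 de : R, 0 < de & forall h : R, `|h| < de ->
  `|g (x + h) - g x - a * h| <= e * `|h|.
Proof.
move=> [dg <-] e e0; have /derivable_nbhs /eqaddoP /(_ e e0) := dg.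
move=> /nbhs_ballP[de /= de0 hde]; exists de => // h hh.
have {}hde : `|g (h *: 1 + x) - (g x + h *: 'D_1 g x)| <= e * `|h|.
  by apply: hde; rewrite -ball_normE /= sub0r normrN.
by move: hde; rewrite opprD addrA /GRing.scale/= mulr1 (addrC h) (mulrC h).
Qed.

Definition cis (t : R) : C := cos t +i* sin t.
Definition cexp (w : C) : C := (expR (complex.Re w))%:C * cis (complex.Im w).

Lemma cisD s t : cis (s + t) = cis s * cis t.
Proof. by apply: complexP; rewrite ?ReM ?ImM /= ?cosD ?sinD // addrC. Qed.

Lemma cexpD v w : cexp (v + w) = cexp v * cexp w.
Proof. by rewrite /cexp ReD ImD expRD cisD rmorphM/=; ring. Qed.

Lemma normc_cis t : normc (cis t) = 1.
Proof. by rewrite /= cos2Dsin2 sqrtr1. Qed.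

Lemma normc_cexp w : normc (cexp w) = expR (complex.Re w).
Proof. by rewrite normcM normc_cis normc_real mulr1 ger0_norm// expR_ge0. Qed.

Lemma cis0 : cis 0 = 1.
Proof. by apply: complexP; rewrite /= ?cos0 ?sin0. Qed.

Lemma cis2pi : cis (2 * pi) = 1.
Proof.
have -> : 2 * pi = pi *+ 2 :> R by rewrite mulr_natl.
by apply: complexP; rewrite /= ?cos2pi ?sin2pi.
Qed.

Lemma continuous_cis : continuous cis.
Proof.
move=> t; rewrite (_ : cis = fun t => (cos t)%:C + 'i * (sin t)%:C); last first.
  by apply/funext => s; apply: complexP; rewrite ?ReD ?ImD /=; ring.
apply: cvgD.
  by apply: (continuous_comp _ (@continuous_realC _)); exact: continuous_cos.
apply: cvgM; first exact: cvg_cst.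
by apply: (continuous_comp _ (@continuous_realC _)); exact: continuous_sin.
Qed.

Lemma differentiableXC (V : normedModType C) (f : V -> C) x k :
  differentiable f x -> differentiable (fun z => f z ^+ k) x.
Proof.
move=> df; elim: k => [|k ih]; first exact: differentiable_cst.
rewrite (_ : (fun z => _) = f * (fun z => f z ^+ k)); first exact: differentiableM.
by apply/funext => z; rewrite exprS.
Qed.

Lemma differentiable_invXC (z : C) k : z != 0 -> differentiable (fun z : C => z^-1 ^+ k) z.
Proof.
move=> z0; have d : differentiable (fun z : C => z^-1) z by exact: (@differentiable_Rinv C z z0).
exact: (@differentiableXC C (fun z => z^-1) z k d).
Qed.

Lemma differentiable_cexp w : differentiable cexp w.
Proof.
have lin : linear (fun h : C => cexp w * h).
  by move=> k u v; rewrite mulrDr /GRing.scale/=; ring.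
pose D : {linear C -> C} := HB.pack (fun h : C => cexp w * h) (GRing.isLinear.Build _ _ _ _ _ lin).
have cD : continuous D.
  exact: (@scaler_continuous _ C (cexp w)).
apply: (eps_differentiable cD) => e e0.
pose M := normc (cexp w) + 1; have M0 : 0 < M by rewrite ltr_wpDl ?normc_ge0.
(* The first order expansions of exp, cos and sin at 0, with errors e1 |h|, add up to an error 9 e1
   |h|, within the margin given by 24. Imposing |h| < e1 absorbs the terms of second order. *)
have [e1 [e10 e11 e12]] : exists e1 : R, [/\ 0 < e1, e1 <= 1 & e1 <= e / (24 * M)].
  exists (Num.min 1 (e / (24 * M))); split; last 2 first.
  - by rewrite ge_min lexx.
  - by rewrite ge_min lexx orbT.
  by rewrite lt_min ltr01/= divr_gt0// mulr_gt0.
have [d1 d10 h1] := is_derive_eps (is_derive_expR 0) e10.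
have [d2 d20 h2] := is_derive_eps (is_derive_cos 0) e10.
have [d3 d30 h3] := is_derive_eps (is_derive_sin 0) e10.
exists (Num.min (Num.min d1 d2) (Num.min d3 e1)); first by rewrite !lt_min d10 d20 d30.
move=> h; rewrite normrE_c ltcR !lt_min => /andP[/andP[hd1 hd2] /andP[hd3 he1]].
rewrite -[D h]/(cexp w * h) cexpD.
rewrite (_ : _ - _ - _ = cexp w * (cexp h - 1 - h)); last by ring.
rewrite normrM !normrE_c -!rmorphM lec_real.
move: hd1 hd2 hd3 he1; set N := normc h => hd1 hd2 hd3 he1.
have N0 : 0 <= N by exact: normc_ge0.
set s := complex.Re h; set t := complex.Im h.
have sN : `|s| <= N by exact: Re_le_normc.
have tN : `|t| <= N by exact: Im_le_normc.
have := h1 s (le_lt_trans sN hd1); rewrite add0r expR0 mul1r => k1.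
have := h2 t (le_lt_trans tN hd2); rewrite add0r cos0 sin0 oppr0 mul0r subr0 => k2.
have := h3 t (le_lt_trans tN hd3); rewrite add0r sin0 cos0 subr0 mul1r => k3.
have {}k1 : `|expR s - 1 - s| <= e1 * N by apply: le_trans k1 _; rewrite ler_pM2l.
have {}k2 : `|cos t - 1| <= e1 * N by apply: le_trans k2 _; rewrite ler_pM2l.
have {}k3 : `|sin t - t| <= e1 * N by apply: le_trans k3 _; rewrite ler_pM2l.
have N1 : N <= 1 by apply: le_trans (ltW he1) e11.
have eN1 : e1 * N <= 1 by apply: mulr_ile1 => //; exact: ltW.
have es : `|expR s - 1| <= 2 * N.
  rewrite (_ : expR s - 1 = (expR s - 1 - s) + s); last by ring.
  apply: le_trans (ler_normD _ _) _; rewrite mulr_natl mulr2n lerD//.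
  by apply: le_trans k1 _; rewrite ler_piMl.
have es3 : `|expR s| <= 3.
  rewrite (_ : expR s = (expR s - 1) + 1); last by ring.
  by apply: le_trans (ler_normD _ _) _; rewrite normr1; lra.
have b1 : `|expR s * cos t - 1 - s| <= 4 * (e1 * N).
  rewrite (_ : _ - _ = (expR s - 1 - s) + expR s * (cos t - 1)); last by ring.
  apply: le_trans (ler_normD _ _) _; rewrite normrM.
  have := ler_pM (normr_ge0 _) (normr_ge0 _) es3 k2; lra.
have b2 : `|expR s * sin t - t| <= 5 * (e1 * N).
  rewrite (_ : _ - _ = (expR s - 1) * t + expR s * (sin t - t)); last by ring.
  apply: le_trans (ler_normD _ _) _; rewrite !normrM.
  have c1 := ler_pM (normr_ge0 _) (normr_ge0 _) es3 k3.
  have c2 := ler_pM (normr_ge0 _) (normr_ge0 _) es tN.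
  have : 2 * N * N <= 2 * (e1 * N) by rewrite -mulrA ler_pM2l// ler_wpM2r// ltW.
  lra.
have b3 : normc (cexp h - 1 - h) <= 9 * (e1 * N).
  apply: le_trans (normc_le_ReIm _) _.
  have -> : complex.Re (cexp h - 1 - h) = expR s * cos t - 1 - s.
    by rewrite /s /t /cexp; case: (h) => u v /=; rewrite !mul0r subr0.
  have -> : complex.Im (cexp h - 1 - h) = expR s * sin t - t.
    by rewrite /s /t /cexp; case: (h) => u v /=; rewrite !mul0r addr0 subr0.
  lra.
apply: (@le_trans _ _ (M * (9 * (e1 * N)))).
  by apply: ler_pM; rewrite ?normc_ge0// lerDl.
move: e12; rewrite ler_pdivlMr ?mulr_gt0// => k.
have : e1 * (24 * M) * N <= e * N by rewrite ler_wpM2r.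
have : 0 <= M * (e1 * N) by apply: mulr_ge0; [exact: ltW|apply: mulr_ge0 => //; exact: ltW].
lra.
Qed.

Local Notation leb := (@lebesgue_measure R).
Local Notation circ := (`[0%R, 2 * pi]%classic : set R).
(** Not divided by 2 pi: it is 2 pi times the mean of phi over [0, 2 pi]. *)
Definition cmean (phi : R -> C) : C := cint leb circ phi.

(** These are the imaginary part of G(w) dw and the opposite of its real part. The equality of the
    crossed partial derivatives is the Cauchy-Riemann equations, read off from the complex
    derivative A. *)
Lemma closed_form_differentiable (G : C -> C) (s t : R) : differentiable G (s +i* t) ->
  closed_form_at (fun s t => complex.Im (G (s +i* t))) (fun s t => complex.Re (G (s +i* t))) s t /\
  closed_form_at (fun s t => - complex.Re (G (s +i* t))) (fun s t => complex.Im (G (s +i* t))) s t.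
Proof.
move=> dG; set w := s +i* t in dG *; set A := 'd G w (1 : C).
have dE h : 'd G w h = h * A.
  by rewrite -[in LHS](mulr1 h) -[h * 1]/(h *: (1 : C)) linearZ.
have key e : 0 < e -> exists2 de : R, 0 < de & forall s' t', `|s' - s| < de -> `|t' - t| < de ->
    `|complex.Re (G (s' +i* t')) - complex.Re (G w) - (complex.Re A * (s' - s) - complex.Im A * (t' - t))|
      <= e * (`|s' - s| + `|t' - t|) /\
    `|complex.Im (G (s' +i* t')) - complex.Im (G w) - (complex.Im A * (s' - s) + complex.Re A * (t' - t))|
      <= e * (`|s' - s| + `|t' - t|).
  move=> e0; have [de de0 hde] := differentiable_eps dG e0.
  exists (de / 2) => [|s' t' hs ht]; first by rewrite divr_gt0.
  set h : C := (s' - s) +i* (t' - t).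
  have hN : normc h <= `|s' - s| + `|t' - t| by exact: (normc_le_ReIm h).
  have hh : `|h| < de%:C by rewrite normrE_c ltcR; apply: le_lt_trans hN _; lra.
  have := hde h hh.
  have -> : w + h = s' +i* t' by apply: complexP; rewrite ?ReD ?ImD /=; ring.
  rewrite dE normrE_c -rmorphM/= lec_real => k.
  have {}k : normc (G (s' +i* t') - G w - h * A) <= e * (`|s' - s| + `|t' - t|).
    by apply: le_trans k _; rewrite ler_pM2l.
  split.
    apply: le_trans k; apply: le_trans (Re_le_normc _); rewrite le_eqVlt; apply/orP; left; apply/eqP.
    congr `|_|; rewrite /h; case: (G _) (G w) (A) => [? ?] [? ?] [? ?] /=; ring.
  apply: le_trans k; apply: le_trans (Im_le_normc _); rewrite le_eqVlt; apply/orP; left; apply/eqP.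
  congr `|_|; rewrite /h; case: (G _) (G w) (A) => [? ?] [? ?] [? ?] /=; ring.
split.
  exists (complex.Im A), (complex.Re A), (- complex.Im A) => e e0.
  have [de de0 h] := key e e0; exists de => // s' t' hs ht; have [hr hi] := h s' t' hs ht.
  split; [apply: le_trans hi|apply: le_trans hr]; rewrite le_eqVlt; apply/orP; left; apply/eqP; congr `|_|; ring.
exists (- complex.Re A), (complex.Im A), (complex.Re A) => e e0.
have [de de0 h] := key e e0; exists de => // s' t' hs ht; have [hr hi] := h s' t' hs ht.
split; [apply: le_trans hr; rewrite -normrN|apply: le_trans hi]; rewrite le_eqVlt; apply/orP; left; apply/eqP; congr `|_|; ring.
Qed.

(** Goursat on [a, b] x [0, 2 pi]: by periodicity the two horizontal sides cancel. *)
Lemma cmean_strip (G : C -> C) (a b : R) : a <= b ->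
  (forall w, a <= complex.Re w <= b -> differentiable G w) ->
  (forall s, G (s +i* 0) = G (s +i* (2 * pi))) ->
  cmean (fun t => G (a +i* t)) = cmean (fun t => G (b +i* t)).
Proof.
move=> ab dG per; have pi0 : 0 <= 2 * pi :> R by rewrite mulr_ge0// pi_ge0.
have cl s t (sab : a <= s <= b) (_ : 0 <= t <= 2 * pi) := closed_form_differentiable (dG (s +i* t) sab).
have /eqP := goursat (fun s t h1 h2 => (cl s t h1 h2).1) ab pi0.
have /eqP := goursat (fun s t h1 h2 => (cl s t h1 h2).2) ab pi0.
rewrite /loop_integral.
under [X in _ - X + _]eq_Rintegral do rewrite -per.
rewrite subrK subr_eq0 => /eqP hi.
under [X in _ - X + _]eq_Rintegral do rewrite -per.
rewrite subrK subr_eq0 => /eqP hr.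
by rewrite /cmean /cint hi hr.
Qed.

(** The exponential carries the vertical segments at ln r1 and ln r2 to the two circles, so that
    Goursat on rectangles suffices. *)
Lemma cmean_annulus (f : C -> C) (r1 r2 : R) : 0 < r1 -> r1 <= r2 ->
  (forall z, r1 <= normc z <= r2 -> differentiable f z) ->
  cmean (fun t => f (r1%:C * cis t)) = cmean (fun t => f (r2%:C * cis t)).
Proof.
move=> r10 r12 df; have r20 := lt_le_trans r10 r12.
have E (r : R) (t : R) : 0 < r -> cexp (ln r +i* t) = r%:C * cis t by move=> r0; rewrite /cexp/= lnK.
have l12 : ln r1 <= ln r2 by rewrite ler_ln.
have E1 (r : R) : 0 < r -> (fun t => f (r%:C * cis t)) = (fun t => (f \o cexp) (ln r +i* t)).
  by move=> r0; apply/funext => t; rewrite -E.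
rewrite (E1 _ r10) (E1 _ r20); apply: (cmean_strip l12).
  move=> w /andP[w1 w2]; apply: differentiable_comp; first exact: differentiable_cexp.
  apply: df; rewrite normc_cexp -[X in X <= _]lnK ?posrE// -[X in _ && (_ <= X)]lnK ?posrE//.
  by rewrite !ler_expR w1.
by move=> s; rewrite /cexp /= cis0 cis2pi.
Qed.

Lemma integrable_circ (phi : R -> C) : continuous phi -> cintegrable leb circ phi.
Proof.
move=> cphi; split; apply: continuous_compact_integrable; try exact: segment_compact.
  by apply: continuous_subspaceT => t; apply: (continuous_comp (cphi t)); exact: continuous_Re.
by apply: continuous_subspaceT => t; apply: (continuous_comp (cphi t)); exact: continuous_Im.
Qed.

Lemma continuous_circle (f : C -> C) (s : R) :
  (forall z, normc z = `|s| -> differentiable f z) -> continuous (fun t => f (s%:C * cis t)).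
Proof.
move=> df t; apply: (@continuous_comp _ _ _ (fun t => s%:C * cis t) f).
  by apply: cvgM; [exact: cvg_cst|exact: continuous_cis].
apply: differentiable_continuous; apply: df.
by rewrite normcM normc_cis normc_real mulr1.
Qed.

Lemma cmean_cst (c : C) : cmean (fun=> c) = (2 * pi)%:C * c.
Proof.
have pi0 : 0 < 2 * pi :> R by rewrite mulr_gt0// pi_gt0.
have l : fine (leb circ) = 2 * pi by rewrite lebesgue_measure_itv/= lte_fin pi0 /= subr0.
apply: complexP; rewrite /= Rintegral_cst// l; case: (c) => a b /=; ring.
Qed.

Lemma normc_cmean_le (phi : R -> C) (M : R) : continuous phi -> (forall t, normc (phi t) <= M) ->
  normc (cmean phi) <= 2 * pi * M.
Proof.
move=> cphi pM; have ip := integrable_circ cphi.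
apply: le_trans (normc_cint_le _ ip) _ => //.
have pi0 : 0 < 2 * pi :> R by rewrite mulr_gt0// pi_gt0.
have l : fine (leb circ) = 2 * pi by rewrite lebesgue_measure_itv/= lte_fin pi0 /= subr0.
have mI : measurable circ by exact: measurable_itv.
have -> : 2 * pi * M = \int[leb]_(x in circ) M by rewrite Rintegral_cst// l mulrC.
apply: le_Rintegral => //.
  by have /(cintegrableP leb (measurable_itv _))[] := ip.
by apply: continuous_compact_integrable; [exact: segment_compact|apply: continuous_subspaceT => t; exact: cst_continuous].
Qed.

(** For s > 0 the mean does not depend on the radius, by [cmean_annulus], and on small circles it is
    close to 2 pi f(0) by continuity. *)
Lemma cmean_center (f : C -> C) (s : R) : 0 <= s <= 1 ->
  (forall z, normc z <= 1 -> differentiable f z) ->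
  cmean (fun t => f (s%:C * cis t)) = (2 * pi)%:C * f 0.
Proof.
move=> /andP[s0 s1] df; have [->|sn0] := eqVneq s 0.
  by rewrite -cmean_cst; congr cmean; apply/funext => t; rewrite mul0r.
have {sn0}s0 : 0 < s by rewrite lt_def sn0.
apply/eqP; rewrite -subr_eq0; apply/eqP/normc_eq0/eqP.
rewrite eq_le normc_ge0 andbT; apply/ler_addgt0Pr => e e0; rewrite add0r.
have pi0 : 0 < 2 * pi :> R by rewrite mulr_gt0// pi_gt0.
have ep : 0 < e / (2 * pi) by rewrite divr_gt0.
have c0 : {for 0, continuous f}.
  by apply: differentiable_continuous; apply: df; rewrite normc_real normr0.
have /cvgrPdist_le /(_ (e / (2 * pi))%:C) := c0; rewrite ltcR => /(_ ep) /nbhs_complex_norm[de de0 hde].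
pose r := Num.min s (de / 2).
have r0 : 0 < r by rewrite lt_min s0 divr_gt0.
have rde : r < de by rewrite gt_min; apply/orP; right; lra.
have rs : r <= s by rewrite ge_min lexx.
have dfr z : normc z = `|r| -> differentiable f z.
  by move=> zr; apply: df; rewrite zr gtr0_norm// (le_trans rs).
have <- : cmean (fun t => f (r%:C * cis t)) = cmean (fun t => f (s%:C * cis t)).
  by apply: (cmean_annulus r0 rs) => z /andP[_ zs]; apply: df; exact: le_trans zs s1.
have i1 : cintegrable leb circ (fun t => f (r%:C * cis t)) by exact/integrable_circ/continuous_circle.
have i2 : cintegrable leb circ (fun=> f 0) by apply: integrable_circ => t; exact: cst_continuous.
have <- := cmean_cst (f 0); rewrite -[cmean _ - _](cintB (mu := leb) (measurable_itv _) i1 i2).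
have -> : e = 2 * pi * (e / (2 * pi)) by rewrite mulrC divfK// gt_eqF.
apply: normc_cmean_le.
  by move=> t; apply: cvgB; [exact: continuous_circle|exact: cvg_cst].
move=> t; rewrite -normcN opprB -lec_real -normrE_c.
have := hde (r%:C * cis t); rewrite add0r; apply.
by rewrite normrE_c ltcR normcM normc_cis normc_real mulr1 gtr0_norm.
Qed.

Lemma cmean_neg (f : C -> C) (k : nat) : (0 < k)%N ->
  (forall z, normc z <= 1 -> differentiable f z) ->
  cmean (fun t => f (cis t) * cis t ^+ k) = 0.
Proof.
move=> k0 df; have := @cmean_center (fun z => f z * z ^+ k) 1.
rewrite lexx ler01 => /(_ isT) h.
transitivity (cmean (fun t => f (1%:C * cis t) * (1%:C * cis t) ^+ k)).
  by congr cmean; apply/funext => t; rewrite mul1r.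
rewrite h ?expr0n ?(gtn_eqF k0) ?mulr0//.
move=> z z1; apply: (@differentiableM _ _ f (fun z => z ^+ k)); first exact: df.
exact: (@differentiableXC _ id).
Qed.

Lemma cmean_cisX (k : nat) : (0 < k)%N -> cmean (fun t => cis t ^+ k) = 0.
Proof.
move=> k0; rewrite -(@cmean_neg (cst 1) k k0) => [|z _]; last exact: differentiable_cst.
by congr cmean; apply/funext => t; rewrite mul1r.
Qed.

(** The function f(z) z^-d is differentiable away from 0, so its means over the circles of radii s
    and 1 agree. This is the scaling of a Taylor coefficient, obtained without a power series. *)
Lemma cmean_coef (f : C -> C) (s : R) (d : nat) : 0 <= s <= 1 ->
  (forall z, normc z <= 1 -> differentiable f z) ->
  cmean (fun t => f (s%:C * cis t) * conjc (cis t) ^+ d) =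
  s%:C ^+ d * cmean (fun t => f (cis t) * conjc (cis t) ^+ d).
Proof.
move=> s01 df; case: d => [|d].
  have E (r : R) : 0 <= r <= 1 -> cmean (fun t => f (r%:C * cis t) * conjc (cis t) ^+ 0) = (2 * pi)%:C * f 0.
    move=> r01; rewrite -(cmean_center r01 df); congr cmean; apply/funext => t.
    by rewrite expr0 mulr1.
  rewrite expr0 mul1r E// -(E 1) ?lexx ?ler01//.
  by congr cmean; apply/funext => t; rewrite mul1r.
have /andP[s0 s1] := s01; have [->|sn0] := eqVneq s 0.
  rewrite expr0n mul0r.
  have -> : (fun t => f (0%:C * cis t) * conjc (cis t) ^+ d.+1) = (fun t => f 0 * conjc (cis t ^+ d.+1)).
    by apply/funext => t; rewrite mul0r rmorphXn.
  have ic : cintegrable leb circ (fun t => cis t ^+ d.+1).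
    apply: integrable_circ => t.
    apply: (@continuous_comp _ _ _ cis (fun z => z ^+ d.+1)); first exact: continuous_cis.
    by apply: differentiable_continuous; exact: (@differentiableXC _ id).
  by rewrite /cmean cintZ ?cint_conj ?[cint _ _ _]cmean_cisX ?conjc0 ?mulr0//; exact: cintegrable_conj.
have {sn0}s0 : 0 < s by rewrite lt_def sn0.
have h := @cmean_annulus (fun z => f z * z^-1 ^+ d.+1) s 1 s0 s1.
have cV (r : R) (t : R) : 0 < r -> (r%:C * cis t)^-1 = r%:C^-1 * conjc (cis t).
  move=> _.  have m : cis t * conjc (cis t) = 1 by rewrite mulc_conj normc_cis expr1n.
  by rewrite invfM (mulr1_eq m).
have E (r : R) : 0 < r <= 1 -> cmean (fun t => f (r%:C * cis t) * (r%:C * cis t)^-1 ^+ d.+1) =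
   (r%:C^-1) ^+ d.+1 * cmean (fun t => f (r%:C * cis t) * conjc (cis t) ^+ d.+1).
  move=> /andP[r0 r1].
  have i : cintegrable leb circ (fun t => f (r%:C * cis t) * conjc (cis t) ^+ d.+1).
    have dg (z : C) : normc z = `|r| -> differentiable (fun z => f z * z^-1 ^+ d.+1) z.
      move=> zr; apply: (@differentiableM _ _ f (fun z => z^-1 ^+ d.+1)).
        by apply: df; rewrite zr gtr0_norm.
      apply: differentiable_invXC.
      by apply/eqP => z0; move: zr r0; rewrite z0 normc_real normr0 => /esym/eqP; rewrite normr_eq0 => /eqP ->; rewrite ltxx.
    have ig := integrable_circ (continuous_circle dg).
    have := cintegrableZ (mu := leb) (measurable_itv _) (r%:C ^+ d.+1) ig.
    apply: (eq_cintegrable (mu := leb) (measurable_itv _)) => t _.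
    have rn0 : r%:C != 0 :> C by rewrite -[0]/(0%:C) (inj_eq (@complexI _)) gt_eqF.
    rewrite (cV r t r0); move: (conjc (cis t)) (f _) => c x.
    by rewrite mulrCA -exprMn mulrA (mulfV rn0) mul1r.
  rewrite /cmean -(cintZ (mu := leb) (measurable_itv _) _ i); apply: eq_cint => t _.
  rewrite (cV r t r0); move: (conjc (cis t)) (f _) => c x.
  by rewrite exprMn mulrCA.
have {}h : cmean (fun t => f (s%:C * cis t) * (s%:C * cis t)^-1 ^+ d.+1) = cmean (fun t => f (1%:C * cis t) * (1%:C * cis t)^-1 ^+ d.+1).
  apply: h => z /andP[z0 z1]; apply: (@differentiableM _ _ f (fun z => z^-1 ^+ d.+1)).
    exact: df.
  apply: differentiable_invXC.
  by apply/eqP => zz; move: (lt_le_trans s0 z0); rewrite zz normc_real normr0 ltxx.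
have s01' : 0 < s <= 1 by rewrite s0.
have o01 : (0 : R) < (1 : R) <= (1 : R) by apply/andP; split; [exact: ltr01|exact: lexx].
have {h} h := etrans (esym (E s s01')) (etrans h (E 1 o01)).
have sn0 : s%:C != 0 :> C by rewrite -[0]/(0%:C) (inj_eq (@complexI _)) gt_eqF.
have o1 : (1%:C)^-1 ^+ d.+1 = 1 :> C by rewrite invr1 expr1n.
have f1 : (fun t => f (1%:C * cis t) * conjc (cis t) ^+ d.+1) = (fun t => f (cis t) * conjc (cis t) ^+ d.+1).
  by apply/funext => t; rewrite mul1r.
move: h; rewrite o1 mul1r f1 => <-.
move: (cmean _) => x; rewrite mulrA -exprMn (mulfV sn0) expr1n; exact: (esym (mul1r x)).
Qed.

End complex_topology.

Lemma measurable_continuousRC (R : realType) (f : R -> R[i]) : continuous f ->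
  measurable_fun setT (f : measurableTypeR R -> R[i]).
Proof.
move=> cf; apply/measurable_complexP; split; apply: continuous_measurable_fun => t;
  apply: (continuous_comp (cf t)); [exact: continuous_Re|exact: continuous_Im].
Qed.

Section sigma_finite.
Context (R : realType) d (T : measurableType d) (mu : {measure set T -> \bar R}).

(** An alias of mu that carries the sigma-finite structure coming from the hypothesis h. *)
Definition sf_measure (h : sigma_finite setT mu) : set T -> \bar R := mu.

HB.instance Definition _ h := Measure.copy (sf_measure h) mu.
HB.instance Definition _ h := Measure_isSigmaFinite.Build _ _ _ (sf_measure h) h.

End sigma_finite.

Section finite_measures.
Context (R : realType) d1 d2 (T1 : measurableType d1) (T2 : measurableType d2).

Let sigma_finite_fin d (T : measurableType d) (mu : {measure set T -> \bar R}) :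
  (mu setT < +oo)%E -> sigma_finite setT mu.
Proof.
move=> fin; exists (fun=> setT) => [|i]; last by split.
by apply/seteqP; split=> // x _; exists 0%N.
Qed.

Lemma cint_fubini_fin (m1 : {measure set T1 -> \bar R}) (m2 : {measure set T2 -> \bar R})
    (D1 : set T1) (D2 : set T2) (mD1 : measurable D1) (mD2 : measurable D2)
    (f : T1 -> T2 -> R[i]) (M : R) :
  sigma_finite setT m1 -> (m2 setT < +oo)%E -> (m1 D1 < +oo)%E ->
  measurable_fun (D1 `*` D2) (fun p => f p.1 p.2) ->
  (forall x, D1 x -> cintegrable m2 D2 (f x) /\ \int[m2]_(y in D2) normc (f x y) <= M) ->
  (forall y, D2 y -> cintegrable m1 D1 (f^~ y)) ->
  cint m1 D1 (fun x => cint m2 D2 (f x)) = cint m2 D2 (fun y => cint m1 D1 (f^~ y)).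
Proof.
move=> s1 s2 D1fin mf fx fy.
pose n1 : {sigma_finite_measure set T1 -> \bar R} := sf_measure s1.
pose n2 : {sigma_finite_measure set T2 -> \bar R} := sf_measure (sigma_finite_fin s2).
exact: (@cint_fubini R _ _ T1 T2 n1 n2 D1 D2 mD1 mD2 D1fin f M mf fx fy).
Qed.

End finite_measures.

(** * Completeness of the monomials *)

Section scaling.
Context (R : realType) (n : nat).
Local Notation C := R[i].
Local Notation Cn := 'cV[R[i]]_n.
Local Notation B := (@unit_ball R n).
Local Notation leb := (@lebesgue_measure R).
Local Notation circ := (`[0%R, 2 * pi]%classic : set R).
Implicit Types (P : pred 'I_n) (z : Cn) (w : C).

Lemma sqnorm_scl_le P w z : normc w <= 1 -> sqnorm (scl P w z) <= sqnorm z.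
Proof.
move=> w1; apply: ler_sum => i _; rewrite mxE; case: ifP => // _.
rewrite normcM exprMn ler_piMl ?sqr_ge0// -(expr1n _ 2).
by rewrite ler_pXn2r ?nnegrE ?normc_ge0.
Qed.

Lemma sqnorm_scl P w z : normc w = 1 -> sqnorm (scl P w z) = sqnorm z.
Proof.
move=> w1; apply: eq_bigr => i _; rewrite mxE; case: ifP => // _.
by rewrite normcM w1 mul1r.
Qed.

Lemma scl_scl P v w z : scl P v (scl P w z) = scl P (v * w) z.
Proof. by apply/colP => i; rewrite !mxE; case: (P i); rewrite ?mulrA. Qed.

Lemma scl1 P z : scl P 1 z = z.
Proof. by apply/colP => i; rewrite !mxE mul1r; case: ifP. Qed.

Lemma unit_ball_scl P w z : normc w <= 1 -> B z -> B (scl P w z).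
Proof. by move=> w1 Bz; apply: le_lt_trans Bz; exact: sqnorm_scl_le. Qed.

Lemma measurable_scl_comp d (T : measurableType d) P (u : T -> C) (g : T -> Cn) :
  measurable_fun setT u -> measurable_fun setT g ->
  measurable_fun setT (fun x => scl P (u x) (g x)).
Proof.
move=> mu mg; apply/measurable_vectorP => i.
rewrite (_ : (fun x => _) = fun x : T => (if P i then u x else 1) * g x i 0); last first.
  by apply/funext => x; rewrite mxE; case: ifP; rewrite ?mul1r.
apply: measurableC_mul; first by case: (P i).
exact: (measurableT_comp (measurable_coord i) mg).
Qed.

Lemma differentiable_scl P z w : differentiable (fun w : C => scl P w z) w.
Proof.
have -> : (fun w : C => scl P w z) = cst (scl P 0 z) + (fun w : C => w *: (z - scl P 0 z)).
  apply/funext => v; apply/colP => i; rewrite /cst /= [in RHS]/GRing.add /= !mxE.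
  by case: ifP => _; rewrite ?mul0r ?subr0 ?add0r ?subrr ?mulr0 ?addr0.
apply: differentiableD; first exact: differentiable_cst.
exact: differentiableZl.
Qed.

Variables (mu : {measure set Cn -> \bar R}) (bm : ball_measure mu).
Let mB := @measurable_unit_ball R n.

Lemma preimage_scl_ball P w : normc w = 1 -> scl P w @^-1` B = B.
Proof. by move=> w1; apply/seteqP; split=> z; rewrite /unit_ball/= sqnorm_scl. Qed.

Lemma mpres_scl_ball P w : normc w = 1 -> mpres mu (scl P w).
Proof.
move=> w1; apply: (ball_measure_mpres bm); first exact: mpres_scl.
by move=> z; rewrite sqnorm_scl.
Qed.

(** The measure is invariant under phases of the coordinates in P, so the integral can be averaged
    over them. Exchanging the integrals replaces f by a mean of the one variable function w -> f(scl
    P w z), weighted by the character chi of F. *)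
Lemma scale_circle P (f F : Cn -> C) (chi : C -> C) (s : R) : 0 <= s <= 1 ->
  holomorphic_on B f -> measurable_fun B f -> measurable_fun setT F ->
  (forall u z, normc u = 1 -> F (scl P u z) = chi u * F z) ->
  (forall u, normc u = 1 -> normc (chi u) = 1) -> continuous (chi \o @cis R) ->
  cintegrable mu B (fun z => f (scl P s%:C z) * F z) ->
  (2 * pi)%:C * cint mu B (fun z => f (scl P s%:C z) * F z) =
  cint mu B (fun z => F z * cmean (fun t => f (scl P (s%:C * cis t) z) * chi (cis t))).
Proof.
move=> /andP[s0 s1] hf mf mF Fchi chi1 cchi ig.
have sn : normc (s%:C : C) <= 1 by rewrite normc_real ger0_norm.
pose g z := f (scl P s%:C z) * F z.
pose k (t : measurableTypeR R) z := f (scl P (s%:C * cis t) z) * (chi (cis t) * F z).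
have gk t z : g (scl P (cis t) z) = k t z.
  by rewrite /g /k scl_scl Fchi ?normc_cis.
have kg t : cintegrable mu B (k t) /\ cint mu B (k t) = cint mu B g.
  have [i e] := cint_mpres mB (mpres_scl_ball P (normc_cis t)) (preimage_scl_ball P (normc_cis t)) ig.
  have -> : k t = fun z => g (scl P (cis t) z) by apply/funext => z; rewrite gk.
  by [].
have kn t : \int[mu]_(z in B) normc (k t z) = \int[mu]_(z in B) normc (g z).
  have [_ ign] := (cintegrableP mu mB g).1 ig.
  have [_ <-] := Rintegral_mpres mB (mpres_scl_ball P (normc_cis t)) (preimage_scl_ball P (normc_cis t)) ign.
  by apply: eq_Rintegral => z _; rewrite gk.
have fin : (leb circ < +oo)%E.
  by rewrite lebesgue_measure_itv/=; case: ifP => _; rewrite ?ltry// -EFinB ltry.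
have ct z t : B z -> {for t, continuous (fun t => f (scl P (s%:C * cis t) z))}.
  move=> Bz; apply: (@continuous_circle _ (fun w => f (scl P w z)) s _ t) => w ws.
  apply: (differentiable_comp (differentiable_scl P z w)); apply: hf.
  by apply: unit_ball_scl => //; rewrite ws ger0_norm.
have ik z : B z -> cintegrable leb circ (k ^~ z).
  move=> Bz; apply: integrable_circ => t.
  apply: cvgM; first exact: ct.
  by apply: cvgM; [exact: cchi|exact: cvg_cst].
have mk : measurable_fun (circ `*` B) (fun p : measurableTypeR R * Cn => k p.1 p.2).
  apply: measurableC_mul; last first.
    apply: measurableC_mul; last by apply: measurable_funTS; exact: (measurableT_comp mF measurable_snd).
    apply: measurable_funTS; exact: (measurableT_comp (measurable_continuousRC cchi) (@measurable_fst _ _ (measurableTypeR R) Cn)).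
  apply: (@measurable_comp _ _ _ _ _ _ B f (circ `*` B) (fun p : measurableTypeR R * Cn => scl P (s%:C * cis p.1) p.2)) => //.
    move=> _ [p [_ Bp] <-]; apply: unit_ball_scl => //.
    by rewrite normcM normc_cis mulr1.
  apply: measurable_funTS; apply: measurable_scl_comp; last exact: measurable_snd.
  apply: measurableC_mul; first exact: measurable_cst.
  by apply: (measurableT_comp (measurable_continuousRC (@continuous_cis R))); exact: measurable_fst.
rewrite -cmean_cst /cmean.
have E : cint leb circ (fun=> cint mu B g) = cint leb circ (fun t => cint mu B (k t)).
  by apply: eq_cint => t _; rewrite (kg t).2.
rewrite E.
rewrite (@cint_fubini_fin R _ _ (measurableTypeR R) Cn leb mu circ B (measurable_itv _) mB k (\int[mu]_(z in B) normc (g z))).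
- apply: eq_cint => z Bz; rewrite -(cintZ (mu := leb) (measurable_itv _)).
    by apply: eq_cint => t _; rewrite /k mulrA mulrC.
  apply: integrable_circ => t.
  by apply: cvgM; [exact: ct|exact: cchi].
- exact: sigma_finiteT.
- exact: (ball_measure_lty bm).
- exact: fin.
- exact: mk.
- by move=> t _; split; [exact: (kg t).1|rewrite kn].
- exact: ik.
Qed.

(** Being of weight - d under phases, F only sees the part of f which is homogeneous of degree d in
    the coordinates of P. *)
Lemma scale_coef P (f F : Cn -> C) (d : nat) (s : R) : 0 <= s <= 1 ->
  holomorphic_on B f -> measurable_fun B f -> measurable_fun setT F ->
  (forall u z, normc u = 1 -> F (scl P u z) = conjc u ^+ d * F z) ->
  cintegrable mu B (fun z => f (scl P s%:C z) * F z) ->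
  cintegrable mu B (fun z => f z * F z) ->
  cint mu B (fun z => f (scl P s%:C z) * F z) = s%:C ^+ d * cint mu B (fun z => f z * F z).
Proof.
move=> s01 hf mf mF FP i1 i2.
have chi1 (u : C) : normc u = 1 -> normc (conjc u ^+ d) = 1.
  by move=> u1; rewrite normcX normc_conj u1 expr1n.
have cchi : continuous ((fun u : C => conjc u ^+ d) \o @cis R).
  move=> t; have -> : (fun u : C => conjc u ^+ d) \o @cis R = (fun u => u ^+ d) \o (@cis R \o -%R).
    by apply/funext => x /=; rewrite /cis cosN sinN.
  apply: (@continuous_comp _ _ _ (@cis R \o -%R) (fun u : C => u ^+ d)).
    by apply: continuous_comp; [exact: opp_continuous|exact: continuous_cis].
  by apply: differentiable_continuous; exact: (@differentiableXC _ C id).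
have o01 : (0 : R) <= (1 : R) <= (1 : R) by apply/andP; split; [exact: ler01|exact: lexx].
have pn0 : (2 * pi)%:C != 0 :> C.
  by rewrite -[0]/(0%:C) (inj_eq (@complexI _)) gt_eqF// mulr_gt0// pi_gt0.
(* With s^d absorbed into F, the right side is an instance of [scale_circle] for the radius 1, and
   [cmean_coef] compares it with the left side, of radius s. *)
pose F' z := s%:C ^+ d * F z.
have mF' : measurable_fun setT F' by apply: measurableC_mul.
have FP' u z : normc u = 1 -> F' (scl P u z) = conjc u ^+ d * F' z.
  by move=> u1; rewrite /F' (FP _ _ u1) mulrCA.
have fF' : (fun z => f (scl P 1%:C z) * F' z) = (fun z => s%:C ^+ d * (f z * F z)).
  by apply/funext => z; rewrite scl1 /F' mulrCA.
have i2' : cintegrable mu B (fun z => f (scl P 1%:C z) * F' z).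
  by rewrite fF'; exact: cintegrableZ.
apply: (mulfI pn0); rewrite -(cintZ mB)// -fF'.
rewrite (scale_circle s01 hf mf mF FP chi1 cchi i1) (scale_circle o01 hf mf mF' FP' chi1 cchi i2').
apply: eq_cint => z Bz; rewrite (@cmean_coef _ (fun w => f (scl P w z)))//; last first.
  move=> w w1; apply: (differentiable_comp (differentiable_scl P z w)); apply: hf.
  exact: unit_ball_scl.
rewrite /F' mulrA (mulrC (F z)); congr (_ * cmean _).
by apply/funext => t; rewrite mul1r.
Qed.

(** A holomorphic f only has parts of nonnegative weight, and none of them can cancel the positive
    weight k of F. *)
Lemma scale_neg P (f F : Cn -> C) (k : nat) : (0 < k)%N ->
  holomorphic_on B f -> measurable_fun B f -> measurable_fun setT F ->
  (forall u z, normc u = 1 -> F (scl P u z) = u ^+ k * F z) ->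
  cintegrable mu B (fun z => f z * F z) ->
  cint mu B (fun z => f z * F z) = 0.
Proof.
move=> k0 hf mf mF FP i2.
have chi1 (u : C) : normc u = 1 -> normc (u ^+ k) = 1.
  by move=> u1; rewrite normcX u1 expr1n.
have cchi : continuous ((fun u : C => u ^+ k) \o @cis R).
  move=> t; apply: (@continuous_comp _ _ _ (@cis R) (fun u : C => u ^+ k)).
    exact: continuous_cis.
  by apply: differentiable_continuous; exact: (@differentiableXC _ C id).
have o01 : (0 : R) <= (1 : R) <= (1 : R) by apply/andP; split; [exact: ler01|exact: lexx].
have pn0 : (2 * pi)%:C != 0 :> C.
  by rewrite -[0]/(0%:C) (inj_eq (@complexI _)) gt_eqF// mulr_gt0// pi_gt0.
have fF : (fun z => f (scl P 1%:C z) * F z) = (fun z => f z * F z).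
  by apply/funext => z; rewrite scl1.
have i2' : cintegrable mu B (fun z => f (scl P 1%:C z) * F z) by rewrite fF.
apply: (mulfI pn0); rewrite -fF (scale_circle o01 hf mf mF FP chi1 cchi i2').
rewrite mulr0 -(cint0 mu B); apply: eq_cint => z Bz.
have -> : (fun t => f (scl P (1%:C * cis t) z) * cis t ^+ k) = (fun t => f (scl P (cis t) z) * cis t ^+ k).
  by apply/funext => t; rewrite mul1r.
rewrite (@cmean_neg _ (fun w => f (scl P w z)))//; last first.
  move=> w w1; apply: (differentiable_comp (differentiable_scl P z w)); apply: hf.
  exact: unit_ball_scl.
exact: mulr0.
Qed.

Lemma scale_coefC P (f F : Cn -> C) (d : nat) (w : C) : normc w <= 1 ->
  holomorphic_on B f -> measurable_fun B f -> measurable_fun setT F ->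
  (forall u z, normc u = 1 -> F (scl P u z) = conjc u ^+ d * F z) ->
  cintegrable mu B (fun z => f (scl P (normc w)%:C z) * F z) ->
  cintegrable mu B (fun z => f z * F z) ->
  cint mu B (fun z => f (scl P w z) * F z) = w ^+ d * cint mu B (fun z => f z * F z).
Proof.
move=> w1 hf mf mF FP i1 i2; set s := normc w.
have [u u1 wE] : exists2 u : C, normc u = 1 & w = s%:C * u.
  have [w0|w0] := eqVneq w 0; first by exists 1; rewrite ?normc_real ?normr1// /s w0 normc_real normr0 mul0r.
  have s0 : s != 0 by apply: contra_neq w0 => /normc_eq0.
  have sC : s%:C != 0 :> C by rewrite -[0]/(0%:C) (inj_eq (@complexI _)).
  exists (w / s%:C); last by rewrite mulrC divfK.
  apply: (mulIf s0); rewrite mul1r -[X in _ * X](ger0_norm (normc_ge0 w)) -normc_real -normcM.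
  by rewrite divfK.
have uc : u * conjc u = 1 by rewrite mulc_conj u1 expr1n.
rewrite wE exprMn mulrAC -(@scale_coef P f F d s)// ?normc_ge0//.
have [_ <-] := cint_mpres mB (mpres_scl_ball P u1) (preimage_scl_ball P u1) i1.
rewrite [RHS]mulrC -(cintZ mB); last first.
  by have [] := cint_mpres mB (mpres_scl_ball P u1) (preimage_scl_ball P u1) i1.
apply: eq_cint => z _; rewrite scl_scl FP//.
by rewrite mulrCA [u ^+ d * _]mulrA -exprMn uc expr1n mul1r.
Qed.

End scaling.

(** * Topology of the unit ball *)

Section topology.
Context (R : realType) (n : nat).
Local Notation C := R[i].
Local Notation Cn := 'cV[R[i]]_n.
Local Notation B := (@unit_ball R n).
Implicit Types z h : Cn.

Lemma mx_norm_lt h (e : R) : 0 < e -> (`|h| < e%:C <-> forall i, normc (h i 0) < e).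
Proof.
move=> e0; have be := congr1 (fun b => b 0 e%:C h) (@mx_norm_ball C n 1).
move: be; rewrite /ball_/= sub0r normrN => <-; split=> [[_ hb] i|hb].
  have := hb i 0; rewrite mxE -ball_normE/= sub0r normrN normrE_c ltcR; exact.
split=> [|i j]; first by rewrite ltcR.
by rewrite !ord1 mxE -ball_normE/= sub0r normrN normrE_c ltcR; exact: hb.
Qed.

Lemma normc_coord_lt z (e : R) i : 0 <= e -> sqnorm z < e ^+ 2 -> normc (z i 0) < e.
Proof.
move=> e0 ze; rewrite -(@ltr_pXn2r _ 2)// ?nnegrE ?normc_ge0//.
apply: le_lt_trans ze; rewrite /sqnorm (bigD1 i)//= lerDl.
by apply: sumr_ge0 => j _; exact: sqr_ge0.
Qed.

Lemma normc_coord_le z (e : R) i : 0 <= e -> sqnorm z <= e ^+ 2 -> normc (z i 0) <= e.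
Proof.
move=> e0 ze; rewrite -(@ler_pXn2r _ 2)// ?nnegrE ?normc_ge0//.
apply: le_trans ze; rewrite /sqnorm (bigD1 i)//= lerDl.
by apply: sumr_ge0 => j _; exact: sqr_ge0.
Qed.

Lemma ball_coord_le1 z i : B z -> normc (z i 0) <= 1.
Proof. by move=> /ltW Bz; apply: normc_coord_le; rewrite ?expr1n. Qed.

Lemma near_sqnorm z0 (Q : Cn -> Prop) : (\forall z \near z0, Q z) ->
  exists2 e : R, 0 < e & forall z, sqnorm (z - z0) < e ^+ 2 -> Q z.
Proof.
move=> /nbhs_complex_norm[e e0 he]; exists e => // z ze.
rewrite -(subrKC z0 z); apply: he; apply/(mx_norm_lt _ e0) => i.
by apply: normc_coord_lt => //; exact: ltW.
Qed.

Lemma continuous_sqnorm : continuous (@sqnorm R n).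
Proof.
apply: (@continuous_big R); first exact: add_continuous.
move=> i _ z.
have c : {for z, continuous (fun z : Cn => z i 0 : C)} by exact: coord_continuous.
have -> : (fun z : Cn => normc (z i 0) ^+ 2) =
   (fun z => complex.Re (z i 0) * complex.Re (z i 0) + complex.Im (z i 0) * complex.Im (z i 0)).
  by apply/funext => x; rewrite normc_sqrE !expr2.
have cr : {for z, continuous (fun z : Cn => complex.Re (z i 0))} by exact: (continuous_comp c (@continuous_Re _ _)).
have ci : {for z, continuous (fun z : Cn => complex.Im (z i 0))} by exact: (continuous_comp c (@continuous_Im _ _)).
exact: cvgD (cvgM cr cr) (cvgM ci ci).
Qed.

Lemma near_unit_ball z0 : B z0 -> \forall z \near z0, B z.
Proof.
move=> Bz; have := @continuous_sqnorm z0 => /cvgrPdist_lt /(_ (1 - sqnorm z0)).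
rewrite subr_gt0 => /(_ Bz); apply: filterS => z /=.
by rewrite /unit_ball/= ltr_distlC => /andP[_]; lra.
Qed.

Lemma continuous_sqnorm_near z0 (f : Cn -> C) (e : R) : {for z0, continuous f} -> 0 < e ->
  exists2 eta : R, 0 < eta & forall z, sqnorm (z - z0) < eta ^+ 2 -> normc (f z - f z0) < e.
Proof.
move=> cf e0; apply: near_sqnorm; have /cvgrPdist_lt /(_ e%:C) := cf.
rewrite ltcR => /(_ e0); apply: filterS => z.
by rewrite distrC normrE_c ltcR.
Qed.

Lemma compact_square_closed : compact [set z : C | `|complex.Re z| <= 1 /\ `|complex.Im z| <= 1].
Proof.
pose I := (`[(-1 : R), 1]%classic : set R).
have cI : compact (I `*` I) by apply: compact_setX; exact: segment_compact.
have -> : [set z : C | `|complex.Re z| <= 1 /\ `|complex.Im z| <= 1] = (fun p : R * R => p.1 +i* p.2) @` (I `*` I).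
  apply/seteqP; split=> [[a b]/= [h1 h2]|_ [[a b] [/= h1 h2] <-]] /=.
    by exists (a, b) => //=; split; rewrite /I/= in_itv/= -ler_norml.
  by move: h1 h2; rewrite /I/= !in_itv/= -!ler_norml.
apply: continuous_compact => //; apply: continuous_subspaceT => p.
rewrite (_ : (fun p => _) = fun p : R * R => p.1%:C + 'i * p.2%:C); last first.
  by apply/funext => q; apply: complexP; rewrite ?ReD ?ImD /=; ring.
apply: cvgD; first by apply: (continuous_comp _ (@continuous_realC R _)); exact: cvg_fst.
apply: cvgM; first exact: cvg_cst.
by apply: (continuous_comp _ (@continuous_realC R _)); exact: cvg_snd.
Qed.

Lemma continuous_trmx_row : continuous (fun v : 'rV[C]_n => (v^T : Cn)).
Proof.
move=> v A /nbhs_ballP[e e0 hA]; apply/nbhs_ballP; exists e => // w [_ vw]; apply: hA.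
by split=> // i j; rewrite !mxE.
Qed.

(** The set |z|^2 <= rho is closed in a product of compact squares, hence compact, and f is
    continuous there as rho < 1. Transposition is due to [rV_compact] being about rows. *)
Lemma bounded_on_ball (f : Cn -> C) (rho : R) : rho < 1 -> holomorphic_on B f ->
  exists M, forall z, sqnorm z <= rho -> normc (f z) <= M.
Proof.
move=> rho1 hf.
pose S := [set z : C | `|complex.Re z| <= 1 /\ `|complex.Im z| <= 1].
have cS : compact [set v : 'rV[C]_n | forall i, S (v ord0 i)].
  by apply: (@rV_compact C n (fun=> S)) => _; exact: compact_square_closed.
pose A := [set v : 'rV[C]_n | sqnorm (v^T) <= rho].
have clA : closed A.
  have : continuous (fun v : 'rV[C]_n => sqnorm (v^T)).
    by move=> v; apply: continuous_comp; [exact: continuous_trmx_row|exact: continuous_sqnorm].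
  move=> c; apply: (preimage_closed (fun v _ => c v) (@closed_le R rho)).
have cA : compact A.
  apply: (subclosed_compact clA cS) => v Av i.
  have : normc (v ord0 i) <= 1.
    have := @normc_coord_le (v^T) 1 i; rewrite mxE; apply => //.
    by rewrite expr1n; apply: le_trans Av (ltW rho1).
  by move=> h; split; [apply: le_trans (Re_le_normc _) h|apply: le_trans (Im_le_normc _) h].
have cf : {within A, continuous (fun v : 'rV[C]_n => normc (f v^T))}.
  have cn : continuous (@normc R : C -> R).
    move=> z D /nbhs_ballP[e /= e0 hD]; apply: (nbhs_complex_normP e0) => h he; apply: hD.
    rewrite -ball_normE/=; move: he; rewrite normrE_c ltcR; apply: le_lt_trans.
    have := normcD z h; have := normcD (z + h) (- h); rewrite addrK normcN ler_norml; lra.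
  apply: continuous_in_subspaceT => v; rewrite inE => Av.
  have cf : {for v^T, continuous f}.
    by apply: differentiable_continuous; apply: hf; exact: le_lt_trans Av rho1.
  have cfT : {for v, continuous (fun v : 'rV[C]_n => f v^T)}.
    by apply: (continuous_comp (@continuous_trmx_row v)).
  exact: (continuous_comp cfT (cn _)).
have /compact_bounded[M [_ hM]] := continuous_compact cf cA.
exists (M + 1) => z zr; rewrite -[leLHS]ger0_norm ?normc_ge0//.
apply: (hM (M + 1)); first by rewrite ltrDl.
by exists z^T; rewrite /A/= trmxK.
Qed.

End topology.

Section positivity.
Context (R : realType) (n : nat).
Local Notation C := R[i].
Local Notation Cn := 'cV[R[i]]_n.
Local Notation B := (@unit_ball R n).
Variables (mu : {measure set Cn -> \bar R}) (bm : ball_measure mu).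

Lemma sqnorm_le_half (z z0 : Cn) : sqnorm z0 < 1 -> forall e : R, 0 < e ->
  exists2 d : R, 0 < d <= e & forall z, sqnorm (z - z0) < d ^+ 2 -> sqnorm z <= (1 + sqnorm z0) / 2.
Proof.
move=> z01 e e0; have := @continuous_sqnorm R n z0 => /cvgrPdist_lt /(_ ((1 - sqnorm z0) / 2)).
rewrite divr_gt0 ?subr_gt0// => /(_ isT) /near_sqnorm[d d0 hd].
exists (Num.min d e) => [|{}z zd]; first by rewrite lt_min d0 e0 ge_min lexx orbT.
have : sqnorm (z - z0) < d ^+ 2.
  apply: lt_le_trans zd _; rewrite ler_pXn2r ?nnegrE ?(ltW d0)//; first by rewrite ge_min lexx.
  by rewrite le_min !ltW.
by move=> /hd; rewrite ltr_distlC => /andP[_]; lra.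
Qed.

Lemma measurable_sqnorm_ball (z0 : Cn) (e : R) : measurable [set z : Cn | sqnorm (z - z0) < e].
Proof.
have m : measurable_fun setT (fun z : Cn => sqnorm (z - z0)).
  exact: (measurableT_comp (@measurable_sqnorm R n) (measurable_shift (- z0))).
rewrite (_ : [set z : Cn | _] = setT `&` (fun z : Cn => sqnorm (z - z0)) @^-1` `]-oo, e[).
  exact: m.
by rewrite setTI; apply/seteqP; split=> z /=; rewrite in_itv/=.
Qed.

Lemma ball_measure_nbhs (z0 : Cn) (e : R) : B z0 -> 0 < e ->
  (0 < mu [set z : Cn | (sqnorm (z - z0) < e ^+ 2)%R])%E.
Proof.
move=> Bz0 e0; have [d /andP[d0 de] hd] := sqnorm_le_half z0 Bz0 e0.
have rho1 : (1 + sqnorm z0) / 2 < 1 by have : sqnorm z0 < 1 := Bz0; lra.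
have [K K0 hK] := ball_measure_ge bm rho1.
(* In a cube of half side r the squared distance to the centre is at most 2 n r^2 < d^2; n + 1 in
   place of n covers n = 0. *)
pose r := d / (2 * n.+1%:R).
have r0 : 0 < r by rewrite divr_gt0// mulr_gt0// ltr0n.
pose A := (fun z : Cn => z - z0) @^-1` @polybox R (square r) n.
have mP : measurable (@polybox R (square r) n) by apply: measurable_polybox; exact: measurable_square.
have mA : measurable A by rewrite -[A]setTI; exact: (measurable_shift (- z0)).
have AE : lebesgueCn R n A = lebesgueCn R n (@polybox R (square r) n) by exact: (mpres_shift (- z0)).2.
have A0 : (0 < lebesgueCn R n A)%E.
  rewrite AE; apply: lebesgueCn_polybox_gt0; rewrite ?lebesgueC_square//; first exact: measurable_square.
  by rewrite lte_fin exprn_gt0// mulr_gt0.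
have Ad : A `<=` [set z : Cn | sqnorm (z - z0) < d ^+ 2].
  move=> z Az /=; apply: (@le_lt_trans _ _ (\sum_(i < n) 2 * r ^+ 2)).
    apply: ler_sum => i _; rewrite normc_sqrE; have [h1 h2] := Az i.
    have k1 : complex.Re ((z - z0) i 0) ^+ 2 <= r ^+ 2.
      by rewrite -(ger0_norm (sqr_ge0 _)) normrX ler_pXn2r ?nnegrE ?normr_ge0 ?(ltW r0)// ltW.
    have k2 : complex.Im ((z - z0) i 0) ^+ 2 <= r ^+ 2.
      by rewrite -(ger0_norm (sqr_ge0 _)) normrX ler_pXn2r ?nnegrE ?normr_ge0 ?(ltW r0)// ltW.
    lra.
  rewrite sumr_const card_ord -[X in _ < X]mulr1 -[X in X < _]mulr_natr /r expr_div_n.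
  have nn : (0 : R) < n.+1%:R by rewrite ltr0n.
  have n0 : (0 : R) <= n%:R by rewrite ler0n.
  have nS : n.+1%:R = n%:R + 1 :> R by rewrite -natr1.
  rewrite mulrA mulrAC ltr_pdivrMr; last by rewrite exprn_gt0// mulr_gt0.
  rewrite nS; have d20 : 0 < d ^+ 2 by rewrite exprn_gt0.
  rewrite mulr1 -mulrA mulrCA ltr_pM2l//; nra.
have Ar : A `<=` [set z | sqnorm z <= (1 + sqnorm z0) / 2].
  by move=> z /Ad; exact: hd.
have Ae : A `<=` [set z : Cn | sqnorm (z - z0) < e ^+ 2].
  move=> z /Ad/= h; apply: lt_le_trans h _; rewrite ler_pXn2r ?nnegrE ?(ltW d0) ?(ltW e0)//.
have := lt_le_trans A0 (hK _ mA Ar).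
rewrite pmule_rgt0 ?lte_fin// => /lt_le_trans; apply; apply: le_measure => //; rewrite inE//.
exact: measurable_sqnorm_ball.
Qed.

End positivity.

(** * Placeholder *)

Lemma realC_neq0 (R : realType) (r : R) : 0 < r -> r%:C != 0 :> R[i].
Proof. by move=> r0; rewrite eq_complex/= eqxx andbT gt_eqF. Qed.

Section monomials.
Context (R : realType) (n : nat).
Local Notation C := R[i].
Local Notation Cn := 'cV[R[i]]_n.
Local Notation B := (@unit_ball R n).
Implicit Types (z w : Cn) (al be ga : 'I_n -> nat).

Definition mono al z : C := \prod_(i < n) z i 0 ^+ al i.

Lemma measurable_mono al : measurable_fun setT (mono al).
Proof. by apply: measurableC_prod => i; apply: measurableC_exp; exact: measurable_coord. Qed.

Lemma differentiable_mono al z : differentiable (mono al) z.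
Proof.
rewrite /mono; elim: (index_enum _) => [|i s ih].
  rewrite (_ : (fun z => _) = cst 1); first exact: differentiable_cst.
  by apply/funext => w; rewrite big_nil.
rewrite (_ : (fun z => _) = (fun z : Cn => z i 0 ^+ al i) * (fun z => \prod_(j <- s) z j 0 ^+ al j)).
  apply: differentiableM => //; apply: (@differentiableXC _ _ (fun z : Cn => z i 0)).
  exact: differentiable_coord.
by apply/funext => w; rewrite big_cons.
Qed.

Lemma mono_scl (P : pred 'I_n) u al z :
  mono al (scl P u z) = u ^+ (\sum_(i | P i) al i) * mono al z.
Proof.
rewrite /mono expr_sum [X in _ = X * _]big_mkcond -big_split/=.
by apply: eq_bigr => i _; rewrite mxE; case: (P i); rewrite ?exprMn ?mul1r.
Qed.

Lemma mono_scl1 i u al z : mono al (scl (pred1 i) u z) = u ^+ al i * mono al z.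
Proof. by rewrite mono_scl big_pred1_eq. Qed.

Lemma normc_mono_le1 al z : B z -> normc (mono al z) <= 1.
Proof.
move=> Bz; rewrite /mono; elim/big_ind: _ => [|x y hx hy|i _].
- by rewrite normc_real normr1.
- by rewrite normcM mulr_ile1 ?normc_ge0.
by rewrite normcX exprn_ile1 ?normc_ge0 ?ball_coord_le1.
Qed.

Lemma monoD al be z : mono (fun i => al i + be i)%N z = mono al z * mono be z.
Proof. by rewrite /mono -big_split/=; apply: eq_bigr => i _; rewrite exprD. Qed.

Definition vmul z w : Cn := \col_i (z i 0 * w i 0).

Lemma vmulC z w : vmul z w = vmul w z.
Proof. by apply/colP => i; rewrite !mxE mulrC. Qed.

Lemma measurable_vmul : measurable_fun setT (fun p : Cn * Cn => vmul p.1 p.2).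
Proof.
apply/measurable_vectorP => i.
rewrite (_ : (fun p => _) = fun p : Cn * Cn => p.1 i 0 * p.2 i 0); last first.
  by apply/funext => p; rewrite mxE.
apply: measurableC_mul.
  exact: (measurableT_comp (measurable_coord i) measurable_fst).
exact: (measurableT_comp (measurable_coord i) measurable_snd).
Qed.

Lemma unit_ball_vmul z w : B z -> B w -> B (vmul z w).
Proof.
move=> Bz Bw; apply: le_lt_trans Bw; apply: ler_sum => i _.
rewrite mxE normcM exprMn ler_piMl ?sqr_ge0// -(expr1n _ 2).
by rewrite ler_pXn2r ?nnegrE ?normc_ge0// ball_coord_le1.
Qed.

Lemma differentiable_scl_vec (P : pred 'I_n) u z : differentiable (scl P u) z.
Proof.
have lin : linear (scl P u).
  by move=> k x y; apply/colP => i; rewrite !mxE; case: ifP => // _; rewrite mulrDr mulrCA.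
pose D : {linear Cn -> Cn} := HB.pack (scl P u) (GRing.isLinear.Build _ _ _ _ _ lin).
rewrite -[scl P u]/(D : Cn -> Cn); apply: linear_differentiable.
move=> x A /nbhs_complex_norm[e e0 hA].
pose M := normc u + 1; have M0 : 0 < M by rewrite ltr_wpDl ?normc_ge0.
apply: (@nbhs_complex_normP R Cn x (fun y => A (D y)) _ (divr_gt0 e0 M0)) => h he; rewrite (linearD D); apply: hA.
have := (mx_norm_lt h (divr_gt0 e0 M0)).1 he => {}he.
apply/(mx_norm_lt _ e0) => i; rewrite mxE; have := he i; rewrite ltr_pdivlMr// => hi.
apply: le_lt_trans hi; case: ifP => _; rewrite ?normcM.
  by rewrite mulrC ler_wpM2l ?normc_ge0// lerDl.
by rewrite ler_peMr ?normc_ge0// lerDr normc_ge0.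
Qed.

End monomials.

(** * Functions orthogonal to all monomials *)

Section completeness.
Context (R : realType) (n : nat).
Local Notation C := R[i].
Local Notation Cn := 'cV[R[i]]_n.
Local Notation B := (@unit_ball R n).
Implicit Types (z w : Cn) (al be ga : 'I_n -> nat).
Variables (mu : {measure set Cn -> \bar R}) (bm : ball_measure mu).
Let mB := @measurable_unit_ball R n.

Let muB : (mu B < +oo)%E.
Proof. by apply: le_lt_trans (ball_measure_lty bm); rewrite le_measure// inE. Qed.

Definition bounded_mfun (f : Cn -> C) :=
  measurable_fun B f /\ exists M, forall z, B z -> normc (f z) <= M.

Lemma bounded_mfun_cintegrable f : bounded_mfun f -> cintegrable mu B f.
Proof. by move=> [mf [M hM]]; apply: cintegrable_bounded hM. Qed.

Lemma bounded_mfunM f g : bounded_mfun f -> bounded_mfun g -> bounded_mfun (fun z => f z * g z).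
Proof.
move=> [mf [M hM]] [mg [N hN]]; split; first exact: measurableC_mul.
exists (M * N) => z Bz; rewrite normcM; apply: ler_pM; rewrite ?normc_ge0//; [exact: hM|exact: hN].
Qed.

Lemma bounded_mfunD f g : bounded_mfun f -> bounded_mfun g -> bounded_mfun (fun z => f z + g z).
Proof.
move=> [mf [M hM]] [mg [N hN]]; split; first exact: measurableC_add.
exists (M + N) => z Bz; apply: le_trans (normcD _ _) _; apply: lerD; [exact: hM|exact: hN].
Qed.

Lemma bounded_mfun_cst c : bounded_mfun (fun=> c).
Proof. by split; [exact: measurable_cst|exists (normc c)]. Qed.

Lemma bounded_mfun_conj f : bounded_mfun f -> bounded_mfun (fun z => conjc (f z)).
Proof.
by move=> [mf [M hM]]; split; [exact: measurableC_conj|exists M => z Bz; rewrite normc_conj; exact: hM].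
Qed.

Lemma bounded_mfun_mono al : bounded_mfun (mono al).
Proof.
split; first by apply: measurable_funTS; exact: measurable_mono.
by exists 1 => z; exact: normc_mono_le1.
Qed.

Lemma bounded_mfun_coord i : bounded_mfun (fun z => z i 0).
Proof.
split; first by apply: measurable_funTS; exact: measurable_coord.
by exists 1 => z; exact: ball_coord_le1.
Qed.

(** Each factor w_i is extracted by [scale_coefC]; the induction runs over the list s of the
    coordinates already multiplied. *)
Lemma vmul_coef (f F : Cn -> C) al w : B w -> holomorphic_on B f -> bounded_mfun f ->
  measurable_fun setT F -> bounded_mfun F ->
  (forall i u z, normc u = 1 -> F (scl (pred1 i) u z) = conjc u ^+ al i * F z) ->
  cint mu B (fun z => f (vmul w z) * F z) = mono al w * cint mu B (fun z => f z * F z).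
Proof.
move=> Bw hf bf mF bF FP.
pose W (s : seq 'I_n) z : Cn := \col_i if i \in s then w i 0 * z i 0 else z i 0.
suff H s : uniq s -> [/\ holomorphic_on B (f \o W s), bounded_mfun (f \o W s) &
    cint mu B (fun z => f (W s z) * F z) = (\prod_(i <- s) w i 0 ^+ al i) * cint mu B (fun z => f z * F z)].
  have [_ _] := H (enum 'I_n) (enum_uniq _); rewrite big_enum/= => <-.
  apply: eq_cint => z _; congr (f _ * _); apply/colP => i; rewrite !mxE.
  by rewrite mem_enum.
elim: s => [_|i s ih /= /andP[iNs us]].
  have E z : W [::] z = z by apply/colP => i; rewrite mxE.
  split.
  - by rewrite (_ : f \o W [::] = f)//; apply/funext => z; rewrite /= E.
  - by rewrite (_ : f \o W [::] = f)//; apply/funext => z; rewrite /= E.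
  - by rewrite big_nil mul1r; apply: eq_cint => z _; rewrite E.
have [hfs bfs Es] := ih us.
have wi := ball_coord_le1 i Bw.
have E : f \o W (i :: s) = (f \o W s) \o scl (pred1 i) (w i 0).
  apply/funext => z /=; congr f; apply/colP => j; rewrite !mxE inE /=.
  by have [->|] := eqVneq j i; rewrite ?(negbTE iNs).
have bsc u : normc u <= 1 -> bounded_mfun ((f \o W s) \o scl (pred1 i) u).
  move=> u1; case: bfs => mfs [M hM]; split.
    apply: (@measurable_comp _ _ _ _ _ _ B) => //.
      by move=> _ [z Bz <-]; exact: unit_ball_scl.
    by apply: measurable_funTS; exact: measurable_scl.
  by exists M => z Bz; apply: hM; exact: unit_ball_scl.
split; rewrite ?E.
- move=> z Bz; apply: differentiable_comp; first exact: differentiable_scl_vec.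
  by apply: hfs; exact: unit_ball_scl.
- exact: bsc.
rewrite big_cons -mulrA -Es -(@scale_coefC R n mu bm (pred1 i) (f \o W s) F (al i) (w i 0))//.
- by apply: eq_cint => z _; rewrite -[f (W _ _)]/((f \o W (i :: s)) z) E.
- exact: bfs.1.
- move=> u z; exact: FP.
- apply: bounded_mfun_cintegrable; apply: (@bounded_mfunM ((f \o W s) \o scl (pred1 i) _)) => //.
  by apply: bsc; rewrite normc_real ger0_norm ?normc_ge0.
- by apply: bounded_mfun_cintegrable; exact: (@bounded_mfunM (f \o W s)).
Qed.

Lemma integrable_ball_cst (r : R) : mu.-integrable B (EFin \o (fun=> r)).
Proof. by have [] := bounded_mfun_cintegrable (bounded_mfun_cst r%:C). Qed.

Lemma Rintegral_ge_on (g : Cn -> R) A m : measurable A -> A `<=` B ->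
  mu.-integrable B (fun z => (g z)%:E) -> (forall z, B z -> 0 <= g z) ->
  (forall z, A z -> m <= g z) -> m * fine (mu A) <= \int[mu]_(z in B) g z.
Proof.
move=> mA AB ig g0 gm.
have iA := integrableS mB mA AB ig.
have muA : (mu A < +oo)%E by apply: le_lt_trans muB; rewrite le_measure// inE.
have BE : B = A `|` (B `\` A) by rewrite setDUK.
have mD : measurable (B `\` A) by exact: measurableD.
rewrite BE Rintegral_setU//; last 2 first.
- by rewrite -BE.
- by apply/disj_setPS => z [? []].
rewrite -[leLHS]addr0; apply: lerD; last by apply: Rintegral_ge0 => z [Bz _]; exact: g0.
rewrite -Rintegral_cst//; apply: le_Rintegral => //.
exact: integrableS mB mA AB (integrable_ball_cst m).
Qed.

Lemma bounded_mfun_normc f : bounded_mfun f -> mu.-integrable B (fun z => (normc (f z))%:E).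
Proof. by move/bounded_mfun_cintegrable/(cintegrableP mu mB) => -[]. Qed.

Lemma Rintegral_normc_le f M : measurable_fun B f -> (forall z, B z -> normc (f z) <= M) ->
  \int[mu]_(z in B) normc (f z) <= M * fine (mu B).
Proof.
move=> mf fM; rewrite -Rintegral_cst//; apply: le_Rintegral => //.
  by apply: bounded_mfun_normc; split=> //; exists M.
exact: integrable_ball_cst.
Qed.

Lemma fubini_bounded (k : Cn -> Cn -> C) M :
  measurable_fun (B `*` B) (fun p : Cn * Cn => k p.1 p.2) ->
  (forall w z, B w -> B z -> normc (k w z) <= M) ->
  cint mu B (fun w => cint mu B (k w)) = cint mu B (fun z => cint mu B (k ^~ z)).
Proof.
move=> mk kM; have lty := ball_measure_lty bm.
have sf : sigma_finite setT mu.
  by exists (fun=> setT) => [|i]; [apply/seteqP; split=> // x _; exists 0%N|split].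
have m1 w : B w -> measurable_fun B (k w).
  move=> Bw; apply: (@measurable_comp _ _ _ _ _ _ (B `*` B) (fun p : Cn * Cn => k p.1 p.2) B (fun z => (w, z))) => //.
  - exact: measurableX.
  - by move=> _ [z Bz <-].
  - by apply: measurable_funTS; exact: pair1_measurable.
have m2 w : B w -> measurable_fun B (k ^~ w).
  move=> Bw; apply: (@measurable_comp _ _ _ _ _ _ (B `*` B) (fun p : Cn * Cn => k p.1 p.2) B (fun z => (z, w))) => //.
  - exact: measurableX.
  - by move=> _ [z Bz <-].
  - by apply: measurable_funTS; exact: pair2_measurable.
apply: (@cint_fubini_fin R _ _ Cn Cn mu mu B B mB mB k (M * fine (mu B))) => //.
  move=> w Bw; split; last by apply: Rintegral_normc_le; [exact: m1|move=> z; exact: kM].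
  by apply: bounded_mfun_cintegrable; split; [exact: m1|exists M => z; exact: kM].
move=> z Bz; apply: bounded_mfun_cintegrable; split; [exact: m2|exists M => w Bw; exact: kM].
Qed.

Lemma integral_mono_gt0 al : 0 < \int[mu]_(z in B) normc (mono al z) ^+ 2.
Proof.
(* The point with all coordinates 1 / (n + 1) lies in the ball and z^al does not vanish there; a
   neighbourhood of it has positive measure. *)
pose c : R := n.+1%:R^-1; have c0 : 0 < c by rewrite invr_gt0 ltr0n.
pose z0 : Cn := \col_i c%:C.
have Bz0 : B z0.
  rewrite /unit_ball/= /sqnorm (eq_bigr (fun=> c ^+ 2)); last first.
    by move=> i _; rewrite mxE normc_real gtr0_norm.
  rewrite sumr_const card_ord -[_ *+ n]mulr_natr expr2 mulrAC -mulrA.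
  have h : c * n%:R < 1 by rewrite /c mulrC ltr_pdivrMr ?ltr0n// mul1r ltr_nat.
  have c1 : c <= 1 by rewrite invf_le1 ?ltr0n// ler1n.
  have := mulr_ge0 (ltW c0) (ler0n R n); nra.
have m0 : 0 < normc (mono al z0).
  rewrite lt_def normc_ge0 andbT; apply/eqP => /normc_eq0/eqP.
  by rewrite prodf_seq_eq0 => /hasP[i _ /=]; rewrite mxE expf_eq0 (negbTE (realC_neq0 c0)) andbF.
pose m := normc (mono al z0) / 2; have m00 : 0 < m by rewrite divr_gt0.
have cm : {for z0, continuous (mono al)} by apply: differentiable_continuous; exact: differentiable_mono.
have [d d0 hd] := continuous_sqnorm_near cm m00.
have [e e0 he] := near_sqnorm (near_unit_ball Bz0).
pose r := Num.min d e; have r0 : 0 < r by rewrite lt_min d0.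
have rd : r ^+ 2 <= d ^+ 2 by rewrite ler_pXn2r ?nnegrE ?(ltW r0) ?(ltW d0)// ge_min lexx.
have re : r ^+ 2 <= e ^+ 2 by rewrite ler_pXn2r ?nnegrE ?(ltW r0) ?(ltW e0)// ge_min lexx orbT.
have mA := measurable_sqnorm_ball z0 (r ^+ 2).
have := ball_measure_nbhs bm Bz0 r0; set A := [set z | _] in mA * => A0.
have AB : A `<=` B by move=> z /= zr; apply: he; exact: lt_le_trans zr re.
have fA : mu A \is a fin_num.
  by rewrite ge0_fin_numE//; apply: le_lt_trans muB; rewrite le_measure// inE.
apply: (@lt_le_trans _ _ (m ^+ 2 * fine (mu A))).
  by rewrite mulr_gt0 ?exprn_gt0// fine_gt0// A0 -ge0_fin_numE.
apply: Rintegral_ge_on => //.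
- have := bounded_mfun_normc (bounded_mfunM (bounded_mfun_mono al) (bounded_mfun_mono al)).
  by under eq_fun do rewrite normcM -expr2.
- by move=> z _; exact: sqr_ge0.
- move=> z /= zr; rewrite ler_pXn2r ?nnegrE ?normc_ge0 ?(ltW m00)//.
  have := hd z (lt_le_trans zr rd); have := normcD (mono al z) (mono al z0 - mono al z).
  rewrite subrKC -[_ - mono al z]opprB normcN /m; lra.
Qed.

(* Integrate f(w z) conj(z^al) conj(w^al) |w^ga|^2 over w and z, for the
   coordinatewise product w z. Integrating over z first gives 0, and integrating
   over w first gives the claimed integral times the squared norm of z^al. *)
Lemma mono_conj_mono0 (f : Cn -> C) : holomorphic_on B f -> bounded_mfun f ->
  (forall al, cint mu B (fun z => f z * conjc (mono al z)) = 0) ->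
  forall al ga, cint mu B (fun z => f z * (conjc (mono al z) * (normc (mono ga z) ^+ 2)%:C)) = 0.
Proof.
move=> hf bf f0 al ga.
pose F1 z := conjc (mono al z).
pose F2 z := conjc (mono al z) * (normc (mono ga z) ^+ 2)%:C.
have mF1 : measurable_fun setT F1 by apply: measurableC_conj; exact: measurable_mono.
have F2E : F2 = fun z => conjc (mono al z) * (mono ga z * conjc (mono ga z)).
  by apply/funext => z; rewrite mulc_conj.
have mF2 : measurable_fun setT F2.
  rewrite F2E; apply: measurableC_mul => //; apply: measurableC_mul; first exact: measurable_mono.
  by apply: measurableC_conj; exact: measurable_mono.
have bF1 : bounded_mfun F1 by apply: bounded_mfun_conj; exact: bounded_mfun_mono.
have bF2 : bounded_mfun F2.
  rewrite F2E; apply: bounded_mfunM => //; apply: bounded_mfunM; first exact: bounded_mfun_mono.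
  by apply: bounded_mfun_conj; exact: bounded_mfun_mono.
have P1 i u z : normc u = 1 -> F1 (scl (pred1 i) u z) = conjc u ^+ al i * F1 z.
  by move=> u1; rewrite /F1 mono_scl1 rmorphM rmorphXn.
have P2 i u z : normc u = 1 -> F2 (scl (pred1 i) u z) = conjc u ^+ al i * F2 z.
  move=> u1; rewrite /F2 !mono_scl1 rmorphM rmorphXn -mulrA normcM normcX u1 expr1n mul1r //.
have [mf [M hM]] := bf; have [_ [M1 hM1]] := bF1; have [_ [M2 hM2]] := bF2.
pose k w z := f (vmul w z) * (F1 z * F2 w).
have E : cint mu B (fun w => cint mu B (k w)) = cint mu B (fun z => cint mu B (k ^~ z)).
  have mv : measurable_fun setT (fun p : Cn * Cn => F1 p.2 * F2 p.1).
    apply: measurableC_mul; first exact: (measurableT_comp mF1 measurable_snd).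
    exact: (measurableT_comp mF2 measurable_fst).
  apply: (@fubini_bounded k (M * (M1 * M2))).
    apply: measurableC_mul; last exact: measurable_funTS.
    apply: (@measurable_comp _ _ _ _ _ _ B f) => //.
      by move=> _ [[w z] /= [Bw Bz] <-]; exact: unit_ball_vmul.
    by apply: measurable_funTS; exact: measurable_vmul.
  move=> w z Bw Bz; rewrite /k normcM (normcM (F1 z) (F2 w)); apply: ler_pM; rewrite ?mulr_ge0 ?normc_ge0//.
    by apply: hM; exact: unit_ball_vmul.
  by apply: ler_pM; rewrite ?normc_ge0//; [exact: hM1|exact: hM2].
have bv w : B w -> bounded_mfun (fun z => f (vmul w z)).
  move=> Bw; split.
    apply: (@measurable_comp _ _ _ _ _ _ B f); [exact: mB| |exact: mf|].
      by move=> _ [z Bz <-]; exact: unit_ball_vmul.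
    apply: measurable_funTS.
    exact: (measurableT_comp (@measurable_vmul R n) (@pair1_measurable _ _ Cn Cn w)).
  by exists M => z Bz; apply: hM; exact: unit_ball_vmul.
have L : cint mu B (fun w => cint mu B (k w)) = 0.
  rewrite -(cint0 mu B); apply: eq_cint => w Bw.
  transitivity (cint mu B (fun z => F2 w * (f (vmul w z) * F1 z))).
    by apply: eq_cint => z _; rewrite /k mulrA mulrC.
  rewrite (cintZ mB _ (bounded_mfun_cintegrable (bounded_mfunM (bv w Bw) bF1))).
  by rewrite (vmul_coef Bw hf bf mF1 bF1 P1) f0 !mulr0.
pose K := cint mu B (fun z => f z * F2 z).
have : cint mu B (fun z => cint mu B (k ^~ z)) = K * (\int[mu]_(z in B) normc (mono al z) ^+ 2)%:C.
  rewrite -cint_real -(cintZ mB); last first.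
    apply: bounded_mfun_cintegrable.
    have := bounded_mfunM (bounded_mfun_mono al) (bounded_mfun_conj (bounded_mfun_mono al)).
    by under eq_fun do rewrite mulc_conj.
  apply: eq_cint => z Bz.
  transitivity (cint mu B (fun w => F1 z * (f (vmul z w) * F2 w))).
    by apply: eq_cint => w _; rewrite /k vmulC mulrCA.
  rewrite (cintZ mB _ (bounded_mfun_cintegrable (bounded_mfunM (bv z Bz) bF2))).
  rewrite (vmul_coef Bz hf bf mF2 bF2 P2) -/K mulrA [LHS]mulrC; congr (_ * _).
  by rewrite /F1 mulrC mulc_conj.
rewrite -E L => /esym/eqP; rewrite mulf_eq0 (negbTE (realC_neq0 (integral_mono_gt0 al))) orbF.
by move/eqP.
Qed.

(** If al <= be in each coordinate, then z^al conj(z^be) = |z^al|^2 conj(z^(be - al)), the case of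
    [mono_conj_mono0]. Otherwise some coordinate has positive weight and [scale_neg] applies. *)
Lemma mono_bimono0 (f : Cn -> C) : holomorphic_on B f -> bounded_mfun f ->
  (forall al, cint mu B (fun z => f z * conjc (mono al z)) = 0) ->
  forall al be, cint mu B (fun z => f z * (mono al z * conjc (mono be z))) = 0.
Proof.
move=> hf bf f0 al be; case: (pickP (fun i => be i < al i)%N) => [i abi|ba]; last first.
  have ab i : (al i <= be i)%N by rewrite leqNgt ba.
  have := mono_conj_mono0 hf bf f0 (fun i => be i - al i)%N al.
  move=> <-; apply: eq_cint => z _; congr (_ * _).
  have -> : mono be z = mono (fun i => (be i - al i) + al i)%N z.
    by apply: eq_bigr => i _; rewrite subnK.
  by rewrite monoD rmorphM -mulc_conj mulrCA.
apply: (@scale_neg R n mu bm (pred1 i) f _ (al i - be i)); rewrite ?subn_gt0//.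
- exact: bf.1.
- apply: measurableC_mul; first exact: measurable_mono.
  by apply: measurableC_conj; exact: measurable_mono.
- move=> u z u1; rewrite !mono_scl1 rmorphM rmorphXn -{1}(subnK (ltnW abi)) exprD.
  have uc : u * conjc u = 1 by rewrite mulc_conj u1 expr1n.
  have -> : u ^+ (al i - be i) * u ^+ be i * mono al z * (conjc u ^+ be i * conjc (mono be z)) =
    (u * conjc u) ^+ be i * (u ^+ (al i - be i) * (mono al z * conjc (mono be z))).
    by rewrite exprMn; ring.
  by rewrite uc expr1n mul1r.
- apply: bounded_mfun_cintegrable; apply: bounded_mfunM => //.
  by apply: bounded_mfunM; [|apply: bounded_mfun_conj]; exact: bounded_mfun_mono.
Qed.

Section peak.
Variable f : Cn -> C.
Hypotheses (bf : bounded_mfun f)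
  (f0 : forall al be, cint mu B (fun z => f z * (mono al z * conjc (mono be z))) = 0).

(** Keeping the extra monomials in the condition makes it stable under multiplication of Q by
    coordinates and their conjugates, and thus reaches the powers of the peak kernel. *)
Let annihil (Q : Cn -> C) := bounded_mfun Q /\
  forall al be, cint mu B (fun z => f z * (Q z * (mono al z * conjc (mono be z)))) = 0.

Let bmm al be : bounded_mfun (fun z => mono al z * conjc (mono be z)).
Proof. by apply: bounded_mfunM; [|apply: bounded_mfun_conj]; exact: bounded_mfun_mono. Qed.

Let annihil1 : annihil (fun=> 1).
Proof.
split=> [|al be]; first exact: bounded_mfun_cst.
by rewrite -(f0 al be); apply: eq_cint => z _; rewrite mul1r.
Qed.

Let annihilD Q1 Q2 : annihil Q1 -> annihil Q2 -> annihil (fun z => Q1 z + Q2 z).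
Proof.
move=> [b1 q1] [b2 q2]; split=> [|al be]; first exact: bounded_mfunD.
transitivity (cint mu B (fun z => f z * (Q1 z * (mono al z * conjc (mono be z))) +
  f z * (Q2 z * (mono al z * conjc (mono be z))))).
  by apply: eq_cint => z _; rewrite -mulrDr -mulrDl.
rewrite cintD//; first by rewrite q1 q2 addr0.
- by apply: bounded_mfun_cintegrable; apply: bounded_mfunM => //; apply: bounded_mfunM.
- by apply: bounded_mfun_cintegrable; apply: bounded_mfunM => //; apply: bounded_mfunM.
Qed.

Let annihilZ c Q : annihil Q -> annihil (fun z => c * Q z).
Proof.
move=> [b1 q1]; split=> [|al be]; first exact: (bounded_mfunM (bounded_mfun_cst c)).
transitivity (cint mu B (fun z => c * (f z * (Q z * (mono al z * conjc (mono be z)))))).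
  by apply: eq_cint => z _; rewrite -mulrA mulrCA.
rewrite cintZ//; first by rewrite q1 mulr0.
by apply: bounded_mfun_cintegrable; apply: bounded_mfunM => //; apply: bounded_mfunM.
Qed.

Let mono_delta i z : mono (fun j => nat_of_bool (j == i)) z = z i 0.
Proof.
rewrite /mono (bigD1 i)//= eqxx expr1 big1 ?mulr1// => j ji.
by rewrite (negbTE ji).
Qed.

Let annihil_coord i Q : annihil Q -> annihil (fun z => z i 0 * Q z).
Proof.
move=> [b1 q1]; split=> [|al be]; first exact: (bounded_mfunM (bounded_mfun_coord i)).
rewrite -(q1 (fun j => (j == i) + al j)%N be); apply: eq_cint => z _.
by rewrite (monoD (fun j => nat_of_bool (j == i))) mono_delta; congr (_ * _); ring.
Qed.

Let annihil_conj i Q : annihil Q -> annihil (fun z => conjc (z i 0) * Q z).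
Proof.
move=> [b1 q1]; split=> [|al be].
  exact: (bounded_mfunM (bounded_mfun_conj (bounded_mfun_coord i))).
rewrite -(q1 al (fun j => (j == i) + be j)%N); apply: eq_cint => z _.
by rewrite (monoD (fun j => nat_of_bool (j == i))) mono_delta rmorphM; congr (_ * _); ring.
Qed.

Let annihil_sum (s : seq 'I_n) (Q : 'I_n -> Cn -> C) Q0 : annihil Q0 -> (forall i, annihil (Q i)) ->
  annihil (fun z => Q0 z + \sum_(i <- s) Q i z).
Proof.
move=> h0 hQ; elim: s => [|i s ih].
  by under eq_fun do rewrite big_nil addr0.
by under eq_fun do rewrite big_cons addrCA; exact: annihilD.
Qed.

(** The factor 1/4 keeps it nonnegative on the ball, where |z - z0|^2 <= 2 |z|^2 + 2 |z0|^2 < 4. *)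
Definition peak_kernel z0 z : R := 1 - sqnorm (z - z0) / 4.

Let annihil_peak z0 N : annihil (fun z => (peak_kernel z0 z ^+ N)%:C).
Proof.
elim: N => [|N ih]; first exact: annihil1.
have -> : (fun z => (peak_kernel z0 z ^+ N.+1)%:C) = (fun z => (peak_kernel z0 z ^+ N)%:C +
    \sum_(i < n) (- 4^-1) * ((z i 0 - z0 i 0) * conjc (z i 0 - z0 i 0) * (peak_kernel z0 z ^+ N)%:C)).
  apply/funext => z; rewrite -mulr_sumr -mulr_suml exprS rmorphM/=.
  have -> : \sum_(i < n) (z i 0 - z0 i 0) * conjc (z i 0 - z0 i 0) = (sqnorm (z - z0))%:C.
    by rewrite /sqnorm rmorph_sum/=; apply: eq_bigr => i _; rewrite mulc_conj !mxE.
  by rewrite /peak_kernel rmorphB rmorph1 rmorphM fmorphV rmorph_nat; ring.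
apply: annihil_sum => // i; apply: annihilZ.
have -> : (fun z : Cn => (z i 0 - z0 i 0) * conjc (z i 0 - z0 i 0) * (peak_kernel z0 z ^+ N)%:C) =
  (fun z : Cn => (z i 0 * (conjc (z i 0) * (peak_kernel z0 z ^+ N)%:C)) +
     (- conjc (z0 i 0)) * (z i 0 * (peak_kernel z0 z ^+ N)%:C) +
    ((- z0 i 0) * (conjc (z i 0) * (peak_kernel z0 z ^+ N)%:C) +
     (z0 i 0 * conjc (z0 i 0)) * (peak_kernel z0 z ^+ N)%:C)).
  by apply/funext => z; rewrite rmorphB; ring.
apply: annihilD; apply: annihilD.
- exact/annihil_coord/annihil_conj.
- exact/annihilZ/annihil_coord.
- exact/annihilZ/annihil_conj.
- exact: annihilZ.
Qed.

(* The powers of a kernel with a strict maximum at [z0] localise f at [z0]. *)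
Lemma peak_zero z0 : B z0 -> {for z0, continuous f} -> f z0 = 0.
Proof.
move=> Bz0 cf; apply/eqP/negPn/negP => f0n.
pose c := conjc (f z0); have nc : 0 < normc (f z0).
  by rewrite lt_def normc_ge0 andbT; apply: contra f0n => /eqP/normc_eq0/eqP.
have ncE : normc c = normc (f z0) by rewrite normc_conj.
have [d1 d10 hd1] := continuous_sqnorm_near cf (divr_gt0 nc (ltr0n _ 2)).
have [d2 d20 hd2] := near_sqnorm (near_unit_ball Bz0).
pose a0 := normc (f z0); have a00 : 0 < a0 by [].
have [d [d0 dd1 dd2 d1']] : exists d : R, [/\ 0 < d, d <= d1 ^+ 2, d <= d2 ^+ 2 & d <= 1].
  exists (Num.min (Num.min (d1 ^+ 2) (d2 ^+ 2)) 1); split.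
  - by rewrite !lt_min !exprn_gt0// ltr01.
  - by rewrite !ge_min lexx.
  - by rewrite !ge_min lexx orbT.
  - by rewrite ge_min lexx orbT.
have [mf [M0 hM0]] := bf.
pose M := Num.max M0 0; have M_ge0 : 0 <= M by rewrite le_max lexx orbT.
have hM z : B z -> normc (f z) <= M by move=> Bz; rewrite le_max hM0.
pose e := Num.sqrt (d / 2); have e0 : 0 < e by rewrite sqrtr_gt0 divr_gt0.
have eE : e ^+ 2 = d / 2 by rewrite sqr_sqrtr// ltW// divr_gt0.
have mA := measurable_sqnorm_ball z0 (e ^+ 2).
have := ball_measure_nbhs bm Bz0 e0; set A := [set z | _] in mA * => A0.
have AB : A `<=` B by move=> z; rewrite /A /= eE => zr; apply: hd2; apply: lt_le_trans dd2; lra.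
have fA : mu A \is a fin_num.
  by rewrite ge0_fin_numE//; apply: le_lt_trans muB; rewrite le_measure// inE.
have fA0 : 0 < fine (mu A) by rewrite fine_gt0// A0 -ge0_fin_numE.
(* The kernel is at least a on A, where |z - z0|^2 < d / 2, and at most b where |z - z0|^2 >= d;
   what matters is a > b. *)
pose a := 1 - d / 8; pose b := 1 - d / 4.
have b0 : 0 < b by rewrite /b; lra.
have q1 z : B z -> 0 <= peak_kernel z0 z.
  move=> Bz; rewrite /peak_kernel subr_ge0 ler_pdivrMr// mul1r.
  have : sqnorm (z - z0) <= 2 * sqnorm z + 2 * sqnorm z0.
    rewrite /sqnorm !mulr_sumr -big_split/=; apply: ler_sum => i _.
    rewrite !mxE !normc_sqrE ReD ImD.
    have -> : complex.Re (- z0 i 0) = - complex.Re (z0 i 0) by case: (z0 i 0).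
    have -> : complex.Im (- z0 i 0) = - complex.Im (z0 i 0) by case: (z0 i 0).
    have := sqr_ge0 (complex.Re (z i 0) + complex.Re (z0 i 0)).
    have := sqr_ge0 (complex.Im (z i 0) + complex.Im (z0 i 0)); nra.
  have : sqnorm z < 1 := Bz; have : sqnorm z0 < 1 := Bz0; lra.
have gE z : complex.Re (c * f z) = a0 ^+ 2 + complex.Re (c * (f z - f z0)).
  rewrite -[in LHS](subrKC (f z0) (f z)) mulrDr ReD; congr (_ + _).
  by rewrite /c mulrC mulc_conj.
have gn z : sqnorm (z - z0) < d -> a0 ^+ 2 / 2 <= complex.Re (c * f z).
  move=> zd; rewrite gE; have := Re_le_normc (c * (f z - f z0)).
  rewrite normcM ncE -/a0 ler_norml => /andP[h _].
  have := hd1 z (lt_le_trans zd dd1); rewrite -/a0 => h2.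
  have : a0 * normc (f z - f z0) <= a0 * (a0 / 2) by rewrite ler_pM2l// ltW.
  nra.
have key N : a0 ^+ 2 / 2 * a ^+ N * fine (mu A) <= a0 * M * b ^+ N * fine (mu B).
  (* The added constant makes the real part of [Fc] nonnegative on the ball: away from z0 the first
     term is at least - a0 M b^N. As f annihilates the kernel, the integral of [Fc] is that of the
     constant. *)
  pose Fc z := c * (f z * (peak_kernel z0 z ^+ N)%:C) + (a0 * M * b ^+ N)%:C.
  have [bq hq] := annihil_peak z0 N.
  have bfq : bounded_mfun (fun z => f z * (peak_kernel z0 z ^+ N)%:C) by exact: bounded_mfunM.
  have bFc : bounded_mfun Fc.
    apply: (bounded_mfunD _ (bounded_mfun_cst _)); exact: (bounded_mfunM (bounded_mfun_cst c)).
  have iFc := bounded_mfun_cintegrable bFc.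
  have EFc : cint mu B Fc = (a0 * M * b ^+ N * fine (mu B))%:C.
    rewrite /Fc cintD//; last 2 first.
    - exact/cintegrableZ/bounded_mfun_cintegrable.
    - exact/bounded_mfun_cintegrable/bounded_mfun_cst.
    rewrite cintZ//; last exact: bounded_mfun_cintegrable.
    rewrite cint_real Rintegral_cst// -[RHS]add0r; congr (_ + _).
    apply/eqP; rewrite mulf_eq0; apply/orP; right; apply/eqP.
    rewrite -(hq (fun=> 0%N) (fun=> 0%N)); apply: eq_cint => z _.
    by rewrite /mono big1// mul1r conjc1 mulr1.
  have := congr1 (@complex.Re R) EFc; rewrite [RHS]/= => <-.
  have ReFc z : complex.Re (Fc z) = complex.Re (c * f z) * peak_kernel z0 z ^+ N + a0 * M * b ^+ N.
    by rewrite /Fc ReD mulrA; move: (c * f z) => -[x y] /=; rewrite mulr0 subr0.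
  apply: Rintegral_ge_on => //.
  - exact: iFc.1.
  - move=> z Bz; rewrite ReFc; have [zd|zd] := ltP (sqnorm (z - z0)) d.
      apply: addr_ge0; last by rewrite !mulr_ge0 ?exprn_ge0 ?(ltW a00) ?(ltW b0).
      rewrite mulr_ge0 ?exprn_ge0 ?q1//; apply: le_trans (gn z zd).
      by rewrite divr_ge0 ?exprn_ge0 ?(ltW a00).
    have h1 : - (a0 * M) <= complex.Re (c * f z).
      have := Re_le_normc (c * f z); rewrite normcM ncE -/a0 ler_norml => /andP[h _].
      apply: le_trans h; rewrite lerN2 ler_pM2l//; exact: hM.
    have h2 : peak_kernel z0 z ^+ N <= b ^+ N.
      rewrite lerXn2r ?nnegrE ?q1 ?(ltW b0)// /peak_kernel /b; lra.
    have h3 : 0 <= peak_kernel z0 z ^+ N by rewrite exprn_ge0 ?q1.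
    have : - (a0 * M) * peak_kernel z0 z ^+ N <= complex.Re (c * f z) * peak_kernel z0 z ^+ N.
      by rewrite ler_wpM2r.
    have : a0 * M * peak_kernel z0 z ^+ N <= a0 * M * b ^+ N by rewrite ler_wpM2l ?mulr_ge0 ?(ltW a00).
    lra.
  - move=> z; rewrite /A /= eE => zA; rewrite ReFc.
    have h1 : a ^+ N <= peak_kernel z0 z ^+ N.
      rewrite lerXn2r ?nnegrE /peak_kernel /a; lra.
    have h2 : a0 ^+ 2 / 2 <= complex.Re (c * f z) by apply: gn; lra.
    have h3 : 0 <= a0 * M * b ^+ N by rewrite !mulr_ge0 ?exprn_ge0 ?(ltW a00) ?(ltW b0).
    have h4 : a0 ^+ 2 / 2 * a ^+ N <= complex.Re (c * f z) * peak_kernel z0 z ^+ N.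
      apply: ler_pM => //; first by rewrite divr_ge0 ?exprn_ge0 ?(ltW a00).
      rewrite exprn_ge0 /a//; lra.
    lra.
(* After division by b^N, the left side of [key] grows at least linearly in N by Bernoulli's
   inequality, while the right side is constant. *)
pose x := a / b - 1; have x0 : 0 < x by rewrite subr_gt0 ltr_pdivlMr// mul1r /a /b; lra.
pose L := a0 * M * fine (mu B); pose K := a0 ^+ 2 / 2 * fine (mu A).
have K0 : 0 < K by rewrite mulr_gt0// divr_gt0 ?exprn_gt0.
have bern N : 1 + N%:R * x <= (a / b) ^+ N.
  elim: N => [|N ih]; first by rewrite mul0r addr0.
  have -> : a / b = 1 + x by rewrite /x; ring.
  move: ih; have -> : a / b = 1 + x by rewrite /x; ring.
  rewrite exprS => ih; have : (1 + x) * (1 + N%:R * x) <= (1 + x) * (1 + x) ^+ N.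
    rewrite ler_pM2l//; lra.
  rewrite -natr1; have := mulr_ge0 (ler0n R N) (sqr_ge0 x); nra.
have key2 N : K * (1 + N%:R * x) <= L.
  apply: (@le_trans _ _ (K * (a / b) ^+ N)); first by rewrite ler_pM2l.
  rewrite expr_div_n mulrA ler_pdivrMr ?exprn_gt0//.
  by have := key N; rewrite /K /L; lra.
pose N := Num.Def.archi_bound `|L / (K * x)|.
have : `|L / (K * x)| < N%:R by apply: archi_boundP; exact: normr_ge0.
move=> /(le_lt_trans (ler_norm _)); rewrite ltr_pdivrMr ?mulr_gt0//.
have := key2 N; nra.
Qed.

End peak.

Lemma sqnorm_sclT u z : sqnorm (scl predT u z) = normc u ^+ 2 * sqnorm z.
Proof. by rewrite /sqnorm mulr_sumr; apply: eq_bigr => i _; rewrite mxE normcM exprMn. Qed.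

Lemma mono_conj_weight al u z :
  conjc (mono al (scl predT u z)) = conjc u ^+ (\sum_i al i) * conjc (mono al z).
Proof. by rewrite mono_scl rmorphM rmorphXn. Qed.

(* The dilate f(z) = h(r z) is bounded, and still orthogonal to the monomials by
   homogeneity. *)
Lemma mono_complete (h : Cn -> C) : holomorphic_on B h -> cintegrable mu B h ->
  (forall al, cint mu B (fun z => h z * conjc (mono al z)) = 0) -> forall z, B z -> h z = 0.
Proof.
move=> hh ih h0 z Bz.
have [mh inh] := (cintegrableP mu mB h).1 ih.
pose s := Num.sqrt (sqnorm z); have s0 : 0 <= s by exact: sqrtr_ge0.
have sE : s ^+ 2 = sqnorm z by rewrite sqr_sqrtr// sqnorm_ge0.
have s1 : s < 1 by have : sqnorm z < 1 := Bz; rewrite -sE; nra.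
(* With r strictly between |z| and 1, z / r is still in the ball, and the dilate only takes values
   of h where |w| <= r. *)
pose r := (1 + s) / 2; have r0 : 0 < r by rewrite /r; lra.
have r1 : r < 1 by rewrite /r; lra.
have sr : s < r by rewrite /r; lra.
have r01 : 0 <= r <= 1 by rewrite !ltW.
have nr : normc (r%:C : C) = r by rewrite normc_real gtr0_norm.
have rC : r%:C != 0 :> C by exact: realC_neq0.
pose f := h \o scl predT r%:C.
have Bsc w : B w -> B (scl predT r%:C w) by move=> Bw; apply: unit_ball_scl; rewrite ?nr ?ltW.
have hf : holomorphic_on B f.
  move=> w Bw; apply: differentiable_comp; first exact: differentiable_scl_vec.
  exact/hh/Bsc.
have bf : bounded_mfun f.
  split.
    apply: (@measurable_comp _ _ _ _ _ _ B h); [exact: mB| |exact: mh|].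
      by move=> _ [w Bw <-]; exact: Bsc.
    by apply: measurable_funTS; exact: measurable_scl.
  have r21 : r ^+ 2 < 1 by rewrite expr2; nra.
  have [M hM] := bounded_on_ball r21 hh.
  exists M => w Bw; apply: hM; rewrite sqnorm_sclT nr ler_piMr ?sqr_ge0//; exact: ltW.
have f0 al : cint mu B (fun z => f z * conjc (mono al z)) = 0.
  have mF : measurable_fun setT (fun z => conjc (mono al z)).
    by apply: measurableC_conj; exact: measurable_mono.
  rewrite (@scale_coef R n mu bm predT h _ (\sum_i al i) r r01 hh mh mF) ?h0 ?mulr0//.
  - by move=> u w _; exact: mono_conj_weight.
  - apply: bounded_mfun_cintegrable; apply: (bounded_mfunM bf).
    by apply: bounded_mfun_conj; exact: bounded_mfun_mono.
  - apply: (cintegrable_le mB _ inh).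
      by apply: measurableC_mul => //; exact: measurable_funTS.
    move=> w Bw; rewrite normcM normc_conj ler_piMr ?normc_ge0//; exact: normc_mono_le1.
have w1 : scl predT r%:C (scl predT r%:C^-1 z) = z.
  by rewrite scl_scl mulfV// scl1.
have Bw : B (scl predT r%:C^-1 z).
  have : sqnorm z < r ^+ 2 by rewrite -sE; nra.
  rewrite -{1}w1 sqnorm_sclT nr /unit_ball/= -[X in _ < X -> _]mulr1 ltr_pM2l// exprn_gt0//.
rewrite -w1 -[h _]/(f (scl predT r%:C^-1 z)).
apply: (peak_zero bf) => //; first exact: mono_bimono0.
by apply: differentiable_continuous; exact: hf.
Qed.

End completeness.

(** * The Bergman projection *)

Section L2.
Context (R : realType) (n : nat).
Local Notation C := R[i].
Local Notation Cn := 'cV[R[i]]_n.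
Local Notation B := (@unit_ball R n).
Implicit Types (z w : Cn) (al be ga : 'I_n -> nat) (f g h : Cn -> C).
Variables (mu : {measure set Cn -> \bar R}) (bm : ball_measure mu).
Let mB := @measurable_unit_ball R n.

Definition L2 f := measurable_fun B f /\ mu.-integrable B (fun z => (normc (f z) ^+ 2)%:E).
Definition ip f g : C := cint mu B (fun z => f z * conjc (g z)).
Definition N2 f : R := \int[mu]_(z in B) normc (f z) ^+ 2.

Lemma N2_ge0 f : 0 <= N2 f.
Proof. by apply: Rintegral_ge0 => z _; exact: sqr_ge0. Qed.

Lemma L2_le f (g : Cn -> R) : measurable_fun B f -> mu.-integrable B (fun z => (g z)%:E) ->
  (forall z, B z -> normc (f z) ^+ 2 <= g z) -> L2 f.
Proof.
move=> mf ig fg; split=> //; apply: (le_integrable mB _ _ ig).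
  by apply/measurable_EFinP; exact: measurable_sqr_normc.
move=> z Bz; rewrite !abse_EFin lee_fin ger0_norm ?sqr_ge0//.
by apply: le_trans (fg z Bz) _; exact: ler_norm.
Qed.

Lemma bounded_mfun_L2 f : bounded_mfun f -> L2 f.
Proof.
move=> [mf [M hM]]; apply: (L2_le mf (integrable_ball_cst bm (M ^+ 2))) => z Bz.
by rewrite ler_pXn2r ?nnegrE ?normc_ge0 ?hM// (le_trans (normc_ge0 _) (hM z Bz)).
Qed.

Lemma cintegrable_mul_conj f g : L2 f -> L2 g -> cintegrable mu B (fun z => f z * conjc (g z)).
Proof.
move=> [mf i1] [mg i2]; apply: (@cintegrable_le _ _ _ _ _ mB _ (fun z => normc (f z) ^+ 2 + normc (g z) ^+ 2)).
- by apply: measurableC_mul => //; exact: measurableC_conj.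
- by under eq_fun do rewrite EFinD; exact: integrableD.
move=> z Bz; rewrite normcM normc_conj; have := sqr_ge0 (normc (f z) - normc (g z)).
have := normc_ge0 (f z); have := normc_ge0 (g z); nra.
Qed.

Lemma L2D f g : L2 f -> L2 g -> L2 (fun z => f z + g z).
Proof.
move=> [mf i1] [mg i2]; apply: (@L2_le _ (fun z => 2 * normc (f z) ^+ 2 + 2 * normc (g z) ^+ 2)).
- exact: measurableC_add.
- under eq_fun do rewrite EFinD !EFinM; apply: integrableD => //; exact: integrableZl.
move=> z _; have := normcD (f z) (g z); have := normc_ge0 (f z); have := normc_ge0 (g z).
have := normc_ge0 (f z + g z); have := sqr_ge0 (normc (f z) - normc (g z)); nra.
Qed.

Lemma L2Z (c : C) f : L2 f -> L2 (fun z => c * f z).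
Proof.
move=> [mf i1]; apply: (@L2_le _ (fun z => normc c ^+ 2 * normc (f z) ^+ 2)).
- exact: measurableC_mul.
- by under eq_fun do rewrite EFinM; exact: integrableZl.
by move=> z _; rewrite normcM exprMn.
Qed.

Lemma L2N f : L2 f -> L2 (fun z => - f z).
Proof. by move=> /(L2Z (-1)); under eq_fun do rewrite mulN1r. Qed.

Lemma L2B f g : L2 f -> L2 g -> L2 (fun z => f z - g z).
Proof. by move=> L2f /L2N; exact: L2D. Qed.

Lemma L2_eq f g : (forall z, B z -> f z = g z) -> L2 f -> L2 g.
Proof.
move=> fg [mf i1]; split; first by apply: eq_measurable_fun mf => z /set_mem /fg.
by apply: eq_integrable i1 => // z /set_mem Bz; rewrite fg.
Qed.

Lemma L2_cst0 : L2 (fun=> 0).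
Proof. exact/bounded_mfun_L2/bounded_mfun_cst. Qed.

Lemma L2_sum (I : Type) (s : seq I) (F : I -> Cn -> C) : (forall i, L2 (F i)) ->
  L2 (fun z => \sum_(i <- s) F i z).
Proof.
move=> hF; elim: s => [|i s ih]; first by under eq_fun do rewrite big_nil; exact: L2_cst0.
by under eq_fun do rewrite big_cons; exact: L2D.
Qed.

Lemma ipDl f g h : L2 f -> L2 g -> L2 h -> ip (fun z => f z + g z) h = ip f h + ip g h.
Proof.
move=> *; rewrite /ip -cintD//; [|exact: cintegrable_mul_conj..].
by apply: eq_cint => z _; rewrite mulrDl.
Qed.

Lemma ipZl c f h : L2 f -> L2 h -> ip (fun z => c * f z) h = c * ip f h.
Proof.
move=> *; rewrite /ip -cintZ//; last exact: cintegrable_mul_conj.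
by apply: eq_cint => z _; rewrite mulrA.
Qed.

Lemma ipBl f g h : L2 f -> L2 g -> L2 h -> ip (fun z => f z - g z) h = ip f h - ip g h.
Proof.
move=> *; rewrite /ip -cintB//; [|exact: cintegrable_mul_conj..].
by apply: eq_cint => z _; rewrite mulrBl.
Qed.

Lemma ip_conj f g : L2 f -> L2 g -> ip g f = conjc (ip f g).
Proof.
move=> *; rewrite /ip -cint_conj//; last exact: cintegrable_mul_conj.
by apply: eq_cint => z _; rewrite rmorphM/= conjcK mulrC.
Qed.

Lemma ip_suml (I : Type) (s : seq I) (c : I -> C) (F : I -> Cn -> C) h : (forall i, L2 (F i)) -> L2 h ->
  ip (fun z => \sum_(i <- s) c i * F i z) h = \sum_(i <- s) c i * ip (F i) h.
Proof.
move=> hF hh; elim: s => [|i s ih].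
  transitivity (cint mu B (fun=> 0)); last by rewrite big_nil cint0.
  by apply: eq_cint => z _; rewrite big_nil mul0r.
rewrite big_cons -ih -ipZl// -ipDl//; [|exact: L2Z|by apply: L2_sum => j; exact: L2Z].
by apply: eq_cint => z _; rewrite big_cons.
Qed.

Lemma ip_ff f : ip f f = (N2 f)%:C.
Proof. by rewrite -cint_real; apply: eq_cint => z _; rewrite mulc_conj. Qed.

Lemma eq_ip f f' g g' : (forall z, B z -> f z = f' z) -> (forall z, B z -> g z = g' z) ->
  ip f g = ip f' g'.
Proof. by move=> h1 h2; apply: eq_cint => z Bz; rewrite h1// h2. Qed.

Lemma cauchy_schwarz f g : L2 f -> L2 g -> normc (ip f g) ^+ 2 <= N2 f * N2 g.
Proof.
move=> hf hg; have i := cintegrable_mul_conj hf hg.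
pose I := \int[mu]_(z in B) normc (f z * conjc (g z)).
have [_ iI] := (cintegrableP mu mB _).1 i.
have le1 : normc (ip f g) <= I by exact: normc_cint_le.
have I0 : 0 <= I by apply: Rintegral_ge0 => z _; exact: normc_ge0.
(* Integrate (s |f| - |g|)^2 >= 0. The value s = I / N2 f, used at the end, is optimal. *)
have Q (s : R) : 0 <= s -> 2 * s * I <= s ^+ 2 * N2 f + N2 g.
  move=> s0; have [_ if2] := hf; have [_ ig2] := hg.
  rewrite /I /N2 -!RintegralZl// -RintegralD//; last exact: (integrableZl mB (s ^+ 2) if2).
  apply: le_Rintegral => //.
  - exact: (integrableZl mB (2 * s) iI).
  - exact: (integrableD mB (integrableZl mB (s ^+ 2) if2) ig2).
  move=> z _; rewrite normcM normc_conj; have := sqr_ge0 (s * normc (f z) - normc (g z)); nra.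
have h1 : normc (ip f g) ^+ 2 <= I ^+ 2 by rewrite ler_pXn2r ?nnegrE ?normc_ge0.
apply: le_trans h1 _; have f0 := N2_ge0 f; have g0 := N2_ge0 g.
have [fz|fz] := eqVneq (N2 f) 0.
  have [Iz|Iz] := eqVneq I 0; first by rewrite Iz expr0n mulr_ge0.
  have Ip : 0 < I by rewrite lt_def Iz.
  (* When N2 f = 0 and I > 0, this s would give N2 g + 1 <= N2 g. *)
  have := Q ((N2 g + 1) / (2 * I)); rewrite fz mulr0 add0r.
  have -> : 2 * ((N2 g + 1) / (2 * I)) * I = N2 g + 1 by field.
  by rewrite divr_ge0 ?addr_ge0 ?mulr_ge0// => /(_ isT); lra.
have fp : 0 < N2 f by rewrite lt_def fz.
have := Q (I / N2 f) (divr_ge0 I0 f0).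
have -> : 2 * (I / N2 f) * I = 2 * (I ^+ 2 / N2 f) by rewrite expr2; ring.
have -> : (I / N2 f) ^+ 2 * N2 f = I ^+ 2 / N2 f by field.
move=> h; have {}h : I ^+ 2 / N2 f <= N2 g by lra.
by move: h; rewrite ler_pdivrMr// mulrC.
Qed.

Lemma N2D f g : L2 f -> L2 g -> ip f g = 0 -> N2 (fun z => f z + g z) = N2 f + N2 g.
Proof.
move=> hf hg fg; have hfg := L2D hf hg.
have e : ip (fun z => f z + g z) (fun z => f z + g z) = ip f f + ip g g.
  rewrite ipDl// (ip_conj hfg hf) (ip_conj hfg hg) !ipDl//.
  by rewrite (ip_conj hf hg) fg conjc0 addr0 add0r -!ip_conj.
by have := congr1 (@complex.Re R) e; rewrite !ip_ff.
Qed.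

Lemma N2D_le f g : L2 f -> L2 g -> N2 (fun z => f z + g z) <= 2 * N2 f + 2 * N2 g.
Proof.
move=> hf hg; have [_ if2] := hf; have [_ ig2] := hg; have [_ ifg] := L2D hf hg.
rewrite /N2 -!RintegralZl// -RintegralD//; [|exact: (integrableZl mB 2 if2)|exact: (integrableZl mB 2 ig2)].
apply: le_Rintegral => //.
  exact: (integrableD mB (integrableZl mB 2 if2) (integrableZl mB 2 ig2)).
move=> z _; have := normcD (f z) (g z); have := normc_ge0 (f z); have := normc_ge0 (g z).
have := normc_ge0 (f z + g z); have := sqr_ge0 (normc (f z) - normc (g z)); nra.
Qed.

Lemma eq_N2 f g : (forall z, B z -> f z = g z) -> N2 f = N2 g.
Proof. by move=> fg; apply: eq_Rintegral => z /set_mem Bz; rewrite fg. Qed.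

Lemma N2N f : N2 (fun z => - f z) = N2 f.
Proof. by apply: eq_Rintegral => z _; rewrite normcN. Qed.

Lemma L2_mono al : L2 (mono al).
Proof. exact/bounded_mfun_L2/bounded_mfun_mono. Qed.

(** A phase under which a difference k of weights gives the factor -1; invariance of a coefficient c
    then reads c = - c. *)
Lemma unit_root_neg1 (k : nat) : (0 < k)%N -> exists2 u : C, normc u = 1 & u ^+ k = -1.
Proof.
move=> k0; exists (cis (pi / k%:R)); first exact: normc_cis.
have cisM (t : R) m : cis t ^+ m = cis (m%:R * t).
  elim: m => [|m ih]; first by rewrite mul0r cis0.
  by rewrite exprS ih -cisD -natr1 mulrDl mul1r addrC.
rewrite cisM mulrC divfK ?pnatr_eq0 -?lt0n//.
by apply: complexP; rewrite /= ?cospi ?sinpi ?oppr0.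
Qed.

Lemma mono_orth i al be : al i != be i -> ip (mono al) (mono be) = 0.
Proof.
move=> ab; wlog lt : al be ab / (be i < al i)%N => [H|].
  case: (ltngtP (be i) (al i)) => [/(H _ _ ab)//|h|/esym/eqP]; last by rewrite (negbTE ab).
  by rewrite (ip_conj (L2_mono be) (L2_mono al)) H ?conjc0// eq_sym.
have [u u1 uk] := unit_root_neg1 (eq_trans (subn_gt0 _ _) lt).
have hi := cintegrable_mul_conj (L2_mono al) (L2_mono be).
have [_ e] := cint_mpres mB (mpres_scl_ball bm (pred1 i) u1) (preimage_scl_ball (pred1 i) u1) hi.
have uc : u * conjc u = 1 by rewrite mulc_conj u1 expr1n.
have : ip (mono al) (mono be) = - 1 * ip (mono al) (mono be).
  rewrite -[in LHS]/(ip _ _) {1}/ip -e -ipZl; [|exact: L2_mono..].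
  apply: eq_cint => z _; rewrite !mono_scl1 rmorphM rmorphXn -uk.
  rewrite -{1}(subnK (ltnW lt)) exprD.
  have -> : u ^+ (al i - be i) * u ^+ be i * mono al z * (conjc u ^+ be i * conjc (mono be z)) =
    (u * conjc u) ^+ be i * (u ^+ (al i - be i) * mono al z * conjc (mono be z)) by rewrite exprMn; ring.
  by rewrite uc expr1n mul1r.
move: (ip _ _) => x; rewrite mulN1r => /eqP; rewrite -subr_eq0 opprK -mulr2n -mulr_natl mulf_eq0.
by rewrite pnatr_eq0 => /eqP.
Qed.

End L2.

(** * Polynomials and Cauchy estimates *)

Section polynomials.
Context (R : realType) (n : nat).
Local Notation C := R[i].
Local Notation Cn := 'cV[R[i]]_n.
Local Notation B := (@unit_ball R n).
Implicit Types (z w : Cn) (al be ga : 'I_n -> nat) (p q : Cn -> C).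

(* A slice t |-> p (z + t w) is a polynomial in t, the linear coefficient of which
   is linear in w; this is all the algebra of polynomials in n variables needed. *)
Definition slice_poly p := forall z, exists Q : Cn -> {poly C}, exists l : 'I_n -> C,
  forall w, [/\ forall t, p (z + t *: w) = (Q w).[t], (Q w)`_0 = p z &
                (Q w)`_1 = \sum_i w i 0 * l i].

Lemma slice_polyD p q : slice_poly p -> slice_poly q -> slice_poly (fun z => p z + q z).
Proof.
move=> hp hq z; have [P [l hP]] := hp z; have [Q [k hQ]] := hq z.
exists (fun w => P w + Q w), (fun i => l i + k i) => w.
have [p1 p2 p3] := hP w; have [q1 q2 q3] := hQ w; split.
- by move=> t; rewrite hornerD p1 q1.
- by rewrite coefD p2 q2.
- by rewrite coefD p3 q3 -big_split; apply: eq_bigr => i _; rewrite mulrDr.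
Qed.

Lemma slice_polyM p q : slice_poly p -> slice_poly q -> slice_poly (fun z => p z * q z).
Proof.
move=> hp hq z; have [P [l hP]] := hp z; have [Q [k hQ]] := hq z.
exists (fun w => P w * Q w), (fun i => p z * k i + l i * q z) => w.
have [p1 p2 p3] := hP w; have [q1 q2 q3] := hQ w; split.
- by move=> t; rewrite hornerM p1 q1.
- by rewrite coef0M p2 q2.
- rewrite coefM !big_ord_recl big_ord0 /= addr0 p2 q3 p3 q2 mulr_sumr mulr_suml -big_split.
  by apply: eq_bigr => i _ /=; ring.
Qed.

Lemma slice_poly_cst c : slice_poly (fun=> c).
Proof.
move=> z; exists (fun=> c%:P), (fun=> 0) => w; split=> [t||].
- by rewrite hornerC.
- by rewrite coefC.
- by rewrite coefC big1// => i _; rewrite mulr0.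
Qed.

Lemma slice_poly_coord i : slice_poly (fun z => z i 0).
Proof.
move=> z; exists (fun w => (z i 0)%:P + (w i 0)%:P * 'X), (fun j => (j == i)%:R) => w; split=> [t||].
- by rewrite !hornerE !mxE mulrC.
- by rewrite coefD coefC coefCM coefX mulr0 addr0.
- rewrite coefD coefC coefCM coefX mulr1 add0r (bigD1 i)//= eqxx mulr1 big1 ?addr0//.
  by move=> j /negbTE ->; rewrite mulr0.
Qed.

Lemma slice_poly_mono al : slice_poly (mono al).
Proof.
have hX i k : slice_poly (fun z => z i 0 ^+ k).
  elim: k => [|k ih]; first exact: slice_poly_cst.
  by under eq_fun do rewrite exprS; apply: slice_polyM => //; exact: slice_poly_coord.
rewrite /mono; elim: (index_enum _) => [|i s ih].
  by under eq_fun do rewrite big_nil; exact: slice_poly_cst.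
by under eq_fun do rewrite big_cons; exact: slice_polyM.
Qed.

Definition polyfun p := [/\ measurable_fun setT p, forall z, differentiable p z & slice_poly p].

Lemma polyfun_cst c : polyfun (fun=> c).
Proof. by split; [exact: measurable_cst|move=> z; exact: differentiable_cst|exact: slice_poly_cst]. Qed.

Lemma polyfunD p q : polyfun p -> polyfun q -> polyfun (fun z => p z + q z).
Proof.
move=> [p1 p2 p3] [q1 q2 q3]; split; [exact: measurableC_add| |exact: slice_polyD].
by move=> z; apply: (@differentiableD _ _ _ p q).
Qed.

Lemma polyfunM p q : polyfun p -> polyfun q -> polyfun (fun z => p z * q z).
Proof.
move=> [p1 p2 p3] [q1 q2 q3]; split; [exact: measurableC_mul| |exact: slice_polyM].
by move=> z; apply: (@differentiableM _ _ p q).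
Qed.

Lemma polyfun_mono al : polyfun (mono al).
Proof. by split; [exact: measurable_mono|exact: differentiable_mono|exact: slice_poly_mono]. Qed.

Lemma polyfun_sum (I : Type) (s : seq I) (c : I -> C) (al : I -> 'I_n -> nat) :
  polyfun (fun z => \sum_(i <- s) c i * mono (al i) z).
Proof.
elim: s => [|i s ih]; first by under eq_fun do rewrite big_nil; exact: polyfun_cst.
under eq_fun do rewrite big_cons; apply: polyfunD => //.
by apply: polyfunM; [exact: polyfun_cst|exact: polyfun_mono].
Qed.

Lemma polyfunB p q : polyfun p -> polyfun q -> polyfun (fun z => p z - q z).
Proof.
move=> hp hq; have := polyfunD hp (polyfunM (polyfun_cst (-1)) hq).
by under eq_fun do rewrite mulN1r.
Qed.

Lemma polyfun_bounded p : polyfun p -> bounded_mfun p.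
Proof.
move=> [mp dp sp]; split; first exact: measurable_funTS.
pose q z := p (2%:C *: z).
have hq : holomorphic_on B q.
  move=> z _;
  have -> : q = p \o scl predT 2%:C.
    by apply/funext => v; rewrite /q /=; congr p; apply/colP => i; rewrite !mxE.
  by apply: differentiable_comp; first exact: differentiable_scl_vec.
have h1 : (1 / 2 : R) < 1 by lra.
have [M hM] := bounded_on_ball h1 hq.
exists M => z Bz; have -> : p z = q ((2%:C)^-1 *: z).
  by rewrite /q scalerA mulfV ?scale1r// realC_neq0.
apply: hM; have -> : sqnorm ((2%:C)^-1 *: z) = 4^-1 * sqnorm z.
  rewrite /sqnorm mulr_sumr; apply: eq_bigr => i _; rewrite !mxE normcM exprMn; congr (_ * _).
  have -> : (2%:C)^-1 = (2^-1)%:C :> C by rewrite fmorphV.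
  by rewrite normc_real ger0_norm ?invr_ge0// expr2; lra.
have : sqnorm z < 1 := Bz; lra.
Qed.

Lemma cmean_cisXconj (i k : nat) :
  cmean (fun t => cis t ^+ i * conjc (cis t) ^+ k) = if i == k then (2 * pi)%:C else 0 :> C.
Proof.
have u t : cis t * conjc (cis t) = 1 :> C by rewrite mulc_conj normc_cis expr1n.
have c1 (h : C -> C) : (forall v : C, normc v = 1 -> differentiable h v) -> continuous (fun t => h (cis t)).
  move=> dh t; apply: (@continuous_comp _ _ _ (@cis R) h); first exact: continuous_cis.
  by apply: differentiable_continuous; apply: dh; exact: normc_cis.
case: (ltngtP i k) => [ik|ik|->].
- rewrite (_ : (fun t => _) = fun t => conjc (cis t ^+ (k - i))); last first.
    apply/funext => t; rewrite -{1}(subnK (ltnW ik)) exprD mulrCA -exprMn u expr1n mulr1.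
    by rewrite rmorphXn.
  have ii : cintegrable (@lebesgue_measure R) `[0%R, 2 * pi]%classic (fun t => cis t ^+ (k - i) : C).
    by apply: integrable_circ; apply: (c1 (fun v => v ^+ _)) => v _; exact: (@differentiableXC _ C id).
  rewrite /cmean (cint_conj (mu := @lebesgue_measure R) (measurable_itv _) ii).
  by rewrite [cint _ _ _]cmean_cisX ?conjc0// subn_gt0.
- rewrite (_ : (fun t => _) = fun t => cis t ^+ (i - k)); last first.
    by apply/funext => t; rewrite -{1}(subnK (ltnW ik)) exprD -mulrA -exprMn u expr1n mulr1.
  by rewrite cmean_cisX// subn_gt0.
- rewrite (_ : (fun t => _) = fun=> 1); last by apply/funext => t; rewrite -exprMn u expr1n.
  by rewrite cmean_cst mulr1.
Qed.

Lemma continuous_cisXconj (i k : nat) : continuous (fun t : R => cis t ^+ i * conjc (cis t) ^+ k : C).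
Proof.
have cX j : continuous (fun t : R => cis t ^+ j : C).
  move=> t; apply: (@continuous_comp _ _ _ (@cis R) (fun v : C => v ^+ j)); first exact: continuous_cis.
  by apply: differentiable_continuous; exact: (@differentiableXC _ C id).
have cN : continuous (fun t : R => conjc (cis t) ^+ k : C).
  have -> : (fun t : R => conjc (cis t) ^+ k) = (fun t => cis t ^+ k : C) \o -%R.
    by apply/funext => x /=; rewrite /cis cosN sinN.
  by move=> t; apply: continuous_comp; [exact: opp_continuous|exact: cX].
by move=> t; apply: cvgM; [exact: cX|exact: cN].
Qed.

(** Cauchy's estimate: the coefficient is a Fourier coefficient over the unit circle. *)
Lemma poly_coef_le (Q : {poly C}) (M : R) k : (forall t : R, normc Q.[cis t] <= M) ->
  normc Q`_k <= M.
Proof.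
move=> hM; have M0 : 0 <= M by apply: le_trans (hM 0); exact: normc_ge0.
have pi0 : 0 < 2 * pi :> R by rewrite mulr_gt0// pi_gt0.
have [kQ|kQ] := ltnP k (size Q); last by rewrite nth_default// normc_real normr0.
have ic j : cintegrable (@lebesgue_measure R) `[0%R, 2 * pi]%classic (fun t => cis t ^+ j * conjc (cis t) ^+ k : C).
  by apply: integrable_circ; exact: continuous_cisXconj.
have E : (fun t => Q.[cis t] * conjc (cis t) ^+ k) =
    (fun t => \sum_(i < size Q) Q`_i * (cis t ^+ i * conjc (cis t) ^+ k)).
  by apply/funext => t; rewrite horner_coef mulr_suml; apply: eq_bigr => i _; rewrite mulrA.
have e : cmean (fun t => Q.[cis t] * conjc (cis t) ^+ k) = Q`_k * (2 * pi)%:C.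
  rewrite E /cmean (cint_sum (mu := @lebesgue_measure R) (measurable_itv _)); last first.
    by move=> i; exact: (cintegrableZ (mu := @lebesgue_measure R) (measurable_itv _)).
  rewrite (bigD1 (Ordinal kQ))//= (cintZ (mu := @lebesgue_measure R) (measurable_itv _))//.
  rewrite [cint _ _ _]cmean_cisXconj eqxx big1 ?addr0// => i ik.
  rewrite (cintZ (mu := @lebesgue_measure R) (measurable_itv _))//.
  rewrite [cint _ _ _]cmean_cisXconj; case: eqP => [ik'|_]; last by rewrite mulr0.
  by move: ik; rewrite -val_eqE/= ik' eqxx.
have ce : continuous (fun t => Q.[cis t] * conjc (cis t) ^+ k).
  rewrite E; apply: (@continuous_big C); first exact: add_continuous.
  by move=> i _ t; apply: cvgM; [exact: cvg_cst|exact: continuous_cisXconj].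
have := @normc_cmean_le _ _ M ce; rewrite e normcM normc_real (gtr0_norm pi0) mulrC ler_pM2l//.
apply => t; rewrite normcM normcX normc_conj normc_cis expr1n mulr1; exact: hM.
Qed.

Lemma geometric_le2 (s : R) m : 0 <= s <= 1 / 2 -> \sum_(k < m) s ^+ k <= 2.
Proof.
move=> /andP[s0 s2]; have := subrX1 s m; set S := \sum_(k < m) _ => h.
have sm0 : 0 <= s ^+ m by rewrite exprn_ge0.
have S0 : 0 <= S by apply: sumr_ge0 => i _; rewrite exprn_ge0.
have s20 : 0 <= 1 / 2 - s by rewrite subr_ge0.
by have := mulr_ge0 S0 s20; move: h sm0; move: (s ^+ _) => x; clear; lra.
Qed.

(** Write w = s w' with s = |w| / de. By Cauchy's estimate on the slice through w', the term of
    degree k is at most M s^k, and s <= 1/2 makes the geometric series at most 2. The bounds depend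
    on p through M only, which makes them uniform along a sequence. *)
Lemma slice_taylor p z0 (de M : R) : 0 < de -> slice_poly p ->
  (forall z, sqnorm (z - z0) <= de ^+ 2 -> normc (p z) <= M) ->
  exists l : 'I_n -> C, (forall i, normc (l i) <= M / de) /\
    forall w, sqnorm w <= de ^+ 2 / 4 ->
    normc (p (z0 + w) - p z0 - \sum_i w i 0 * l i) <= 2 * M / de ^+ 2 * sqnorm w.
Proof.
move=> de0 /(_ z0)[Q [l hQ]] hM; exists l.
have deC : de%:C != 0 :> C by exact: realC_neq0.
have M0 : 0 <= M.
  apply: le_trans (hM z0 _); first exact: normc_ge0.
  by rewrite subrr /sqnorm big1 ?sqr_ge0// => i _; rewrite mxE normc_real normr0 expr0n.
have snZ (c : C) w : sqnorm (c *: w) = normc c ^+ 2 * sqnorm w.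
  by rewrite /sqnorm mulr_sumr; apply: eq_bigr => i _; rewrite mxE normcM exprMn.
have hk w k : sqnorm w <= de ^+ 2 -> normc (Q w)`_k <= M.
  move=> wd; apply: poly_coef_le => t; have [<- _ _] := hQ w; apply: hM.
  by rewrite addrAC subrr add0r snZ normc_cis expr1n mul1r.
split.
  move=> i; pose w : Cn := \col_j if j == i then de%:C else 0.
  have wd : sqnorm w <= de ^+ 2.
    rewrite /sqnorm (bigD1 i)//= mxE eqxx normc_real gtr0_norm// big1 ?addr0// => j /negbTE ji.
    by rewrite mxE ji normc_real normr0 expr0n.
  have [_ _ q1] := hQ w; have := hk w 1%N wd; rewrite q1 (bigD1 i)//= mxE eqxx big1 ?addr0; last first.
    by move=> j /negbTE ji; rewrite mxE ji mul0r.
  by rewrite normcM normc_real gtr0_norm// mulrC ler_pdivlMr.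
move=> w wd; set s := Num.sqrt (sqnorm w) / de.
have s0 : 0 <= s by rewrite divr_ge0 ?sqrtr_ge0// ltW.
have sE : s ^+ 2 * de ^+ 2 = sqnorm w.
  by rewrite -exprMn divfK ?gt_eqF// sqr_sqrtr// sqnorm_ge0.
have s2 : s <= 1 / 2.
  have d20 : 0 < de ^+ 2 by rewrite exprn_gt0.
  have : s ^+ 2 <= (1 / 2) ^+ 2.
    rewrite -(ler_pM2r d20) sE; apply: le_trans wd _; rewrite expr2 expr2; lra.
  by rewrite ler_pXn2r ?nnegrE//; lra.
have [sz|sn0] := eqVneq s 0.
  have w0 : w = 0.
    apply/colP => i; rewrite mxE; apply: normc_eq0; apply/eqP; rewrite eq_le normc_ge0 andbT.
    by apply: normc_coord_le => //; rewrite -sE sz expr0n mul0r.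
  rewrite w0 addr0 subrr sub0r normcN big1 => [|i _]; last by rewrite mxE mul0r.
  by rewrite normc_real normr0 -w0 !mulr_ge0 ?sqnorm_ge0 ?invr_ge0 ?sqr_ge0.
have sp : 0 < s by rewrite lt_def sn0.
have sC : s%:C != 0 :> C by exact: realC_neq0.
pose w' := s%:C^-1 *: w.
have ww : w = s%:C *: w' by rewrite scalerA mulfV// scale1r.
have w'd : sqnorm w' <= de ^+ 2.
  have sw : sqnorm w = s ^+ 2 * sqnorm w' by rewrite [in LHS]ww snZ normc_real gtr0_norm.
  by rewrite -(ler_pM2l (exprn_gt0 2 sp)) -sw sE.
have [q0 qz q1] := hQ w'.
have -> : \sum_i w i 0 * l i = s%:C * (Q w')`_1.
  by rewrite q1 mulr_sumr; apply: eq_bigr => i _; rewrite {1}ww mxE mulrA.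
rewrite {1}ww q0 -qz.
have -> : (Q w').[s%:C] - (Q w')`_0 - s%:C * (Q w')`_1 = \sum_(k < size (Q w')) (Q w')`_k.+2 * s%:C ^+ k.+2.
  rewrite (@horner_coef_wide _ (size (Q w')).+2); last by rewrite ltnW.
  have e (F : nat -> C) m : \sum_(i < m.+2) F i = F 0%N + (F 1%N + \sum_(k < m) F k.+2).
    by rewrite !big_ord_recl.
  rewrite (e (fun i => (Q w')`_i * s%:C ^+ i)) expr0 expr1; move: (\sum_(k < _) _) => S; ring.
apply: (@le_trans _ _ (\sum_(k < size (Q w')) M * s ^+ 2 * s ^+ k)).
  elim/big_ind2: _ => [|x1 x2 y1 y2 h1 h2|k _].
  - by rewrite normc_real normr0.
  - by apply: le_trans (normcD _ _) _; exact: lerD.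
  - rewrite normcM normcX normc_real gtr0_norm// -mulrA -exprD ler_wpM2r ?exprn_ge0//.
    exact: hk.
rewrite -mulr_sumr; set S := \sum_(k < _) _.
have S2 : S <= 2.
  by apply: geometric_le2; rewrite s0.
have -> : 2 * M / de ^+ 2 * sqnorm w = M * s ^+ 2 * 2.
  by rewrite -sE; field; rewrite gt_eqF.
have Ms : 0 <= M * s ^+ 2 by rewrite mulr_ge0 ?sqr_ge0.
exact: ler_wpM2l.
Qed.


End polynomials.

(** * Bounded point evaluations *)

Section point_evaluation.
Context (R : realType) (n : nat).
Local Notation C := R[i].
Local Notation Cn := 'cV[R[i]]_n.
Local Notation B := (@unit_ball R n).
Implicit Types (z w : Cn) (p q : Cn -> C).
Variables (mu : {measure set Cn -> \bar R}) (bm : ball_measure mu).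
Let mB := @measurable_unit_ball R n.
Local Notation leb := (lebesgueCn R n).

(** The comparison is assumed inside A only, so both measures are first restricted to A. *)
Lemma ge0_integral_dom (m1 m2 : {measure set Cn -> \bar R}) (K : R) A (g : Cn -> R) :
  0 < K -> measurable A -> measurable_fun setT g -> (forall z, 0 <= g z) ->
  (forall S, measurable S -> S `<=` A -> (m1 S <= K%:E * m2 S)%E) ->
  (\int[m1]_(z in A) (g z)%:E <= K%:E * \int[m2]_(z in A) (g z)%:E)%E.
Proof.
move=> K0 mA mg g0 h.
have K0' : (0 <= K) by exact: ltW.
pose k := NngNum K0'.
rewrite -(@ge0_integral_mscale _ _ _ m2 A mA k)//; last 2 first.
- by apply/measurable_EFinP; exact: measurable_funTS.
- by move=> z _; rewrite lee_fin.
rewrite (@eq_measure_integral _ _ _ A (mrestr m1 mA)); last first.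
  by move=> S mS SA; rewrite /mrestr; congr (m1 _); apply/esym/setIidPl.
rewrite [X in (_ <= X)%E](@eq_measure_integral _ _ _ A (mrestr (mscale k m2) mA)); last first.
  by move=> S mS /setIidPl/esym SA; exact: (congr1 (mscale k m2) SA).
apply: ge0_le_measure_integral => //.
- move=> S mS; rewrite /mrestr; apply: h; first exact: measurableI.
  exact: subIsetr.
- exact/measurable_EFinP.
Qed.

(* p(z)^2 is the mean over circles of p(z + u w)^2, and thus its mean over a small
   ball around z. *)
Lemma point_evaluation (rho : R) : rho < 1 -> exists K : R, 0 <= K /\ forall p, polyfun p ->
  forall z, sqnorm z <= rho -> normc (p z) ^+ 2 <= K * N2 mu p.
Proof.
move=> rho1; have [rho0|rho0] := ltP rho 0.
  exists 0; split=> // p _ z zr.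
  by have := lt_le_trans rho0 (le_trans (sqnorm_ge0 z) zr); rewrite ltxx.
(* From |z + w|^2 <= (1 + t) |z|^2 + (1 + 1/t) |w|^2: with this t, the ball of squared radius d2
   around any z with |z|^2 <= rho stays in |y|^2 <= rho' < 1. *)
pose t := (1 - rho) / 2; have t0 : 0 < t by rewrite /t; lra.
pose d2 := (1 - rho) / 4 / (1 + t^-1).
have tV : 0 < t^-1 by rewrite invr_gt0.
have d20 : 0 < d2 by rewrite divr_gt0//; lra.
have d21 : d2 < 1 by rewrite ltr_pdivrMr; lra.
pose rho' := (3 + rho) / 4; have rho'1 : rho' < 1 by rewrite /rho'; lra.
pose D := [set w : Cn | sqnorm (w - 0) < d2].
have mD : measurable D by exact: measurable_sqnorm_ball.
have DB : D `<=` B by move=> w; rewrite /D /= subr0 => h; exact: lt_trans h d21.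
have zD z w : sqnorm z <= rho -> D w -> sqnorm (z + w) <= rho'.
  rewrite /D /= subr0 => zr wD.
  have : sqnorm (z + w) <= (1 + t) * sqnorm z + (1 + t^-1) * sqnorm w.
    rewrite /sqnorm !mulr_sumr -big_split/=; apply: ler_sum => i _.
    rewrite !mxE; have := normcD (z i 0) (w i 0).
    move: (normc_ge0 (z i 0)) (normc_ge0 (w i 0)) (normc_ge0 (z i 0 + w i 0)).
    move: (normc (z i 0)) (normc (w i 0)) (normc (_ + _)) => a b c a0 b0 c0 cab.
    have : c ^+ 2 <= (a + b) ^+ 2 by rewrite ler_pXn2r ?nnegrE ?addr_ge0.
    have : 0 <= t^-1 * (t * a - b) ^+ 2 by rewrite mulr_ge0 ?sqr_ge0// ltW.
    have -> : t^-1 * (t * a - b) ^+ 2 = t * a ^+ 2 - 2 * a * b + t^-1 * b ^+ 2 by field; rewrite gt_eqF.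
    lra.
  have h1 : (1 + t) * sqnorm z <= (1 + t) * rho by rewrite ler_pM2l//; lra.
  have h2 : (1 + t^-1) * sqnorm w <= (1 - rho) / 4.
    rewrite mulrC -ler_pdivlMr; [exact: ltW|lra].
  have h3 : 0 <= (1 - rho) ^+ 2 by exact: sqr_ge0.
  move: h1 h2; rewrite /t /rho' => h1 h2 h4; apply: le_trans h4 _; nra.
have [Kg Kg0 hKg] := ball_measure_ge bm rho'1.
have lebD : (leb D < +oo)%E.
  apply: le_lt_trans (lebesgueCn_ball_lty R n); apply: le_measure => //; rewrite inE//.
have B0 : B (0 : Cn) by rewrite /unit_ball/= /sqnorm big1// => i _; rewrite mxE normc_real normr0 expr0n.
have lebD0 : 0 < fine (leb D).
  rewrite fine_gt0// lebD andbT lt_def measure_ge0 andbT; apply/eqP => D0.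
  have d0 : 0 < Num.sqrt d2 by rewrite sqrtr_gt0.
  have := ball_measure_nbhs bm B0 d0; rewrite sqr_sqrtr ?(ltW d20)//.
  by rewrite (ball_measure_dom bm mD D0) ltxx.
exists (Kg / fine (leb D)); split; first by rewrite divr_ge0 ?ltW.
move=> p hp z zr; have [mp dp _] := hp.
have [_ [M hM]] := polyfun_bounded hp.
have bp := polyfun_bounded hp.
pose g y := normc (p y) ^+ 2.
have mg : measurable_fun setT g by exact: measurable_sqr_normc.
have g0 y : 0 <= g y by exact: sqr_ge0.
have gM y : B y -> g y <= M ^+ 2.
  by move=> By; rewrite ler_pXn2r ?nnegrE ?normc_ge0 ?hM// (le_trans (normc_ge0 _) (hM y By)).
have zDB w : D w -> B (z + w) by move=> Dw; exact: le_lt_trans (zD _ _ zr Dw) rho'1.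
have scD u : normc u = 1 -> scl predT u @^-1` D = D.
  by move=> u1; apply/seteqP; split=> w; rewrite /D /= !subr0 sqnorm_scl.
(* The square is inside the mean, so that the triangle inequality for integrals directly bounds
   |p(z)|^2 by the mean of |p|^2. *)
pose k (s : measurableTypeR R) w : C := p (z + scl predT (cis s) w) ^+ 2.
have mshift : measurable_fun setT (fun w : Cn => z + w).
  by under eq_fun do rewrite addrC; exact: measurable_shift.
have nk y : normc (p y ^+ 2) = g y by rewrite normcX.
have ig : cintegrable leb D (fun w => p (z + w) ^+ 2).
  apply: (cintegrable_bounded (M := M ^+ 2) mD lebD).
    apply: measurableC_exp; apply: measurable_funTS; exact: (measurableT_comp mp mshift).
  by move=> w Dw; rewrite nk gM//; exact: zDB.
pose J := \int[leb]_(w in D) g (z + w).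
pose H0 := cint leb D (fun w => p (z + w) ^+ 2).
have H0J : normc H0 <= J.
  apply: le_trans (normc_cint_le mD ig) _; rewrite le_eqVlt; apply/orP; left; apply/eqP.
  by apply: eq_Rintegral => w _; rewrite nk.
have iga := (cintegrableP leb mD _).1 ig.
have nkJ s : \int[leb]_(w in D) normc (k s w) = J.
  have [_ e] := Rintegral_mpres mD (mpres_scl predT (normc_cis s)) (scD _ (normc_cis s)) iga.2.
  by rewrite [LHS]e; apply: eq_Rintegral => w _; rewrite nk.
have Jk s : cintegrable leb D (k s) /\ cint leb D (k s) = H0.
  exact: (cint_mpres mD (mpres_scl predT (normc_cis s)) (scD _ (normc_cis s)) ig).
have kD s w : D w -> normc (k s w) <= M ^+ 2.
  move=> Dw; rewrite nk; apply/gM/zDB.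
  by rewrite -[D _]/((scl predT (cis s) @^-1` D) w) scD// normc_cis.
pose circ := `[0%R, 2 * pi]%classic : set R.
have sl t' w : z + scl predT t' w = z + t' *: w.
  by congr (_ + _); apply/colP => i; rewrite !mxE.
have dsl w (v : C) : differentiable (fun v : C => p (z + v *: w) ^+ 2) v.
  apply: (@differentiableXC _ C (fun v : C => p (z + v *: w))).
  by apply: (@differentiable_comp _ _ _ _ (fun v : C => z + v *: w) p).
have fin : ((@lebesgue_measure R) circ < +oo)%E.
  by rewrite lebesgue_measure_itv/=; case: ifP => _; rewrite ?ltry// -EFinB ltry.
have o01 : (0 : R) <= (1 : R) <= (1 : R) by apply/andP; split; [exact: ler01|exact: lexx].
have mk : measurable_fun setT (fun x : measurableTypeR R * Cn => k x.1 x.2).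
  apply: measurableC_exp; apply: (measurableT_comp mp); apply: (measurableT_comp mshift).
  apply: measurable_scl_comp; last exact: measurable_snd.
  by apply: (measurableT_comp (measurable_continuousRC (@continuous_cis R))); exact: measurable_fst.
have F : cint (@lebesgue_measure R) circ (fun s => cint leb D (k s)) =
         cint leb D (fun w => cint (@lebesgue_measure R) circ (k ^~ w)).
  apply: (@cint_fubini R _ _ (measurableTypeR R) Cn (@lebesgue_measure R) leb circ D (measurable_itv _) mD fin k J).
  - exact: measurable_funTS.
  - by move=> s _; split; [exact: (Jk s).1|rewrite nkJ].
  - move=> w Dw; apply: (cintegrable_bounded (mu := @lebesgue_measure R) (M := M ^+ 2) (measurable_itv _) fin).
      apply: measurable_funTS.
      exact: (measurableT_comp mk (@pair2_measurable _ _ (measurableTypeR R) Cn w)).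
    by move=> s _; exact: kD.
have E1 : cint (@lebesgue_measure R) circ (fun s => cint leb D (k s)) = (2 * pi)%:C * H0.
  by rewrite -cmean_cst; apply: eq_cint => s _; rewrite (Jk s).2.
have E2 : cint leb D (fun w => cint (@lebesgue_measure R) circ (k ^~ w)) =
    (2 * pi)%:C * (p z ^+ 2 * (fine (leb D))%:C).
  have ic : cintegrable leb D (fun=> 1).
    by apply: (cintegrable_bounded (M := 1) mD lebD) => [|w _]; [exact: measurable_cst|rewrite normc_real normr1].
  have -> : (fine (leb D))%:C = cint leb D (fun=> 1).
    have -> : (fun=> 1 : C) = (fun _ : Cn => (1 : R)%:C) by [].
    by rewrite cint_real Rintegral_cst// mul1r.
  rewrite mulrA -(cintZ mD _ ic); apply: eq_cint => w Dw; rewrite mulr1.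
  have := cmean_center o01 (fun v _ => dsl w v); rewrite scale0r addr0 => <-.
  by congr cmean; apply/funext => s; rewrite /k sl mul1r.
have pC : (2 * pi)%:C != 0 :> C by apply: realC_neq0; rewrite mulr_gt0// pi_gt0.
have E : H0 = p z ^+ 2 * (fine (leb D))%:C by apply: (mulfI pC); rewrite -E1 F E2.
have key : normc (p z) ^+ 2 * fine (leb D) <= J.
  by apply: le_trans H0J; rewrite E normcM normcX normc_real (gtr0_norm lebD0).
rewrite mulrAC ler_pdivlMr//; apply: le_trans key _.
pose D' := [set y : Cn | sqnorm (y - z) < d2].
have mD' : measurable D' by exact: measurable_sqnorm_ball.
have DE : (fun w => z + w) @^-1` D' = D.
  by apply/seteqP; split=> w; rewrite /D /D' /= subr0 addrAC subrr add0r.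
have mpz : mpres leb (fun w => z + w).
  by have -> : (fun w => z + w) = (fun w => w + z); [apply/funext => w; rewrite addrC|exact: mpres_shift].
have D'B : D' `<=` [set y | sqnorm y <= rho'].
  by move=> y yD; rewrite -(subrKC z y); apply: zD => //; rewrite /D /= subr0.
have D'B1 : D' `<=` B by move=> y /D'B /= h; exact: le_lt_trans h rho'1.
have mg' A : measurable_fun A (fun y => (g y)%:E).
  by apply/measurable_EFinP; exact: measurable_funTS.
have [_ ip2] := bounded_mfun_L2 bm bp.
have JE : (\int[leb]_(w in D) (g (z + w))%:E <= Kg%:E * \int[mu]_(y in B) (g y)%:E)%E.
  rewrite -DE (ge0_integral_mpres mpz mD' (mg' D')); last by move=> y _; rewrite lee_fin.
  apply: le_trans (ge0_integral_dom (m1 := leb) (m2 := mu) Kg0 mD' mg g0 _) _.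
    by move=> S mS SD; apply: hKg => // y /SD; exact: D'B.
  rewrite lee_wpmul2l ?lee_fin ?(ltW Kg0)//; apply: ge0_subset_integral => //.
  by move=> y _; rewrite lee_fin.
have finB : (\int[mu]_(y in B) (g y)%:E)%E \is a fin_num by exact: integrable_fin_num.
rewrite -lee_fin /J /N2 /Rintegral EFinM [X in (_ <= _ * X)%E]fineK//.
apply: le_trans JE; rewrite fineK//; apply: integrable_fin_num => //.
have := iga.2; apply: eq_integrable => // w _; by rewrite nk.
Qed.

End point_evaluation.

Section sequences.
Context (R : realType).
Local Notation C := R[i].

Lemma cauchy_real (u : nat -> R) :
  (forall e, 0 < e -> exists N, forall j k, (N <= j)%N -> (N <= k)%N -> `|u j - u k| <= e) ->
  exists l : R, u @ \oo --> l.
Proof.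
move=> cu; apply/cvg_ex; apply/cauchy_cvgP; apply: cauchy_exP => e e0.
have [N hN] := cu (e / 2) (divr_gt0 e0 (ltr0n _ 2)).
exists (u N), N => // k /= Nk; rewrite /ball/=.
by apply: le_lt_trans (hN N k _ _) _ => //; lra.
Qed.

Definition cto (u : nat -> C) (l : C) :=
  forall e : R, 0 < e -> exists N, forall k, (N <= k)%N -> normc (u k - l) <= e.

Lemma cauchy_complex (u : nat -> C) :
  (forall e : R, 0 < e -> exists N, forall j k, (N <= j)%N -> (N <= k)%N -> normc (u j - u k) <= e) ->
  exists2 l, cto u l & ((fun k => complex.Re (u k)) @ \oo --> complex.Re l) /\ ((fun k => complex.Im (u k)) @ \oo --> complex.Im l).
Proof.
move=> cu.
have ReB (z w : C) : complex.Re (z - w) = complex.Re z - complex.Re w by case: z w => ? ? [].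
have ImB (z w : C) : complex.Im (z - w) = complex.Im z - complex.Im w by case: z w => ? ? [].
have [x hx] : exists l : R, (fun k => complex.Re (u k)) @ \oo --> l.
  apply: cauchy_real => e e0; have [N hN] := cu e e0; exists N => j k Nj Nk.
  by rewrite /= -ReB; apply: le_trans (Re_le_normc _) (hN _ _ _ _).
have [y hy] : exists l : R, (fun k => complex.Im (u k)) @ \oo --> l.
  apply: cauchy_real => e e0; have [N hN] := cu e e0; exists N => j k Nj Nk.
  by rewrite /= -ImB; apply: le_trans (Im_le_normc _) (hN _ _ _ _).
exists (x +i* y) => // e e0.
have e20 : 0 < e / 2 by rewrite divr_gt0.
have /cvgrPdist_le /(_ _ e20) [N1 _ h1] := hx.
have /cvgrPdist_le /(_ _ e20) [N2 _ h2] := hy.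
exists (maxn N1 N2) => k; rewrite geq_max => /andP[k1 k2].
apply: le_trans (normc_le_ReIm _) _; rewrite ReB ImB /=.
move: (h1 k k1) (h2 k k2); rewrite /= (distrC x) (distrC y); lra.
Qed.

Lemma cto_le (u : nat -> C) l c (M : R) N : cto u l ->
  (forall k, (N <= k)%N -> normc (c - u k) <= M) -> normc (c - l) <= M.
Proof.
move=> ul hM; apply/ler_addgt0Pr => e e0; have [K hK] := ul e e0.
have -> : c - l = (c - u (maxn N K)) + (u (maxn N K) - l) by ring.
by apply: le_trans (normcD _ _) _; apply: lerD; [apply: hM; exact: leq_maxl|apply: hK; exact: leq_maxr].
Qed.

Lemma cto_cst c : cto (fun=> c) c.
Proof. by move=> e e0; exists 0%N => k _; rewrite subrr normc_real normr0 ltW. Qed.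

Lemma ctoD u v l k : cto u l -> cto v k -> cto (fun i => u i + v i) (l + k).
Proof.
move=> hu hv e e0; have e20 : 0 < e / 2 by rewrite divr_gt0.
have [N1 h1] := hu _ e20; have [N2 h2] := hv _ e20.
exists (maxn N1 N2) => i; rewrite geq_max => /andP[i1 i2].
have -> : u i + v i - (l + k) = (u i - l) + (v i - k) by ring.
by apply: le_trans (normcD _ _) _; have := h1 i i1; have := h2 i i2; lra.
Qed.

Lemma ctoM c u l : cto u l -> cto (fun i => c * u i) (c * l).
Proof.
move=> hu e e0; pose M := normc c + 1; have M0 : 0 < M by rewrite ltr_wpDl ?normc_ge0.
have [N hN] := hu (e / M) (divr_gt0 e0 M0); exists N => i Ni.
rewrite -mulrBr normcM; have := hN i Ni; rewrite ler_pdivlMr// => h.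
apply: le_trans h; rewrite mulrC ler_wpM2l ?normc_ge0// lerDl//.
Qed.

Lemma cto_sum (I : Type) (s : seq I) (u : I -> nat -> C) l : (forall i, cto (u i) (l i)) ->
  cto (fun k => \sum_(i <- s) u i k) (\sum_(i <- s) l i).
Proof.
move=> h; elim: s => [|i s ih].
  by under eq_fun do rewrite big_nil; rewrite big_nil; exact: cto_cst.
by under eq_fun do rewrite big_cons; rewrite big_cons; exact: ctoD.
Qed.

End sequences.

(** * Limits of polynomials in square mean *)

Section holomorphic_limit.
Context (R : realType) (n : nat).
Local Notation C := R[i].
Local Notation Cn := 'cV[R[i]]_n.
Local Notation B := (@unit_ball R n).
Implicit Types (z w : Cn).

Lemma differentiable_quadratic (g : Cn -> C) z0 (l : 'I_n -> C) (r K : R) : 0 < r -> 0 <= K ->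
  (forall w, sqnorm w <= r ^+ 2 -> normc (g (z0 + w) - g z0 - \sum_i w i 0 * l i) <= K * sqnorm w) ->
  differentiable g z0.
Proof.
move=> r0 K0 hg.
have lin : linear (fun w : Cn => \sum_i w i 0 * l i).
  move=> k x y; rewrite /GRing.scale/= mulr_sumr -big_split; apply: eq_bigr => i _.
  by rewrite !mxE mulrDl mulrA.
pose D : {linear Cn -> C} := HB.pack (fun w : Cn => \sum_i w i 0 * l i) (GRing.isLinear.Build _ _ _ _ _ lin).
have cD : continuous D.
  apply: (@continuous_big C); first exact: add_continuous.
  move=> i _ x; have c : {for x, continuous (fun z : Cn => z i 0 : C)} by exact: coord_continuous.
  exact: (cvgM c (cvg_cst _)).
apply: (eps_differentiable cD) => e e0.
pose n1 : R := n.+1%:R; have n10 : 1 <= n1 by rewrite ler1n.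
have n1p : 0 < n1 by rewrite ltr0n.
have K1 : 0 < K + 1 by lra.
(* The norm of a column is the sup norm t, and the sum of squares is at most (n + 1) t^2; n + 1 is
   positive even for n = 0. *)
pose de := Num.min (r / n1) (e / ((K + 1) * n1)).
have de0 : 0 < de by rewrite lt_min !divr_gt0// mulr_gt0.
have de1 : de <= r / n1 by rewrite ge_min lexx.
have de2 : de <= e / ((K + 1) * n1) by rewrite ge_min lexx orbT.
exists de => // h hd.
have [t t0 hE] : exists2 t : R, 0 <= t & `|h| = t%:C.
  have := normr_ge0 h; case: (`|h|) => a b; rewrite lecE/= => /andP[/eqP -> a0].
  by exists a.
have td : t < de by move: hd; rewrite hE ltcR.
have ht i : normc (h i 0) <= t.
  apply/ler_addgt0Pr => x x0; apply: ltW.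
  have tx : 0 < t + x by lra.
  by apply: ((mx_norm_lt h tx).1 _ i); rewrite hE ltcR; lra.
have sn : sqnorm h <= n1 * t ^+ 2.
  apply: (@le_trans _ _ (\sum_(i < n) t ^+ 2)).
    by apply: ler_sum => i _; rewrite ler_pXn2r ?nnegrE ?normc_ge0.
  by rewrite sumr_const card_ord -mulr_natl ler_wpM2r ?sqr_ge0// ler_nat.
rewrite hE normrE_c -rmorphM lec_real.
have hr : sqnorm h <= r ^+ 2.
  apply: le_trans sn _; have k1 : t * n1 <= r by rewrite -ler_pdivlMr//; exact: le_trans (ltW td) de1.
  have : (t * n1) ^+ 2 <= r ^+ 2 by rewrite ler_pXn2r ?nnegrE//; [exact: mulr_ge0 t0 (ltW n1p)|exact: ltW].
  apply: le_trans; rewrite exprMn mulrC ler_wpM2l ?sqr_ge0//.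
  by rewrite expr2 ler_peMl// ltW.
apply: le_trans (hg h hr) _.
have k2 : t * ((K + 1) * n1) <= e.
  by rewrite -ler_pdivlMr ?mulr_gt0//; exact: le_trans (ltW td) de2.
apply: (@le_trans _ _ (K * (n1 * t ^+ 2))); first by rewrite ler_wpM2l.
have -> : K * (n1 * t ^+ 2) = t * (K * n1) * t by ring.
rewrite ler_wpM2r//; apply: le_trans k2; rewrite ler_wpM2l// ler_wpM2r ?ltW//; lra.
Qed.


Variables (mu : {measure set Cn -> \bar R}) (bm : ball_measure mu).
Let mB := @measurable_unit_ball R n.

Lemma fatou_N2 (q : nat -> Cn -> C) (h : Cn -> C) (e : R) : (forall j, L2 mu (q j)) ->
  (forall z, B z -> ((fun k => complex.Re (q k z)) @ \oo --> complex.Re (h z)) /\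
                    ((fun k => complex.Im (q k z)) @ \oo --> complex.Im (h z))) ->
  (forall j, N2 mu (q j) <= e) -> L2 mu h /\ N2 mu h <= e.
Proof.
move=> hq qh qe.
have mh : measurable_fun B h.
  apply/measurable_complexP; split.
    apply: (measurable_fun_cvg (h := fun k z => complex.Re (q k z))).
      by move=> j; have [/measurable_complexP[]] := hq j.
    by move=> z Bz; have [] := qh z Bz.
  apply: (measurable_fun_cvg (h := fun k z => complex.Im (q k z))).
    by move=> j; have [/measurable_complexP[]] := hq j.
  by move=> z Bz; have [] := qh z Bz.
have lim z : B z -> limn_einf (fun j => (normc (q j z) ^+ 2)%:E) = (normc (h z) ^+ 2)%:E.
  move=> Bz; have [h1 h2] := qh z Bz.
  have : (fun j => (normc (q j z) ^+ 2)%:E) @ \oo --> (normc (h z) ^+ 2)%:E.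
    apply: cvg_EFin; first exact: nearW.
    have -> : fine \o (fun j => (normc (q j z) ^+ 2)%:E) = fun j => complex.Re (q j z) * complex.Re (q j z) + complex.Im (q j z) * complex.Im (q j z).
      by apply/funext => j /=; rewrite normc_sqrE !expr2.
    by rewrite normc_sqrE !expr2; exact: cvgD (cvgM h1 h1) (cvgM h2 h2).
  by move/cvg_limn_einf_sup => -[].
have Ie : (\int[mu]_(z in B) (normc (h z) ^+ 2)%:E <= e%:E)%E.
  rewrite (eq_integral (fun z => limn_einf (fun j => (normc (q j z) ^+ 2)%:E))); last first.
    by move=> z /set_mem Bz; rewrite lim.
  apply: le_trans (@fatou _ _ _ mu B mB (fun j z => (normc (q j z) ^+ 2)%:E) _ _) _.
  - by move=> j; apply/measurable_EFinP; apply: measurable_sqr_normc; have [] := hq j.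
  - by move=> j z _; rewrite lee_fin sqr_ge0.
  rewrite limn_einf_lim; apply: lime_le; first exact: is_cvg_einfs.
  apply: nearW => j; apply: (@le_trans _ _ (\int[mu]_(z in B) (normc (q j z) ^+ 2)%:E)%E).
    by apply: ereal_inf_lbound; exists j => //=.
  have [_ ij] := hq j; rewrite -[X in (X <= _)%E]fineK ?integrable_fin_num// lee_fin.
  exact: qe.
have L2h : L2 mu h.
  split=> //; apply/integrableP; split.
    by apply/measurable_EFinP; exact: measurable_sqr_normc.
  rewrite (eq_integral (fun z => (normc (h z) ^+ 2)%:E)).
    exact: le_lt_trans Ie (ltry _).
  by move=> z _; rewrite gee0_abs// lee_fin sqr_ge0.
split=> //; rewrite -lee_fin; apply: le_trans Ie; have [_ ih] := L2h.
by rewrite /N2 /Rintegral fineK// integrable_fin_num.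
Qed.

(** The limit is holomorphic because the p k have first order expansions with a common quadratic
    remainder, by [slice_taylor], and linear coefficients that converge; such an expansion then
    holds for g. *)
Lemma polyfun_limit (p : nat -> Cn -> C) : (forall k, polyfun (p k)) ->
  (forall e : R, 0 < e -> exists N, forall j k, (N <= j)%N -> (N <= k)%N ->
    N2 mu (fun z => p j z - p k z) <= e) ->
  exists g : Cn -> C, [/\ holomorphic_on B g, L2 mu g, forall z, ~ B z -> g z = 0 &
   forall e : R, 0 < e -> exists N, forall k, (N <= k)%N -> N2 mu (fun z => g z - p k z) <= e].
Proof.
move=> hp cp.
have unif (rho : R) : rho < 1 -> forall e : R, 0 < e -> exists N, forall j k z, (N <= j)%N -> (N <= k)%N ->
    sqnorm z <= rho -> normc (p j z - p k z) <= e.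
  move=> rho1 e e0; have [K [K0 hK]] := point_evaluation bm rho1.
  have K1 : 0 < K + 1 by lra.
  have [N hN] := cp (e ^+ 2 / (K + 1)) (divr_gt0 (exprn_gt0 2 e0) K1).
  exists N => j k z Nj Nk zr; rewrite -(@ler_pXn2r _ 2)// ?nnegrE ?normc_ge0 ?(ltW e0)//.
  apply: le_trans (hK _ (polyfunB (hp j) (hp k)) z zr) _.
  have := hN j k Nj Nk; rewrite ler_pdivlMr// => h.
  have := N2_ge0 mu (fun z => p j z - p k z); nra.
have ptw z : B z -> exists l, cto (p ^~ z) l /\
    ((fun k => complex.Re (p k z)) @ \oo --> complex.Re l) /\ ((fun k => complex.Im (p k z)) @ \oo --> complex.Im l).
  move=> Bz; have [|l h1 h2] := @cauchy_complex _ (p ^~ z); last by exists l.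
  by move=> e e0; have [N hN] := unif _ Bz e e0; exists N => j k Nj Nk; exact: hN.
pose G z := [set l : C | cto (p ^~ z) l /\
    ((fun k => complex.Re (p k z)) @ \oo --> complex.Re l) /\ ((fun k => complex.Im (p k z)) @ \oo --> complex.Im l)].
pose g z : C := if `[< B z >] then xget 0 (G z) else 0.
have gP z : B z -> cto (p ^~ z) (g z) /\
    ((fun k => complex.Re (p k z)) @ \oo --> complex.Re (g z)) /\ ((fun k => complex.Im (p k z)) @ \oo --> complex.Im (g z)).
  move=> Bz; rewrite /g asboolT//; exact: (@xgetPex _ 0 (G z) (ptw z Bz)).
have gunif (rho : R) : rho < 1 -> forall e : R, 0 < e -> exists N, forall k z, (N <= k)%N ->
    sqnorm z <= rho -> normc (p k z - g z) <= e.
  move=> rho1 e e0; have [N hN] := unif _ rho1 e e0; exists N => k z Nk zr.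
  have Bz : B z by exact: le_lt_trans zr rho1.
  by apply: (cto_le (N := N) (gP z Bz).1) => j Nj; exact: hN.
have fat N k (e : R) : (forall j, (N <= j)%N -> N2 mu (fun z => p j z - p k z) <= e) ->
    L2 mu (fun z => g z - p k z) /\ N2 mu (fun z => g z - p k z) <= e.
  move=> h; apply: (@fatou_N2 (fun j z => p (j + N)%N z - p k z)).
  - by move=> j; apply: bounded_mfun_L2 => //; apply: polyfun_bounded; exact: polyfunB.
  - have ReB (z w : C) : complex.Re (z - w) = complex.Re z - complex.Re w by case: z w => ? ? [].
    have ImB (z w : C) : complex.Im (z - w) = complex.Im z - complex.Im w by case: z w => ? ? [].
    move=> z Bz; have [_ [h1 h2]] := gP z Bz; split.
      rewrite ReB; under eq_fun do rewrite ReB; apply: cvgB; last exact: cvg_cst.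
      by rewrite (cvg_shiftn N (fun j => complex.Re (p j z))).
    rewrite ImB; under eq_fun do rewrite ImB; apply: cvgB; last exact: cvg_cst.
    by rewrite (cvg_shiftn N (fun j => complex.Im (p j z))).
  - by move=> j; apply: h; exact: leq_addl.
exists g; split.
- move=> z0 Bz0; have [d /andP[d0 _] hd] := sqnorm_le_half z0 Bz0 (ltr01 : 0 < (1 : R)).
  have rho1 : (1 + sqnorm z0) / 2 < 1 by have : sqnorm z0 < 1 := Bz0; lra.
  pose de := d / 2; have de0 : 0 < de by rewrite divr_gt0.
  have hde z : sqnorm (z - z0) <= de ^+ 2 -> sqnorm z <= (1 + sqnorm z0) / 2.
    by move=> h; apply: hd; apply: le_lt_trans h _; rewrite /de; nra.
  have [N0 hN0] := unif _ rho1 1 ltr01.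
  have [_ [M0 hM0]] := polyfun_bounded (hp N0).
  pose M := M0 + 1.
  (* From N0 on, the polynomials are within 1 of p N0 near z0, so that M bounds all of them
     there. *)
  pose q k := p (k + N0)%N.
  have qM k z : sqnorm (z - z0) <= de ^+ 2 -> normc (q k z) <= M.
    move=> zd; have zr := hde z zd; have Bz : B z by exact: le_lt_trans zr rho1.
    have := normcD (q k z - p N0 z) (p N0 z); rewrite subrK => h; apply: le_trans h _.
    by rewrite addrC; apply: lerD; [exact: hM0|apply: hN0 => //; exact: leq_addl].
  have /choice[L hL] : forall k, exists l : 'I_n -> C, (forall i, normc (l i) <= M / de) /\
      forall w, sqnorm w <= de ^+ 2 / 4 ->
      normc (q k (z0 + w) - q k z0 - \sum_i w i 0 * l i) <= 2 * M / de ^+ 2 * sqnorm w.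
    by move=> k; apply: slice_taylor => //; [have [_ _] := hp (k + N0)%N|exact: qM].
  have M_ge0 : 0 <= M.
    apply: le_trans (normc_ge0 (q 0%N z0)) (qM 0%N z0 _); rewrite subrr /sqnorm big1 ?sqr_ge0// => i _.
    by rewrite mxE normc_real normr0 expr0n.
  pose K := 2 * M / de ^+ 2.
  have K0 : 0 <= K by apply: divr_ge0; [exact: mulr_ge0|exact: sqr_ge0].
  have d4 : de ^+ 2 / 4 = (de / 2) ^+ 2 by move: (de) => x; rewrite !expr2; field.
  have cL i : exists2 l, cto (fun k => L k i) l & True.
    have [|l hl _] := @cauchy_complex _ (fun k => L k i); last by exists l.
    (* The coefficients are compared through increments of length t along the i-th axis. They differ
       by at most e / 2, from uniform convergence, plus 2 K t <= e / 2, from the two remainders. *)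
    move=> e e0; pose t := Num.min (de / 2) (e / (4 * (K + 1))).
    have t0 : 0 < t by rewrite lt_min !divr_gt0//; lra.
    have t1 : t <= de / 2 by rewrite ge_min lexx.
    have t2 : t <= e / (4 * (K + 1)) by rewrite ge_min lexx orbT.
    have et0 : 0 < e * t / 4 by rewrite divr_gt0// mulr_gt0.
    have [N hN] := unif _ rho1 _ et0; exists N => j k Nj Nk.
    pose w : Cn := \col_l if l == i then t%:C else 0.
    have sw : sqnorm w = t ^+ 2.
      rewrite /sqnorm (bigD1 i)//= mxE eqxx normc_real gtr0_norm// big1 ?addr0// => l /negbTE li.
      by rewrite mxE li normc_real normr0 expr0n.
    have wl (l : 'I_n -> C) : \sum_i w i 0 * l i = t%:C * l i.
      by rewrite (bigD1 i)//= mxE eqxx big1 ?addr0// => m /negbTE mi; rewrite mxE mi mul0r.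
    have wd : sqnorm w <= de ^+ 2 / 4.
      by rewrite d4 sw ler_pXn2r ?nnegrE ?(ltW t0)//; apply: le_trans t1; exact: ltW.
    have wd1 : sqnorm (z0 + w - z0) <= de ^+ 2.
      rewrite addrAC subrr add0r; apply: le_trans wd _; have := sqr_ge0 de; lra.
    have z0d : sqnorm (z0 - z0) <= de ^+ 2.
      by rewrite subrr /sqnorm big1 ?sqr_ge0// => l _; rewrite mxE normc_real normr0 expr0n.
    have [_ /(_ w wd) hj] := hL j; have [_ /(_ w wd) hk] := hL k.
    move: hj hk; rewrite !wl sw -/K => hj hk.
    have a1 : normc (q j (z0 + w) - q k (z0 + w)) <= e * t / 4.
      by apply: hN; [exact: leq_trans Nj (leq_addr _ _)|exact: leq_trans Nk (leq_addr _ _)|exact: hde].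
    have a2 : normc (q j z0 - q k z0) <= e * t / 4.
      by apply: hN; [exact: leq_trans Nj (leq_addr _ _)|exact: leq_trans Nk (leq_addr _ _)|exact: hde].
    have : normc (t%:C * (L j i - L k i)) <= e * t / 4 + e * t / 4 + (K * t ^+ 2 + K * t ^+ 2).
      have -> : t%:C * (L j i - L k i) = ((q j (z0 + w) - q k (z0 + w)) + - (q j z0 - q k z0)) +
         (- (q j (z0 + w) - q j z0 - t%:C * L j i) + (q k (z0 + w) - q k z0 - t%:C * L k i)) by ring.
      apply: le_trans (normcD _ _) _; apply: lerD.
        by apply: le_trans (normcD _ _) _; rewrite normcN; exact: lerD.
      by apply: le_trans (normcD _ _) _; rewrite normcN; exact: lerD.
    rewrite normcM normc_real (gtr0_norm t0) => h; rewrite -(ler_pM2l t0); apply: le_trans h _.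
    have : t * (4 * (K + 1)) <= e by rewrite -ler_pdivlMr// mulr_gt0//; lra.
    nra.
  have /choice[l hl] : forall i, exists l, cto (fun k => L k i) l by move=> i; have [l hl _] := cL i; exists l.
  apply: (@differentiable_quadratic _ _ l (de / 2) K); rewrite ?divr_gt0// => w wd.
  have wd' : sqnorm w <= de ^+ 2 / 4 by rewrite d4.
  have Bw : B (z0 + w).
    apply: le_lt_trans rho1; apply: hde; rewrite addrAC subrr add0r; apply: le_trans wd' _.
    have := sqr_ge0 de; lra.
  have qc z : B z -> cto (q ^~ z) (g z).
    move=> Bz e e0; have [N hN] := (gP z Bz).1 e e0; exists N => k Nk.
    by apply: hN; rewrite (leq_trans Nk)// leq_addr.
  have cl : cto (fun k => q k (z0 + w) + (-1 * q k z0 + -1 * (\sum_i w i 0 * L k i)))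
     (g (z0 + w) + (-1 * g z0 + -1 * (\sum_i w i 0 * l i))).
    apply: ctoD; first exact: qc.
    apply: ctoD; first by apply: ctoM; exact: qc.
    by apply: ctoM; apply: cto_sum => i; exact: ctoM.
  have := cto_le (c := 0) (M := K * sqnorm w) (N := 0%N) cl; rewrite !sub0r !normcN.
  have E (a b c : C) : a + (-1 * b + -1 * c) = a - b - c by ring.
  rewrite E; apply => k _; rewrite sub0r normcN E; exact: (hL k).2.
- have [N hN] := cp 1 ltr01.
  have [h _] := fat N N 1 (fun j Nj => hN j N Nj (leqnn _)).
  have := L2D h (bounded_mfun_L2 bm (polyfun_bounded (hp N))).
  by under eq_fun do rewrite subrK.
- by move=> z nBz; rewrite /g asboolF.
- move=> e e0; have [N hN] := cp e e0; exists N => k Nk.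
  by have [] := fat N k e (fun j Nj => hN j k Nj Nk).
Qed.

End holomorphic_limit.

(** * Expansion in monomials and existence of the projection *)

Section projection.
Context (R : realType) (n : nat).
Local Notation C := R[i].
Local Notation Cn := 'cV[R[i]]_n.
Local Notation B := (@unit_ball R n).
Implicit Types (z w : Cn) (al be : 'I_n -> nat) (f g h : Cn -> C).
Variables (mu : {measure set Cn -> \bar R}) (bm : ball_measure mu).
Let mB := @measurable_unit_ball R n.
Local Notation L2 := (L2 mu).
Local Notation ip := (ip mu).
Local Notation N2 := (N2 mu).

(** Exponents below N in every coordinate, indexed by a finite type so that partial sums are finite
    sums. *)
Definition box N (a : {ffun 'I_n -> 'I_N}) : 'I_n -> nat := fun i => a i.

Definition mono_coef f al : C := ip f (mono al) / (N2 (mono al))%:C.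

Definition partial_sum f N z : C :=
  \sum_(a : {ffun 'I_n -> 'I_N}) mono_coef f (box a) * mono (box a) z.

Let N2_mono_gt0 al : 0 < N2 (mono al).
Proof. exact: integral_mono_gt0. Qed.

Let L2m al : L2 (mono al).
Proof. exact: L2_mono. Qed.

Lemma polyfun_partial_sum f N : polyfun (partial_sum f N).
Proof. exact: polyfun_sum. Qed.

Let L2p f N : L2 (partial_sum f N).
Proof. by apply: bounded_mfun_L2 => //; apply: polyfun_bounded; exact: polyfun_partial_sum. Qed.

Lemma ip_partial_sum f N h : L2 h ->
  ip (partial_sum f N) h = \sum_(a : {ffun 'I_n -> 'I_N}) mono_coef f (box a) * ip (mono (box a)) h.
Proof. by move=> hh; rewrite -ip_suml. Qed.

Lemma partial_sum_orth f N be : L2 f -> (forall i, be i < N)%N ->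
  ip (fun z => f z - partial_sum f N z) (mono be) = 0.
Proof.
move=> hf hbe; rewrite ipBl// ip_partial_sum//.
pose a0 : {ffun 'I_n -> 'I_N} := [ffun i => Ordinal (hbe i)].
have a0E : box a0 = be by apply/funext => i; rewrite /box ffunE.
rewrite (bigD1 a0)//= a0E big1 ?addr0.
  by rewrite /mono_coef (ip_ff mu) divfK ?subrr// realC_neq0.
move=> a /eqP aa0; have [i ai] : exists i, a i != a0 i.
  apply/existsP; rewrite -negb_forall; apply/negP => /forallP h; apply: aa0.
  by apply/ffunP => i; apply/eqP.
rewrite -a0E (@mono_orth _ _ _ bm i) ?mulr0//.
Qed.

Lemma partial_sum_orth2 f M N : L2 f -> (M <= N)%N ->
  ip (fun z => f z - partial_sum f N z) (partial_sum f M) = 0.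
Proof.
move=> hf MN; have hfp := L2B hf (L2p f N).
rewrite (ip_conj (L2p f M) hfp) ip_partial_sum// big1 ?conjc0// => a _.
rewrite (ip_conj hfp (L2m _)) partial_sum_orth// ?conjc0 ?mulr0// => i.
exact: leq_trans (ltn_ord _) MN.
Qed.

Lemma partial_sum_pyth f M N : L2 f -> (M <= N)%N ->
  N2 (fun z => f z - partial_sum f M z) = N2 (fun z => f z - partial_sum f N z) +
    N2 (fun z => partial_sum f N z - partial_sum f M z).
Proof.
move=> hf MN; have hfp := L2B hf (L2p f N); have hpp := L2B (L2p f N) (L2p f M).
rewrite -(N2D hfp hpp); first by apply: eq_N2 => z _; ring.
rewrite (ip_conj hpp hfp) ipBl// (ip_conj hfp)// (ip_conj hfp)//.
by rewrite !partial_sum_orth2// !conjc0 subrr conjc0.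
Qed.

(** By [partial_sum_pyth] the squared distances d N decrease, hence converge, and the squared norm
    of a difference of two partial sums is a difference of two of them. *)
Lemma partial_sum_cauchy f : L2 f -> forall e : R, 0 < e -> exists N, forall j k, (N <= j)%N -> (N <= k)%N ->
  N2 (fun z => partial_sum f j z - partial_sum f k z) <= e.
Proof.
move=> hf e e0; pose d N := N2 (fun z => f z - partial_sum f N z).
have dd M N : (M <= N)%N -> d N <= d M.
  by move=> MN; rewrite /d (partial_sum_pyth hf MN) lerDl N2_ge0.
have cd : d @ \oo --> inf (d @` setT).
  apply: nonincreasing_cvgn; first by move=> M N MN; exact: dd.
  by exists 0 => _ [N _ <-]; exact: N2_ge0.
have /cvgrPdist_le /(_ (e / 2)) := cd; rewrite divr_gt0// => /(_ isT)[N _ hN].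
exists N => j k.
have key i l : (N <= i)%N -> (i <= l)%N -> N2 (fun z => partial_sum f l z - partial_sum f i z) <= e.
  move=> Ni il; have := partial_sum_pyth hf il; rewrite -/(d i) -/(d l).
  have := hN i Ni; have := hN l (leq_trans Ni il); rewrite /= !ler_distl => /andP[h1 h2] /andP[h3 h4]; lra.
move=> Nj Nk; have [jk|/ltnW kj] := leqP j k; last exact: key.
have -> : N2 (fun z => partial_sum f j z - partial_sum f k z) = N2 (fun z => partial_sum f k z - partial_sum f j z).
  by rewrite -(N2N mu); apply: eq_N2 => z _; rewrite opprB.
exact: key.
Qed.

Let orth_limit f h (p : nat -> Cn -> C) : L2 f -> L2 h -> (forall k, L2 (p k)) ->
  (forall e : R, 0 < e -> exists N, forall k, (N <= k)%N -> N2 (fun z => h z - p k z) <= e) ->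
  (exists N, forall k, (N <= k)%N -> ip f (p k) = 0) -> ip f h = 0.
Proof.
move=> hf hh hp cp [N0 h0]; apply: normc_eq0; apply/eqP; rewrite eq_le normc_ge0 andbT.
rewrite -(@ler_pXn2r _ 2)// ?nnegrE ?normc_ge0// expr0n; apply/ler_addgt0Pr => e e0; rewrite add0r.
have f1 : 0 < N2 f + 1 by rewrite ltr_wpDl ?N2_ge0.
have [N hN] := cp (e / (N2 f + 1)) (divr_gt0 e0 f1).
pose k := maxn N N0.
have hhp := L2B hh (hp k).
have -> : ip f h = ip f (fun z => h z - p k z).
  rewrite (ip_conj hhp hf) ipBl// (ip_conj hf hh) (ip_conj hf (hp k)).
  by rewrite (h0 k (leq_maxr _ _)) conjc0 subr0 conjcK.
apply: le_trans (cauchy_schwarz hf hhp) _.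
have := hN k (leq_maxl _ _); rewrite ler_pdivlMr// => h1.
have := N2_ge0 mu f; have := N2_ge0 mu (fun z => h z - p k z); nra.
Qed.

Let L2_cintegrable h : L2 h -> cintegrable mu B h.
Proof.
move=> hh; have := cintegrable_mul_conj hh (bounded_mfun_L2 bm (bounded_mfun_cst n 1)).
by apply: (eq_cintegrable mB) => z _; rewrite conjc1 mulr1.
Qed.

Let limit_orth f g : L2 f -> L2 g ->
  (forall e : R, 0 < e -> exists N, forall k, (N <= k)%N -> N2 (fun z => g z - partial_sum f k z) <= e) ->
  forall al, ip (fun z => f z - g z) (mono al) = 0.
Proof.
move=> hf hg cg al; have hfg := L2B hf hg.
rewrite (ip_conj (L2m al) hfg) (@orth_limit (mono al) (fun z => f z - g z) (fun k z => f z - partial_sum f k z)) ?conjc0//.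
- by move=> k; exact: (L2B hf (L2p f k)).
- move=> e e0; have [N hN] := cg e e0; exists N => k Nk; apply: le_trans (hN k Nk).
  by rewrite -(N2N mu) le_eqVlt; apply/orP; left; apply/eqP; apply: eq_N2 => z _; ring.
exists (\max_(i < n) al i).+1 => k Nk.
rewrite (ip_conj (L2B hf (L2p f k)) (L2m al)) partial_sum_orth ?conjc0// => i.
by apply: leq_trans Nk; rewrite ltnS; exact: leq_bigmax.
Qed.

(** h has the same inner products with monomials as the limit of its partial sums, so both agree on
    the ball by [mono_complete]; orthogonality to the partial sums passes to the limit. *)
Lemma holomorphic_orth f h : L2 f -> (forall al, ip f (mono al) = 0) ->
  holomorphic_on B h -> L2 h -> ip f h = 0.
Proof.
move=> hf f0 dh hh.
have [g [dg L2g _ cg]] := polyfun_limit bm (polyfun_partial_sum h) (partial_sum_cauchy hh).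
have gm := limit_orth hh L2g cg.
have hg z : B z -> h z = g z.
  move=> Bz; apply/eqP; rewrite -subr_eq0; apply/eqP.
  apply: (mono_complete bm (h := fun z => h z - g z)) => //.
  - by move=> w Bw; apply: (@differentiableB _ _ _ h g); [exact: dh|exact: dg].
  - exact/L2_cintegrable/L2B.
rewrite (eq_ip mu (f' := f) (g' := g))//.
apply: (orth_limit hf L2g (L2p h) cg); exists 0%N => k _.
rewrite (ip_conj (L2p h k) hf) ip_partial_sum// big1 ?conjc0// => a _.
by rewrite (ip_conj hf (L2m _)) f0 conjc0 mulr0.
Qed.

Theorem projection_exists f : L2 f -> exists g, [/\ holomorphic_on B g, L2 g,
  forall z, ~ B z -> g z = 0 &
  forall h, holomorphic_on B h -> L2 h -> ip (fun z => f z - g z) h = 0].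
Proof.
move=> hf; have [g [dg L2g g0 cg]] := polyfun_limit bm (polyfun_partial_sum f) (partial_sum_cauchy hf).
exists g; split=> // h dh hh; apply: holomorphic_orth => //; first exact: L2B.
exact: limit_orth.
Qed.

End projection.

(** Meant for functions cut off to 0 outside the ball, which is open. *)
Lemma differentiable_near_eq (R : realType) (V W : normedModType R[i]) (f g : V -> W) x :
  (\forall y \near x, f y = g y) -> differentiable f x -> differentiable g x.
Proof.
move=> /nbhs_complex_norm[d1 d10 fg] df.
apply: (eps_differentiable (D := 'd f x)); first exact: diff_continuous.
move=> e e0; have [d2 d20 hd] := differentiable_eps df e0.
exists (Num.min d1 d2) => [|h hh]; first by rewrite lt_min d10.
have h1 : `|h| < d1%:C by apply: lt_le_trans hh _; rewrite lec_real ge_min lexx.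
have h2 : `|h| < d2%:C by apply: lt_le_trans hh _; rewrite lec_real ge_min lexx orbT.
have fgx : f x = g x by rewrite -[x]addr0; apply: fg; rewrite normr0 ltcR.
by rewrite -fg// -fgx; exact: hd.
Qed.

(** * Toeplitz operators *)

Section toeplitz.
Context (R : realType) (n : nat) (lam : R) (lam_gtN1 : -1 < lam).
Local Notation C := R[i].
Local Notation Cn := 'cV[R[i]]_n.
Local Notation B := (@unit_ball R n).
Local Notation v := (@bergman_measure R n lam).
Local Notation H := (bergman n lam).
Implicit Types (z w : Cn) (al be : 'I_n -> nat) (a b f g h : Cn -> C).
Let bm := @bergman_measure_ball_measure R n lam lam_gtN1.
Let mB := @measurable_unit_ball R n.
Local Notation ip := (ip v).
Local Notation N2 := (N2 v).
Local Notation L2 := (L2 v).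

Lemma square_integrableP f : square_integrable lam f <-> L2 f.
Proof.
split=> [[mf fin]|[mf /integrableP[_ fin]]]; split=> //.
  apply/integrableP; split; first by apply/measurable_EFinP; exact: measurable_sqr_normc.
  rewrite (eq_integral (fun z => (normc (f z) ^+ 2)%:E))//.
  by move=> z _; rewrite gee0_abs// lee_fin sqr_ge0.
rewrite (eq_integral (fun z => `|(normc (f z) ^+ 2)%:E|%E))//.
by move=> z _; rewrite gee0_abs// lee_fin sqr_ge0.
Qed.

Lemma bergmanP (f : H) : [/\ holomorphic_on B f, L2 f & forall z, ~ B z -> (f : Cn -> C) z = 0].
Proof.
case: f => f /=; rewrite inE/= => -[h1 /square_integrableP h2 h3]; by [].
Qed.

Lemma bergman_exists g : holomorphic_on B g -> L2 g -> (forall z, ~ B z -> g z = 0) ->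
  exists G : H, (G : Cn -> C) = g.
Proof.
move=> h1 h2 h3; have gp : g \in @bergman_pred R n lam.
  by rewrite inE/=; split=> //; apply/square_integrableP.
by exists (Bergman gp).
Qed.

Lemma innerE f g : inner lam f g = ip f g.
Proof. by []. Qed.

Lemma norm2E f : norm2 lam f = Num.sqrt (N2 f).
Proof. by []. Qed.

Lemma bergman_eq (f g : H) : (forall al, ip f (mono al) = ip g (mono al)) -> f = g.
Proof.
move=> fg; have [df hf f0] := bergmanP f; have [dg hg g0] := bergmanP g.
apply/val_inj/funext => z /=; have [Bz|nBz] := pselect (B z); last by rewrite f0// g0.
apply/eqP; rewrite -subr_eq0; apply/eqP.
have hfg := L2B hf hg.
apply: (mono_complete bm (h := fun z => (f : Cn -> C) z - (g : Cn -> C) z)) => //.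
- by move=> w Bw; apply: (@differentiableB _ _ _ (f : Cn -> C) (g : Cn -> C)); [exact: df|exact: dg].
- have := cintegrable_mul_conj hfg (bounded_mfun_L2 bm (bounded_mfun_cst n 1)).
  by apply: (eq_cintegrable mB) => w _; rewrite conjc1 mulr1.
- by move=> al; rewrite -[LHS]/(ip _ _) ipBl ?fg ?subrr//; exact: L2_mono.
Qed.

Lemma L2_mul a f : bounded_mfun a -> L2 f -> L2 (fun z => a z * f z).
Proof.
move=> [ma [M hM]] [mf if2]; apply: (@L2_le _ _ _ _ (fun z => M ^+ 2 * normc (f z) ^+ 2)).
- exact: measurableC_mul.
- exact: (integrableZl mB (M ^+ 2) if2).
move=> z Bz; rewrite normcM exprMn ler_wpM2r ?sqr_ge0//.
by rewrite ler_pXn2r ?nnegrE ?normc_ge0 ?hM// (le_trans (normc_ge0 _) (hM z Bz)).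
Qed.

(** The projection is chosen by [xget]; its defining property becomes available once
    [projection_exists] gives a witness. *)
Lemma toeplitzP a (f : H) : bounded_mfun a -> forall h : H,
  ip (toeplitz a f : Cn -> C) h = ip (fun z => a z * (f : Cn -> C) z) h.
Proof.
move=> ba h; have [df hf f0] := bergmanP f; have [dh hh h0] := bergmanP h.
have haf := L2_mul ba hf.
pose S := [set g : H | forall h : H, inner lam (a * (f : Cn -> C) - (g : Cn -> C)) h = 0].
have : exists g : H, S g.
  have [g [dg hg g0 gh]] := projection_exists bm haf.
  have [G GE] := bergman_exists dg hg g0; exists G => k.
  by have [dk hk _] := bergmanP k; rewrite GE innerE; exact: gh.
move=> /(@xgetPex _ 0 S) /(_ h); rewrite -[xget 0 S]/(toeplitz a f) innerE.
have [dt ht _] := bergmanP (toeplitz a f).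
rewrite (ipBl haf ht hh) => /eqP; rewrite subr_eq0 => /eqP <-; by [].
Qed.

(** Elements of [bergman] vanish off the ball while polynomials do not; this passes from one to the
    other. *)
Lemma bergman_restrict p : holomorphic_on B p -> L2 p ->
  exists P : H, forall z, B z -> (P : Cn -> C) z = p z.
Proof.
move=> dp hp; pose g z := if `[< B z >] then p z else 0 : C.
have gE z : B z -> g z = p z by move=> Bz; rewrite /g asboolT.
have dg : holomorphic_on B g.
  move=> z Bz; apply: (@differentiable_near_eq _ _ _ p) (dp z Bz).
  by apply: filterS (near_unit_ball Bz) => w Bw; rewrite gE.
have hg : L2 g by apply: (@L2_eq _ _ _ p) hp => z Bz; rewrite gE.
have g0 z : ~ B z -> g z = 0 by move=> nBz; rewrite /g asboolF.
by have [G GE] := bergman_exists dg hg g0; exists G => z Bz; rewrite GE gE.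
Qed.

Lemma toeplitzP2 a (f : H) h : bounded_mfun a -> holomorphic_on B h -> L2 h ->
  ip (toeplitz a f : Cn -> C) h = ip (fun z => a z * (f : Cn -> C) z) h.
Proof.
move=> ba dh hh; have [G GE] := bergman_restrict dh hh.
have := toeplitzP f ba G.
by rewrite !(eq_ip v (g := (G : Cn -> C)) (g' := h) (fun _ _ => erefl) GE).
Qed.

Lemma toeplitz_mono a (f : H) al : bounded_mfun a ->
  ip (toeplitz a f : Cn -> C) (mono al) = ip (fun z => a z * (f : Cn -> C) z) (mono al).
Proof.
move=> ba; apply: toeplitzP2 => //; last exact: L2_mono.
by move=> z _; exact: differentiable_mono.
Qed.

Lemma ip_mul_conj a f h : ip (fun z => a z * f z) h = ip f (fun z => conjc (a z) * h z).
Proof. by apply: eq_cint => z _; rewrite rmorphM/= conjcK; ring. Qed.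

Lemma toeplitz_adjoint a (f g : H) : bounded_mfun a ->
  ip (toeplitz a f : Cn -> C) g = ip (f : Cn -> C) (toeplitz (fun z => conjc (a z)) g).
Proof.
move=> ba; have bca := bounded_mfun_conj ba.
have [df hf _] := bergmanP f; have [dg hg _] := bergmanP g.
have [_ ht _] := bergmanP (toeplitz (fun z => conjc (a z)) g).
rewrite toeplitzP// ip_mul_conj (ip_conj (L2_mul bca hg) hf) (ip_conj ht hf).
by rewrite toeplitzP.
Qed.

Lemma eq_bergman_ip (f g : H) : (forall h : H, ip f h = ip g h) -> f = g.
Proof.
move=> fg; apply: bergman_eq => al.
have dm : holomorphic_on B (mono al) by move=> z _; exact: differentiable_mono.
have [P PE] := bergman_restrict dm (L2_mono bm al).
by have := fg P; rewrite !(eq_ip v (g := (P : Cn -> C)) (g' := mono al) (fun _ _ => erefl) PE).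
Qed.

Lemma toeplitz_bounded a : bounded_mfun a -> @bounded_operator R n lam (toeplitz a).
Proof.
move=> ba; have [_ [M0 hM0]] := ba; split.
  move=> c f g; apply: eq_bergman_ip => h.
  have [_ hf _] := bergmanP f; have [_ hg _] := bergmanP g; have [_ hh _] := bergmanP h.
  have [_ htf _] := bergmanP (toeplitz a f); have [_ htg _] := bergmanP (toeplitz a g).
  rewrite toeplitzP// -[RHS]/(ip (fun z => c * (toeplitz a f : Cn -> C) z + (toeplitz a g : Cn -> C) z) h).
  rewrite (ipDl (L2Z c htf) htg hh) (ipZl c htf hh) !toeplitzP//.
  rewrite -(ipZl c (L2_mul ba hf) hh) -(ipDl (L2Z c (L2_mul ba hf)) (L2_mul ba hg) hh).
  apply: eq_cint => z _; congr (_ * _).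
  have E : ((c *: f + g : H) : Cn -> C) z = c * (f : Cn -> C) z + (g : Cn -> C) z by [].
  by rewrite E mulrDr mulrCA.
pose M := Num.max M0 0; have M_ge0 : 0 <= M by rewrite le_max lexx orbT.
have hM z : B z -> normc (a z) <= M by move=> Bz; rewrite le_max hM0.
exists M => f; have [_ hf _] := bergmanP f; have [_ ht _] := bergmanP (toeplitz a f).
have haf := L2_mul ba hf; set t := toeplitz a f in ht *.
(* Testing against T_a f itself: its squared norm is <a f, T_a f>, to which Cauchy-Schwarz
   applies. *)
have key : N2 (t : Cn -> C) ^+ 2 <= N2 (fun z => a z * (f : Cn -> C) z) * N2 (t : Cn -> C).
  have -> : N2 (t : Cn -> C) ^+ 2 = normc (ip (fun z => a z * (f : Cn -> C) z) t) ^+ 2.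
    by rewrite -toeplitzP// ip_ff normc_real ger0_norm ?N2_ge0.
  exact: cauchy_schwarz.
have le2 : N2 (fun z => a z * (f : Cn -> C) z) <= M ^+ 2 * N2 (f : Cn -> C).
  have [_ i1] := haf; have [_ i2] := hf.
  rewrite /N2 -RintegralZl//; apply: le_Rintegral => //; first exact: (integrableZl mB (M ^+ 2) i2).
  move=> z Bz; rewrite normcM exprMn ler_wpM2r ?sqr_ge0//.
  by rewrite ler_pXn2r ?nnegrE ?normc_ge0 ?hM.
have t0 := N2_ge0 v (t : Cn -> C).
have le3 : N2 (t : Cn -> C) <= M ^+ 2 * N2 (f : Cn -> C).
  apply: le_trans le2; have [->|tn0] := eqVneq (N2 (t : Cn -> C)) 0; first exact: N2_ge0.
  by move: key; rewrite expr2 ler_pM2r// lt_def tn0.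
rewrite !norm2E -[M]ger0_norm// -sqrtr_sqr -sqrtrM ?sqr_ge0//.
by rewrite ler_wsqrtr.
Qed.

End toeplitz.

(** * Matrix coefficients in the monomials *)

Section matrix_coefficients.
Context (R : realType) (n : nat).
Local Notation C := R[i].
Local Notation Cn := 'cV[R[i]]_n.
Local Notation B := (@unit_ball R n).
Implicit Types (z : Cn) (al be ga : 'I_n -> nat) (a f g h : Cn -> C) (u w i : 'I_n).
Variables (mu : {measure set Cn -> \bar R}) (bm : ball_measure mu).
Let mB := @measurable_unit_ball R n.

Definition ae_invariant a (phi : Cn -> Cn) := {ae mu, forall z, B z -> a (phi z) = a z}.

(* The matrix coefficient <a z^al, z^be>. *)
Definition Imat a al be : C := cint mu B (fun z => a z * (mono al z * conjc (mono be z))).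

Lemma preimage_ball (phi : Cn -> Cn) : (forall z, sqnorm (phi z) = sqnorm z) -> phi @^-1` B = B.
Proof. by move=> h; apply/seteqP; split=> z; rewrite /unit_ball/= h. Qed.

Lemma cint_invariant a (phi : Cn -> Cn) g : mpres (lebesgueCn R n) phi ->
  (forall z, sqnorm (phi z) = sqnorm z) -> ae_invariant a phi ->
  bounded_mfun a -> bounded_mfun g ->
  cint mu B (fun z => a z * g z) = cint mu B (fun z => a z * g (phi z)).
Proof.
move=> mphi nphi inva ba bg; have mphi' := ball_measure_mpres bm mphi nphi.
have iag := bounded_mfun_cintegrable bm (bounded_mfunM ba bg).
have [i1 <-] := cint_mpres mB mphi' (preimage_ball nphi) iag.
have mgphi : measurable_fun B (fun z => g (phi z)).
  apply: (@measurable_comp _ _ _ _ _ _ B g); [exact: mB| |exact: bg.1|].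
    by move=> _ [z Bz <-]; rewrite /unit_ball/= nphi.
  by apply: measurable_funTS; exact: mphi.1.
apply: (ae_eq_cint mB); first exact: cintegrable_measurable i1.
- by apply: measurableC_mul => //; exact: ba.1.
- by apply: filterS inva => z h Bz; rewrite h.
Qed.

(** A phase t multiplies the coefficient by t^x conj(t)^y, where x and y are the degrees on P; for
    t^|x - y| = -1 this forces it to vanish. *)
Lemma Imat_phase a (P : pred 'I_n) al be : bounded_mfun a ->
  (forall t, normc t = 1 -> ae_invariant a (scl P t)) ->
  (\sum_(i | P i) al i != \sum_(i | P i) be i)%N -> Imat a al be = 0.
Proof.
move=> ba inva; set x := (\sum_(i | P i) al i)%N; set y := (\sum_(i | P i) be i)%N => xy.
have key t : normc t = 1 -> Imat a al be = t ^+ x * conjc t ^+ y * Imat a al be.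
  move=> t1; have bg : bounded_mfun (fun z => mono al z * conjc (mono be z)).
    by apply: bounded_mfunM; [|apply: bounded_mfun_conj]; exact: bounded_mfun_mono.
  rewrite {1}/Imat (cint_invariant (phi := scl P t) _ _ (inva t t1) ba bg); last 2 first.
  - exact: mpres_scl.
  - by move=> z; exact: sqnorm_scl.
  rewrite -(cintZ mB); last by apply: bounded_mfun_cintegrable => //; exact: bounded_mfunM.
  by apply: eq_cint => z _; rewrite !mono_scl rmorphM rmorphXn -/x -/y; ring.
have fin (c : C) : c = - c -> c = 0.
  move=> /eqP; rewrite -subr_eq0 opprK -mulr2n -mulr_natl mulf_eq0 pnatr_eq0 => /eqP; exact.
apply: fin; case: (ltngtP x y) xy => // [lt|lt] _.
- have [t t1 tk] := unit_root_neg1 R (eq_trans (subn_gt0 _ _) lt).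
  have tc : t * conjc t = 1 by rewrite mulc_conj t1 expr1n.
  rewrite {1}(key t t1); suff -> : t ^+ x * conjc t ^+ y = -1 by rewrite mulN1r.
  rewrite -{1}(subnKC (ltnW lt)) exprD mulrA -exprMn tc expr1n mul1r -rmorphXn tk.
  by apply: complexP; rewrite /= ?oppr0.
- have [t t1 tk] := unit_root_neg1 R (eq_trans (subn_gt0 _ _) lt).
  have tc : t * conjc t = 1 by rewrite mulc_conj t1 expr1n.
  rewrite {1}(key t t1); suff -> : t ^+ x * conjc t ^+ y = -1 by rewrite mulN1r.
  by rewrite -{1}(subnK (ltnW lt)) exprD -mulrA -exprMn tc expr1n mulr1 tk.
Qed.

Lemma Imat_phase1 a i al be : bounded_mfun a ->
  (forall t, normc t = 1 -> ae_invariant a (scl (pred1 i) t)) ->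
  al i != be i -> Imat a al be = 0.
Proof. by move=> ba inva ab; apply: (Imat_phase ba inva); rewrite !big_pred1_eq. Qed.

Definition upd al u w (p q : nat) : 'I_n -> nat := fun i => if i == u then p else if i == w then q else al i.

Definition rest al u w z : C := \prod_(i | (i != u) && (i != w)) z i 0 ^+ al i.

Lemma mono_upd al u w p q z : u != w ->
  mono (upd al u w p q) z = z u 0 ^+ p * z w 0 ^+ q * rest al u w z.
Proof.
move=> uw; rewrite /mono (bigD1 u)//= (bigD1 w)/=; last by rewrite eq_sym.
rewrite /upd eqxx (negbTE (_ : w != u)) ?eqxx 1?eq_sym// mulrA; congr (_ * _).
by apply: eq_bigr => i /andP[/negbTE -> /negbTE ->].
Qed.

Lemma upd_id al u w : upd al u w (al u) (al w) = al.
Proof. by apply/funext => i; rewrite /upd; case: eqP => [->//|_]; case: eqP => [->|]. Qed.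

Lemma sqnorm_rot4 u w z : u != w -> sqnorm (rot4 u w z) = sqnorm z.
Proof.
move=> uw; have wu : (w == u) = false by rewrite eq_sym (negbTE uw).
rewrite /sqnorm (bigD1 u)//= (bigD1 w)/=; last by rewrite eq_sym.
rewrite [in RHS](bigD1 u)//= [in RHS](bigD1 w)/=; last by rewrite eq_sym.
rewrite !addrA; congr (_ + _).
  rewrite !mxE eqxx wu eqxx; set c := Num.sqrt _.
  have c2 : c ^+ 2 = 2^-1 by rewrite sqr_sqrtr// invr_ge0.
  rewrite !normcM !normc_real !exprMn !(real_normK (num_real c)) c2 !normc_sqrE.
  by case: (z u 0) (z w 0) => [a1 b1] [a2 b2] /=; field.
by apply: eq_bigr => i /andP[iu iw]; rewrite mxE (negbTE iu) (negbTE iw).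
Qed.

(** Only the coefficient 1 of X^(x + y) is recorded: every other term has a positive power of Y, and
    [Imat_merge] discards it by phase invariance. *)
Lemma binomial_expansion (x y : nat) : exists s : seq (C * (nat * nat)), forall X Y : C,
  (X - Y) ^+ x * (X + Y) ^+ y = X ^+ (x + y) + \sum_(t <- s) t.1 * (X ^+ t.2.1 * Y ^+ t.2.2.+1).
Proof.
have step (N : nat) (c : C) (s : seq (C * (nat * nat))) : exists s', forall X Y : C,
    (X + c * Y) * (X ^+ N + \sum_(t <- s) t.1 * (X ^+ t.2.1 * Y ^+ t.2.2.+1)) =
    X ^+ N.+1 + \sum_(t <- s') t.1 * (X ^+ t.2.1 * Y ^+ t.2.2.+1).
  exists ((c, (N, 0%N)) :: [seq (t.1, (t.2.1.+1, t.2.2)) | t <- s] ++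
      [seq (c * t.1, (t.2.1, t.2.2.+1)) | t <- s]) => X Y.
  have e1 : X * \sum_(t <- s) t.1 * (X ^+ t.2.1 * Y ^+ t.2.2.+1) =
      \sum_(t <- s) t.1 * (X ^+ t.2.1.+1 * Y ^+ t.2.2.+1).
    by rewrite mulr_sumr; apply: eq_bigr => t _; rewrite !exprS; ring.
  have e2 : c * Y * \sum_(t <- s) t.1 * (X ^+ t.2.1 * Y ^+ t.2.2.+1) =
      \sum_(t <- s) c * t.1 * (X ^+ t.2.1 * Y ^+ t.2.2.+2).
    by rewrite mulr_sumr; apply: eq_bigr => t _; rewrite !exprS; ring.
  rewrite big_cons big_cat !big_map /= -e1 -e2 expr1 exprS; move: (\sum_(t <- s) _) (X ^+ N) => S T; ring.
elim: x => [|x [s hs]].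
  elim: y => [|y [s hs]]; first by exists [::] => X Y; rewrite big_nil !expr0 mulr1 addr0.
  have [s' hs'] := step y 1 s; exists s' => X Y; rewrite expr0 mul1r add0n.
  by have := hs X Y; rewrite expr0 mul1r add0n => hsXY; rewrite exprS hsXY -hs' mul1r.
have [s' hs'] := step (x + y)%N (-1) s; exists s' => X Y.
by rewrite exprS -mulrA hs addSn -hs' mulN1r.
Qed.

(* Apply the rotation to (z_u - z_w)^x (z_u + z_w)^y conj(z_u)^(x + y): by torus
   invariance each side keeps a single monomial. *)
Lemma Imat_merge a u w al be : u != w -> bounded_mfun a ->
  (forall t, normc t = 1 -> ae_invariant a (scl (pred1 w) t)) -> ae_invariant a (rot4 u w) ->
  al u = be u -> al w = be w ->
  'C(al u + al w, al u)%:R * Imat a al be =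
  Imat a (upd al u w (al u + al w) 0) (upd be u w (al u + al w) 0).
Proof.
move=> uw ba invw invr abu abw; set x := al u; set y := al w; set N := (x + y)%N.
pose Rr z := rest al u w z * conjc (rest be u w z).
pose G z := (z u 0 - z w 0) ^+ x * (z u 0 + z w 0) ^+ y * conjc (z u 0) ^+ N * Rr z.
have [s hs] := binomial_expansion x y.
have bI al' be' : bounded_mfun (fun z => mono al' z * conjc (mono be' z)).
  by apply: bounded_mfunM; [|apply: bounded_mfun_conj]; exact: bounded_mfun_mono.
have iI al' be' : cintegrable mu B (fun z => a z * (mono al' z * conjc (mono be' z))).
  by apply: bounded_mfun_cintegrable => //; exact: bounded_mfunM.
have GE z : G z = mono (upd al u w N 0) z * conjc (mono (upd be u w N 0) z) +
   \sum_(t <- s) t.1 * (mono (upd al u w t.2.1 t.2.2.+1) z * conjc (mono (upd be u w N 0) z)).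
  rewrite /G hs /Rr !mono_upd// !expr0 !mulr1 rmorphM rmorphXn.
  rewrite mulrDl mulrDl mulr_suml mulr_suml; congr (_ + _); first by rewrite /N; ring.
  by apply: eq_bigr => t _; rewrite mono_upd//; ring.
have bG : bounded_mfun G.
  have -> : G = fun z => mono (upd al u w N 0) z * conjc (mono (upd be u w N 0) z) +
   \sum_(t <- s) t.1 * (mono (upd al u w t.2.1 t.2.2.+1) z * conjc (mono (upd be u w N 0) z)).
    by apply/funext => z; exact: GE.
  apply: bounded_mfunD => //; elim: (s) => [|t s' ih].
    by under eq_fun do rewrite big_nil; exact: bounded_mfun_cst.
  under eq_fun do rewrite big_cons; apply: bounded_mfunD => //.
  by apply: bounded_mfunM => //; exact: bounded_mfun_cst.
have L : cint mu B (fun z => a z * G z) = Imat a (upd al u w N 0) (upd be u w N 0).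
  transitivity (cint mu B (fun z => a z * (mono (upd al u w N 0) z * conjc (mono (upd be u w N 0) z)) +
     \sum_(t <- s) t.1 * (a z * (mono (upd al u w t.2.1 t.2.2.+1) z * conjc (mono (upd be u w N 0) z))))).
    apply: eq_cint => z _; rewrite GE mulrDr mulr_sumr; congr (_ + _).
    by apply: eq_bigr => t _; rewrite mulrCA.
  rewrite (cintD mB)//; last by apply: (cintegrable_sum mB) => t; exact: (cintegrableZ mB).
  rewrite (cint_sum mB); last by move=> t; exact: (cintegrableZ mB).
  rewrite big1 ?addr0// => t _; rewrite (cintZ mB)// -[cint _ _ _]/(Imat _ _ _).
  rewrite (Imat_phase1 (i := w) ba invw) ?mulr0//.
  by rewrite /upd [w == u]eq_sym (negbTE uw) eqxx.
have Grot z : G (rot4 u w z) = \sum_(k < N.+1) 'C(N, k)%:R *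
    (mono al z * conjc (mono (upd be u w (N - k) k) z)).
  have c2 := @sqrt_half R; set c : C := (Num.sqrt 2^-1)%:C in c2.
  have cc : conjc c = c by apply: complexP; rewrite /= ?oppr0.
  have wu : (w == u) = false by rewrite eq_sym (negbTE uw).
  have zu : rot4 u w z u 0 = c * (z u 0 + z w 0) by rewrite mxE eqxx.
  have zw : rot4 u w z w 0 = c * (z w 0 - z u 0) by rewrite mxE wu eqxx.
  have zr ga : rest ga u w (rot4 u w z) = rest ga u w z.
    by apply: eq_bigr => i /andP[iu iw]; rewrite mxE (negbTE iu) (negbTE iw).
  have ma : mono al z = z u 0 ^+ x * z w 0 ^+ y * rest al u w z.
    by rewrite -[in LHS](upd_id al u w) mono_upd.
  have c1 : 2 * c * c = 1 by rewrite -mulrA -expr2 c2 mulfV// pnatr_eq0.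
  rewrite /G zu zw /Rr !zr.
  (* The rotation turns z_u - z_w and z_u + z_w into 2 c z_u and 2 c z_w, and conj(z_u) into c times
     a sum; the constants disappear because 2 c^2 = 1. *)
  have -> : c * (z u 0 + z w 0) - c * (z w 0 - z u 0) = 2 * c * z u 0 by ring.
  have -> : c * (z u 0 + z w 0) + c * (z w 0 - z u 0) = 2 * c * z w 0 by ring.
  have -> : conjc (c * (z u 0 + z w 0)) = c * (conjc (z u 0) + conjc (z w 0)).
    by rewrite rmorphM rmorphD /=; congr (_ * _); exact: cc.
  transitivity (((2 * c) * c) ^+ N * (z u 0 ^+ x * z w 0 ^+ y * (conjc (z u 0) + conjc (z w 0)) ^+ N *
     (rest al u w z * conjc (rest be u w z)))).
    by rewrite !exprMn /N !exprD; ring.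
  rewrite c1 expr1n mul1r exprDn mulr_sumr mulr_suml; apply: eq_bigr => k _.
  by rewrite ma mono_upd// !rmorphM !rmorphXn -mulr_natl /=; ring.
have Rt : cint mu B (fun z => a z * G (rot4 u w z)) = 'C(N, x)%:R * Imat a al be.
  transitivity (cint mu B (fun z => \sum_(k < N.+1) 'C(N, k)%:R *
    (a z * (mono al z * conjc (mono (upd be u w (N - k) k) z))))).
    by apply: eq_cint => z _; rewrite Grot mulr_sumr; apply: eq_bigr => k _; rewrite mulrCA.
  rewrite (cint_sum mB); last by move=> k; exact: (cintegrableZ mB).
  (* Of the binomial expansion only k = y survives, the exponents of z_w being then equal; C(N, y)
     is C(N, x) by symmetry. *)
  have yN : (y < N.+1)%N by rewrite ltnS leq_addl.
  rewrite (bigD1 (Ordinal yN))//= big1 ?addr0; last first.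
    move=> k ky; rewrite (cintZ mB)// -[cint _ _ _]/(Imat _ _ _).
    rewrite (Imat_phase1 (i := w) ba invw) ?mulr0// /upd [w == u]eq_sym (negbTE uw) eqxx.
    by rewrite -/y eq_sym -val_eqE/= in ky *.
  rewrite (cintZ mB)// -[cint _ _ _]/(Imat _ _ _) addnK.
  have -> : upd be u w x y = be by rewrite /x /y abu abw upd_id.
  by congr (_%:R * _); rewrite /N -bin_sub ?leq_addl// addnK.
rewrite -Rt -L; symmetry; apply: cint_invariant => //; first exact: mpres_rot4.
by move=> z; exact: sqnorm_rot4.
Qed.


(** * Coefficients of symbols invariant under U(k, j, T) *)

Section blocks.
Variables (m : nat) (blk : 'I_n -> 'I_m).

(** The invariances under U(k, j, T) that the argument uses, stated for single maps of C^n.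
    Boundedness holds everywhere on the ball, which a truncation of the symbol ensures. *)
Record quasi_invariant a (j : 'I_m) : Prop := QuasiInvariant {
  quasi_bounded : bounded_mfun a;
  quasi_phase1 : forall i t, blk i != j -> normc t = 1 -> ae_invariant a (scl (pred1 i) t);
  quasi_phase : forall t, normc t = 1 -> ae_invariant a (scl [pred i | blk i == j] t);
  quasi_rot4 : forall u w, u != w -> blk u = blk w -> blk u != j -> ae_invariant a (rot4 u w)
}.

Lemma quasi_invariant1 j : quasi_invariant (fun=> 1) j.
Proof. by split=> *; [exact: bounded_mfun_cst|exact: aeW..]. Qed.

Definition wt (l : 'I_m) al := (\sum_(i | blk i == l) al i)%N.
Definition facs (l : 'I_m) al := (\prod_(i | blk i == l) (al i)`!)%N.

Lemma facs_gt0 l al : (0 < facs l al)%N.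
Proof. by apply: prodn_gt0 => i; exact: fact_gt0. Qed.

Lemma concentrate_step (F x0 p c f2 I I' : C) : F * I = x0 * p * I' ->
  c * (F * f2) * I = x0 * (f2 * p) * (c * I').
Proof. move=> h; have -> : c * (F * f2) * I = c * f2 * (F * I) by ring.
by rewrite h; ring. Qed.

(** Repeating [Imat_merge] along the block moves its whole weight to i0, and the binomial
    coefficients multiply to the multinomial coefficient (wt l al)! / facs l al. *)
Lemma Imat_concentrate a j l i0 al be : quasi_invariant a j -> l != j -> blk i0 = l ->
  (forall i, blk i = l -> al i = be i) ->
  (wt l al)`!%:R * Imat a al be = (facs l al)%:R *
    Imat a (fun i => if i == i0 then wt l al else if blk i == l then 0%N else al i)
           (fun i => if i == i0 then wt l al else if blk i == l then 0%N else be i).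
Proof.
move=> qa lj bi0 ab.
pose cc (s : seq 'I_n) (ga : 'I_n -> nat) := fun i => if i == i0 then (ga i0 + \sum_(k <- s) ga k)%N
   else if i \in s then 0%N else ga i.
have key (s : seq 'I_n) : uniq (i0 :: s) -> (forall i, i \in s -> blk i = l) ->
  ((al i0 + \sum_(k <- s) al k)%N`!)%:R * Imat a al be =
  ((al i0)`! * \prod_(k <- s) (al k)`!)%N%:R * Imat a (cc s al) (cc s be).
  elim: s => [_ _|w s ih].
    have c0 ga : cc [::] ga = ga.
      by apply/funext => i; rewrite /cc big_nil addn0 in_nil; case: eqP => [->|].
    by rewrite !c0 !big_nil addn0 muln1.
  rewrite /= inE negb_or => /andP[/andP[i0w i0s] /andP[ws us]] hs.
  have bw : blk w = l by apply: hs; rewrite inE eqxx.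
  have hs' i : i \in s -> blk i = l by move=> is'; apply: hs; rewrite inE is' orbT.
  have {}ih := ih (_ : uniq (i0 :: s)) hs'; rewrite /= i0s us in ih; have {}ih := ih isT.
  have ss : (\sum_(k <- s) be k = \sum_(k <- s) al k)%N.
    by rewrite big_seq [RHS]big_seq; apply: eq_bigr => k ks; rewrite ab// hs'.
  have wi0 : (w == i0) = false by rewrite eq_sym (negbTE i0w).
  pose A := (al i0 + \sum_(k <- s) al k)%N.
  have cA : cc s al i0 = A by rewrite /cc eqxx.
  have cAb : cc s be i0 = A by rewrite /cc eqxx ss -ab.
  have cw : cc s al w = al w by rewrite /cc wi0 (negbTE ws).
  have cwb : cc s be w = al w by rewrite /cc wi0 (negbTE ws) -ab.
  have E ga : cc s ga i0 = A -> cc s ga w = al w -> (ga i0 + \sum_(k <- s) ga k = A)%N ->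
      ga w = al w -> upd (cc s ga) i0 w (A + al w) 0 = cc (w :: s) ga.
    move=> h1 h2 h3 h4; apply/funext => i; rewrite /upd /cc big_cons.
    case: eqP => [_|_]; first by rewrite addnCA h3 h4 addnC.
    by rewrite inE; case: eqP => [->|].
  have := Imat_merge (al := cc s al) (be := cc s be) i0w (quasi_bounded qa) _ _ _ _.
  rewrite cA cAb cw cwb => /(_ _ _ erefl erefl) mg.
  have {}mg : 'C(A + al w, A)%:R * Imat a (cc s al) (cc s be) = Imat a (cc (w :: s) al) (cc (w :: s) be).
    rewrite mg; first by rewrite !E// ?ss -?ab.
      by move=> t t1; apply: (quasi_phase1 qa) => //; rewrite bw.
    by apply: (quasi_rot4 qa) => //; rewrite ?bi0 ?bw.
  have bf : ('C(A + al w, A) * (A`! * (al w)`!))%N = (A + al w)`!.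
    by have := @bin_fact (A + al w) A (leq_addr _ _); rewrite addKn.
  rewrite !big_cons -mg.
  have -> : (al i0 + (al w + \sum_(j0 <- s) al j0))%N = (A + al w)%N by rewrite addnCA addnC.
  rewrite -/A in ih; rewrite -bf !natrM; move: ih; rewrite !natrM.
  by apply: concentrate_step.
pose s := [seq i <- index_enum 'I_n | (blk i == l) && (i != i0)].
have us : uniq (i0 :: s) by rewrite /= mem_filter eqxx andbF filter_uniq// index_enum_uniq.
have hs i : i \in s -> blk i = l by rewrite mem_filter => /andP[/andP[/eqP]].
have is_ i : i \in s = (blk i == l) && (i != i0) by rewrite mem_filter mem_index_enum andbT.
have bl0 : blk i0 == l by rewrite bi0.
have wE ga : (ga i0 + \sum_(k <- s) ga k)%N = wt l ga by rewrite big_filter /wt [in RHS](bigD1 i0).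
have ccE ga : (forall i, blk i = l -> al i = ga i) -> cc s ga = fun i => if i == i0 then wt l al else if blk i == l then 0%N else ga i.
  move=> ag; have wg : wt l ga = wt l al by apply: eq_bigr => i /eqP bi; rewrite ag.
  apply/funext => i; rewrite /cc wE wg is_; case: eqP => [//|/eqP ii0].
  by rewrite andbT.
have := key s us hs; rewrite wE ccE// ccE// => ->.
by congr (_%:R * _); rewrite big_filter /facs [in RHS](bigD1 i0).
Qed.

(** By [Imat_concentrate] both sides reduce to the same coefficient, with the weight of the block at
    one index; if the block is empty the exponents agree. *)
Lemma Imat_block a j l al be al' be' : quasi_invariant a j -> l != j ->
  (forall i, blk i = l -> al i = be i) -> (forall i, blk i = l -> al' i = be' i) ->
  (forall i, blk i != l -> al i = al' i) -> (forall i, blk i != l -> be i = be' i) ->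
  wt l al = wt l al' ->
  (facs l al')%:R * Imat a al be = (facs l al)%:R * Imat a al' be'.
Proof.
move=> qa lj ab ab' aa bb ww.
case: (pickP (fun i => blk i == l)) => [i0 /eqP bi0|nol]; last first.
  have -> : al' = al by apply/funext => i; rewrite aa// nol.
  by have -> : be' = be by apply/funext => i; rewrite bb// nol.
have h := Imat_concentrate qa lj bi0 ab; have h' := Imat_concentrate qa lj bi0 ab'.
have wn : (wt l al)`!%:R != 0 :> C by rewrite pnatr_eq0 -lt0n fact_gt0.
rewrite -ww in h'; apply: (mulfI wn); rewrite mulrCA h [RHS]mulrCA h' mulrCA.
congr (_ * (_ * _)); apply: (f_equal2 (Imat a)).
  by apply/funext => i; case: eqP => // _; case: eqP => // /eqP bl; rewrite aa.
by apply/funext => i; case: eqP => // _; case: eqP => // /eqP bl; rewrite bb.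
Qed.

Definition mix (l : 'I_m) al be := fun i => if blk i == l then be i else al i.

Lemma Imat_wt a j al be : quasi_invariant a j -> wt j al != wt j be -> Imat a al be = 0.
Proof. by move=> qa; apply: Imat_phase; [exact: quasi_bounded qa|exact: quasi_phase qa]. Qed.

Lemma Imat_off a j al be i : quasi_invariant a j -> blk i != j -> al i != be i ->
  Imat a al be = 0.
Proof.
move=> qa ij; apply: (Imat_phase1 (i := i)); first exact: quasi_bounded qa.
by move=> t; exact: (quasi_phase1 qa).
Qed.

(** The algebra of [Imat_comm] over abstract scalars: N0, N1, N2 are the squared norms of z^al and
    of the two intermediate monomials; F, F', G, G' are products of factorials. *)
Lemma comm_step (F F' G G' b1 b2 a1 a2 N0 N1 N2 : C) : F != 0 -> F' != 0 -> G != 0 -> G' != 0 ->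
  G' * b1 = G * b2 -> F * a1 = F' * a2 -> F' * N0 = F * N1 -> G' * N0 = G * N2 ->
  b1 * a1 / N1 = a2 * b2 / N2.
Proof.
move=> F0 F'0 G0 G'0 hA hB hC hD.
have -> : b1 = G / G' * b2 by apply: (mulfI G'0); rewrite hA; field.
have -> : a1 = F' / F * a2 by apply: (mulfI F0); rewrite hB; field.
have -> : N1 = F' / F * N0 by apply: (mulfI F0); rewrite -hC; field.
have -> : N2 = G' / G * N0 by apply: (mulfI G0); rewrite -hD; field.
rewrite !invfM !invrK; move: (N0^-1) => X; field.
by rewrite F0 F'0 G'0.
Qed.

(** The squared norms in the denominators are coefficients of the symbol 1, which is quasi-invariant
    for every index, so the proportionality also governs them and all factorials cancel. Both sides
    vanish if al and be differ outside the blocks j and l or in their degrees on one of these. *)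
Lemma Imat_comm a b j l al be : quasi_invariant a j -> quasi_invariant b l -> j != l ->
  Imat b al (mix l al be) * Imat a (mix l al be) be /
    Imat (fun=> 1) (mix l al be) (mix l al be) =
  Imat a al (mix j al be) * Imat b (mix j al be) be /
    Imat (fun=> 1) (mix j al be) (mix j al be).
Proof.
move=> qa qb jl; set g1 := mix l al be; set g2 := mix j al be.
have g1l i : blk i = l -> g1 i = be i by rewrite /g1 /mix => ->; rewrite eqxx.
have g1n i : blk i != l -> g1 i = al i by rewrite /g1 /mix => /negbTE ->.
have g2j i : blk i = j -> g2 i = be i by rewrite /g2 /mix => ->; rewrite eqxx.
have g2n i : blk i != j -> g2 i = al i by rewrite /g2 /mix => /negbTE ->.
have lj : l != j by rewrite eq_sym.
case: (pickP (fun i => [&& blk i != j, blk i != l & al i != be i])) => [i /and3P[ij il ab]|off].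
  rewrite (Imat_off (i := i) qa) ?g1n// mulr0 mul0r.
  by rewrite (Imat_off (i := i) qb _ (_ : g2 i != be i)) ?g2n// mulr0 mul0r.
have {}off i : blk i != j -> blk i != l -> al i = be i.
  by move=> ij il; have := off i; rewrite ij il /= => /negbFE/eqP.
have w1j : wt j g1 = wt j al by apply: eq_bigr => i /eqP ij; rewrite g1n// ij.
have w1l : wt l g1 = wt l be by apply: eq_bigr => i /eqP il; rewrite g1l.
have w2j : wt j g2 = wt j be by apply: eq_bigr => i /eqP ij; rewrite g2j.
have w2l : wt l g2 = wt l al by apply: eq_bigr => i /eqP il; rewrite g2n// il.
have f1l : facs l g1 = facs l be by apply: eq_bigr => i /eqP il; rewrite g1l.
have f2j : facs j g2 = facs j be by apply: eq_bigr => i /eqP ij; rewrite g2j.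
have [wj|wj] := eqVneq (wt j al) (wt j be); last first.
  rewrite (Imat_wt qa (_ : wt j g1 != _)) ?w1j// mulr0 mul0r.
  by rewrite (Imat_wt qa (_ : wt j al != wt j g2)) ?w2j// mul0r mul0r.
have [wl|wl] := eqVneq (wt l al) (wt l be); last first.
  rewrite (Imat_wt qb (_ : wt l al != wt l g1)) ?w1l// mul0r mul0r.
  by rewrite (Imat_wt qb (_ : wt l g2 != wt l be)) ?w2l// mulr0 mul0r.
have hA : (facs j be)%:R * Imat b al g1 = (facs j al)%:R * Imat b g2 be.
  rewrite -f2j; apply: (Imat_block qb) => //; last by rewrite w2j.
  - by move=> i ij; rewrite g1n// ij.
  - by move=> i ij; rewrite g2n.
  - by move=> i ij; have [/g1l//|il] := eqVneq (blk i) l; rewrite g1n// off.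
have hB : (facs l al)%:R * Imat a g1 be = (facs l be)%:R * Imat a al g2.
  rewrite -f1l; apply: (Imat_block qa) => //; last by rewrite w1l.
  - by move=> i il; rewrite g2n// il.
  - by move=> i il; have [/g2j ->//|ij] := eqVneq (blk i) j; rewrite g2n// off.
have hC : (facs l be)%:R * Imat (fun=> 1) al al = (facs l al)%:R * Imat (fun=> 1) g1 g1.
  by rewrite -f1l; apply: (Imat_block (quasi_invariant1 j)); rewrite ?w1l// => i il; rewrite g1n.
have hD : (facs j be)%:R * Imat (fun=> 1) al al = (facs j al)%:R * Imat (fun=> 1) g2 g2.
  by rewrite -f2j; apply: (Imat_block (quasi_invariant1 l)); rewrite ?w2j// => i il; rewrite g2n.
have f0 (i : 'I_m) ga : (facs i ga)%:R != 0 :> C by rewrite pnatr_eq0 -lt0n facs_gt0.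
by apply: (comm_step _ _ _ _ hA hB hC hD); exact: f0.
Qed.

End blocks.

End matrix_coefficients.

(** * Products of two Toeplitz operators *)

Section commuting_operators.
Context (R : realType) (n : nat) (lam : R) (lam_gtN1 : -1 < lam).
Local Notation C := R[i].
Local Notation Cn := 'cV[R[i]]_n.
Local Notation B := (@unit_ball R n).
Local Notation v := (@bergman_measure R n lam).
Local Notation H := (bergman n lam).
Implicit Types (z w : Cn) (al be : 'I_n -> nat) (a b f g h : Cn -> C) (P : H).
Let bm := @bergman_measure_ball_measure R n lam lam_gtN1.
Let mB := @measurable_unit_ball R n.
Local Notation ip := (ip v).
Local Notation I := (Imat v).
Variables (m : nat) (blk : 'I_n -> 'I_m).
Local Notation quasi := (quasi_invariant v blk).

Lemma quasi_invariant_conj a j : quasi a j -> quasi (fun z => conjc (a z)) j.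
Proof.
have ca phi : ae_invariant v a phi -> ae_invariant v (fun z => conjc (a z)) phi.
  by move=> h; apply: filterS h => z hz Bz; rewrite hz.
move=> [ba h1 h2 h3]; split; first exact: bounded_mfun_conj.
- by move=> i t ij t1; apply: ca; exact: h1.
- by move=> t t1; apply: ca; exact: h2.
- by move=> u w uw uwb uj; apply: ca; exact: h3.
Qed.

Lemma ip_mul_mono b al ga : ip (fun z => b z * mono al z) (mono ga) = I b al ga.
Proof. by apply: eq_cint => z _; rewrite mulrA. Qed.

(* T_b z^al is a polynomial of which the exponents are bounded by |al|. *)
Lemma Imat_reach b l al ga i : quasi b l -> (\sum_i al i < ga i)%N -> I b al ga = 0.
Proof.
move=> qb lt.
have ale k : (al k <= \sum_i al i)%N by rewrite (bigD1 k)//= leq_addr.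
have [il|il] := eqVneq (blk i) l; last first.
  by apply: (Imat_off bm qb il); rewrite neq_ltn (leq_ltn_trans (ale i) lt).
apply: (Imat_wt bm qb); rewrite neq_ltn; apply/orP; left.
apply: leq_ltn_trans (_ : \sum_i al i < _)%N.
  by rewrite [leqRHS](bigID (fun i => blk i == l))/= leq_addr.
by apply: (leq_trans lt); rewrite /wt (bigD1 i)/= ?il// leq_addr.
Qed.

(** It makes the coefficients of a product of two operators finite sums. The equality is on the ball
    only, the left side being extended by 0. *)
Lemma toeplitz_on_mono b l al P : quasi b l -> (forall z, B z -> (P : Cn -> C) z = mono al z) ->
  forall z, B z -> (toeplitz b P : Cn -> C) z =
    partial_sum v (fun z => b z * mono al z) (\sum_i al i).+1 z.
Proof.
move=> qb PE; set N := (\sum_i al i).+1; set q := partial_sum _ _ _.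
have hbm : L2 v (fun z => b z * mono al z) by apply: L2_mul; [exact: quasi_bounded qb|exact: L2_mono].
have pq : polyfun q by exact: polyfun_partial_sum.
have hq : L2 v q by apply: bounded_mfun_L2 => //; exact: polyfun_bounded.
have dq : holomorphic_on B q by move=> z _; have [_ h _] := pq; exact: h.
have [G GE] := bergman_restrict dq hq.
suff -> : toeplitz b P = G by [].
apply: (bergman_eq lam_gtN1) => ga.
rewrite toeplitz_mono//; last exact: quasi_bounded qb.
rewrite (eq_ip v (g := mono ga) (g' := mono ga) (f' := fun z => b z * mono al z)) //; last first.
  by move=> z Bz; rewrite PE.
rewrite [RHS](eq_ip v (g := mono ga) (g' := mono ga) (f' := q)) //.
case: (pickP (fun i => (N <= ga i)%N)) => [i Ni|nN]; last first.
  have gN i : (ga i < N)%N by rewrite ltnNge nN.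
  apply/eqP; rewrite -subr_eq0 -ipBl//; last exact: L2_mono.
  by rewrite partial_sum_orth.
rewrite ip_mul_mono (Imat_reach qb (i := i))// ip_partial_sum//; last exact: L2_mono.
rewrite big1// => c _; rewrite (mono_orth bm (i := i)) ?mulr0//.
by rewrite neq_ltn (leq_trans (ltn_ord _) Ni).
Qed.

Lemma toeplitz_comp_mono a b j l al be P : quasi a j -> quasi b l -> j != l ->
  (forall z, B z -> (P : Cn -> C) z = mono al z) ->
  ip (toeplitz a (toeplitz b P) : Cn -> C) (mono be) =
  I b al (mix blk l al be) * I a (mix blk l al be) be / I (fun=> 1) (mix blk l al be) (mix blk l al be).
Proof.
move=> qa qb jl PE; have ba := quasi_bounded qa; set g1 := mix blk l al be.
set N := (\sum_i al i).+1.
rewrite toeplitz_mono// ip_mul_conj.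
rewrite (eq_ip v (f' := partial_sum v (fun z => b z * mono al z) N)
  (g' := fun z => conjc (a z) * mono be z) (toeplitz_on_mono qb PE)) //.
rewrite ip_partial_sum//; last first.
  by apply: L2_mul; [exact: bounded_mfun_conj|exact: L2_mono].
transitivity (\sum_(c : {ffun 'I_n -> 'I_N}) I b al (box c) * I a (box c) be / I (fun=> 1) (box c) (box c)).
  apply: eq_bigr => c _; rewrite /mono_coef -ip_mul_conj !ip_mul_mono -ip_ff.
  rewrite -mulrA [_^-1 * _]mulrC mulrA; congr (_ / _).
  by rewrite -ip_mul_mono; apply: eq_cint => z _; rewrite mul1r.
(* b can only change the exponents in the block l, and a cannot change them; so c agrees with al off
   l and with be on l. *)
have only (c : {ffun 'I_n -> 'I_N}) : box c != g1 -> I b al (box c) * I a (box c) be = 0.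
  case: (pickP (fun i => box c i != g1 i)) => [i ci _|cE]; last first.
    by move=> /eqP[]; apply/funext => i; apply/eqP; have := cE i => /negbFE.
  move: ci; rewrite /g1 /mix; have [il|il] := eqVneq (blk i) l => ci.
    by rewrite (Imat_off bm qa (i := i)) ?mulr0// il eq_sym.
  by rewrite (Imat_off bm qb il) ?mul0r// eq_sym.
case: (pickP (fun i => (N <= g1 i)%N)) => [i Ni|nN]; last first.
  have gN i : (g1 i < N)%N by rewrite ltnNge nN.
  pose c0 : {ffun 'I_n -> 'I_N} := [ffun i => Ordinal (gN i)].
  have c0E : box c0 = g1 by apply/funext => i; rewrite /box ffunE.
  rewrite (bigD1 c0)//= c0E big1 ?addr0// => c cc0.
  rewrite only ?mul0r//; apply: contra_neq cc0 => cg.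
  by apply/ffunP => i; apply/val_inj; rewrite /= -[val (c i)]/(box c i) cg -c0E.
(* If [g1] is outside the range of the sum, then its coefficient vanishes and both sides are 0. *)
rewrite (Imat_reach qb (i := i) (ga := g1))// !mul0r big1// => c _.
rewrite only ?mul0r//; apply/eqP => cg.
by move: Ni; rewrite -cg leqNgt ltn_ord.
Qed.

Lemma toeplitz_comm_mono a b j l al P : quasi a j -> quasi b l -> j != l ->
  (forall z, B z -> (P : Cn -> C) z = mono al z) ->
  toeplitz a (toeplitz b P) = toeplitz b (toeplitz a P).
Proof.
move=> qa qb jl PE; apply: (bergman_eq lam_gtN1) => be.
have lj : l != j by rewrite eq_sym.
apply: etrans (toeplitz_comp_mono be qa qb jl PE) _.
apply: etrans _ (esym (toeplitz_comp_mono be qb qa lj PE)).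
exact: (Imat_comm bm).
Qed.

(** Testing against z^al and taking adjoints puts the product, with conjugate symbols in the
    opposite order, on a monomial; this replaces an approximation of f by polynomials. *)
Lemma toeplitz_comm a b j l (f : H) : quasi a j -> quasi b l -> j != l ->
  toeplitz a (toeplitz b f) = toeplitz b (toeplitz a f).
Proof.
move=> qa qb jl; apply: (bergman_eq lam_gtN1) => al.
have dm : holomorphic_on B (mono al) by move=> z _; exact: differentiable_mono.
have [P PE] := bergman_restrict dm (L2_mono bm al).
have E (g : H) : ip (g : Cn -> C) (mono al) = ip (g : Cn -> C) P.
  by apply: eq_ip => // z Bz; rewrite PE.
have ba := quasi_bounded qa; have bb := quasi_bounded qb.
have lj : l != j by rewrite eq_sym.
have adj c d (bc : bounded_mfun c) (bd : bounded_mfun d) : ip (toeplitz c (toeplitz d f) : Cn -> C) (mono al) =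
    ip (f : Cn -> C) (toeplitz (fun z => conjc (d z)) (toeplitz (fun z => conjc (c z)) P)).
  apply: etrans (E _) _.
  have h1 := toeplitz_adjoint lam_gtN1 (toeplitz d f) P bc.
  have h2 := toeplitz_adjoint lam_gtN1 f (toeplitz (fun z => conjc (c z)) P) bd.
  exact: (etrans h1 h2).
apply: etrans (adj a b ba bb) _; apply: etrans _ (esym (adj b a bb ba)).
by rewrite (toeplitz_comm_mono (quasi_invariant_conj qb) (quasi_invariant_conj qa) lj PE).
Qed.

End commuting_operators.

(** * Block diagonal unitary matrices *)

Section unitary_matrices.
Context (R : realType) (n : nat).
Local Notation C := R[i].
Implicit Types (P : pred 'I_n) (u w : 'I_n) (z : 'cV[C]_n) (t : C).
Local Open Scope sesquilinear_scope.

Lemma diag_unitary P t : normc t = 1 ->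
  diag_mx (\row_i if P i then t else 1) \is unitarymx.
Proof.
move=> t1; apply/unitarymxP/matrixP => u w; rewrite mul_diag_mx !mxE.
case: (eqVneq u w) => [->|uw]; last by rewrite mulr0n rmorph0 mulr0.
rewrite !mulr1n; case: ifP => _; last by rewrite rmorph1 mulr1.
by apply: etrans (mulc_conj t) _; rewrite t1 expr1n.
Qed.

Lemma mul_diag_scl P t z : diag_mx (\row_i if P i then t else 1) *m z = scl P t z.
Proof. by apply/colP => i; rewrite mul_diag_mx !mxE; case: ifP => // _; rewrite mul1r. Qed.

Definition rot4_mx u w : 'M[C]_n := let c := (Num.sqrt 2^-1)%:C in
  \matrix_(p, q) if p == u then c * ((u == q)%:R + (w == q)%:R)
    else if p == w then c * ((w == q)%:R - (u == q)%:R) else (p == q)%:R.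

Lemma mul_rot4_mx u w z : rot4_mx u w *m z = rot4 u w z.
Proof.
have d p : \sum_q (p == q)%:R * z q 0 = z p 0.
  rewrite (bigD1 p) //= big1 ?eqxx ?mul1r ?addr0// => q qp.
  by rewrite eq_sym (negbTE qp) mul0r.
apply/colP => p; rewrite !mxE; case: eqP => [pu|pu]; [|case: eqP => pw].
- rewrite -(d u) -(d w) -big_split mulr_sumr; apply: eq_bigr => q _ /=.
  by rewrite mxE pu eqxx; ring.
- rewrite -(d u) -(d w) -sumrB mulr_sumr; apply: eq_bigr => q _ /=.
  by rewrite mxE (introF eqP pu) pw eqxx; ring.
- rewrite -(d p); apply: eq_bigr => q _.
  by rewrite mxE (introF eqP pu) (introF eqP pw).
Qed.

Lemma rot4_unitary u w : u != w -> rot4_mx u w \is unitarymx.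
Proof.
move=> uw; have wu : (w == u) = false by rewrite eq_sym (negbTE uw).
apply/unitarymxP/matrixP => p q.
(* Column by column, multiplication by the matrix is the map [rot4], whose coordinates are
   explicit. *)
have -> : (rot4_mx u w *m (rot4_mx u w) ^t*) p q = (rot4_mx u w *m col q ((rot4_mx u w) ^t*)) p 0.
  by rewrite !mxE; apply: eq_bigr => i _; rewrite !mxE.
have c2 := @sqrt_half R; set c : C := (Num.sqrt 2^-1)%:C in c2.
have cc : c * c = 2^-1 by rewrite -expr2.
have rc : conjc c = c by apply: complexP; rewrite /= ?oppr0.
have re i : (col q ((rot4_mx u w) ^t*)) i 0 = if q == u then c * ((u == i)%:R + (w == i)%:R)
    else if q == w then c * ((w == i)%:R - (u == i)%:R) else (q == i)%:R.
  rewrite !mxE; case: ifP => _; [|case: ifP => _]; last by rewrite rmorph_nat.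
    by rewrite rmorphM rmorphD /= !rmorph_nat; congr (_ * _); exact: rc.
  by rewrite rmorphM rmorphB /= !rmorph_nat; congr (_ * _); exact: rc.
rewrite mul_rot4_mx [LHS]mxE -/c !re !eqxx wu (negbTE uw).
have cc2 : 2 * (c * c) = 1 by rewrite cc mulfV// pnatr_eq0.
rewrite [RHS]mxE; case: (eqVneq q u) => [->|qu]; [|case: (eqVneq q w) => [->|qw]].
- case: (eqVneq p u) => [_|pu] /=; first by apply: etrans _ cc2; ring.
  case: (eqVneq p w) => [pw|pw] /=; last by rewrite addr0 mulr0.
  by ring.
- case: (eqVneq p u) => [pu|pu] /=; first by rewrite pu (negbTE uw) /=; ring.
  case: (eqVneq p w) => [_|pw] /=; last by rewrite subr0 mulr0.
  by apply: etrans _ cc2; ring.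
- case: (eqVneq p u) => [pu|pu] /=; first by rewrite pu eq_sym (negbTE qu) /=; ring.
  case: (eqVneq p w) => [pw|pw] /=; last by rewrite eq_sym.
  by rewrite pw eq_sym (negbTE qw) /=; ring.
Qed.

End unitary_matrices.

Section block_matrices.
Context (R : realType) (m : nat) (k : 'I_m -> nat).
Local Notation C := R[i].
Local Notation n := (\sum_(i < m) k i)%N.
Local Notation Cn := 'cV[C]_n.
Implicit Types (A : 'M[C]_n) (P : pred 'I_n) (u w : 'I_n) (z : Cn) (t : C).
Local Open Scope sesquilinear_scope.
Let blk : 'I_n -> 'I_m := tagnat.sig1.

Lemma eq_Rank i (p q : 'I_(k i)) : (tagnat.Rank i p == tagnat.Rank i q) = (p == q).
Proof. by rewrite /tagnat.Rank (inj_eq (@tagnat.rank_inj _ _)) eq_Tagged. Qed.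

Lemma UkT_Uk j A : UkT k j A -> Uk k A.
Proof. by move=> [B [uB _ ->]]; exists B. Qed.

Lemma block_unitary A : A \is unitarymx -> (forall u w, blk u != blk w -> A u w = 0) ->
  A = \mxdiag_(i < m) submxblock A i i /\ forall i, submxblock A i i \is unitarymx.
Proof.
move=> /unitarymxP uA A0.
have AE : A = \mxdiag_(i < m) submxblock A i i.
  rewrite -{1}(submxblockK A); apply/eq_mxblockP => i j; case: eqVneq => [->|ij].
    by rewrite conform_mx_id.
  by apply/matrixP => p q; rewrite !mxE A0// /blk !tagnat.Rank1K.
split=> // i; apply/unitarymxP.
have E : A ^t* = \mxblock_(i < m, j < m) (submxblock A j i)^t*.
  by apply/matrixP => p q; rewrite !mxE !tagnat.sig2K.
have := congr1 (fun M => submxblock M i i) uA.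
rewrite {1}AE E mul_mxdiag_mxblock mxblockK => ->.
apply/matrixP => p q; rewrite !mxE; congr (_%:R); congr nat_of_bool.
exact: eq_Rank.
Qed.

Lemma UkT_intro j A t : A \is unitarymx -> (forall u w, blk u != blk w -> A u w = 0) ->
  normc t = 1 -> (forall u w, blk u = j -> blk w = j -> A u w = t *+ (u == w)) ->
  UkT k j A.
Proof.
move=> uA A0 t1 At; have [AE uB] := block_unitary uA A0.
exists (fun i => submxblock A i i); split=> //; exists t; first by rewrite -[`|t|]/((normc t)%:C) t1.
apply/matrixP => p q; rewrite !mxE At /blk ?tagnat.Rank1K//; congr (_ *+ nat_of_bool _).
exact: eq_Rank.
Qed.

Lemma UkT_scl_pred1 j u t : blk u != j -> normc t = 1 ->
  exists2 A, UkT k j A & forall z, A *m z = scl (pred1 u) t z.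
Proof.
move=> uj t1; exists (diag_mx (\row_i if pred1 u i then t else 1)); last exact: mul_diag_scl.
apply: (@UkT_intro j _ 1); [exact: diag_unitary| |by rewrite normc1|].
- by move=> p q; rewrite !mxE; case: (eqVneq p q) => [->|]; rewrite ?eqxx// mulr0n.
move=> p q pj _; rewrite !mxE /=; case: (eqVneq p u) => [pu|//].
by rewrite -pu pj eqxx in uj.
Qed.

Lemma UkT_scl_block j t : normc t = 1 ->
  exists2 A, UkT k j A & forall z, A *m z = scl [pred i | blk i == j] t z.
Proof.
move=> t1; exists (diag_mx (\row_i if [pred i | blk i == j] i then t else 1)); last exact: mul_diag_scl.
apply: (@UkT_intro j _ t); [exact: diag_unitary| |by []|].
- by move=> p q; rewrite !mxE; case: (eqVneq p q) => [->|]; rewrite ?eqxx// mulr0n.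
by move=> p q pj qj; rewrite !mxE /= pj eqxx.
Qed.

Lemma UkT_rot4 j u w : u != w -> blk u = blk w -> blk u != j ->
  exists2 A, UkT k j A & forall z, A *m z = rot4 u w z.
Proof.
move=> uw buw uj; exists (rot4_mx R u w); last exact: mul_rot4_mx.
apply: (@UkT_intro j _ 1); [exact: rot4_unitary| |by rewrite normc1|].
- move=> p q pq; rewrite !mxE.
  have ne i (bi : blk i = blk p) : (i == q) = false.
    by apply/negbTE; apply: contraNneq pq => <-; rewrite bi.
  case: (eqVneq p u) => [pu|_]; first by rewrite !ne ?pu// addr0 mulr0.
  case: (eqVneq p w) => [pw|_]; first by rewrite !ne ?pw// subr0 mulr0.
  by rewrite ne.
move=> p q pj _; rewrite !mxE; case: (eqVneq p u) => [pu|_]; first by rewrite -pu pj eqxx in uj.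
by case: (eqVneq p w) => [pw|//]; rewrite buw -pw pj eqxx in uj.
Qed.

End block_matrices.

(** * Changing a symbol on a null set *)

Section symbols.
Context (R : realType) (n : nat) (lam : R) (lam_gtN1 : -1 < lam).
Local Notation C := R[i].
Local Notation Cn := 'cV[C]_n.
Local Notation B := (@unit_ball R n).
Local Notation v := (@bergman_measure R n lam).
Local Notation H := (bergman n lam).
Let bm := @bergman_measure_ball_measure R n lam lam_gtN1.
Let mB := @measurable_unit_ball R n.

Lemma ae_bergman_measure (P : Cn -> Prop) : {ae lebesgueCn R n, forall z, P z} -> {ae v, forall z, P z}.
Proof. by move=> [N [mN N0 PN]]; exists N; split=> //; exact: (ball_measure_dom bm). Qed.

(** The two sets from which [xget] chooses are equal, hence so are the choices. *)
Lemma toeplitz_ae_eq (a b : Cn -> C) (f : H) : measurable_fun B a -> measurable_fun B b ->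
  {ae lebesgueCn R n, forall z, B z -> a z = b z} -> toeplitz a f = toeplitz b f.
Proof.
move=> ma mb ab; rewrite /toeplitz /bergman_proj; congr (xget _ _).
have [_ [mf _] _] := bergmanP f.
have E (g h : H) : inner lam (a * (f : Cn -> C) - (g : Cn -> C)) h =
    inner lam (b * (f : Cn -> C) - (g : Cn -> C)) h.
  have [_ [mg _] _] := bergmanP g; have [_ [mh _] _] := bergmanP h.
  have mi (c : Cn -> C) : measurable_fun B c -> measurable_fun B (fun z => (c z * (f : Cn -> C) z - (g : Cn -> C) z) * conjc ((h : Cn -> C) z)).
    move=> mc; apply: measurableC_mul; last exact: measurableC_conj.
    apply: measurableC_add; first exact: measurableC_mul.
    by have := measurableC_mul (measurable_cst (-1 : C)) mg; under eq_fun do rewrite mulN1r.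
  apply: (ae_eq_cint mB (mi a ma) (mi b mb)).
  by apply: filterS (ae_bergman_measure ab) => z h1 Bz; rewrite h1.
by apply/seteqP; split=> g hg h; rewrite ?E// -E.
Qed.

End symbols.

Section block_symbols.
Context (R : realType) (m : nat) (k : 'I_m -> nat) (lam : R) (lam_gtN1 : -1 < lam).
Local Notation C := R[i].
Local Notation n := (\sum_(i < m) k i)%N.
Local Notation Cn := 'cV[C]_n.
Local Notation B := (@unit_ball R n).
Local Notation v := (@bergman_measure R n lam).
Local Notation H := (bergman n lam).
Let mB := @measurable_unit_ball R n.

(** The values of a are truncated, so that b is a function of a and inherits each invariance at
    every point where a has it. *)
Lemma quasi_invariant_representative (a : Cn -> C) j : Linfty_inv (UkT k j) a ->
  exists2 b : Cn -> C, quasi_invariant v (tagnat.sig1 : 'I_n -> 'I_m) b j &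
    forall f : H, toeplitz a f = toeplitz b f.
Proof.
move=> [[ma [M hM]] inva].
pose tr (c : C) : C := if normc c <= M then c else 0.
pose b z := tr (a z).
have mb : measurable_fun B b.
  apply: (@measurable_fun_if _ _ _ _ a (fun=> 0) B mB (fun z => normc (a z) <= M)).
  - by apply: measurable_fun_ler; [exact: measurable_normc|exact: measurable_cst].
  - by apply: (measurable_funS mB _ ma) => z [].
  - exact: measurable_cst.
have ab : {ae lebesgueCn R n, forall z, B z -> a z = b z}.
  by apply: filterS hM => z h Bz; rewrite /b /tr h.
have invb (phi : Cn -> Cn) : (exists2 A, UkT k j A & forall z, A *m z = phi z) -> ae_invariant v b phi.
  move=> [A uA AE]; apply: filterS (ae_bergman_measure lam_gtN1 (inva A uA)) => z h Bz.
  by rewrite /b -AE h.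
exists b; last by move=> f; exact: (toeplitz_ae_eq lam_gtN1).
split.
- split=> //; exists (Num.max M 0) => z Bz; rewrite /b /tr; case: ifP => h.
    by rewrite le_max h.
  by rewrite normc0 le_max lexx orbT.
- by move=> i t ij t1; apply: invb; exact: UkT_scl_pred1.
- by move=> t t1; apply: invb; exact: UkT_scl_block.
- by move=> u w uw buw uj; apply: invb; exact: UkT_rot4.
Qed.

End block_symbols.

Lemma small_le0 (R : realType) (x F : R) : 0 <= F ->
  (forall e : R, 0 < e -> x <= e ^+ 2 * F) -> x <= 0.
Proof.
move=> F0 h; rewrite leNgt; apply/negP => x0.
have xF : x <= F by have := h 1 ltr01; rewrite expr1n mul1r.
have F1 : 0 < F by exact: lt_le_trans xF.
have e0 : 0 < x / (2 * F) by rewrite divr_gt0// mulr_gt0.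
have := h (Num.sqrt (x / (2 * F))); rewrite sqrtr_gt0 => /(_ e0).
rewrite sqr_sqrtr; last exact: ltW.
rewrite invfM !mulrA mulfVK ?gt_eqF// => hx; lra.
Qed.

(** * Commutants *)

Section commutant.
Context (R : realType) (n : nat) (lam : R) (lam_gtN1 : -1 < lam).
Local Notation C := R[i].
Local Notation Cn := 'cV[C]_n.
Local Notation v := (@bergman_measure R n lam).
Local Notation H := (bergman n lam).
Local Notation N2 := (N2 v).
Let bm := @bergman_measure_ball_measure R n lam lam_gtN1.
Implicit Types (S T U : H -> H) (X : set (H -> H)).

Let L2H (f : H) : L2 v (f : Cn -> C). Proof. by have [] := bergmanP f. Qed.

Lemma bounded_operatorP T : bounded_operator T <->
  linear T /\ exists2 K : R, 0 <= K & forall f : H, N2 (T f : Cn -> C) <= K * N2 (f : Cn -> C).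
Proof.
split=> -[lT [K]]; last first.
  move=> K0 hK; split=> //; exists (Num.sqrt K) => f.
  by rewrite !norm2E -sqrtrM// ler_wsqrtr.
move=> hK; split=> //; exists (K ^+ 2) => [|f]; first exact: sqr_ge0.
have h := hK f; rewrite !norm2E in h.
have : Num.sqrt (N2 (T f : Cn -> C)) ^+ 2 <= (K * Num.sqrt (N2 (f : Cn -> C))) ^+ 2.
  by rewrite ler_pXn2r ?nnegrE ?sqrtr_ge0// (le_trans _ h)// sqrtr_ge0.
by rewrite exprMn !sqr_sqrtr ?N2_ge0.
Qed.

Lemma N2Z (c : C) (f : Cn -> C) : L2 v f -> N2 (fun z => c * f z) = normc c ^+ 2 * N2 f.
Proof.
move=> [_ i2]; rewrite /N2 -RintegralZl//; first by apply: eq_Rintegral => z _; rewrite normcM exprMn.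
exact: measurable_unit_ball.
Qed.

Lemma bergman_N2_eq0 (f : H) : N2 (f : Cn -> C) = 0 -> f = 0.
Proof.
move=> f0; apply: (bergman_eq lam_gtN1) => al.
have := cauchy_schwarz (L2H f) (L2_mono bm al); rewrite f0 mul0r => h.
have nz : normc (ip v (f : Cn -> C) (mono al)) = 0.
  by apply/eqP; rewrite -sqrf_eq0 eq_le h sqr_ge0.
rewrite (normc_eq0 nz) -[LHS](mul0r (ip v (f : Cn -> C) (mono al))).
rewrite -(ipZl 0 (L2H f) (L2_mono bm al)); apply: eq_cint => z _.
by rewrite mul0r.
Qed.

Lemma linear_map0 (T : H -> H) : linear T -> T 0 = 0.
Proof. by move=> lT; have := lT (-1) 0 0; rewrite scaler0 addr0 scaleN1r addNr. Qed.

Lemma bounded_operator0 : @bounded_operator R n lam (fun=> 0).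
Proof.
apply/bounded_operatorP; split; first by move=> c f g; rewrite scaler0 addr0.
exists 0 => // f; rewrite mul0r.
have := N2Z 0 (L2H f); rewrite normc0 expr0n mul0r => <-.
by rewrite (@eq_N2 _ _ v _ (fun z => 0 * (f : Cn -> C) z))// => z _; rewrite mul0r.
Qed.

Lemma bounded_operatorD c S T : bounded_operator S -> bounded_operator T ->
  bounded_operator (fun f => c *: S f + T f).
Proof.
move=> /bounded_operatorP[lS [K K0 hK]] /bounded_operatorP[lT [L L0 hL]].
apply/bounded_operatorP; split.
  move=> x f g; rewrite lS lT !scalerDr !scalerA [c * x]mulrC !addrA; congr (_ + _).
  by rewrite addrAC.
exists (2 * (normc c ^+ 2 * K) + 2 * L) => [|f].
  by apply: addr_ge0; do ![exact: sqr_ge0|exact: ler0n|assumption|apply: mulr_ge0].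
have nZ : N2 (fun z => c * (S f : Cn -> C) z) = normc c ^+ 2 * N2 (S f : Cn -> C).
  exact: N2Z.
apply: (le_trans (N2D_le (L2Z c (L2H (S f))) (L2H (T f)))); rewrite nZ.
have := ler_wpM2l (sqr_ge0 (normc c)) (hK f); have := hL f.
by move: (N2 _) (N2 _) (N2 _) => x y z; lra.
Qed.

Lemma bounded_operator_comp S T : bounded_operator S -> bounded_operator T ->
  bounded_operator (S \o T).
Proof.
move=> /bounded_operatorP[lS [K K0 hK]] /bounded_operatorP[lT [L L0 hL]].
apply/bounded_operatorP; split; first by move=> c f g /=; rewrite lT lS.
exists (K * L) => [|f]; first exact: mulr_ge0.
by apply: le_trans (hK _) _; rewrite -mulrA ler_wpM2l.
Qed.

Definition commutant X : set (H -> H) :=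
  [set T | bounded_operator T /\ forall S, X S -> S \o T = T \o S].

Lemma commutant_closed X : X `<=` @bounded_operator R n lam -> closed_subalgebra (commutant X).
Proof.
move=> bX; split.
- by move=> T [].
- by split=> [|S /bX[lS _]]; [exact: bounded_operator0|apply/funext => f /=; rewrite linear_map0].
- move=> c S T [bS cS] [bT cT]; split=> [|U XU]; first exact: bounded_operatorD.
  have [lU _] := bX U XU; apply/funext => f /=; rewrite lU.
  by have /(congr1 (@^~ f)) /= -> := cS U XU; have /(congr1 (@^~ f)) /= -> := cT U XU.
- move=> S T [bS cS] [bT cT]; split=> [|U XU]; first exact: bounded_operator_comp.
  apply/funext => f /=; have /(congr1 (@^~ (T f))) /= -> := cS U XU.
  by have /(congr1 (@^~ f)) /= -> := cT U XU.
move=> T bT limT; split=> // U XU; apply/funext => f /=.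
have [lU [K K0 hK]] := (bounded_operatorP U).1 (bX U XU).
have [lT _] := bT.
apply/eqP; rewrite -subr_eq0; apply/eqP; apply: bergman_N2_eq0.
apply/eqP; rewrite eq_le N2_ge0 andbT.
have F0 : 0 <= 4 * K * N2 (f : Cn -> C) by rewrite !mulr_ge0// N2_ge0.
have key (e : R) : 0 < e -> N2 (U (T f) - T (U f) : H) <= e ^+ 2 * (4 * K * N2 (f : Cn -> C)).
  move=> e0; have [S [bS cS] hS] := limT e e0.
  have [lS _] := bS.
  have hTS (g : H) : N2 (T g - S g : H) <= e ^+ 2 * N2 (g : Cn -> C).
    have h := hS g; rewrite !norm2E in h.
    have : Num.sqrt (N2 (T g - S g : H)) ^+ 2 <= (e * Num.sqrt (N2 (g : Cn -> C))) ^+ 2.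
      by rewrite ler_pXn2r ?nnegrE ?sqrtr_ge0// (le_trans _ h)// sqrtr_ge0.
    by rewrite exprMn !sqr_sqrtr ?N2_ge0.
  (* As S commutes with U, the commutator of U and T is that of U and T - S, which is small. *)
  have -> : U (T f) - T (U f) = U (T f - S f) - (T (U f) - S (U f)).
    have /(congr1 (@^~ f)) /= USf := cS U XU.
    have -> : T f - S f = (-1) *: S f + T f by rewrite scaleN1r addrC.
    by rewrite lU scaleN1r USf opprB [- _ + _]addrC subrKA.
  have le1 : N2 (U (T f - S f) : Cn -> C) <= K * (e ^+ 2 * N2 (f : Cn -> C)).
    by apply: le_trans (hK _) _; rewrite ler_wpM2l.
  have le2 : N2 (T (U f) - S (U f) : H) <= e ^+ 2 * (K * N2 (f : Cn -> C)).
    by apply: le_trans (hTS _) _; rewrite ler_wpM2l ?sqr_ge0.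
  have le3 : N2 (U (T f - S f) - (T (U f) - S (U f)) : H) <=
      2 * N2 (U (T f - S f) : Cn -> C) + 2 * N2 (T (U f) - S (U f) : H).
    rewrite -(N2N v (T (U f) - S (U f) : H)); apply: N2D_le; first exact: L2H.
    exact/L2N/L2H.
  apply: le_trans le3 _; apply: le_trans (lerD (ler_wpM2l (ler0n _ 2) le1) (ler_wpM2l (ler0n _ 2) le2)) _.
  by rewrite le_eqVlt; apply/orP; left; apply/eqP; ring.
exact: (small_le0 F0 key).
Qed.

(** The commutant is taken twice: the generated algebra commutes with X, so X lies in the commutant
    of the generated algebra, and then so does the generated algebra. *)
Lemma commutative_smallest X : X `<=` @bounded_operator R n lam ->
  (forall S T, X S -> X T -> S \o T = T \o S) ->
  forall S T, smallest (@closed_subalgebra R n lam) X S -> smallest (@closed_subalgebra R n lam) X T ->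
    S \o T = T \o S.
Proof.
move=> bX cX.
have h1 : smallest (@closed_subalgebra R n lam) X `<=` commutant X.
  apply: smallest_sub; first exact: commutant_closed.
  by move=> T XT; split; [exact: bX|move=> S XS; exact: cX].
have h2 : smallest (@closed_subalgebra R n lam) X `<=` commutant (smallest (@closed_subalgebra R n lam) X).
  apply: smallest_sub; first by apply: commutant_closed => T /h1[].
  by move=> T XT; split; [exact: bX|move=> S /h1[_ /(_ T XT)]].
by move=> S T /[swap] /h2[_ h] /h.
Qed.

End commutant.

Theorem corollary6p7 (R : realType) (m : nat) (k : 'I_m -> nat)
    (m_ge2 : (2 <= m)%N) (k_gt0 : forall j, (0 < k j)%N)
    (a : 'I_m -> 'cV[R[i]]_(\sum_(j < m) k j) -> R[i])
    (a_inv : forall j, Linfty_inv (UkT k j) (a j))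
    (lam : R) (lam_gtN1 : -1 < lam) :
  forall S T : bergman (\sum_(j < m) k j) lam -> bergman (\sum_(j < m) k j) lam,
    toeplitz_algebra (Linfty_inv (Uk k) `|` range a) S ->
    toeplitz_algebra (Linfty_inv (Uk k) `|` range a) T ->
    S \o T = T \o S.
Proof.
have Uk_inv s j : Linfty_inv (Uk k) s -> Linfty_inv (UkT k j) s.
  by move=> [Ls inv]; split=> // A /UkT_Uk; exact: inv.
have symb s : (Linfty_inv (Uk k) `|` range a) s -> exists j, Linfty_inv (UkT k j) s.
  move=> [/Uk_inv h|[j _ <-]]; last by exists j.
  (* Any index would do for a U(k)-invariant symbol. *)
  by exists (Ordinal m_ge2).
have comm s t j l : Linfty_inv (UkT k j) s -> Linfty_inv (UkT k l) t -> j != l ->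
    toeplitz s \o toeplitz t = toeplitz t \o toeplitz s :> (bergman _ lam -> bergman _ lam).
  move=> /(quasi_invariant_representative lam_gtN1)[s' qs sE].
  move=> /(quasi_invariant_representative lam_gtN1)[t' qt tE] jl.
  by apply/funext => f /=; rewrite !sE !tE; exact: (toeplitz_comm lam_gtN1 f qs qt jl).
have other (j : 'I_m) : exists l : 'I_m, j != l.
  (* [Ordinal m_ge2] is the index 1 and [Ordinal (ltnW m_ge2)] the index 0. *)
  have [j0|j0] := eqVneq (val j) 0%N; first by exists (Ordinal m_ge2); rewrite -val_eqE /= j0.
  by exists (Ordinal (ltnW m_ge2)).
apply: (commutative_smallest lam_gtN1).
  move=> _ [s /symb[j /(quasi_invariant_representative lam_gtN1)[s' qs sE]] <-].
  have -> : toeplitz s = toeplitz s' :> (bergman _ lam -> bergman _ lam) by apply/funext.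
  exact: (toeplitz_bounded lam_gtN1 (quasi_bounded qs)).
move=> _ _ [s hs <-] [t ht <-].
case: hs => [/Uk_inv hs|[j _ <-]]; case: ht => [/Uk_inv ht|[l _ <-]].
- have [l jl] := other (Ordinal m_ge2); exact: comm (hs _) (ht _) jl.
- by have [j lj] := other l; apply: (comm _ _ j l) => //; rewrite eq_sym.
- by have [l jl] := other j; apply: (comm _ _ j l).
have [->//|jl] := eqVneq j l; exact: comm jl.
Qed.
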